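(* Let $\{s^i_{h\tau}\}_{i\in\mathbb N}\subset\mathcal V_{h\tau}$ be the sequence of space-time finite element solutions of the $L$-scheme and, for $i\in\mathbb N$, let $\boldsymbol\sigma^i_{h\tau}$ be the associated equilibrated flux (both defined in the context). Define \begin{align*} \eta^i_{\mathrm F,Q}&:=\|\boldsymbol\sigma^i_{h\tau}+\boldsymbol F^i_{h\tau}\|_{L^2(Q)},\qquad \eta^i_{\mathrm{osc},Q}:=C^{\mathrm P}_\Omega h_\Omega\,\|(\mathbb I-\Pi^0_{h\tau})(\partial_t b(s^i_{h\tau})-f)\|_{L^2(Q)},\\ \eta^i_{\mathrm{disc}}&:=\Big((\eta^i_{\mathrm F,Q}+\eta^i_{\mathrm{osc},Q})^2+L^2\|s^i_{h\tau}(0)-s_0\|^2\Big)^{1/2},\\ \eta^i_{\mathrm{lin}}&:=\Big([C^{\mathrm P}_\Omega h_\Omega]^2\|\partial_t(s^{i+1}_{h\tau}-s^i_{h\tau})\|^2_{L^2(Q)}+\|\nabla(s^{i+1}_{h\tau}-s^i_{h\tau})\|^2_{L^2(Q)}+\|(s^{i+1}_{h\tau}-s^i_{h\tau})(T)\|^2\Big)^{1/2},\\ \eta^i&:=\eta^i_{\mathrm{disc}}+L\,\eta^i_{\mathrm{lin}}. \end{align*} Then the errors \begin{align*} \mathcal E(s^i_{h\tau})&:=\Big(\|\mathcal R(s^i_{h\tau})\|^2_{L^2(0,T;H^{-1}(\Omega))}+L^2\|s^i_{h\tau}(0)-s_0\|^2\Big)^{1/2},\\ \mathcal E^{\mathrm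 H}_{\mathrm{disc}}(s^{i+1}_{h\tau})&:=\Big(\|\mathcal R_{\mathrm{lin}}(s^{i+1}_{h\tau},s^i_{h\tau})\|^2_{L^2(0,T;H^{-1}(\Omega))}+L^2\|s^{i+1}_{h\tau}(0)-s_0\|^2\Big)^{1/2},\\ \mathcal E^i_{\mathrm{lin}}&:=\|s^{i+1}_{h\tau}-s^i_{h\tau}\|_{\mathcal V} \end{align*} satisfy the reliability estimates $$\mathcal E^{\mathrm H}_{\mathrm{disc}}(s^{i+1}_{h\tau})\le\eta^i_{\mathrm{disc}},\qquad \mathcal E^i_{\mathrm{lin}}\le\eta^i_{\mathrm{lin}},\qquad \mathcal E(s^i_{h\tau})\le\eta^i .$$
   Context: Domain: $\Omega\subset\mathbb R^d$ is a bounded open domain with Lipschitz boundary and diameter $h_\Omega$, $T>0$, $Q=(0,T]\times\Omega$, $\Gamma_T=\partial\Omega\times[0,T]$. $(\cdot,\cdot)$ and $\|\cdot\|$ are the inner product and norm of $L^2(\Omega)$; $\langle\cdot,\cdot\rangle$ is the $H^{-1}(\Omega)$–$H^1_0(\Omega)$ duality pairing; $\nabla$ and $\nabla\cdot$ are the spatial gradient and divergence. $C^{\mathrm P}_\Omega>0$ is a constant with $\|v\|\le C^{\mathrm P}_\Omega h_\Omega\|\nabla v\|$ for all $v\in H^1_0(\Omega)$. $\|g\|_{H^{-1}(\Omega)}=\sup_{0\ne\varphi\in H^1_0(\Omega)}\langle g,\varphi\rangle/\|\nabla\varphi\|$, and $\|\mathcal F\|_{L^2(0,T;H^{-1}(\Omega))}=\sup\{\mathcal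 F(\varphi):\varphi\in L^2(0,T;H^1_0(\Omega)),\ \int_0^T\|\nabla\varphi\|^2=1\}$. Nonlinearities and data: $b,B:\mathbb R\to\mathbb R$ are Lipschitz continuous and non-decreasing, $b(0)=0$, $|B(s)-B(r)|\le|s-r|$, $|b(s)-b(r)|\le|s-r|$ for all $s,r$, and $(b+B)(s)-(b+B)(r)\ge s-r$ for $s\ge r$. (They come from a degenerate nonlinearity $\Phi$ via $B=\Phi\circ b$ on $[0,\infty)$, where $B(s)=0$, $b(s)=s$ on $(-\infty,0]$ is an admissible extension.) $f\in L^2(Q)$, $u_0\in L^2(\Omega)$, $s_0\in L^2(\Omega)$ with $b(s_0)=u_0$. $L>1$ is a constant. Spaces: $\mathcal S=\{s\in L^2(Q): b(s)\in H^1(0,T;H^{-1}(\Omega)),\ B(s)\in L^2(0,T;H^1_0(\Omega))\}$; $\mathcal V=L^2(0,T;H^1_0(\Omega))\cap H^1(0,T;H^{-1}(\Omega))$ with $\|v\|_{\mathcal V}^2=\int_0^T(\|\nabla v\|^2+\|\partial_t v\|^2_{H^{-1}(\Omega)})\,dt+\|v(T)\|^2$. For $Q'\subseteq Q$, $H(\mathrm{div};Q')=\{\boldsymbol v\in[L^2(Q')]^d:\nabla\cdot\boldsymbol v\in L^2(Q')\}$ (spatial weak divergence). Residuals, for $\varphi\in L^2(0,T;H^1_0(\Omega))$: $\mathcal R(s)(\varphi)=\int_0^T\langle\partial_t b(s),\varphi\rangle+\int_0^T(\nabla B(s),\nabla\varphi)-\int_0^T(f,\varphi)$; $\mathcal R_{\mathrm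 H}(s)(\varphi)=\int_0^T\langle\partial_t s,\varphi\rangle+\int_0^T(\nabla s,\nabla\varphi)$; $\mathcal R_{\mathrm{lin}}(s,\bar s)=L\mathcal R_{\mathrm H}(s-\bar s)+\mathcal R(\bar s)$. Mesh: $\mathcal T_{h\tau}$ is a shape-regular conforming partition of $Q$ into $(d+1)$-simplices with vertex set $\mathcal N_{h\tau}$. For $a\in\mathcal N_{h\tau}$, $\mathcal T^a_{h\tau}$ is the set of elements having $a$ as a vertex, $\phi_a$ is the continuous piecewise affine hat function with $\phi_a(a)=1$ and value $0$ at the other vertices, and $\omega_a$ is the support of $\phi_a$. $\mathcal P_p(\mathcal T_{h\tau})$ is the space of (discontinuous) piecewise polynomials of total degree $\le p$ in $(\boldsymbol x,t)$. $\mathcal V_{h\tau}=\mathcal P_1(\mathcal T_{h\tau})\cap H^1(Q)$, with zero trace on $\Gamma_T$, so that $\mathcal V_{h\tau}\subset\mathcal S\cap\mathcal V$. $\Pi^0_{h\tau}$ is the $L^2(Q)$-orthogonal projection onto $\mathcal P_0(\mathcal T_{h\tau})$ and $\boldsymbol\Pi^0_{h\tau}$ its componentwise version for vector fields. Finite element sequence: $\{s^i_{h\tau}\}_{i\in\mathbb N}\subset\mathcal V_{h\tau}$ all have the same discrete initial value $s^i_{h\tau}(0)$ (the discrete projection of $s_0$) and satisfy $\mathcal R_{\mathrm{lin}}(s^{i+1}_{h\tau},s^i_{h\tau})(\varphi_{h\tau})=0$ for all $\varphi_{h\tau}\in\mathcal V_{h\tau}$. Set $$\mathcal S^i_{h\tau}=\partial_t\big(L(s^{i+1}_{h\tau}-s^i_{h\tau})+b(s^i_{h\tau})\big)-f,\qquad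 \boldsymbol F^i_{h\tau}=\nabla\big(L(s^{i+1}_{h\tau}-s^i_{h\tau})+B(s^i_{h\tau})\big).$$ Equilibrated flux: fix $p\ge 2$. Let $\boldsymbol{\mathcal Q}_{h\tau}=H(\mathrm{div};Q)\cap[\mathcal P_p(\mathcal T_{h\tau})]^d$ and $\boldsymbol{\mathcal Q}^a_{h\tau}=\{\boldsymbol v\in H(\mathrm{div};\omega_a)\cap[\mathcal P_p(\mathcal T^a_{h\tau})]^d:\boldsymbol v\cdot\boldsymbol n_{\mathrm x}=0\text{ on }\partial\omega_a\setminus\Gamma_T\}$, where $\boldsymbol n_{\mathrm x}$ is the spatial part of the outward normal of $\partial\omega_a$. For each $a\in\mathcal N_{h\tau}$, $\boldsymbol\sigma^a_{h\tau}$ is the minimizer of $\|\boldsymbol v+\phi_a\boldsymbol F^i_{h\tau}\|_{L^2(\omega_a)}$ over $\boldsymbol v\in\boldsymbol{\mathcal Q}^a_{h\tau}$ subject to $\nabla\cdot\boldsymbol v=-\Pi^0_{h\tau}(\phi_a\mathcal S^i_{h\tau})-\nabla\phi_a\cdot\boldsymbol\Pi^0_{h\tau}\boldsymbol F^i_{h\tau}$; it is extended by zero to $Q\setminus\omega_a$, and $\boldsymbol\sigma^i_{h\tau}:=\sum_{a\in\mathcal N_{h\tau}}\boldsymbol\sigma^a_{h\tau}\in\boldsymbol{\mathcal Q}_{h\tau}$. *)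

(* Defs.v *)
From HB Require Import structures.
From mathcomp Require Import all_boot all_order all_algebra.
From mathcomp Require Import all_classical all_reals all_analysis.
Set Implicit Arguments. Unset Strict Implicit. Unset Printing Implicit Defensive.
Import Order.TTheory GRing.Theory Num.Theory numFieldNormedType.Exports.
Local Open Scope classical_set_scope.
Local Open Scope ring_scope.

Section borel_rV.
Variables (R : realType) (n : nat).

Let coor (i : 'I_n) (x : 'rV[R]_n) : measurableTypeR R := x ord0 i.

Let rV0 : g_sigma_preimage coor set0. Proof. exact: sigma_algebra0. Qed.
Let rVC A : g_sigma_preimage coor A -> g_sigma_preimage coor (~` A).
Proof. exact: sigma_algebraC. Qed.
Let rVU (F : _^nat) : (forall i, g_sigma_preimage coor (F i)) ->
  g_sigma_preimage coor (\bigcup_i F i).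
Proof. exact: sigma_algebra_bigcup. Qed.

Definition rV_display : measure_display. Proof. exact. Qed.

HB.instance Definition _ := @isMeasurable.Build rV_display
  'rV[R]_n (g_sigma_preimage coor) rV0 rVC rVU.

Lemma measurable_coor (i : 'I_n) :
  measurable_fun [set: 'rV[R]_n] (fun x => x ord0 i : measurableTypeR R).
Proof.
move=> _ Y mY; rewrite setTI; apply: sub_sigma_algebra => /=.
rewrite -bigcup_seq/=; exists i => /=; first by rewrite mem_index_enum.
by exists Y => //; rewrite setTI.
Qed.

Lemma measurable_fun_rVP d (T : measurableType d) (f : T -> 'rV[R]_n) :
  (forall i, measurable_fun [set: T] (fun t => f t ord0 i : measurableTypeR R)) ->
  measurable_fun [set: T] f.
Proof.
move=> mf; rewrite -[X in measurable_fun _ X]/(f).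
apply: (@measurability _ _ _ _ _ _
  (\big[setU/set0]_(i < n) preimage_set_system setT (coor i) measurable)) => //.
move=> _ [A + <-]; rewrite -bigcup_seq => -[i _ [B mB <-]].
by have := mf i measurableT B mB; rewrite !setTI.
Qed.

End borel_rV.

Section lebesgue_rV.
Variable R : realType.

Definition consrV n (p : measurableTypeR R * 'rV[R]_n) : 'rV[R]_n.+1 :=
  \row_i (if unlift ord0 i is Some j then p.2 ord0 j else p.1).

Definition unconsrV n (x : 'rV[R]_n.+1) : measurableTypeR R * 'rV[R]_n :=
  (x ord0 ord0, \row_j x ord0 (lift ord0 j)).

Lemma unconsrVK n : cancel (@unconsrV n) (@consrV n).
Proof.
move=> x; apply/rowP => i; rewrite mxE; case: unliftP => [j ->|->] //=.
by rewrite mxE.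
Qed.

Lemma consrVK n : cancel (@consrV n) (@unconsrV n).
Proof.
move=> [a x]; congr (_, _); first by rewrite mxE unlift_none.
by apply/rowP => j; rewrite !mxE liftK.
Qed.

Lemma measurable_consrV n : measurable_fun [set: _] (@consrV n).
Proof.
apply: measurable_fun_rVP => i.
rewrite (_ : (fun t => _) = fun p : measurableTypeR R * 'rV[R]_n =>
  if unlift ord0 i is Some j then p.2 ord0 j : measurableTypeR R else p.1); last first.
  by apply/funext => p; rewrite mxE.
case: (unlift ord0 i) => [j|]; last exact: measurable_fst.
exact: (measurableT_comp (measurable_coor j) measurable_snd).
Qed.

Lemma measurable_unconsrV n : measurable_fun [set: _] (@unconsrV n).
Proof.
apply/measurable_fun_pairP; split; first exact: measurable_coor.
apply: measurable_fun_rVP => j /=.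
rewrite (_ : (fun t => _) = fun t : 'rV[R]_n.+1 => t ord0 (lift ord0 j)).
  exact: measurable_coor.
by apply/funext => t; rewrite mxE.
Qed.

Section step.
Variables (n : nat) (m : {sigma_finite_measure set 'rV[R]_n -> \bar R}).

Definition lebesgue_rV_step : set 'rV[R]_n.+1 -> \bar R :=
  pushforward (lebesgue_measure \x m)%E (@consrV n).

Let step0 : lebesgue_rV_step set0 = 0%E.
Proof. by rewrite /lebesgue_rV_step /pushforward preimage_set0 measure0. Qed.

Let step_ge0 A : (0 <= lebesgue_rV_step A)%E.
Proof. by have mf := @measurable_consrV n; exact: measure_ge0. Qed.

Let step_sigma_additive : semi_sigma_additive lebesgue_rV_step.
Proof.
have mf := @measurable_consrV n.
exact: measure_semi_sigma_additive.
Qed.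

HB.instance Definition _ := isMeasure.Build _ _ _ lebesgue_rV_step
  step0 step_ge0 step_sigma_additive.

Let step_sigma_finite : sigma_finite setT lebesgue_rV_step.
Proof.
have /sigma_finiteP[F [FT ndF Foo]] := sigma_finiteT (@lebesgue_measure R).
have /sigma_finiteP[G [GT ndG Goo]] := sigma_finiteT m.
exists (fun k => @unconsrV n @^-1` (F k `*` G k)).
  rewrite -preimage_bigcup (_ : \bigcup_k _ = setT) ?preimage_setT//.
  rewrite -setXTT FT GT predeqE => -[x y]; split.
    by move=> [k _ []] /= Fx Gy; split; exists k.
  move=> [/= [k _ Fx] [l _ Gy]]; exists (maxn k l) => //; split => /=.
    by move: x Fx; exact/subsetPset/ndF/leq_maxl.
  by move: y Gy; exact/subsetPset/ndG/leq_maxr.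
move=> k; have [mF Fk] := Foo k; have [mG Gk] := Goo k; split.
  rewrite -[X in measurable X]setTI; apply: measurable_unconsrV => //.
  exact: measurableX.
rewrite /lebesgue_rV_step /pushforward -comp_preimage.
rewrite (_ : _ \o _ = id); last by apply/funext => p; exact: consrVK.
by rewrite preimage_id product_measure1E// lte_mul_pinfty// ge0_fin_numE.
Qed.

HB.instance Definition _ := Measure_isSigmaFinite.Build _ _ _ lebesgue_rV_step
  step_sigma_finite.

End step.

Fixpoint lebesgue_rV n : {sigma_finite_measure set 'rV[R]_n -> \bar R} :=
  if n is k.+1 then lebesgue_rV_step (lebesgue_rV k)
  else dirac (0 : 'rV[R]_0).

End lebesgue_rV.

Section L2.
Context (R : realType) (disp : measure_display) (T : measurableType disp).
Variables (mu : {measure set T -> \bar R}) (D : set T).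

Definition L2norm (f : T -> R) : \bar R := 'N[mu]_2%:E[EFin \o (f \_ D)]%E.

Definition in_L2 (f : T -> R) : Prop :=
  measurable_fun D (f : T -> measurableTypeR R) /\ (L2norm f < +oo)%E.

(* [g] is the L^2 weak derivative of [u] on [D]; [test] is the class of test
   functions on [D] and [del] the corresponding classical derivative. *)
Definition is_weak_derivative (test : set (T -> R)) (del : (T -> R) -> T -> R)
    (u g : T -> R) : Prop :=
  in_L2 g /\ forall psi, test psi ->
    \int[mu]_(z in D) (u z * del psi z) = - \int[mu]_(z in D) (g z * psi z).

End L2.

Section test_functions.
Context (R : realType) (V : normedModType R).

Fixpoint iter_derive (vs : seq V) (f : V -> R) : V -> R :=
  if vs is v :: vs' then iter_derive vs' (fun x => 'D_v f x) else f.

Definition smooth (f : V -> R) : Prop :=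
  forall (vs : seq V) (x : V), differentiable (iter_derive vs f) x.

(* C_c^\infty(O) *)
Definition test_fun (O : set V) (f : V -> R) : Prop :=
  [/\ smooth f, compact (closure [set x | f x != 0])
    & closure [set x | f x != 0] `<=` O].

End test_functions.

Section space.
Variables (R : realType) (d : nat).
Local Notation X := 'rV[R]_d.
Implicit Types (Omega : set X) (v : X -> R).

Definition dotv (x y : X) : R := \sum_i x ord0 i * y ord0 i.

(* the library norm of ['rV_d] is the sup norm *)
Definition enorm (x : X) : R := Num.sqrt (dotv x x).

Definition diam Omega : R :=
  sup [set enorm (p.1 - p.2) | p in Omega `*` Omega].

Definition bdry Omega : set X := closure Omega `\` interior Omega.

(* Near each boundary point, [Omega] is the strict epigraph, in the direction of
   a unit vector [e], of a Lipschitz function of the component orthogonal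
   to [e]. *)
Definition lipschitz_boundary Omega : Prop :=
  forall x0, bdry Omega x0 -> exists (r k : R) (e : X) (gam : X -> R),
    [/\ 0 < r, enorm e = 1,
        forall x y, `|gam x - gam y| <= k * enorm (x - y),
        forall x c, gam (x + c *: e) = gam x
      & forall x, enorm (x - x0) < r -> (Omega x <-> gam x < dotv x e)].

Definition lipschitz_domain Omega : Prop :=
  [/\ open Omega, connected Omega, Omega !=set0, bounded_set Omega
    & lipschitz_boundary Omega].

Definition e_ (j : 'I_d) : X := delta_mx ord0 j.

Definition is_d Omega (j : 'I_d) (v g : X -> R) : Prop :=
  is_weak_derivative (lebesgue_rV R d) Omega (@test_fun R X Omega)
    (fun psi x => 'D_(e_ j) psi x) v g.

(* weak gradient; a component that does not exist in L^2 has the junk value 0 *)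
Definition grad Omega v (x : X) : X :=
  \row_j xget (cst 0) [set g | is_d Omega j v g] x.

Definition in_H1 Omega v : Prop :=
  in_L2 (lebesgue_rV R d) Omega v /\ forall j, exists g, is_d Omega j v g.

Definition normX Omega v : \bar R := L2norm (lebesgue_rV R d) Omega v.

Definition normX_vec Omega (w : X -> X) : \bar R := normX Omega (enorm \o w).

(* closure of C_c^\infty(Omega) in H^1(Omega) *)
Definition in_H10 Omega v : Prop :=
  in_H1 Omega v /\ forall eps : R, 0 < eps -> exists psi,
    [/\ @test_fun R X Omega psi, (normX Omega (v \- psi)%R < eps%:E)%E
      & (normX_vec Omega (grad Omega (v \- psi)%R) < eps%:E)%E].

Definition poincare_constant Omega (C : R) : Prop :=
  0 < C /\ forall v, in_H10 Omega v ->
    (normX Omega v <= (C * diam Omega)%:E * normX_vec Omega (grad Omega v))%E.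

(* elements of H^{-1}(Omega), as functionals relevant only on H^1_0(Omega) *)
Definition in_Hm1 Omega (g : (X -> R) -> R) : Prop :=
  (forall (a : R) v w, in_H10 Omega v -> in_H10 Omega w ->
     g (fun x => a * v x + w x) = a * g v + g w) /\
  exists C : R, forall v, in_H10 Omega v ->
    (`|g v|%:E <= C%:E * normX_vec Omega (grad Omega v))%E.

Definition Hm1norm Omega (g : (X -> R) -> R) : \bar R :=
  ereal_sup [set (g v / fine (normX_vec Omega (grad Omega v)))%:E
            | v in [set v | in_H10 Omega v /\ normX Omega v != 0%E]].

End space.

Section bochner.
Variables (R : realType) (d : nat) (T : R) (Omega : set 'rV[R]_d).
Local Notation X := 'rV[R]_d.
Local Notation I := (`]0, T[%classic : set (measurableTypeR R)).
Local Notation leb := (@lebesgue_measure R).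

Definition simple_H10 (phi : R -> X -> R) : Prop :=
  exists (n : nat) (A : 'I_n -> set (measurableTypeR R)) (v : 'I_n -> X -> R),
    (forall k, measurable (A k) /\ in_H10 Omega (v k)) /\
    phi = fun t x => \sum_k \1_(A k) t * v k x.

(* int_0^T ||nabla phi||^2 *)
Definition energy (phi : R -> X -> R) : \bar R :=
  (\int[leb]_(t in I) (normX_vec Omega (grad Omega (phi t)) ^+ 2))%E.

(* The Bochner space L^2(0,T;H^1_0(Omega)): strongly measurable functions, i.e.
   almost everywhere limits of simple functions, of finite energy. *)
Definition in_L2H10 (phi : R -> X -> R) : Prop :=
  [/\ {ae leb, forall t, I t -> in_H10 Omega (phi t)},
      exists phi_ : nat -> R -> X -> R,
        (forall k, simple_H10 (phi_ k)) /\
        {ae leb, forall t, I t ->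
          normX_vec Omega (grad Omega (phi_ k t \- phi t)%R)
            @[k --> \oo] --> 0%E}
    & (energy phi < +oo)%E].

(* dual norm of a functional on L^2(0,T;H^1_0(Omega)) *)
Definition L2Hm1norm (F : (R -> X -> R) -> R) : \bar R :=
  ereal_sup [set (F phi)%:E
            | phi in [set phi | in_L2H10 phi /\ energy phi = 1%E]].

(* [g] in L^2(0,T;H^{-1}(Omega)) is the time derivative of [u], i.e.
   int_0^T theta' (u, v) = - int_0^T theta <g, v> for all v in H^1_0(Omega)
   and theta in C_c^\infty(0,T); measurability of [g] is weak measurability,
   which is enough since H^1_0(Omega) is separable. *)
Definition is_dt_Hm1 (u : R * X -> R) (g : R -> (X -> R) -> R) : Prop :=
  [/\ forall t, I t -> in_Hm1 Omega (g t),
      forall v, in_H10 Omega v ->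
        measurable_fun I (fun t => g t v : measurableTypeR R),
      (\int[leb]_(t in I) (Hm1norm Omega (g t) ^+ 2) < +oo)%E
    & forall v (theta : R -> R), in_H10 Omega v ->
        @test_fun R R `]0, T[%classic theta ->
        \int[leb]_(t in I) ('D_1 theta t *
            \int[lebesgue_rV R d]_(x in Omega) (u (t, x) * v x)) =
        - \int[leb]_(t in I) (theta t * g t v)].

(* junk value 0 if [u] has no time derivative in L^2(0,T;H^{-1}(Omega)) *)
Definition dt_Hm1 (u : R * X -> R) : R -> (X -> R) -> R :=
  xget (fun _ _ => 0) [set g | is_dt_Hm1 u g].

End bochner.

Section spacetime.
Variables (R : realType) (d : nat) (T : R) (Omega : set 'rV[R]_d).
Local Notation X := 'rV[R]_d.
Local Notation Z := (R * 'rV[R]_d)%type.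
Local Notation MZ := (measurableTypeR R * 'rV[R]_d)%type.
Local Notation I := (`]0, T[%classic : set (measurableTypeR R)).
Local Notation leb := (@lebesgue_measure R).

Definition lebZ : {measure set MZ -> \bar R} :=
  (@lebesgue_measure R \x lebesgue_rV R d)%E.

Definition Qset : set MZ := `]0, T] `*` Omega.
Definition Qopen : set MZ := `]0, T[ `*` Omega.
Definition Qclosed : set Z := closure (Qset : set Z).
Definition GammaT : set Z := `[0, T] `*` bdry Omega.

Definition normQ (u : Z -> R) : \bar R := L2norm lebZ Qset u.
Definition normQ_vec (w : Z -> X) : \bar R := normQ (fun z => enorm (w z)).

(* L^2(Q) weak derivatives, tested with C_c^\infty((0,T) x Omega) *)
Definition is_dt (u g : Z -> R) : Prop :=
  is_weak_derivative lebZ Qset (@test_fun R Z Qopen)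
    (fun psi z => 'D_(1, 0) psi z) u g.

Definition is_dx (j : 'I_d) (u g : Z -> R) : Prop :=
  is_weak_derivative lebZ Qset (@test_fun R Z Qopen)
    (fun psi z => 'D_(0, e_ R j) psi z) u g.

Definition dt (u : Z -> R) : Z -> R := xget (cst 0) [set g | is_dt u g].

Definition gradx (u : Z -> R) (z : Z) : X :=
  \row_j xget (cst 0) [set g | is_dx j u g] z.

Definition in_H1Q (u : Z -> R) : Prop :=
  [/\ in_L2 lebZ Qset u, exists g, is_dt u g
    & forall j, exists g, is_dx j u g].

(* classical spatial gradient, for test functions *)
Definition cgradx (psi : Z -> R) (z : Z) : X :=
  \row_j 'D_(0, e_ R j) psi z.

Definition is_divx (O : set Z) (v : Z -> X) (g : Z -> R) : Prop :=
  in_L2 lebZ O g /\ forall psi, @test_fun R Z O psi ->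
    \int[lebZ]_(z in O) dotv (v z) (cgradx psi z) =
    - \int[lebZ]_(z in O) (g z * psi z).

Definition residual (b B : R -> R) (f : Z -> R) (s : Z -> R)
    (phi : R -> X -> R) : R :=
  \int[leb]_(t in I) dt_Hm1 T Omega (b \o s) t (phi t)
  + \int[leb]_(t in I) \int[lebesgue_rV R d]_(x in Omega)
      dotv (gradx (B \o s) (t, x)) (grad Omega (phi t) x)
  - \int[leb]_(t in I) \int[lebesgue_rV R d]_(x in Omega)
      (f (t, x) * phi t x).

Definition residual_H (s : Z -> R) (phi : R -> X -> R) : R :=
  \int[leb]_(t in I) dt_Hm1 T Omega s t (phi t)
  + \int[leb]_(t in I) \int[lebesgue_rV R d]_(x in Omega)
      dotv (gradx s (t, x)) (grad Omega (phi t) x).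

Definition residual_lin (L : R) (b B : R -> R) (f : Z -> R) (s sbar : Z -> R)
    (phi : R -> X -> R) : R :=
  L * residual_H (s \- sbar) phi + residual b B f sbar phi.

Definition Vnorm (v : Z -> R) : \bar R :=
  sqrte (\int[leb]_(t in I)
           (normX_vec Omega (fun x => gradx v (t, x)) ^+ 2
            + Hm1norm Omega (dt_Hm1 T Omega v t) ^+ 2)
         + normX Omega (fun x => v (T, x)) ^+ 2)%E.

End spacetime.

(* Vertices are indexed by ['I_nnode]; a cell is the set of its vertices. *)
Record mesh (R : realType) (d : nat) := Mesh {
  nnode : nat;
  pos : 'I_nnode -> R * 'rV[R]_d;
  cells : {set {set 'I_nnode}} }.

Section mesh.
Variables (R : realType) (d : nat).
Local Notation X := 'rV[R]_d.
Local Notation Z := (R * 'rV[R]_d)%type.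
Implicit Types M : mesh R d.

Definition conv_cell M (K : {set 'I_(nnode M)}) : set Z :=
  [set z | exists l : 'I_(nnode M) -> R,
     [/\ forall a, 0 <= l a, \sum_(a in K) l a = 1
       & z = \sum_(a in K) l a *: pos a]].

Definition affinely_independent M (K : {set 'I_(nnode M)}) : Prop :=
  forall l : 'I_(nnode M) -> R,
    \sum_(a in K) l a = 0 -> \sum_(a in K) l a *: pos a = 0 ->
    forall a, a \in K -> l a = 0.

Definition distZ (z w : Z) : R :=
  Num.sqrt ((z.1 - w.1) ^+ 2 + enorm (z.2 - w.2) ^+ 2).

(* h_K <= kappa * rho_K, with h_K the diameter of K and rho_K the diameter of
   its largest inscribed ball *)
Definition shape_regular M (kappa : R) : Prop :=
  forall K, K \in cells M -> exists (c : Z) (r : R),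
    [/\ 0 < r, [set z | distZ z c <= r] `<=` conv_cell K
      & forall z w, conv_cell K z -> conv_cell K w ->
          distZ z w <= kappa * (2 * r)].

Definition simplicial_mesh (D : set Z) (kappa : R) M : Prop :=
  [/\ injective (@pos _ _ M),
      forall a, exists2 K, K \in cells M & a \in K,
      forall K, K \in cells M -> #|K| = d.+2 /\ affinely_independent K,
      (forall K K', K \in cells M -> K' \in cells M ->
        conv_cell K `&` conv_cell K' = conv_cell (K :&: K')) /\
      \bigcup_(K in [set K | K \in cells M]) conv_cell K = D
    & shape_regular M kappa].

(* polynomial functions of total degree <= p in (t, x): the index (k, al)
   stands for the monomial t^k x^al *)
Definition poly_fun (p : nat) (q : Z -> R) : Prop :=
  exists c : 'I_p.+1 * {ffun 'I_d -> 'I_p.+1} -> R, forall z,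
    q z = \sum_(m : 'I_p.+1 * {ffun 'I_d -> 'I_p.+1} | (m.1 + \sum_j m.2 j <= p)%N)
            c m * z.1 ^+ m.1 * \prod_j z.2 ord0 j ^+ m.2 j.

Definition piecewise_poly M (Ks : {set {set 'I_(nnode M)}}) (D : set Z)
    (p : nat) (v : Z -> R) : Prop :=
  in_L2 (lebZ R d) D v /\ forall K, K \in Ks -> exists2 q, poly_fun p q
    & {ae lebZ R d, forall z, conv_cell K z -> v z = q z}.

(* L^2(Q)-orthogonal projection onto the piecewise constants *)
Definition is_Pi0 M (D : set Z) (v g : Z -> R) : Prop :=
  piecewise_poly (cells M) D 0 g /\
  forall w, piecewise_poly (cells M) D 0 w ->
    \int[lebZ R d]_(z in D) ((v z - g z) * w z) = 0.

Definition Pi0 M (D : set Z) (v : Z -> R) : Z -> R :=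
  xget (cst 0) [set g | is_Pi0 M D v g].

Definition Pi0_vec M (D : set Z) (w : Z -> X) (z : Z) : X :=
  \row_j Pi0 M D (fun y => w y ord0 j) z.

Definition is_hat M (D : set Z) (a : 'I_(nnode M)) (phi : Z -> R) : Prop :=
  [/\ {within D, continuous phi},
      forall K, K \in cells M -> exists2 q, poly_fun 1 q
        & forall z, conv_cell K z -> phi z = q z
    & forall c, phi (pos c) = (c == a)%:R].

(* omega_a is used through its interior, from which it differs by a null set *)
Definition patch_set (D : set Z) (phi : Z -> R) : set Z :=
  interior (closure [set z | D z /\ phi z != 0]).

Variables (T : R) (Omega : set X).

(* P_1(T_htau) \cap H^1(Q) with zero trace on Gamma_T; an element of this space
   is represented by its continuous representative on the closure of Q, whose
   traces at t = 0, t = T and on Gamma_T are its pointwise values. *)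
Definition in_Vh M (v : Z -> R) : Prop :=
  [/\ piecewise_poly (cells M) (Qset T Omega) 1 v, in_H1Q T Omega v,
      {within Qclosed T Omega, continuous v}
    & forall z, GammaT T Omega z -> v z = 0].

(* a linear projection of L^2(Omega) onto { v(0) : v in V_htau } *)
Definition discrete_projection M (P : (X -> R) -> X -> R) : Prop :=
  let L2X := in_L2 (lebesgue_rV R d) Omega in
  [/\ forall (a : R) w w', L2X w -> L2X w' -> forall x, Omega x ->
        P (fun y => a * w y + w' y) x = a * P w x + P w' x,
      forall w, L2X w -> exists2 v, in_Vh M v
        & forall x, Omega x -> P w x = v (0, x)
    & forall v, in_Vh M v -> forall x, Omega x ->
        P (fun y => v (0, y)) x = v (0, x)].

(* [v] belongs to Q^a_htau, where [om] is the patch around [a], and its divergence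
   is [g].  For v in H(div; om) the condition v . n_x = 0 on the boundary part
   outside Gamma_T is understood, as usual, through the Green formula
   int_om (v . nabla psi + (div v) psi) = int_{bdry om} (v . n_x) psi, tested
   with the smooth psi vanishing in a neighbourhood of Gamma_T. *)
Definition in_Qa M (p : nat) (a : 'I_(nnode M)) (om : set Z) (v : Z -> X)
    (g : Z -> R) : Prop :=
  [/\ forall j, piecewise_poly [set K in cells M | a \in K] om p
        (fun z => v z ord0 j),
      is_divx om v g
    & forall psi, @test_fun R Z (~` GammaT T Omega) psi ->
        \int[lebZ R d]_(z in om) (dotv (v z) (cgradx psi z) + g z * psi z) = 0].

Definition local_flux M (p : nat) (a : 'I_(nnode M)) (phi : Z -> R)
    (S : Z -> R) (F : Z -> X) (sig : Z -> X) : Prop :=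
  let Q := Qset T Omega in
  let om := patch_set (Qclosed T Omega) phi in
  let g := fun z => - Pi0 M Q (phi \* S) z
                    - dotv (gradx T Omega phi z) (Pi0_vec M Q F z) in
  let J := fun v : Z -> X =>
    L2norm (lebZ R d) om (fun z => enorm (v z + phi z *: F z)) in
  in_Qa p a om sig g /\ forall v, in_Qa p a om v g -> (J sig <= J v)%E.

(* sum over the vertices of the local fluxes extended by zero *)
Definition global_flux M (phi : 'I_(nnode M) -> Z -> R)
    (sig : 'I_(nnode M) -> Z -> X) (z : Z) : X :=
  \sum_a \1_(patch_set (Qclosed T Omega) (phi a)) z *: sig a z.

End mesh.

Definition admissible_nonlinearities (R : realType) (b B : R -> R) : Prop :=
  [/\ {homo b : r s / r <= s}, {homo B : r s / r <= s}, b 0 = 0,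
      forall r s, `|B s - B r| <= `|s - r| /\ `|b s - b r| <= `|s - r|
    & forall r s, r <= s -> s - r <= (b s + B s) - (b r + B r)].

(* Main.v *)
(** Write [P] for the cellwise mean of the residual density [S], and [ds] for the
  increment [s_{i+1} - s_i]. The hat functions are a partition of unity and their
  gradients sum to zero, so the local constraints add up to [div sigma = - P]; tensor
  products of test functions and the separability of [H^1_0] turn this into an identity
  for almost every time slice. Hence the linearised residual at [phi] equals
  [(S - P, phi) + (F + sigma, grad phi)]. Since [d_t ds] is piecewise constant, [S - P] is
  the data oscillation, and Cauchy-Schwarz with the Poincare inequality gives the first
  estimate.

  The second estimate bounds the [H^{-1}] norm of [d_t ds], which is an [L^2] function,
  by the Poincare inequality. For the third, [R(s_i) = R_lin - L R_H(ds)]. Applying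
  Cauchy-Schwarz to [phi -> (d_t ds, phi) + (grad ds, grad phi)] slice by slice bounds
  its squared norm by [C_P^2 h^2 |d_t ds|^2 + 2 (d_t ds, ds) + |grad ds|^2]; as
  [ds(0) = 0], the cross term integrates to [|ds(T)|^2], which yields [eta_lin].

  The data being piecewise affine, everything reduces to explicit weak derivatives: [b]
  and [B] are differentiable almost everywhere, and almost every slice of [ds] is in
  [H^1_0] by quasi-interpolation. *)

(* The derivatives and projections in the statement are chosen functions with a junk value, so each
   of them needs an explicit representative and uniqueness almost everywhere before anything can be
   computed. A path in [L^2(0,T;H^1_0)] is a family of slices without joint measurability on [Q], so
   Fubini's theorem does not apply to a pairing with it: the data are sliced in time, the functional
   is evaluated on almost every slice, and measurability in [t] comes from the approximating simple
   paths. Exceptional sets of times must therefore not depend on the function tested with, hence the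
   countable dense family. The dual norms are suprema that get squared, and an empty supremum would
   have an infinite square, so nonzero test functions have to be exhibited. In the third estimate,
   Cauchy-Schwarz applied term by term would bound the heat residual by a sum of two norms, which is
   in general larger than [eta_lin]; keeping the cross term on each slice is what produces
   [|ds(T)|^2] instead. *)
Require Import Defs.
From HB Require Import structures.
From mathcomp Require Import all_boot all_order all_algebra.
From mathcomp Require Import all_classical all_reals all_analysis.
From mathcomp Require Import measurable_realfun zify ring lra.
Set Implicit Arguments.
Unset Strict Implicit.
Unset Printing Implicit Defensive.
Import Order.TTheory GRing.Theory Num.Theory numFieldNormedType.Exports.
Local Open Scope classical_set_scope.
Local Open Scope ring_scope.

(** * Smooth functions *)

Section smooth_closure.
Context (R : realType).

(** [smooth] quantifies over lists of directions, which suits neither products nor compositions,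
    whose derivatives are sums of products. Recursion on the order lets each closure property be
    proved by induction, one derivative at a time. *)
Fixpoint smoothN (V : normedModType R) (n : nat) (f : V -> R) : Prop :=
  (forall x, differentiable f x) /\
  if n is m.+1 then forall v, smoothN m (fun x => 'D_v f x) else True.

Lemma smoothP (V : normedModType R) (f : V -> R) : smooth f <-> forall n, smoothN n f.
Proof.
split=> [+ n|h vs].
  elim: n f => [|n IH] f sf; first by split=> // x; exact: (sf [::] x).
  split=> [x|v]; first exact: (sf [::] x).
  by apply: IH => vs x; exact: (sf (v :: vs) x).
have {h} := h (size vs).
elim: vs f => [|v vs IH] f [df h] x; first exact: df.
exact: (IH _ (h v)).
Qed.

Lemma smoothNW (V : normedModType R) n (f : V -> R) : smoothN n.+1 f -> smoothN n f.
Proof.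
elim: n f => [|n IH] f [df h]; split=> // v; exact/IH/h.
Qed.

Lemma smoothN_cst (V : normedModType R) n (c : R) : smoothN n (fun _ : V => c).
Proof.
elim: n c => [|n IH] c; (split; first by move=> x; exact: (differentiable_cst c x)) => // v.
by rewrite [X in smoothN _ X](_ : _ = fun=> 0); [exact: IH|apply/funext => x; rewrite (derive_cst c)].
Qed.

Lemma smoothN_add (V : normedModType R) n (f g : V -> R) : smoothN n f -> smoothN n g ->
  smoothN n (fun x => f x + g x).
Proof.
elim: n f g => [|n IH] f g [df hf] [dg hg];
  (split; first by move=> x; exact: (differentiableD (df x) (dg x))) => // v.
rewrite [X in smoothN _ X](_ : _ = fun x => 'D_v f x + 'D_v g x); first by apply: IH; [exact: hf|exact: hg].
by apply/funext => x; rewrite -deriveD //; apply: diff_derivable.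
Qed.

Lemma smoothN_mul (V : normedModType R) n (f g : V -> R) : smoothN n f -> smoothN n g ->
  smoothN n (fun x => f x * g x).
Proof.
elim: n f g => [|n IH] f g sf sg; have [df hf] := sf; have [dg hg] := sg;
  (split; first by move=> x; exact: (differentiableM (df x) (dg x))) => // v.
rewrite [X in smoothN _ X](_ : _ = fun x => f x * 'D_v g x + g x * 'D_v f x).
  by apply: smoothN_add; apply: IH; by [exact: smoothNW|exact: hf|exact: hg].
by apply/funext => x; rewrite -[_ * 'D_v g x]/(_ *: _) -[_ * 'D_v f x]/(_ *: _)
  -deriveM //; apply: diff_derivable.
Qed.

Lemma smoothN_inv (V : normedModType R) n (f : V -> R) : smoothN n f -> (forall x, f x != 0) ->
  smoothN n (fun x => (f x)^-1).
Proof.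
elim: n f => [|n IH] f sf f0; have [df hf] := sf;
  (split; first by move=> x; exact: (differentiableV (df x) (f0 x))) => // v.
rewrite [X in smoothN _ X](_ : _ = fun x => (-1) * ((f x)^-1 * (f x)^-1 * 'D_v f x)).
  apply: smoothN_mul; first exact: smoothN_cst.
  apply: smoothN_mul; last exact: hf.
  by apply: smoothN_mul; apply: IH => //; apply: smoothNW.
apply/funext => x; rewrite deriveV //; last exact: diff_derivable.
by rewrite mulN1r -[_ *: _]/(_ * _) mulNr -expr2 exprVn.
Qed.

Lemma derive_comp_affine (V W : normedModType R) (A : {linear V -> W}) (c : W) (f : W -> R)
  (v x : V) : 'D_v (fun x => f (A x + c)) x = 'D_(A v) f (A x + c).
Proof.
rewrite /derive.
have -> // : (fun h => h^-1 *: (((fun x => f (A x + c)) \o shift x) (h *: v) - f (A x + c))) =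
  (fun h => h^-1 *: ((f \o shift (A x + c)) (h *: A v) - f (A x + c))).
by apply/funext => h /=; rewrite (linearD A) (linearZ_LR A) addrA.
Qed.

Lemma smoothN_comp_affine (V W : normedModType R) (A : {linear V -> W}) (c : W) n (f : W -> R) :
  continuous A -> smoothN n f -> smoothN n (fun x => f (A x + c)).
Proof.
move=> cA; elim: n f => [|n IH] f [df hf];
  (split; first (move=> x; apply: (differentiable_comp (f := fun x => A x + c) (g := f)) => //;
    by apply: differentiableD; [exact: linear_differentiable|exact: differentiable_cst])) => // v.
rewrite [X in smoothN _ X](_ : _ = fun x => ('D_(A v) f) (A x + c)); first by apply: (IH (fun x => 'D_(A v) f x)); exact: hf.
by apply/funext => x; rewrite derive_comp_affine.
Qed.

Lemma smooth_cst (V : normedModType R) (c : R) : smooth (fun _ : V => c).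
Proof. by apply/smoothP => n; exact: smoothN_cst. Qed.

Lemma smooth_add (V : normedModType R) (f g : V -> R) : smooth f -> smooth g ->
  smooth (fun x => f x + g x).
Proof. by move=> /smoothP sf /smoothP sg; apply/smoothP => n; exact: smoothN_add. Qed.

Lemma smooth_mul (V : normedModType R) (f g : V -> R) : smooth f -> smooth g ->
  smooth (fun x => f x * g x).
Proof. by move=> /smoothP sf /smoothP sg; apply/smoothP => n; exact: smoothN_mul. Qed.

Lemma smooth_inv (V : normedModType R) (f : V -> R) : smooth f -> (forall x, f x != 0) ->
  smooth (fun x => (f x)^-1).
Proof. by move=> /smoothP sf f0; apply/smoothP => n; exact: smoothN_inv. Qed.

Lemma smooth_comp_affine (V W : normedModType R) (A : {linear V -> W}) (c : W) (f : W -> R) :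
  continuous A -> smooth f -> smooth (fun x => f (A x + c)).
Proof. by move=> cA /smoothP sf; apply/smoothP => n; exact: smoothN_comp_affine. Qed.

Lemma smooth_derive (V : normedModType R) (f : V -> R) v : smooth f -> smooth (fun x => 'D_v f x).
Proof. by move=> sf vs x; exact: (sf (v :: vs) x). Qed.

Lemma smooth_diff (V : normedModType R) (f : V -> R) : smooth f -> forall x, differentiable f x.
Proof. by move=> sf x; exact: (sf [::] x). Qed.

Lemma smooth_continuous (V : normedModType R) (f : V -> R) : smooth f -> continuous f.
Proof. by move=> sf x; apply: differentiable_continuous; exact: smooth_diff. Qed.

Lemma smooth_sum (V : normedModType R) (I : Type) (r : seq I) (f : I -> V -> R) :
  (forall i, smooth (f i)) -> smooth (fun x => \sum_(i <- r) f i x).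
Proof.
move=> sf; elim: r => [|i r IH].
  by under eq_fun do rewrite big_nil; exact: smooth_cst.
by under eq_fun do rewrite big_cons; exact: smooth_add.
Qed.

Lemma smooth_prod (V : normedModType R) (I : Type) (r : seq I) (f : I -> V -> R) :
  (forall i, smooth (f i)) -> smooth (fun x => \prod_(i <- r) f i x).
Proof.
move=> sf; elim: r => [|i r IH].
  by under eq_fun do rewrite big_nil; exact: smooth_cst.
by under eq_fun do rewrite big_cons; exact: smooth_mul.
Qed.

End smooth_closure.

(** * A smooth transition from 0 to 1 *)

Section smooth_step.
Context (R : realType).
Implicit Types (p : {poly R}) (x y : R).

(** The flat function [exp(-1/x)] with a polynomial factor in [1/x]. The factor makes the family
    stable under differentiation, so that one first-order computation gives smoothness of every
    order. *)
Definition expinv p x : R := if 0 < x then p.[x^-1] * expR (- x^-1) else 0.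

(** With [y = 1/x] this says that [expinv p] decays faster than any power at 0. The induction on [p]
    moves one factor [y] from the polynomial into the power, which is why [n] is arbitrary. *)
Lemma poly_expRN_bound p n : exists C : R, forall y, 0 <= y ->
  `|p.[y] * expR (- y)| * y ^+ n <= C.
Proof.
elim/poly_ind: p n => [n|p c IH n].
  by exists 0 => y _; rewrite horner0 mul0r normr0 mul0r.
have [C hC] := IH n.+1.
exists (C + `|c| * n.+1`!%:R + `|c|) => y y0.
rewrite hornerMXaddC mulrDl; apply: le_trans (_ : (`|p.[y] * y * expR (- y)| + `|c * expR (- y)|) * y ^+ n <= _).
  by apply: ler_wpM2r; [exact: exprn_ge0|exact: ler_normD].
rewrite mulrDl -addrA; apply: lerD.
  by rewrite mulrAC normrM (ger0_norm y0) -mulrA -exprS; exact: hC.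
rewrite normrM (ger0_norm (expR_ge0 _)) -mulrA.
rewrite -[leRHS]mulr1 -[X in _ + X]mulr1 -mulrDr mulr1; apply: ler_wpM2l => //.
rewrite expRN mulrC ler_pdivrMr ?expR_gt0 //.
have f0 m : 0 < m`!%:R :> R by rewrite ltr0n fact_gt0.
case: n {IH hC} => [|n].
  by have := expR_ge1Dx y; rewrite expr0 factS fact0 muln1; lra.
have := expR_ge1Dxn n y0; rewrite -(ler_pM2r (f0 n.+1)) mulrDl divfK ?gt_eqF // => h.
have : (n.+1`! <= n.+2`!)%N by rewrite [leqRHS]factS leq_pmull.
rewrite -(ler_nat R) => h2; have := f0 n.+1; have := expR_ge0 y; nra.
Qed.

(** Read off from [(p(1/x) exp(-1/x))' = (p(1/x) - p'(1/x)) x^(-2) exp(-1/x)]. *)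
Let expinv_deriv p : {poly R} := (p - p^`()) * 'X^2.

Lemma is_derive_expinv p x : is_derive x 1 (expinv p) (expinv (expinv_deriv p) x).
Proof.
have [x0|x0|->] := ltgtP x 0.
- rewrite {2}/expinv ltNge (ltW x0) /=.
  apply: (@near_eq_is_derive _ _ _ (cst 0)).
  near=> y; rewrite /expinv ltNge ltW //.
  by near: y; exact: lt_nbhsl.
- rewrite {2}/expinv x0.
  apply: (@near_eq_is_derive _ _ _ (fun y => p.[y^-1] * expR (- y^-1))).
    near=> y; rewrite /expinv ifT //.
    by near: y; exact: lt_nbhsr.
  have xn0 : x != 0 by rewrite gt_eqF.
  have di : is_derive x 1 (fun y : R => y^-1) (- x ^- 2).
    apply: is_derive_eq; first exact: (is_deriveV (f := id)).
    by rewrite -[_ *: _]/(_ * _) mulr1.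
  have dp := is_derive1_comp (is_derive_poly p x^-1) di.
  have dn : is_derive x 1 (fun y : R => - y^-1) (- - x ^- 2) by exact: is_deriveN.
  have de := @is_derive1_comp R expR (fun y => - y^-1) x _ _ (is_derive_expR (- x^-1)) dn.
  apply: (is_derive_eq (is_deriveM dp de)).
  rewrite /expinv_deriv !hornerE.
  change (p.[x^-1] * (expR (- x^-1) * - - x ^- 2) + expR (- x^-1) * (p^`().[x^-1] * - x ^- 2) =
    (p.[x^-1] - p^`().[x^-1]) * x^-1 * x^-1 * expR (- x^-1)).
  by rewrite -exprVn; ring.
- rewrite {2}/expinv ltxx.
  have h0 : (fun h : R => h^-1 *: ((expinv p \o shift 0) (h *: 1) - expinv p 0)) @ 0^' --> (0 : R).
    (* Of the two powers of [h], one absorbs the division by [h] and the other makes the quotient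
       tend to 0. *)
    have [C hC] := poly_expRN_bound p 2.
    apply/cvgr0Pnorm_lt => e e0.
    have C0 : 0 < `|C| + 1 by rewrite ltr_wpDl.
    near=> h; rewrite /= addr0 [h *: 1]mulr1 {2}/expinv ltxx subr0 -[_ *: _]/(_ * _).
    have hn0 : h != 0 by near: h; exact: nbhs_dnbhs_neq.
    rewrite /expinv; case: ifPn => h0; last by rewrite mulr0 normr0.
    have := hC h^-1; rewrite invr_ge0 (ltW h0) exprVn => /(_ isT).
    rewrite ler_pdivrMr ?exprn_gt0 // => hh; rewrite normrM (gtr0_norm (x := h^-1)) ?invr_gt0 //.
    rewrite ltr_pdivrMl //; apply: le_lt_trans hh _.
    have hs : `|h| < e / (`|C| + 1).
      by near: h; apply: dnbhs0_lt; exact: divr_gt0.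
    rewrite gtr0_norm // ltr_pdivlMr // in hs.
    rewrite expr2 mulrA mulrC ltr_pM2l //; apply: le_lt_trans hs.
    have := ler_norm C; nra.
  apply: DeriveDef; first by apply/cvg_ex; exists 0.
  exact/cvg_lim.
Unshelve. all: by end_near. Qed.

Lemma smooth_expinv p : smooth (expinv p).
Proof.
apply/smoothP => n; elim: n p => [|n IH] p.
  by split=> // x; apply/derivable1_diffP; have := is_derive_expinv p x; case.
split=> [x|v]; first by apply/derivable1_diffP; have := is_derive_expinv p x; case.
have -> : (fun x => 'D_v (expinv p) x) = expinv (v *: expinv_deriv p).
  apply/funext => x; have dx : differentiable (expinv p) x.
    by apply/derivable1_diffP; have := is_derive_expinv p x; case.
  have vE : v = v *: (1 : R) by exact/esym/mulr1.
  rewrite deriveE // {1}vE (linearZ_LR ('d (expinv p) x)) -deriveE //.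
  have /@derive_val -> := is_derive_expinv p x.
  rewrite /expinv; case: ifP => _; last exact: mulr0.
  by rewrite hornerZ; exact: mulrA.
exact: IH.
Qed.

Definition step x : R := expinv 1 x / (expinv 1 x + expinv 1 (1 - x)).

Lemma expinv1_ge0 x : 0 <= expinv 1 x.
Proof. by rewrite /expinv; case: ifP => // _; rewrite hornerE mul1r expR_ge0. Qed.

Lemma expinv1_gt0 x : 0 < x -> 0 < expinv 1 x.
Proof. by move=> x0; rewrite /expinv x0 hornerE mul1r expR_gt0. Qed.

Lemma expinv_le0 p x : x <= 0 -> expinv p x = 0.
Proof. by move=> x0; rewrite /expinv ltNge x0. Qed.

Lemma step_den_gt0 x : 0 < expinv 1 x + expinv 1 (1 - x).
Proof.
have [x0|x0] := ltP 0 x; first by rewrite ltr_pwDl ?expinv1_gt0 ?expinv1_ge0.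
by rewrite ltr_wpDl ?expinv1_ge0 // expinv1_gt0 //; lra.
Qed.

Lemma smooth_step : smooth step.
Proof.
have s1 : smooth (fun x => expinv 1 (1 - x)).
  have := @smooth_comp_affine R R R (-%R : {linear R -> R}) 1 (expinv 1).
  by rewrite (_ : (fun x => expinv 1 (- x + 1)) = fun x => expinv 1 (1 - x));
    [apply=> //; [move=> x; exact: opp_continuous|exact: smooth_expinv]|apply/funext => x; rewrite addrC].
apply: smooth_mul; first exact: smooth_expinv.
apply: smooth_inv => [|x]; last by rewrite gt_eqF ?step_den_gt0.
by apply: smooth_add => //; exact: smooth_expinv.
Qed.

Lemma step_le0 x : x <= 0 -> step x = 0.
Proof. by move=> x0; rewrite /step expinv_le0 ?mul0r. Qed.

Lemma step_ge1 x : 1 <= x -> step x = 1.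
Proof.
by move=> x1; rewrite /step (expinv_le0 1 (x := 1 - x)) ?addr0 ?divff ?gt_eqF ?expinv1_gt0 //; lra.
Qed.

Lemma step_ge0 x : 0 <= step x.
Proof. by rewrite divr_ge0 ?expinv1_ge0 // ltW // step_den_gt0. Qed.

Lemma step_le1 x : step x <= 1.
Proof. by rewrite ler_pdivrMr ?step_den_gt0 // mul1r lerDl expinv1_ge0. Qed.

End smooth_step.

(** * L2 spaces *)

Section integral_nomeas.
Context d (T : measurableType d) (R : realType) (mu : {measure set T -> \bar R}).
Local Open Scope ereal_scope.
Import HBNNSimple.

(* No measurability is required: the integral of a nonnegative function is a
   supremum over simple functions below it. *)
Lemma ge0_ae_le_integral (D : set T) (f g : T -> \bar R) :
  (forall x, D x -> 0 <= f x) -> (forall x, D x -> 0 <= g x) ->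
  {ae mu, forall x, D x -> f x <= g x} ->
  \int[mu]_(x in D) f x <= \int[mu]_(x in D) g x.
Proof.
move=> f0 g0 [N [mN N0 fgN]].
rewrite 2?ge0_integralE //; apply: ub_ereal_sup => _ [h hf <-].
have mNC : measurable (~` N) by exact: measurableC.
have -> : sintegral mu h = sintegral mu (proj_nnsfun h mNC).
  rewrite -!integralT_nnsfun (ge0_negligible_integral mN) //; last 2 first.
  - exact/measurable_EFinP.
  - by move=> x _; rewrite lee_fin.
  rewrite setTD integral_mkcond; apply: eq_integral => x _.
  rewrite /= patchE mindicE; case: ifPn => xN; first by rewrite mulr1.
  by rewrite mulr0.
apply: ereal_sup_ubound; exists (proj_nnsfun h mNC) => // x /=.
rewrite mindicE; case: (boolP (x \in ~` N)) => xN; last first.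
  by rewrite mulr0 patchE; case: ifPn => // /set_mem; exact: g0.
rewrite mulr1 (le_trans (hf x)) // !patchE; case: ifPn => // xD.
apply: contrapT => h1; move/set_mem : xN; apply; apply: fgN => h2.
by apply: h1; exact: (h2 (set_mem xD)).
Qed.

Lemma ge0_ae_eq_integral_nomeas (D : set T) (f g : T -> \bar R) :
  (forall x, D x -> 0 <= f x) -> (forall x, D x -> 0 <= g x) ->
  {ae mu, forall x, D x -> f x = g x} ->
  \int[mu]_(x in D) f x = \int[mu]_(x in D) g x.
Proof.
move=> f0 g0 fg; apply/eqP; rewrite eq_le; apply/andP; split;
  apply: ge0_ae_le_integral => //; apply: filterS fg => x fg Dx; by rewrite fg.
Qed.

Lemma ae_eq_integral_nomeas (D : set T) (f g : T -> \bar R) :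
  {ae mu, forall x, D x -> f x = g x} ->
  \int[mu]_(x in D) f x = \int[mu]_(x in D) g x.
Proof.
move=> fg; rewrite integralE [RHS]integralE; congr (_ - _);
  apply: ge0_ae_eq_integral_nomeas => //; apply: filterS fg => x fg Dx;
  by rewrite ?funeposE ?funenegE fg.
Qed.

Lemma ae_eq_Rintegral_nomeas (D : set T) (f g : T -> R) :
  {ae mu, forall x, D x -> f x = g x} ->
  (\int[mu]_(x in D) f x = \int[mu]_(x in D) g x)%R.
Proof.
move=> fg; congr fine; apply: ae_eq_integral_nomeas.
by apply: filterS fg => x fg Dx; rewrite fg.
Qed.

End integral_nomeas.

(** The discriminant criterion for a form that may be degenerate; it yields Cauchy-Schwarz for every
    semi-inner product. *)
Lemma quad_CS (R : realFieldType) (p q r : R) :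
  (forall x y, 0 <= x ^+ 2 * p + 2 * x * y * q + y ^+ 2 * r) -> q ^+ 2 <= p * r.
Proof.
move=> h; have p0 : 0 <= p by have := h 1 0; lra.
have r0 : 0 <= r by have := h 0 1; lra.
have [p00|p0'] := eqVneq p 0.
  have [->|q0] := eqVneq q 0; first by rewrite p00 mul0r expr0n.
  (* With [p = 0] the form takes the value [- r - 2] here, which is negative. *)
  have := h (- (r + 1) / q) 1; rewrite p00 mulr0 mulr1 -mulrA divfK //; lra.
have pp : 0 < p by rewrite lt_def p0'.
have h' := h (- q) p; rewrite -(ler_pM2l pp); lra.
Qed.

Lemma sqr_le_sqrt (R : rcfType) (q p r : R) : 0 <= p -> q ^+ 2 <= p * r ->
  `|q| <= Num.sqrt p * Num.sqrt r.
Proof.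
by move=> p0 h; rewrite -sqrtr_sqr -sqrtrM // ler_wsqrtr.
Qed.

Section L2_theory.
Context d (T : measurableType d) (R : realType) (mu : {measure set T -> \bar R}).
Variables (D : set T) (mD : measurable D).
Implicit Types f g h : T -> R.
Local Notation L2 f := (in_L2 mu D f).

Definition ip f g : R := \int[mu]_(z in D) (f z * g z).

Lemma L2normE f :
  L2norm mu D f = ((\int[mu]_(z in D) ((f z) ^+ 2)%:E) `^ 2^-1)%E.
Proof.
rewrite /L2norm unlock; congr (_ `^ _)%E; rewrite [RHS]integral_mkcond.
apply: eq_integral => x _; rewrite /= !patchE; case: ifPn => _.
  by rewrite powR_mulrn // real_normK // num_real.
by rewrite normr0 powR0.
Qed.

Lemma L2norm_sqr f : (L2norm mu D f ^+ 2 = \int[mu]_(z in D) ((f z) ^+ 2)%:E)%E.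
Proof.
have h0 : (0 <= \int[mu]_(z in D) ((f z) ^+ 2)%:E)%E.
  by apply: integral_ge0 => x _; rewrite lee_fin sqr_ge0.
rewrite L2normE; case: (\int[mu]_(z in D) _)%E h0 => [r||] // r0.
  by rewrite poweR_EFin -EFin_expe powR12_sqrt // sqr_sqrtr.
by rewrite poweRyr ?invr_eq0 // expe2 mulyy.
Qed.

Lemma L2norm_ge0 f : (0 <= L2norm mu D f)%E.
Proof. by rewrite L2normE poweR_ge0. Qed.

Lemma in_L2E f : L2 f <-> measurable_fun D (f : T -> measurableTypeR R) /\
  (\int[mu]_(z in D) ((f z) ^+ 2)%:E < +oo)%E.
Proof.
rewrite /in_L2 -L2norm_sqr; split => -[mf h]; split=> //.
  by move: h (L2norm_ge0 f); case: (L2norm _ _ _) => [r||] // _ _; rewrite -EFin_expe ltry.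
by move: h (L2norm_ge0 f); case: (L2norm _ _ _) => [r||] // ; rewrite ?expe2 ?mulyy ?ltry.
Qed.

Lemma in_L2_integrable_sqr f : L2 f -> mu.-integrable D (EFin \o (fun z => f z ^+ 2)).
Proof.
move=> /in_L2E[mf h]; apply/integrableP; split.
  by apply/measurable_EFinP; exact: measurable_funX.
rewrite (eq_integral (fun z => ((f z) ^+ 2)%:E)) // => z _.
by rewrite /= ger0_norm // sqr_ge0.
Qed.

Lemma in_L2_integrableM f g : L2 f -> L2 g -> mu.-integrable D (EFin \o (fun z => f z * g z)).
Proof.
move=> Lf Lg; have If := in_L2_integrable_sqr Lf; have Ig := in_L2_integrable_sqr Lg.
apply: (le_integrable mD _ _ (integrableD mD If Ig)).
  by apply/measurable_EFinP; apply: measurable_funM; [exact: Lf.1|exact: Lg.1].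
move=> z _ /=; rewrite lee_fin [leRHS]ger0_norm ?addr_ge0 ?sqr_ge0 // normrM.
rewrite -(real_normK (num_real (f z))) -(real_normK (num_real (g z))).
move: (normr_ge0 (f z)) (normr_ge0 (g z)); nra.
Qed.

Lemma in_L2_lin a f g : L2 f -> L2 g -> L2 (fun z => a * f z + g z).
Proof.
move=> Lf Lg; apply/in_L2E; split.
  by apply: measurable_funD; [apply: measurable_funM => //; exact: Lf.1|exact: Lg.1].
have If := in_L2_integrable_sqr Lf; have Ig := in_L2_integrable_sqr Lg.
have I2 := integrableD mD (integrableZl mD (2 * a ^+ 2) If) (integrableZl mD 2 Ig).
apply: le_lt_trans (integrable_lty mD I2); apply: ge0_ae_le_integral.
- by move=> z _; rewrite lee_fin sqr_ge0.
- by move=> z _; rewrite /= lee_fin addr_ge0 // mulr_ge0 ?sqr_ge0 // mulr_ge0 // sqr_ge0.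
- apply: nearW => z _ /=; rewrite lee_fin.
  have := sqr_ge0 (a * f z - g z); rewrite !expr2; lra.
Qed.

Lemma in_L2_0 : L2 (fun _ => 0).
Proof.
apply/in_L2E; split; first exact: measurable_cst.
by rewrite (eq_integral (cst 0%E)) ?integral0 // => z _ /=; rewrite expr0n.
Qed.

Lemma in_L2D f g : L2 f -> L2 g -> L2 (fun z => f z + g z).
Proof.
move=> Lf Lg; have := in_L2_lin 1 Lf Lg.
by under eq_fun do rewrite mul1r.
Qed.

Lemma in_L2Z a f : L2 f -> L2 (fun z => a * f z).
Proof.
move=> Lf; have := in_L2_lin a Lf in_L2_0.
by under eq_fun do rewrite addr0.
Qed.

Lemma in_L2B f g : L2 f -> L2 g -> L2 (fun z => f z - g z).
Proof.
move=> Lf Lg; have := in_L2_lin (-1) Lg Lf.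
by under eq_fun do rewrite mulN1r addrC.
Qed.

Lemma in_L2_sum (I : Type) (r : seq I) (f : I -> T -> R) : (forall i, L2 (f i)) ->
  L2 (fun z => \sum_(i <- r) f i z).
Proof.
move=> Lf; elim: r => [|i r IH].
  by under eq_fun do rewrite big_nil; exact: in_L2_0.
by under eq_fun do rewrite big_cons; exact: in_L2D.
Qed.

Lemma in_L2_dom f g C : measurable_fun D (f : T -> measurableTypeR R) -> L2 g ->
  (forall z, D z -> `|f z| <= C * `|g z|) -> L2 f.
Proof.
move=> mf Lg h; apply/in_L2E; split=> //.
have I2 := integrableZl mD (C ^+ 2) (in_L2_integrable_sqr Lg).
apply: le_lt_trans (integrable_lty mD I2); apply: ge0_ae_le_integral.
- by move=> z _; rewrite lee_fin sqr_ge0.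
- by move=> z _; rewrite /= lee_fin mulr_ge0 ?sqr_ge0.
- apply: nearW => z /h hz /=; rewrite lee_fin -(real_normK (num_real (f z))).
  rewrite -(real_normK (num_real (g z))) -exprMn lerXn2r // ?nnegrE //.
  exact: le_trans hz.
Qed.

Lemma in_L2_bounded f C : (mu D < +oo)%E -> measurable_fun D (f : T -> measurableTypeR R) ->
  (forall z, D z -> `|f z| <= C) -> L2 f.
Proof.
move=> muD mf h; apply: (@in_L2_dom _ (fun=> 1) C) => //; last first.
  by move=> z /h; rewrite normr1 mulr1.
apply/in_L2E; split; first exact: measurable_cst.
by rewrite (eq_integral (cst 1%E)) ?integral_cst ?mul1e // => z _ /=; rewrite expr1n.
Qed.

Lemma in_L2_ae f g : measurable_fun D (g : T -> measurableTypeR R) ->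
  {ae mu, forall z, D z -> f z = g z} -> L2 f -> L2 g.
Proof.
move=> mg fg /in_L2E[mf h]; apply/in_L2E; split=> //.
apply: le_lt_trans h; apply: ge0_ae_le_integral.
- by move=> z _; rewrite lee_fin sqr_ge0.
- by move=> z _; rewrite lee_fin sqr_ge0.
- by apply: filterS fg => z fg Dz; rewrite fg.
Qed.

Lemma ip_ae f f' g g' : {ae mu, forall z, D z -> f z = f' z} ->
  {ae mu, forall z, D z -> g z = g' z} -> ip f g = ip f' g'.
Proof.
by move=> h h'; apply: ae_eq_Rintegral_nomeas; apply: filterS2 h h' => z h h' Dz;
  rewrite h ?h'.
Qed.

Lemma L2norm_ae f g : {ae mu, forall z, D z -> f z = g z} -> L2norm mu D f = L2norm mu D g.
Proof.
move=> fg; rewrite !L2normE; congr (_ `^ _)%E; apply: ae_eq_integral_nomeas.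
by apply: filterS fg => z fg Dz; rewrite fg.
Qed.

Lemma ipC f g : ip f g = ip g f.
Proof. by apply: eq_Rintegral => z _; rewrite mulrC. Qed.

Lemma ip_linl a f g h : L2 f -> L2 g -> L2 h ->
  ip (fun z => a * f z + g z) h = a * ip f h + ip g h.
Proof.
move=> Lf Lg Lh; rewrite /ip -RintegralZl //; last exact: in_L2_integrableM.
rewrite -RintegralD //; last 2 first.
- by have := integrableZl mD a (in_L2_integrableM Lf Lh).
- exact: in_L2_integrableM.
by apply: eq_Rintegral => z _; rewrite mulrDl mulrA.
Qed.

Lemma ip_linr a f g h : L2 f -> L2 g -> L2 h ->
  ip h (fun z => a * f z + g z) = a * ip h f + ip h g.
Proof. by move=> Lf Lg Lh; rewrite ipC ip_linl // [ip f h]ipC [ip g h]ipC. Qed.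

Lemma ipDl f g h : L2 f -> L2 g -> L2 h -> ip (fun z => f z + g z) h = ip f h + ip g h.
Proof.
move=> Lf Lg Lh; rewrite -[ip f h]mul1r -ip_linl //.
by congr ip; apply/funext => z; rewrite mul1r.
Qed.

Lemma ipZl a f h : L2 f -> L2 h -> ip (fun z => a * f z) h = a * ip f h.
Proof.
move=> Lf Lh; have := ip_linl a Lf in_L2_0 Lh.
have -> : ip (fun=> 0) h = 0.
  by rewrite /ip (@eq_Rintegral _ _ _ _ _ (cst 0)) ?Rintegral_cst ?mul0r // => z _; rewrite mul0r.
by rewrite addr0 => <-; congr ip; apply/funext => z; rewrite addr0.
Qed.

Lemma ipBl f g h : L2 f -> L2 g -> L2 h -> ip (fun z => f z - g z) h = ip f h - ip g h.
Proof.
move=> Lf Lg Lh; rewrite -[- ip g h]mulN1r addrC -ip_linl //.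
by congr ip; apply/funext => z; rewrite mulN1r addrC.
Qed.

Lemma ip_suml (I : Type) (r : seq I) (f : I -> T -> R) h : (forall i, L2 (f i)) -> L2 h ->
  ip (fun z => \sum_(i <- r) f i z) h = \sum_(i <- r) ip (f i) h.
Proof.
move=> Lf Lh; elim: r => [|i r IH].
  rewrite big_nil /ip (@eq_Rintegral _ _ _ _ _ (cst 0)) ?Rintegral_cst ?mul0r // => z _.
  by rewrite big_nil mul0r.
rewrite big_cons -IH -ipDl //; last exact: in_L2_sum.
by congr ip; apply/funext => z; rewrite big_cons.
Qed.

Lemma ip_ge0 f : 0 <= ip f f.
Proof. by apply: Rintegral_ge0 => z _; rewrite -expr2 sqr_ge0. Qed.

Lemma ip_integral f : L2 f -> (\int[mu]_(z in D) ((f z) ^+ 2)%:E = (ip f f)%:E)%E.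
Proof.
move=> Lf; rewrite /ip /Rintegral fineK //.
have := integrable_fin_num mD (in_L2_integrable_sqr Lf).
by under eq_integral do rewrite /= expr2.
Qed.

Lemma L2normK f : L2 f -> L2norm mu D f = (Num.sqrt (ip f f))%:E.
Proof. by move=> Lf; rewrite L2normE ip_integral //= powR12_sqrt ?ip_ge0. Qed.

Lemma ip_CS2 f g : L2 f -> L2 g -> ip f g ^+ 2 <= ip f f * ip g g.
Proof.
move=> Lf Lg; apply: quad_CS => x y.
have := ip_ge0 (fun z => x * f z + (y * g z)).
have Lx := in_L2Z x Lf; have Ly := in_L2Z y Lg.
rewrite ip_linl ?(ip_linr x) ?ipZl ?(ipC g) //; last exact: in_L2D.
- by rewrite (ipC f) ipZl // ipZl // (ipC g f); lra.
Qed.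

Lemma ip_CS f g : L2 f -> L2 g -> `|ip f g| <= Num.sqrt (ip f f) * Num.sqrt (ip g g).
Proof. by move=> Lf Lg; apply: sqr_le_sqrt; [exact: ip_ge0|exact: ip_CS2]. Qed.

Lemma ip_eq0 f : L2 f -> ip f f = 0 -> {ae mu, forall z, D z -> f z = 0}.
Proof.
move=> Lf f0.
have mf2 : measurable_fun D (EFin \o (fun z => f z ^+ 2)).
  by apply/measurable_EFinP; apply: measurable_funX; exact: Lf.1.
have /(ae_eq_integral_abs _ mD mf2) : (\int[mu]_(z in D) `|((f z) ^+ 2)%:E| = 0)%E.
  rewrite -[RHS]/(0%:E) -f0 -ip_integral //; apply: eq_integral => z _ /=.
  by rewrite ger0_norm ?sqr_ge0.
by apply: filterS => z h Dz; have /eqP := h Dz; rewrite /= eqe sqrf_eq0 => /eqP.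
Qed.

End L2_theory.

(** * Translations, affine maps and null sets *)

Section measure_preserving.
Context (R : realType).
Local Notation leb := (@lebesgue_measure R).

Definition mpres d (T : measurableType d) (mu : {measure set T -> \bar R}) (f : T -> T) : Prop :=
  measurable_fun setT f /\ forall A, measurable A -> mu (f @^-1` A) = mu A.

Lemma affine_measurable (a s : R) :
  @measurable_fun _ _ (measurableTypeR R) (measurableTypeR R) setT (fun h : R => a + h * s).
Proof. by apply: measurable_funD => //; exact: measurable_funM. Qed.

(** Both sides are measures in [A] that agree on half-open intervals, and these determine Lebesgue
    measure. *)
Lemma lebesgue_measure_affine (a s : R) (A : set (measurableTypeR R)) : 0 < s -> measurable A ->
  leb A = (s%:E * leb ((fun h => a + h * s)%R @^-1` A))%E.
Proof.
move=> s0 mA.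
pose f := (fun h => a + h * s : measurableTypeR R).
have mf : measurable_fun setT f := affine_measurable a s.
pose nu : {measure set _ -> \bar R} := mscale (NngNum (ltW s0)) (pushforward leb f).
rewrite (@lebesgue_measure_unique R (nu mf)) // => _ [[x y]] _ <-.
rewrite /nu /= /mscale /= /pushforward.
have -> : f @^-1` `]x, y]%classic = `](x - a) / s, (y - a) / s]%classic.
  apply/seteqP; split => h; rewrite /= !in_itv /= ltr_pdivrMr // ler_pdivlMr // /f;
    move=> /andP[h1 h2]; apply/andP; split; lra.
rewrite !lebesgue_measure_itv /= !lte_fin ltr_pM2r ?invr_gt0 // ltrBlDr subrK.
case: ifP => _; last by rewrite mule0.
rewrite -EFinD -EFinM; congr (_%:E); field; exact: lt0r_neq0.
Qed.

Lemma lebesgue_measure_affine_null (a s : R) (N : set (measurableTypeR R)) : s != 0 -> measurable N ->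
  leb N = 0%E -> leb ((fun h => a + h * s)%R @^-1` N) = 0%E.
Proof.
have key t : 0 < t -> measurable N -> leb N = 0%E -> leb ((fun h => a + h * t)%R @^-1` N) = 0%E.
  move=> t0 mN; rewrite (lebesgue_measure_affine a t0 mN) => /eqP.
  by rewrite mule_eq0 eqe gt_eqF //= => /eqP.
move=> s0 mN N0; have [sn|sp|/eqP] := ltgtP s 0; last by rewrite (negbTE s0).
- have mf : measurable ((fun h => a + h * - s) @^-1` N : set (measurableTypeR R)).
    by rewrite -(setTI (_ @^-1` _)); exact: (affine_measurable a (- s) measurableT mN).
  have := lebesgue_measureN mf; rewrite (key (- s)) ?oppr_gt0 // => <-.
  by rewrite /pushforward; congr leb; apply/seteqP; split => h /=; rewrite mulrNN.
- exact: key.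
Qed.

Lemma mpres_shiftR (a : R) : mpres leb (fun h => h + a).
Proof.
split; first exact: measurable_funD.
move=> A mA; rewrite [RHS](lebesgue_measure_affine a ltr01 mA) mul1e.
by congr leb; apply/seteqP; split => h /=; rewrite mulr1 addrC.
Qed.

Lemma mpres_prod d1 d2 (T1 : measurableType d1) (T2 : measurableType d2)
    (m1 : {measure set T1 -> \bar R}) (m2 : {sigma_finite_measure set T2 -> \bar R})
    (f : T1 -> T1) (g : T2 -> T2) : mpres m1 f -> mpres m2 g ->
  mpres (m1 \x m2)%E (fun p => (f p.1, g p.2)).
Proof.
move=> [mf hf] [mg hg].
have mfg : measurable_fun setT (fun p : T1 * T2 => (f p.1, g p.2)).
  apply/measurable_fun_pairP; split => /=.
    exact: (measurableT_comp mf measurable_fst).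
  exact: (measurableT_comp mg measurable_snd).
split=> // A mA; rewrite /product_measure1 /=.
transitivity (\int[m1]_x (m2 (xsection A (f x))))%E.
  apply: eq_integral => x _; rewrite -[RHS]hg; last exact: measurable_xsection.
  by congr (m2 _); apply/seteqP; split => y; rewrite /xsection /= !inE.
rewrite -(@ge0_integral_pushforward _ _ _ _ _ f mf m1 setT (fun x => m2 (xsection A x))) //;
  last exact: measurable_fun_xsection.
by apply: eq_measure_integral => B mB _; exact: hf.
Qed.

Lemma integrable_mpres d (T : measurableType d) (mu : {measure set T -> \bar R}) (f : T -> T)
    (F : T -> \bar R) : mpres mu f -> mu.-integrable setT F -> mu.-integrable setT (F \o f).
Proof.
move=> [mf hf] iF; have mF := measurable_int _ iF.
apply/integrableP; split; first exact: measurableT_comp.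
have /integrableP[_] := iF.
suff -> : (\int[mu]_x `|F x| = \int[mu]_x `|(F \o f) x|)%E by [].
rewrite -(@ge0_integral_pushforward _ _ _ _ _ f mf mu setT (abse \o F)) //; last 2 first.
- exact: measurableT_comp.
- by move=> ? _; rewrite abse_ge0.
by apply: eq_measure_integral => B mB _; rewrite -hf.
Qed.

Lemma integral_mpres d (T : measurableType d) (mu : {measure set T -> \bar R}) (f : T -> T)
    (F : T -> \bar R) : mpres mu f -> mu.-integrable setT F ->
  (\int[mu]_x F (f x) = \int[mu]_x F x)%E.
Proof.
move=> hmf iF; have iFf := integrable_mpres hmf iF; have [mf hf] := hmf.
have mF := measurable_int _ iF.
rewrite -[LHS]/(\int[mu]_(x in f @^-1` setT) (F \o f) x)%E -(integral_pushforward mf) //.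
by apply: eq_measure_integral => B mB _; exact: hf.
Qed.

(** Fubini for the set [B] of pairs [(h, z)] with [h] in [[0, 1]] and [l z + h s] in [N]. For fixed
    [h] the section is a translate of the preimage and has its measure; for fixed [z] it lies in the
    preimage of [N] under a nonconstant affine map of the line, hence is null. Averaging over
    translations thus reduces the claim to dimension one. *)
Lemma preimage_affine_null d (T : measurableType d) (mu : {sigma_finite_measure set T -> \bar R})
    (sh : R -> T -> T) (l : T -> R) (s : R) (N : set (measurableTypeR R)) :
  (forall h, mpres mu (sh h)) -> measurable_fun setT (l : T -> measurableTypeR R) ->
  (forall h z, l (sh h z) = l z + h * s) -> s != 0 -> measurable N -> leb N = 0%E ->
  mu (l @^-1` N) = 0%E.
Proof.
move=> msh ml lsh s0 mN N0.
have mA : measurable (l @^-1` N) by rewrite -[X in measurable X]setTI; exact: ml.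
pose B : set (measurableTypeR R * T) := [set p | N (l p.2 + p.1 * s)] `&` (`[0, 1]%classic `*` setT).
have mB : measurable B.
  apply: measurableI; last exact: measurableX.
  have mF : measurable_fun setT (fun p : measurableTypeR R * T => l p.2 + p.1 * s : measurableTypeR R).
    apply: measurable_funD; first exact: (measurableT_comp ml).
    exact: measurable_funM.
  by rewrite -[X in measurable X]setTI; exact: mF.
have h1 : (product_measure1 leb mu B = mu (l @^-1` N)).
  rewrite /product_measure1 /=.
  transitivity (\int[leb]_(h in `[0%R, 1%R]%classic) (cst (mu (l @^-1` N))) h)%E.
    rewrite [RHS]integral_mkcond; apply: eq_integral => h _ /=.
    rewrite patchE; case: ifPn => h01.
      rewrite -[RHS](proj2 (msh h) _ mA); congr (mu _); apply/seteqP; split => z.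
        by rewrite /xsection /= inE => -[/= ? _]; rewrite lsh.
      by rewrite /xsection /= inE lsh => ?; split=> //; split => //; exact: set_mem.
    rewrite -[RHS]/(0%E : \bar R) -(measure0 mu); congr (mu _); apply/seteqP; split => z //.
    by rewrite /xsection /= inE => -[_ [/= h2 _]]; move/negP: h01; apply; exact: mem_set.
  rewrite integral_cst //= lebesgue_measure_itv /= lte_fin ltr01.
  by rewrite oppr0 adde0 mule1.
rewrite -h1.
(* The order of integration is exchanged: the sections are now taken at fixed [z] instead of fixed
   [h]. *)
have -> : product_measure1 leb mu B = product_measure2 leb mu B.
  have mu2 := @product_measure_unique _ _ _ _ R leb mu (product_measure2 leb mu).
  by rewrite -[LHS]/((leb \x mu)%E B) mu2 // => C D mC mD; exact: product_measure2E.
rewrite /product_measure2 /=; apply: integral0_eq => z _ /=.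
apply/eqP; rewrite eq_le measure_ge0 andbT.
rewrite -(lebesgue_measure_affine_null (l z) s0 mN N0); apply: le_measure.
- by rewrite inE; exact: measurable_ysection.
- by rewrite inE -[X in measurable X]setTI; exact: affine_measurable.
- by move=> h; rewrite /ysection /= inE => -[].
Qed.

End measure_preserving.

Section lebesgue_rV_theory.
Context (R : realType).

Lemma consrVD n (p : measurableTypeR R * 'rV[R]_n) (v : 'rV[R]_n.+1) :
  consrV p + v = consrV (p.1 + (unconsrV v).1, p.2 + (unconsrV v).2).
Proof.
apply/rowP => i; rewrite !mxE; case: unliftP => [j ->|->] //=.
by rewrite !mxE.
Qed.

Lemma mpres_shift_rV n (v : 'rV[R]_n) : mpres (lebesgue_rV R n) (fun x => x + v).
Proof.
have mv m (w : 'rV[R]_m) : measurable_fun setT (fun x : 'rV[R]_m => x + w).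
  apply: measurable_fun_rVP => i; under eq_fun do rewrite mxE.
  by apply: measurable_funD => //; exact: measurable_coor.
split; first exact: mv.
elim: n v => [|n IH] v A mA.
  by congr (lebesgue_rV R 0 _); apply/seteqP; split => x; rewrite /= (_ : x + v = x) //;
    apply/rowP => -[].
rewrite /= /lebesgue_rV_step /pushforward /=.
have mc : measurable (@consrV R n @^-1` A).
  by rewrite -[X in measurable X]setTI; exact: measurable_consrV.
rewrite -[RHS](proj2 (mpres_prod (mpres_shiftR (unconsrV v).1)
  (conj (mv n (unconsrV v).2) (IH (unconsrV v).2))) _ mc).
by congr ((_ \x _)%E _); apply/seteqP; split => p /=; rewrite consrVD.
Qed.

Definition boxrV n (a b : 'I_n -> R) : set 'rV[R]_n :=
  [set x | forall k, a k < x ord0 k < b k].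

Lemma boxrV_cons n (a b : 'I_n.+1 -> R) :
  @consrV R n @^-1` boxrV a b =
  `]a ord0, b ord0[%classic `*` boxrV (fun j => a (lift ord0 j)) (fun j => b (lift ord0 j)).
Proof.
apply/seteqP; split => -[t x] /=.
  move=> h; split; first by have := h ord0; rewrite mxE unlift_none /= in_itv.
  by move=> j; have := h (lift ord0 j); rewrite mxE liftK.
move=> [h1 h2] k; rewrite mxE; case: unliftP => [j ->|->]; first exact: h2.
by move: h1; rewrite /= in_itv.
Qed.

Lemma measurable_boxrV n (a b : 'I_n -> R) : measurable (boxrV a b).
Proof.
have -> : boxrV a b = \bigcap_(k in [set: 'I_n]) ((fun x => x ord0 k : measurableTypeR R) @^-1` `]a k, b k[%classic).
  by apply/seteqP; split => x /= h k; have := h k; rewrite /= in_itv //=; apply.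
apply: fin_bigcap_measurable => // k _.
by rewrite -[X in measurable X]setTI; apply: (measurable_coor k).
Qed.

Lemma lebesgue_boxrV n (a b : 'I_n -> R) : (lebesgue_rV R n (boxrV a b) < +oo)%E /\
  ((forall k, a k < b k) -> (0 < lebesgue_rV R n (boxrV a b))%E).
Proof.
elim: n a b => [|n IH] a b.
  have -> : boxrV a b = setT by apply/seteqP; split => // x _ [].
  by rewrite /= diracT; split=> [|_]; rewrite ?ltry // lte_fin.
rewrite /= /lebesgue_rV_step /pushforward boxrV_cons.
have [h1 h2] := IH (fun j => a (lift ord0 j)) (fun j => b (lift ord0 j)).
rewrite product_measure1E //; last exact: measurable_boxrV.
set m := (X in (X * _)%E).
have -> : m = (if (a ord0 < b ord0)%R then (b ord0 - a ord0)%:E else 0)%E.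
  by rewrite /m -[LHS]/(lebesgue_measure _) lebesgue_measure_itv /= lte_fin.
split => [|h].
  case: ifP => ab; last by rewrite mul0e ltry.
  by apply: lte_mul_pinfty => //; rewrite lee_fin subr_ge0 ltW.
rewrite h; apply: mule_gt0; last by apply: h2 => j.
by rewrite lte_fin subr_gt0.
Qed.

End lebesgue_rV_theory.

(** * Test functions and weak derivatives *)

Lemma Rintegral_dominated_cvg d (T : measurableType d) (R : realType)
    (mu : {measure set T -> \bar R}) (D : set T) (f_ : nat -> T -> R) (f g : T -> R) :
  measurable D ->
  (forall m, measurable_fun D (f_ m : T -> measurableTypeR R)) ->
  measurable_fun D (f : T -> measurableTypeR R) ->
  {ae mu, forall x, D x -> f_ m x @[m --> \oo] --> f x} ->
  mu.-integrable D (EFin \o g) ->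
  {ae mu, forall x, D x -> forall m, `|f_ m x| <= g x} ->
  \int[mu]_(x in D) f_ m x @[m --> \oo] --> \int[mu]_(x in D) f x.
Proof.
move=> mD mf_ mf cf ig fg.
have [] := @dominated_convergence _ _ _ mu D mD (fun m x => (f_ m x)%:E) (EFin \o f) (EFin \o g).
- by move=> m; apply/measurable_EFinP; exact: mf_.
- exact/measurable_EFinP.
- by apply: filterS cf => x cf Dx; apply: cvg_EFin; [exact: nearW|exact: cf].
- exact: ig.
- by apply: filterS fg => x fg m Dx; rewrite /= lee_fin; exact: fg.
move=> iF _ h; move: h; rewrite -[X in _ --> X]fineK; last exact: integrable_fin_num iF.
by move=> /fine_cvgP[].
Qed.

Section smooth_more.
Context (R : realType).

Lemma derive_scal (th : R -> R) (y w : R) : differentiable th y -> 'D_w th y = w * 'D_1 th y.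
Proof.
move=> dth; have wE : w = w *: (1 : R) by exact/esym/mulr1.
by rewrite deriveE // {1}wE (linearZ_LR ('d th y)) -deriveE.
Qed.

Lemma smoothN_comp (V : normedModType R) n (th : R -> R) (f : V -> R) :
  smooth th -> smoothN n f -> smoothN n (fun x => th (f x)).
Proof.
elim: n th f => [|n IH] th f sth sf; have [df hf] := sf;
  (split; first by move=> x; exact: (differentiable_comp (df x) (smooth_diff sth (f x)))) => // v.
rewrite [X in smoothN _ X](_ : _ = fun x => 'D_v f x * 'D_1 th (f x)).
  apply: smoothN_mul; first exact: hf.
  by apply: (IH (fun y => 'D_1 th y)); [exact: smooth_derive|exact: smoothNW].
apply/funext => x; have dth := smooth_diff sth (f x).
rewrite deriveE; last exact: differentiable_comp.
by rewrite (@diff_comp _ _ _ _ f th) //= -deriveE // derive_scal // -deriveE.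
Qed.

Lemma smooth_comp (V : normedModType R) (th : R -> R) (f : V -> R) :
  smooth th -> smooth f -> smooth (fun x => th (f x)).
Proof. by move=> sth /smoothP sf; apply/smoothP => n; exact: smoothN_comp. Qed.

Lemma smooth_id : smooth (fun x : R => x).
Proof.
apply/smoothP => -[|n]; (split; first by move=> x; exact/derivable1_diffP/derivable_id) => // v.
rewrite [X in smoothN _ X](_ : _ = fun=> v); first exact: smoothN_cst.
by apply/funext => x; rewrite (derive_id x).
Qed.

(** Sequences instead of filters, as dominated convergence requires. *)
Lemma derive_seq (V : normedModType R) (f : V -> R) (x e : V) (h : nat -> R) :
  derivable f x e -> (forall m, h m != 0) -> h m @[m --> \oo] --> (0 : R) ->
  (h m)^-1 * (f (x + h m *: e) - f x) @[m --> \oo] --> 'D_e f x.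
Proof.
move=> df h0 hc.
have hc' : h m @[m --> \oo] --> (0 : R)^'.
  move=> A [e' /= e'0 hA]; have [N _ hN] := hc _ (nbhsx_ballx (0:R) _ e'0).
  by exists N => // m /hN hm; apply: hA => //; exact: h0.
rewrite (_ : (fun m => _) = (fun t => t^-1 *: ((f \o shift x) (t *: e) - f x)) \o h).
  exact: cvg_comp hc' df.
by apply/funext => m /=; rewrite [_ + x]addrC.
Qed.

Lemma derive_line (V : normedModType R) (f : V -> R) (x e : V) (s : R) : differentiable f (x + s *: e) ->
  is_derive s 1 (fun s => f (x + s *: e)) ('D_e f (x + s *: e)).
Proof.
move=> df.
have E : (fun h : R => h^-1 *: (((fun s => f (x + s *: e)) \o shift s) (h *: 1) - f (x + s *: e)))
  = (fun h => h^-1 *: ((f \o shift (x + s *: e)) (h *: e) - f (x + s *: e))).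
  apply/funext => h /=; rewrite [h *: 1]mulr1 scalerDl addrCA addrA.
  by congr (_ *: (f _ - _)); rewrite addrC addrA.
by apply: DeriveDef; rewrite ?/derivable ?/derive E //; exact: diff_derivable.
Qed.

Lemma smooth_lipschitz_dir (V : normedModType R) (f : V -> R) (e : V) (C : R) : smooth f ->
  (forall x, `|'D_e f x| <= C) -> forall x h, `|f (x + h *: e) - f x| <= C * `|h|.
Proof.
move=> sf hC.
have key (x : V) (h : R) : 0 <= h -> `|f (x + h *: e) - f x| <= C * h.
  move=> h0; have [||c _] := @MVT_segment R (fun s => f (x + s *: e)) (fun s => 'D_e f (x + s *: e)) 0 h h0.
  - by move=> s _; apply: derive_line; exact: smooth_diff.
  - apply: derivable_within_continuous => s _.
    by have := derive_line (smooth_diff sf (x + s *: e)); case.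
  - by rewrite scale0r addr0 subr0 => ->; rewrite normrM (ger0_norm h0) ler_wpM2r.
move=> x h; have [h0|h0] := lerP 0 h; first by rewrite (ger0_norm h0); exact: key.
have := key (x + h *: e) (- h); rewrite oppr_ge0 => /(_ (ltW h0)).
by rewrite scaleNr addrK distrC (ltr0_norm h0).
Qed.

End smooth_more.

(** * A common description of the line, space and space-time by coordinates *)

Section coordinates.
Context (R : realType) (n : nat) (V : normedModType R) (d : measure_display)
  (T : measurableType d).
Variables (tv : T -> V) (mu : {measure set T -> \bar R}) (c : 'I_n -> V -> R)
  (mk : ('I_n -> R) -> V).

Definition cbox (a b : 'I_n -> R) : set V := [set x | forall k, a k <= c k x <= b k].
Definition obox (a b : 'I_n -> R) : set V := [set x | forall k, a k < c k x < b k].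

(* [T] and [V] are the same space, seen as a measurable and as a normed space. *)
Record coords : Prop := Coords {
  coords_lin : forall k h x y, c k (x + h *: y) = c k x + h * c k y;
  coords_smooth : forall k, smooth (c k);
  coords_norm : forall x r, 0 < r -> `|x| < r <-> forall k, `|c k x| < r;
  coords_mk : forall a k, c k (mk a) = a k;
  coords_compact : forall a b, compact (cbox a b);
  coords_measurable : forall k, measurable_fun setT (fun z => c k (tv z) : measurableTypeR R);
  coords_gen : @measurable _ T `<=`
    <<s [set A | exists k (Y : set (measurableTypeR R)), measurable Y /\ A = (fun z => c k (tv z)) @^-1` Y] >>;
  coords_fin : forall a b, (mu (tv @^-1` obox a b) < +oo)%E }.

Hypothesis hc : coords.

Let cB k x y : c k (x - y) = c k x - c k y.
Proof. by rewrite -scaleN1r (coords_lin hc) mulN1r. Qed.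

Lemma measurable_obox a b : measurable (tv @^-1` obox a b).
Proof.
have -> : tv @^-1` obox a b = \bigcap_(k in [set: 'I_n]) ((fun z => c k (tv z) : measurableTypeR R) @^-1` `]a k, b k[%classic).
  by apply/seteqP; split => x /= h k; have := h k; rewrite /= in_itv //=; apply.
apply: fin_bigcap_measurable => // k _.
by rewrite -[X in measurable X]setTI; apply: (coords_measurable hc).
Qed.

(** Open boxes are stable under intersection, so together with generation this is the input of
    Dynkin's theorem in [test_orthogonal0]. *)
Lemma obox_gen : @measurable _ T = <<s [set A | exists a b, A = tv @^-1` obox a b] >>.
Proof.
apply/seteqP; split; last first.
  apply: smallest_sub; first exact: sigma_algebra_measurable.
  by move=> _ [a [b ->]]; exact: measurable_obox.
apply: subset_trans (coords_gen hc) _; apply: smallest_sub; first exact: smallest_sigma_algebra.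
move=> _ [k [Y [mY ->]]]; set G := <<s _ >>.
have sG : sigma_algebra setT G by exact: smallest_sigma_algebra.
have := @sigma_algebra_image T R setT (fun z => c k (tv z)) G sG.
rewrite /image_set_system => sI.
have : ([set A | exists x, A = `]-oo, x[%classic] : set (set R)).-sigma.-measurable Y.
  by rewrite -RGenInftyO.measurableE.
move=> /(_ _ (conj sI _)) /= h; rewrite -(setTI (_ @^-1` _)); apply: h.
move=> _ [x ->] /=; rewrite setTI.
(* A half-space is the union of its truncations to boxes of size [N]; a point is reached once [N]
   exceeds its norm. *)
have -> : (fun z => c k (tv z)) @^-1` `]-oo, x[%classic =
    \bigcup_N (tv @^-1` obox (fun _ => - N%:R) (fun j => if j == k then x else N%:R)).
  apply/seteqP; split => z /=; rewrite in_itv /=; last first.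
    by move=> [N _ /(_ k)]; rewrite eqxx => /andP[].
  move=> zx; exists (Num.bound (`|tv z| + 1)) => // j /=.
  have h1 : `|tv z| < (Num.bound (`|tv z| + 1))%:R.
    by apply: le_lt_trans (archi_boundP _); rewrite ?addr_ge0 // lerDl.
  have /(coords_norm hc) h2 : 0 < (Num.bound (`|tv z| + 1))%:R :> R by exact: le_lt_trans h1.
  by move/h2: h1 => /(_ j); rewrite ltr_norml => /andP[-> ?] /=; case: eqP => [->|].
have [_ _] := sG; apply => N; apply: sub_sigma_algebra.
by exists (fun _ => - N%:R), (fun j => if j == k then x else N%:R).
Qed.

Lemma closed_cbox a b : closed (cbox a b).
Proof. by apply: compact_closed; [exact: norm_hausdorff|exact: (coords_compact hc)]. Qed.

Let qbox (i : {ffun 'I_n -> rat} * nat) : ('I_n -> R) * ('I_n -> R) :=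
  (fun k => ratr (i.1 k) - i.2.+1%:R^-1, fun k => ratr (i.1 k) + i.2.+1%:R^-1).

(** The boxes are the cubes with rational centre and radius [1/(m + 1)] whose closed version lies in
    [O]. The closed version is what gives the bumps of these boxes compact support inside [O]. *)
Lemma open_cover (O : set V) : open O -> exists a b : nat -> 'I_n -> R, exists P : set nat,
  O = \bigcup_(j in P) obox (a j) (b j) /\ forall j, P j -> cbox (a j) (b j) `<=` O.
Proof.
move=> oO.
pose ab j := if @unpickle ({ffun 'I_n -> rat} * nat)%type j is Some i then qbox i else (cst 0, cst 0).
pose P := [set j | cbox (ab j).1 (ab j).2 `<=` O].
exists (fun j => (ab j).1), (fun j => (ab j).2), P; split=> //.
apply/seteqP; split => x; last first.
  by move=> [j Pj h]; apply: Pj => k; have := h k => /andP[/ltW -> /ltW ->].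
move=> Ox; have /nbhs_ballP[e /= e0 he] : nbhs x O by exact: open_nbhs_nbhs.
pose m := Num.bound (2 / e).
(* Twice the radius: [x] and any other point of the cube are each within [r] of its centre. *)
have [r [rE m0 me]] : exists r : R, [/\ r = m.+1%:R^-1, 0 < r & 2 * r < e].
  exists m.+1%:R^-1; split=> //.
  rewrite ltr_pdivrMr // mulrC -ltr_pdivrMr //.
  have h : 2 / e < m%:R by apply: archi_boundP; rewrite divr_ge0 // ltW.
  by apply: lt_le_trans h _; rewrite ler_nat.
have ex k : exists q : rat, c k x - r < ratr q < c k x + r.
  have [|q] := @rat_in_itvoo R (c k x - r) (c k x + r); first lra.
  by rewrite in_itv /= => h; exists q.
pose q : {ffun 'I_n -> rat} := [ffun k => xchoose (ex k)].
have hq k : c k x - r < ratr (q k) < c k x + r.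
  by rewrite ffunE; exact: (xchooseP (ex k)).
have abE : ab (pickle (q, m)) = qbox (q, m) by rewrite /ab pickleK.
exists (pickle (q, m)); last first.
  by rewrite abE /qbox /= -rE => k; have /andP[h1 h2] := hq k; apply/andP; split; lra.
rewrite /P /= abE /qbox /= -rE => y hy; apply: he; rewrite -ball_normE /=.
apply/(coords_norm hc) => // k; rewrite cB.
have /andP[h1 h2] := hq k; have /andP[/= h3 h4] := hy k.
by rewrite ltr_norml; apply/andP; split; lra.
Qed.

Lemma open_measurable_coords (O : set V) : open O -> measurable (tv @^-1` O).
Proof.
move=> /open_cover[a [b [P [-> _]]]]; rewrite preimage_bigcup.
by apply: bigcup_measurable => j _; exact: measurable_obox.
Qed.

Lemma continuous_measurable_coords (f : V -> R) : continuous f ->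
  measurable_fun setT (fun z => f (tv z) : measurableTypeR R).
Proof.
move=> cf; apply: (measurability _ (RGenOInfty.measurableE R)).
move=> _ [_ [x ->] <-]; rewrite setTI.
rewrite [X in measurable X](_ : _ = tv @^-1` (f @^-1` `]x, +oo[%classic)) //.
apply: open_measurable_coords; apply: open_comp => // ? _; exact: cf.
Qed.

(** These functions vanish outside the open box and equal 1 at distance at least [1/(m + 1)] from
    its faces, so they converge to its indicator at every point. *)
Definition bump (a b : 'I_n -> R) (m : nat) (x : V) : R :=
  \prod_k (step (m.+1%:R * (c k x - a k)) * step (m.+1%:R * (b k - c k x))).

Lemma smooth_bump a b m : smooth (bump a b m).
Proof.
apply: smooth_prod => k; have sc := coords_smooth hc k.
have s1 : smooth (fun x => c k x - a k) by apply: (smooth_add sc); exact: smooth_cst.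
have s2 : smooth (fun x => b k - c k x).
  have : smooth (fun x => b k + -1 * c k x).
    by apply: smooth_add; [exact: smooth_cst|apply: smooth_mul => //; exact: smooth_cst].
  by under eq_fun do rewrite mulN1r.
apply: smooth_mul; apply: (smooth_comp (@smooth_step R)); by apply: smooth_mul => //; exact: smooth_cst.
Qed.

Lemma bump_ge0 a b m x : 0 <= bump a b m x.
Proof. by apply: prodr_ge0 => k _; rewrite mulr_ge0 ?step_ge0. Qed.

Lemma bump_le1 a b m x : bump a b m x <= 1.
Proof. by apply: prodr_ile1 => k _; rewrite mulr_ge0 ?step_ge0 // mulr_ile1 ?step_ge0 ?step_le1. Qed.

Lemma bump_out a b m x : ~ obox a b x -> bump a b m x = 0.
Proof.
move=> nx; have [k hk] : exists k, ~~ (a k < c k x < b k).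
  by apply: contrapT => h; apply: nx => k; apply/negPn/negP => h2; apply: h; exists k.
have m0 : 0 < m.+1%:R :> R by rewrite ltr0n.
rewrite /bump (bigD1 k) //=; move: hk; rewrite negb_and -!leNgt => /orP[h|h].
  by rewrite (@step_le0 R (_ * (c k x - a k))) ?mul0r //; nra.
by rewrite (@step_le0 R (_ * (b k - c k x))) ?mulr0 ?mul0r //; nra.
Qed.

Lemma bump_cvg a b x : bump a b m x @[m --> \oo] --> (\1_(obox a b) x : R).
Proof.
rewrite indicE; case: (boolP (x \in obox a b)) => [/set_mem hx|nx]; last first.
  apply: cvg_near_cst; apply: nearW => m; apply: bump_out => h.
  by move: nx; rewrite mem_set.
have near1 (y : R) : 0 < y -> \forall m \near \oo, 1 <= m.+1%:R * y.
  move=> y0; near=> m; rewrite -ler_pdivrMr // mul1r.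
  apply: le_trans (_ : m%:R <= _); last by rewrite ler_nat.
  by near: m; apply: nbhs_infty_ger.
apply: cvg_near_cst; near=> m; rewrite /bump big1 // => k _.
rewrite !step_ge1 ?mulr1 //; move: k; near: m.
  by apply: filter_forall => k; apply: near1; have /andP[] := hx k; lra.
by apply: filter_forall => k; apply: near1; have /andP[] := hx k; lra.
Unshelve. all: by end_near. Qed.

Lemma test_fun_bump (O : set V) a b m : cbox a b `<=` O -> test_fun O (bump a b m).
Proof.
move=> hO; have hs : closure [set x | bump a b m x != 0] `<=` cbox a b.
  have /closure_id -> := @closed_cbox a b; apply: closure_subset => x /= hx k.
  have hx' : obox a b x by apply: contrapT => /(bump_out m) h; rewrite h eqxx in hx.
  by have /andP[/ltW -> /ltW ->] := hx' k.
split; [exact: smooth_bump| |exact: subset_trans hO].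
by apply: subclosed_compact hs; [exact: closed_closure|exact: (coords_compact hc)].
Qed.

End coordinates.

Section L2_more.
Context d (T : measurableType d) (R : realType) (mu : {measure set T -> \bar R}).

Lemma in_L2_sub (D E : set T) (f : T -> R) : measurable D -> measurable E -> E `<=` D ->
  in_L2 mu D f -> in_L2 mu E f.
Proof.
move=> mD mE ED /in_L2E[mf h]; apply/in_L2E; split; first exact: measurable_funS mf.
apply: le_lt_trans h; apply: ge0_subset_integral => //.
  by apply/measurable_EFinP; exact: measurable_funX.
by move=> z _; rewrite lee_fin sqr_ge0.
Qed.

Lemma in_L2_integrable (D : set T) (f : T -> R) : measurable D -> (mu D < +oo)%E ->
  in_L2 mu D f -> mu.-integrable D (EFin \o f).
Proof.
move=> mD fD Lf; have L1 : in_L2 mu D (fun=> 1).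
  by apply: (@in_L2_bounded _ _ _ _ _ mD _ 1) => // z _; rewrite normr1.
have := in_L2_integrableM mD Lf L1; apply: eq_integrable => // z _ /=.
by rewrite mulr1.
Qed.

End L2_more.

Lemma derive_test_out (R : realType) (V : normedModType R) (O : set V) (e : V) psi x : test_fun O psi ->
  ~ closure [set x | psi x != 0] x -> 'D_e psi x = 0.
Proof.
move=> _ hx; rewrite -(derive_cst (0 : R) e x); apply: near_eq_derive.
have : open (~` closure [set x | psi x != 0]) by apply: closed_openC; exact: closed_closure.
rewrite openE => /(_ x hx); apply: filterS => y hy; apply/eqP/negPn/negP => h; apply: hy.
exact: subset_closure.
Qed.

Lemma compact_supp_bounded (R : realType) (V : normedModType R) (S : set V) (f : V -> R) :
  compact S -> continuous f -> (forall x, ~ S x -> f x = 0) -> exists C, forall x, `|f x| <= C.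
Proof.
move=> cS cf h0.
have /compact_bounded[C [_ hC]] : compact (f @` S).
  by apply: continuous_compact => //; exact: continuous_subspaceT.
exists (`|C| + 1) => x; have [Sx|nSx] := pselect (S x).
  by apply: (hC (`|C| + 1)); [rewrite (le_lt_trans (ler_norm _)) // ltrDl|exists x].
by rewrite h0 // normr0 addr_ge0.
Qed.

Lemma test_fun_bounded (R : realType) (V : normedModType R) (O : set V) psi : test_fun O psi ->
  exists C, forall x, `|psi x| <= C.
Proof.
move=> [s cS SO]; apply: (compact_supp_bounded cS); first exact: smooth_continuous.
by move=> x nx; apply/eqP/negPn/negP => h; apply: nx; exact: subset_closure.
Qed.

Lemma derive_test_bounded (R : realType) (V : normedModType R) (O : set V) (e : V) psi :
  test_fun O psi -> exists C, forall x, `|'D_e psi x| <= C.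
Proof.
move=> tp; have [s cS SO] := tp; apply: (compact_supp_bounded cS).
  by apply: smooth_continuous; exact: smooth_derive.
by move=> x; exact: (derive_test_out e tp).
Qed.

Lemma compact_margin (R : realType) (V : normedModType R) (S O : set V) : compact S -> open O ->
  S `<=` O -> exists2 del : R, 0 < del & forall x y, S x -> `|y - x| < del -> O y.
Proof.
move=> cS oO SO.
have /compact_near_coveringP/(_ R 0^'+ (fun del x => forall y, `|y - x| < del -> O y) _) := cS.
case.
  move=> x Sx; have /nbhs_ballP[e /= e0 he] : nbhs x O by apply: open_nbhs_nbhs; split=> //; exact: SO.
  have e2 : 0 < e / 2 by rewrite divr_gt0.
  exists (ball x (e / 2), [set del | del < e / 2]) => /=.
    by split; [exact: nbhsx_ballx|exact: nbhs_right_lt].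
  move=> [x' del] /= [hx' hdel] y hy; apply: he; move: hx'; rewrite -!ball_normE /= => hx'.
  rewrite (_ : x - y = (x - x') + (x' - y)); last by rewrite addrA subrK.
  apply: le_lt_trans (ler_normD _ _) _; rewrite [`|x' - y|]distrC; lra.
move=> e /= e0 he; exists (e / 2); first by rewrite divr_gt0.
move=> x y Sx; apply: (he (e / 2)) => //=; last by rewrite divr_gt0.
by rewrite sub0r normrN gtr0_norm ?divr_gt0 //; lra.
Qed.

(** * The fundamental lemma and a criterion for weak derivatives *)

Section coordinates_weak.
Context (R : realType) (n : nat) (V : normedModType R) (d : measure_display)
  (T : measurableType d).
Variables (tv : T -> V) (mu : {measure set T -> \bar R}) (c : 'I_n -> V -> R)
  (mk : ('I_n -> R) -> V).
Hypothesis hc : coords tv mu c mk.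
Local Notation obox := (obox c).
Local Notation cbox := (cbox c).

Lemma test_fun_measurable (O : set V) psi : test_fun O psi ->
  measurable_fun setT (fun z => psi (tv z) : measurableTypeR R).
Proof.
by move=> [s _ _]; apply: (continuous_measurable_coords hc); exact: smooth_continuous.
Qed.

(** The fundamental lemma of the calculus of variations. Bumps converge to indicators of boxes, so
    the integrals of [g] over boxes inside [O] vanish. Dynkin's theorem extends this to the
    measurable subsets of one such box, where [g] is then null, and [O] is a countable union of
    these boxes. *)
Lemma test_orthogonal0 (O : set V) (D : set T) (g : T -> R) :
  open O -> measurable D -> tv @^-1` O `<=` D -> in_L2 mu D g ->
  (forall psi, test_fun O psi -> \int[mu]_(z in D) (g z * psi (tv z)) = 0) ->
  {ae mu, forall z, O (tv z) -> g z = 0}.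
Proof.
move=> oO mD OD Lg h0.
have subO a b : cbox a b `<=` O -> tv @^-1` obox a b `<=` D.
  by move=> hO z hz; apply: OD; apply: hO => k; have /andP[/ltW -> /ltW ->] := hz k.
have mB a b := measurable_obox hc a b.
have gB a b : cbox a b `<=` O -> mu.-integrable (tv @^-1` obox a b) (EFin \o g).
  move=> hO; apply: in_L2_integrable => //; first exact: (coords_fin hc).
  exact: (in_L2_sub mD (mB a b) (subO _ _ hO) Lg).
have box0 a b : cbox a b `<=` O -> \int[mu]_(z in tv @^-1` obox a b) g z = 0.
  move=> hO; have iB := gB _ _ hO.
  have E (f : T -> R) : \int[mu]_(z in tv @^-1` obox a b) f z
      = \int[mu]_(z in D) (f z * \1_(obox a b) (tv z)).
    rewrite Rintegral_mkcond [RHS]Rintegral_mkcond; apply: eq_Rintegral => z _.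
    rewrite !patchE !indicE; case: (boolP (z \in D)) => zD; case: (boolP (z \in _)) => zB.
    - by rewrite mem_set ?mulr1 //; exact: (set_mem zB).
    - by rewrite memNset ?mulr0 //; move=> h; move: zB; rewrite mem_set.
    - by move/set_mem/(subO _ _ hO): zB => h; move: zD; rewrite mem_set.
    - by [].
  rewrite E.
  suff : \int[mu]_(z in D) (g z * bump c a b m (tv z)) @[m --> \oo] -->
         \int[mu]_(z in D) (g z * \1_(obox a b) (tv z)).
    move=> h; apply: (cvg_unique _ h) => //.
    by apply: cvg_near_cst; apply: nearW => m; apply: h0; exact: (test_fun_bump hc).
  apply: (Rintegral_dominated_cvg (g := fun z => `|g z| * \1_(obox a b) (tv z))) => //.
  - move=> m; apply: measurable_funM; first exact: Lg.1.
    by apply: measurable_funTS; apply: test_fun_measurable; exact: (test_fun_bump hc).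
  - apply: measurable_funM; first exact: Lg.1.
    apply: measurable_funTS; rewrite (_ : (fun z => _) = \1_(tv @^-1` obox a b)) //.
  - apply: nearW => z Dz; apply: cvgM; [exact: cvg_cst|exact: bump_cvg].
  - have /integrable_norm : mu.-integrable D (EFin \o (fun z => g z * \1_(tv @^-1` obox a b) z)).
      have := iB; rewrite (integrable_mkcond _ (mB a b)) => /(integrableS measurableT mD (@subsetT _ _)).
      apply: eq_integrable => // z _ /=; rewrite patchE indicE.
      by case: ifP => _; rewrite ?mulr1 ?mulr0.
    apply: eq_integrable => // z _ /=; congr (_%:E); rewrite normrM; congr (_ * _).
    by rewrite indicE ger0_norm.
  - apply: nearW => z Dz m; rewrite normrM; apply: ler_wpM2l => //.
    rewrite ger0_norm ?bump_ge0 // indicE; case: (boolP (_ \in _)) => [_|nz]; first exact: bump_le1.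
    by rewrite bump_out // => hz; move: nz; rewrite mem_set.
have [a [b [P [OE hP]]]] := open_cover hc oO.
have boxae j : P j -> {ae mu, forall z, obox (a j) (b j) (tv z) -> g z = 0}.
  move=> Pj; set B0 := tv @^-1` obox (a j) (b j).
  have iB0 : mu.-integrable B0 (EFin \o g) by apply: gB; exact: hP.
  have all0 A : measurable A -> (\int[mu]_(z in B0 `&` A) (g z)%:E = 0)%E.
    have fin0 B : measurable B -> (\int[mu]_(z in B0 `&` B) (g z)%:E)%E \is a fin_num.
      move=> mB'; apply: integrable_fin_num; first by apply: measurableI => //; exact: mB.
      by apply: integrableS iB0; [exact: mB|apply: measurableI => //; exact: mB|exact: subIsetl].
    have all0' : (\int[mu]_(z in B0) (g z)%:E = 0)%E.
      have f0 : (\int[mu]_(z in B0) (g z)%:E)%E \is a fin_num by rewrite -[B0]setIT; exact: fin0.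
      by rewrite -(fineK f0); congr (_%:E); exact: (box0 _ _ (hP _ Pj)).
    move=> mA; rewrite -[measurable]/(@measurable _ T) (obox_gen hc) in mA.
    move: A mA; apply: (@dynkin_induction _ T _ (fun A => (\int[mu]_(z in B0 `&` A) (g z)%:E = 0)%E) (obox_gen hc)) => //.
    - move=> _ _ [a1 [b1 ->]] [a2 [b2 ->]].
      exists (fun k => Num.max (a1 k) (a2 k)), (fun k => Num.min (b1 k) (b2 k)).
      apply/seteqP; split => z /=; rewrite /obox /=.
        by move=> [h1 h2] k; rewrite gt_max lt_min; have /andP[-> ->] := h1 k; exact: h2.
      by move=> h; split => k; have := h k; rewrite gt_max lt_min => /andP[/andP[? ?] /andP[? ?]]; apply/andP.
    - by rewrite setIT.
    - move=> _ [a1 [b1 ->]].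
      pose a2 k := Num.max (a j k) (a1 k); pose b2 k := Num.min (b j k) (b1 k).
      have -> : B0 `&` tv @^-1` obox a1 b1 = tv @^-1` obox a2 b2.
        apply/seteqP; split => z /=; rewrite /obox /= /a2 /b2.
          by move=> [h1 h2] k; rewrite gt_max lt_min; have /andP[-> ->] := h1 k; exact: h2.
        by move=> h; split => k; have := h k; rewrite gt_max lt_min => /andP[/andP[? ?] /andP[? ?]]; apply/andP.
      have hc2 : cbox a2 b2 `<=` O.
        apply: subset_trans (hP _ Pj) => x hx k; have := hx k; rewrite /a2 /b2 ge_max le_min.
        by move=> /andP[/andP[-> _] /andP[-> _]].
      have f0 : (\int[mu]_(z in tv @^-1` obox a2 b2) (g z)%:E)%E \is a fin_num.
        by apply: integrable_fin_num; [exact: mB|exact: gB].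
      by rewrite -(fineK f0); congr (_%:E); exact: (box0 _ _ hc2).
    - move=> S mS hS.
      have : (\int[mu]_(z in (B0 `&` S) `|` (B0 `&` ~` S)) (g z)%:E = 0)%E.
        by rewrite -setIUr setUv setIT.
      rewrite integral_setU //; last 4 first.
      + by apply: measurableI => //; exact: mB.
      + by apply: measurableI; [exact: mB|exact: measurableC].
      + by rewrite -setIUr setUv setIT; exact: (measurable_int _ iB0).
      + by apply/disj_setPS => z [[_ h1] [_ h2]].
      by rewrite hS add0e.
    - move=> F mF tF hF; rewrite setI_bigcupr integral_bigcup //.
      + by rewrite eseries0 // => i _ _.
      + exact: trivIset_setIl.
      + by move=> k; apply: measurableI => //; exact: mB.
      + apply: integrableS iB0; first exact: mB.
          by apply: bigcup_measurable => k _; apply: measurableI => //; exact: mB.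
        by move=> z [k _ []].
  have := integral_ae_eq (mB (a j) (b j)) (g := cst 0%E) iB0 (measurable_cst _).
  have h1 : forall E, E `<=` B0 -> measurable E -> (\int[mu]_(x in E) (EFin \o g) x = \int[mu]_(x in E) (cst 0%E) x)%E.
    move=> E EB mE; rewrite integral0 -(all0 E mE); congr (integral mu _ _).
    by apply/esym/setIidPr.
  by move=> /(_ h1); apply: filterS => z hz Bz; have [] := hz Bz.
have : {ae mu, forall z, forall j, P j -> obox (a j) (b j) (tv z) -> g z = 0}.
  apply/ae_foralln => j; have [Pj|nPj] := pselect (P j); last by apply: nearW.
  by apply: filterS (boxae j Pj) => z h _.
apply: filterS => z hz; rewrite OE => -[j Pj]; exact: hz.
Unshelve. all: by exact: (fun=> True).
Qed.

Lemma test_fun_L2 (O : set V) (D : set T) psi : measurable D -> (mu D < +oo)%E ->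
  test_fun O psi -> in_L2 mu D (fun z => psi (tv z)).
Proof.
move=> mD fD tp; have [C hC] := test_fun_bounded tp.
apply: (@in_L2_bounded _ _ _ _ _ mD _ C) => //.
by apply: measurable_funTS; exact: test_fun_measurable tp.
Qed.

(** [O] carries the test functions, while the integrals run over [D]. For the cylinder the two
    differ by the final time, hence the hypothesis that the difference is null. *)
Lemma weak_derivative_unique (O : set V) (D : set T) test del (u g g' : T -> R) :
  open O -> measurable D -> (mu D < +oo)%E -> tv @^-1` O `<=` D ->
  mu (D `\` tv @^-1` O) = 0%E ->
  (forall psi, test_fun O psi -> test (fun z => psi (tv z))) ->
  is_weak_derivative mu D test del u g -> is_weak_derivative mu D test del u g' ->
  {ae mu, forall z, D z -> g z = g' z}.
Proof.
move=> oO mD fD OD DO0 ht [Lg hg] [Lg' hg'].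
have Lgg := in_L2B mD Lg Lg'.
have h : forall psi, test_fun O psi -> \int[mu]_(z in D) ((g z - g' z) * psi (tv z)) = 0.
  move=> psi tp; have Lp := test_fun_L2 mD fD tp.
  rewrite -/(ip mu D (fun z => g z - g' z) (fun z => psi (tv z))) ipBl // /ip.
  by have := hg _ (ht _ tp); rewrite (hg' _ (ht _ tp)) => /oppr_inj ->; rewrite subrr.
have := test_orthogonal0 oO mD OD Lgg h => hO.
have hD : {ae mu, forall z, ~ (D `\` tv @^-1` O) z}.
  exists (D `\` tv @^-1` O); split=> //.
  - by apply: measurableD => //; exact: (open_measurable_coords hc).
  - by move=> z /= /contrapT.
apply: filterS2 hO hD => z h1 h2 Dz; apply/eqP; rewrite -subr_eq0; apply/eqP; apply: h1.
by apply: contrapT => nO; apply: h2.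
Qed.

(** Discrete integration by parts: a translation carries the difference quotient of the test
    function over to [u], and dominated convergence passes to the limit on both sides. The Lipschitz
    bound concerns segments inside [O], since [u] may be arbitrary elsewhere. The abstract [test]
    and [del] let the same statement serve space and space-time. *)
Lemma weak_derivative_lipschitz (O : set V) (D : set T) test del (u g : T -> R) (e : V) (C : R)
    (sh : R -> T -> T) :
  open O -> measurable D -> (mu D < +oo)%E -> tv @^-1` O `<=` D ->
  (forall psi, test psi -> exists2 psi', test_fun O psi' &
    (forall z, psi z = psi' (tv z)) /\ (forall z, del psi z = 'D_e psi' (tv z))) ->
  (forall h, mpres mu (sh h)) -> (forall h z, tv (sh h z) = tv z + h *: e) ->
  (forall h z, sh (- h) (sh h z) = z) ->
  in_L2 mu D u -> measurable_fun D (g : T -> measurableTypeR R) ->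
  (forall z, D z -> `|g z| <= C) ->
  (forall z h, (forall s, 0 <= s <= 1 -> O (tv z + (s * h) *: e)) ->
    `|u (sh h z) - u z| <= C * `|h|) ->
  {ae mu, forall z, O (tv z) ->
    m.+1%:R * (u z - u (sh (- m.+1%:R^-1) z)) @[m --> \oo] --> g z} ->
  is_weak_derivative mu D test del u g.
Proof.
move=> oO mD fD OD ht msh tsh shK Lu mg gC uC ug.
split; first exact: in_L2_bounded gC.
move=> psi1 /ht[psi tp [psiE delE]].
have [sp cS SO] := tp; set S := closure _ in cS SO.
have psi0 : forall z, ~ S (tv z) -> psi (tv z) = 0.
  by move=> z nS; apply/eqP/negPn/negP => h; apply: nS; exact: subset_closure.
have [del0 del0p hdel] := compact_margin cS oO SO.
have [C1 hC1] := derive_test_bounded e tp.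
have [C2 hC2] := test_fun_bounded tp.
(* The offset [m0] makes every step shorter than the margin around the support, so that the
   translated support stays in [O] for all indices. *)
have [m0 hm0] : exists m0 : nat, `|e| < del0 * m0.+1%:R.
  have [k hk] : exists k : nat, `|e| / del0 < k%:R.
    by exists (Num.bound (`|e| / del0)); apply: archi_boundP; rewrite divr_ge0 // ltW.
  exists k; rewrite mulrC -ltr_pdivrMr //; apply: lt_trans hk _; by rewrite ltr_nat.
pose h_ (m : nat) : R := (m + m0).+1%:R^-1.
have h0 m : 0 < h_ m by rewrite invr_gt0.
have h_cvg : h_ m @[m --> \oo] --> (0 : R).
  by have := @cvg_harmonic R; rewrite -(cvg_shiftn m0).
have seg m z : S (tv z) -> forall s, 0 <= s <= 1 -> O (tv z + (s * - h_ m) *: e).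
  move=> Sz s /andP[s0 s1]; apply: (hdel _ _ Sz); rewrite addrAC subrr add0r normrZ normrM normrN.
  rewrite (ger0_norm s0) (gtr0_norm (h0 m)).
  apply: le_lt_trans (_ : h_ m * `|e| < _); first by rewrite -mulrA ler_piMl // mulr_ge0 // ltW.
  rewrite mulrC ltr_pdivrMr //; apply: lt_le_trans hm0 _.
  by rewrite ler_pM2l // ler_nat ltnS leq_addl.
(* Extension by zero: translations preserve integrals over the whole space, not over [D]. *)
pose U := u \_ D; pose G := g \_ D.
have UE z : D z -> U z = u z by move=> Dz; rewrite /U patchE mem_set.
have iU : mu.-integrable setT (EFin \o U).
  have := in_L2_integrable mD fD Lu; rewrite (integrable_mkcond _ mD).
  by apply: eq_integrable => // z _; rewrite /U /= !patchE; case: ifP.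
have mU : measurable_fun setT (U : T -> measurableTypeR R).
  by apply/measurable_EFinP; exact: (measurable_int _ iU).
have mG : measurable_fun setT (G : T -> measurableTypeR R).
  by apply/(measurable_restrict _ mD) => //; rewrite setIidr.
have mpsi : measurable_fun setT (fun z => psi (tv z) : measurableTypeR R) := test_fun_measurable tp.
have msh1 h : measurable_fun setT (sh h) := proj1 (msh h).
have bdd (F : T -> R) (K : T -> R) CK : mu.-integrable setT (EFin \o F) ->
    measurable_fun setT (K : T -> measurableTypeR R) -> (forall z, `|K z| <= CK) ->
    mu.-integrable setT (EFin \o (fun z => F z * K z)).
  move=> iF mK hK.
  have mF : measurable_fun setT (F : T -> measurableTypeR R).
    by apply/measurable_EFinP; exact: (measurable_int _ iF).
  apply: (le_integrable measurableT _ _ (integrableZl measurableT CK (integrable_abse iF))).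
    by apply/measurable_EFinP; exact: measurable_funM.
  move=> z _ /=; rewrite lee_fin normrM [leRHS]ger0_norm ?mulr_ge0 //.
    by rewrite mulrC ler_wpM2r.
  by apply: le_trans (hK z).
(* The discrete integration by parts, an exact identity at each step size. *)
have AB m : \int[mu]_z (U z * ((h_ m)^-1 * (psi (tv (sh (h_ m) z)) - psi (tv z)))) =
    \int[mu]_z (- (psi (tv z) * ((h_ m)^-1 * (U z - U (sh (- h_ m) z))))).
  have i1 : mu.-integrable setT (EFin \o (fun z => U z * psi (tv z))) by exact: (bdd _ _ _ _ mpsi (fun z => hC2 (tv z))).
  have iUs : mu.-integrable setT (EFin \o (fun z => U (sh (- h_ m) z))).
    by have := integrable_mpres (msh (- h_ m)) iU.
  have i2 : mu.-integrable setT (EFin \o (fun z => U (sh (- h_ m) z) * psi (tv z))) by exact: (bdd _ _ _ _ mpsi (fun z => hC2 (tv z))).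
  have i3 : mu.-integrable setT (EFin \o (fun z => U z * psi (tv (sh (h_ m) z)))).
    apply: (bdd _ _ _ iU _ (fun z => hC2 (tv (sh (h_ m) z)))).
    exact: (measurableT_comp mpsi (msh1 (h_ m))).
  have E : \int[mu]_z (U z * psi (tv (sh (h_ m) z))) = \int[mu]_z (U (sh (- h_ m) z) * psi (tv z)).
    rewrite /Rintegral -(integral_mpres (msh (h_ m)) i2); congr fine; apply: eq_integral => z _ /=.
    by rewrite shK.
  transitivity ((h_ m)^-1 * (\int[mu]_z (U z * psi (tv (sh (h_ m) z))) - \int[mu]_z (U z * psi (tv z)))).
    rewrite -RintegralB // -RintegralZl //; last exact: (integrableB measurableT i3 i1).
    by apply: eq_Rintegral => z _; rewrite mulrCA mulrBr.
  rewrite E -RintegralB // -RintegralZl //; last exact: (integrableB measurableT i2 i1).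
  by apply: eq_Rintegral => z _; ring.
have LA : \int[mu]_z (U z * ((h_ m)^-1 * (psi (tv (sh (h_ m) z)) - psi (tv z)))) @[m --> \oo] -->
    \int[mu]_z (U z * 'D_e psi (tv z)).
  apply: (Rintegral_dominated_cvg (g := fun z => C1 * `|U z|)) => //.
  - move=> m; apply: measurable_funM => //; apply: measurable_funM => //.
    by apply: measurable_funB => //; exact: (measurableT_comp mpsi (msh1 (h_ m))).
  - apply: measurable_funM => //; apply: (continuous_measurable_coords hc (f := fun x => 'D_e psi x)).
    by apply: smooth_continuous; exact: smooth_derive.
  - apply: nearW => z _; apply: cvgM; first exact: cvg_cst.
    under eq_fun do rewrite tsh.
    apply: derive_seq => //; first exact/diff_derivable/smooth_diff.
    by move=> m; rewrite gt_eqF.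
  - exact: (integrableZl measurableT C1 (integrable_abse iU)).
  - apply: nearW => z _ m; rewrite normrM mulrC; apply: ler_wpM2r => //.
    rewrite normrM tsh normfV (gtr0_norm (h0 m)) mulrC ler_pdivrMr //.
    by rewrite -{2}(gtr0_norm (h0 m)); exact: smooth_lipschitz_dir.
have LB : \int[mu]_z (- (psi (tv z) * ((h_ m)^-1 * (U z - U (sh (- h_ m) z))))) @[m --> \oo] -->
    \int[mu]_z (- (psi (tv z) * G z)).
  apply: (Rintegral_dominated_cvg (g := fun z => (C2 * `|C|) * \1_D z)) => //.
  - move=> m; apply: measurable_funN; apply: measurable_funM => //; apply: measurable_funM => //.
    by apply: measurable_funB => //; exact: (measurableT_comp mU (msh1 (- h_ m))).
  - by apply: measurable_funN; exact: measurable_funM.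
  - apply: filterS ug => z ug _; apply: cvgN.
    have [Sz|nS] := pselect (S (tv z)); last first.
      by rewrite psi0 // mul0r; under eq_fun do rewrite mul0r; exact: cvg_cst.
    apply: cvgM; first exact: cvg_cst.
    have Oz : O (tv z) := SO _ Sz.
    have -> : G z = g z by rewrite /G patchE mem_set //; exact: OD.
    have := ug Oz; rewrite -(cvg_shiftn m0).
    apply: cvg_trans; apply: near_eq_cvg; apply: nearW => m /=.
    have D1 : D z := OD _ Oz.
    have D2 : D (sh (- h_ m) z).
      by apply: OD; rewrite /= tsh -[- h_ m]mul1r; apply: seg => //; rewrite ler01 lexx.
    by rewrite (UE _ D1) (UE _ D2) /h_ invrK.
  - have L1 : in_L2 mu D (fun=> 1).
      by apply: (@in_L2_bounded _ _ _ _ _ mD _ 1) => // z _; rewrite normr1.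
    have := in_L2_integrable mD fD L1; rewrite (integrable_mkcond _ mD) => i1.
    have := integrableZl measurableT (C2 * `|C|) i1; apply: eq_integrable => // z _ /=.
    by rewrite patchE indicE; case: ifP.
  - apply: nearW => z _ m; rewrite normrN indicE.
    have [Sz|nS] := pselect (S (tv z)); last first.
      by rewrite psi0 // mul0r normr0 mulr_ge0 // mulr_ge0 // (le_trans _ (hC2 (tv z))).
    have Oz : O (tv z) := SO _ Sz.
    rewrite mem_set ?mulr1; last exact: OD.
    rewrite normrM; apply: ler_pM => //.
    have D1 : D z := OD _ Oz.
    have D2 : D (sh (- h_ m) z).
      by apply: OD; rewrite /= tsh -[- h_ m]mul1r; apply: seg => //; rewrite ler01 lexx.
    rewrite normrM normfV (gtr0_norm (h0 m)) mulrC ler_pdivrMr // (UE _ D1) (UE _ D2).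
    rewrite distrC; apply: le_trans (uC z (- h_ m) (seg m z Sz)) _.
    by rewrite normrN (gtr0_norm (h0 m)) ler_wpM2r // ?ler_norm // ltW.
have : \int[mu]_z (U z * 'D_e psi (tv z)) = \int[mu]_z (- (psi (tv z) * G z)).
  apply: (cvg_unique _ LA) => //.
  by apply: cvg_trans LB; apply: near_eq_cvg; apply: nearW => m.
have -> : \int[mu]_z (- (psi (tv z) * G z)) = - \int[mu]_(z in D) (g z * psi1 z).
  have Lg : in_L2 mu D g by exact: in_L2_bounded gC.
  have := in_L2_integrableM mD Lg (test_fun_L2 mD fD tp).
  rewrite (integrable_mkcond _ mD) => i1.
  rewrite [in RHS]Rintegral_mkcond -mulN1r -RintegralZl //; last first.
    apply: eq_integrable i1 => // z _; rewrite /= !patchE /= psiE; by case: ifP.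
  apply: eq_Rintegral => z _; rewrite /G !patchE psiE; case: ifP => _.
    by rewrite mulN1r mulrC.
  by rewrite !mulr0 oppr0.
move=> <-; rewrite Rintegral_mkcond; apply: eq_Rintegral => z _.
by rewrite patchE delE /U patchE; case: ifP => _ //; rewrite mul0r.
Qed.

End coordinates_weak.

Section coords_instances.
Context (R : realType).
Local Notation leb := (@lebesgue_measure R).

Lemma coordsR : coords (fun t : measurableTypeR R => t : R) leb (fun (_ : 'I_1) t => t) (fun a => a ord0).
Proof.
split.
- by move=> _ h x y.
- by move=> _; exact: smooth_id.
- by move=> x r r0; split=> [h _ //|]; apply; exact: ord0.
- by move=> a k; rewrite [k]ord1.
- move=> a b; rewrite (_ : cbox _ _ _ = `[a ord0, b ord0]%classic); first exact: segment_compact.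
  apply/seteqP; split => t; rewrite /= in_itv /=; first by apply.
  by move=> h k; rewrite [k]ord1.
- by move=> k; exact: measurable_id.
- by move=> A mA; apply: sub_sigma_algebra; exists ord0, A.
- move=> a b; rewrite (_ : _ @^-1` _ = `]a ord0, b ord0[%classic); last first.
    apply/seteqP; split => t; rewrite /= in_itv /=; first by move=> /(_ ord0).
    by move=> h k; rewrite [k]ord1.
  rewrite -[X in (X < _)%E]/(lebesgue_measure _) lebesgue_measure_itv /= lte_fin.
  by case: ifP => _; rewrite -?EFinD ltry.
Qed.

Lemma smooth_coord n (k : 'I_n) : smooth (fun x : 'rV[R]_n => x ord0 k).
Proof.
have dc (x : 'rV[R]_n) : differentiable (fun x : 'rV[R]_n => x ord0 k) x by exact: differentiable_coord.
apply/smoothP => -[|m]; (split; first by move=> x; exact: dc) => // v.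
rewrite [X in smoothN _ X](_ : _ = fun=> v ord0 k); first exact: smoothN_cst.
apply/funext => x.
have := @derive_seq R _ _ x v (fun m => m.+1%:R^-1) (diff_derivable (dc x)).
have h0 (m' : nat) : m'.+1%:R^-1 != 0 :> R by rewrite invr_eq0.
move=> /(_ h0 (@cvg_harmonic R)) h; apply/esym; apply: (cvg_unique _ _ h) => //.
apply: cvg_near_cst; apply: nearW => m'; rewrite !mxE addrAC subrr add0r mulrA mulVf ?mul1r //.
Qed.

Lemma norm_rV_lt n (x : 'rV[R]_n) (r : R) : 0 < r -> `|x| < r <-> forall k, `|x ord0 k| < r.
Proof.
move=> r0; have := @mx_norm_ball R 1 n => /(congr1 (fun B => B 0 r (- x))).
rewrite /ball_ /= sub0r opprK => <-; split.
  by move=> [_ h] k; have := h ord0 k; rewrite -ball_normE /= !mxE sub0r opprK.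
by move=> h; split=> // i k; rewrite [i]ord1 -ball_normE /= !mxE sub0r opprK.
Qed.

Lemma rV_gen n : @measurable _ 'rV[R]_n `<=`
  <<s [set A | exists k (Y : set (measurableTypeR R)), measurable Y /\ A = (fun z : 'rV[R]_n => z ord0 k) @^-1` Y] >>.
Proof.
apply: smallest_sub; first exact: smallest_sigma_algebra.
move=> A; rewrite -bigcup_seq => -[k _ [Y mY <-]]; apply: sub_sigma_algebra.
by exists k, Y; rewrite setTI.
Qed.

Lemma coordsV n : coords (fun x : 'rV[R]_n => x) (lebesgue_rV R n) (fun k x => x ord0 k)
  (fun a => \row_k a k).
Proof.
split.
- by move=> k h x y; rewrite !mxE.
- by move=> k; exact: smooth_coord.
- by move=> x r; exact: norm_rV_lt.
- by move=> a k; rewrite mxE.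
- move=> a b; have := @rV_compact R n (fun k => `[a k, b k]%classic) (fun k => @segment_compact _ _ _).
  by rewrite (_ : [set v | _] = cbox (fun k (x : 'rV[R]_n) => x ord0 k) a b).
- by move=> k; exact: measurable_coor.
- exact: rV_gen.
- by move=> a b; exact: (lebesgue_boxrV a b).1.
Qed.

Definition coordZ n (k : 'I_n.+1) (z : R * 'rV[R]_n) : R :=
  if unlift ord0 k is Some j then z.2 ord0 j else z.1.

Lemma obox_coordZ n (a b : 'I_n.+1 -> R) : obox (@coordZ n) a b =
  `]a ord0, b ord0[%classic `*` boxrV (fun j => a (lift ord0 j)) (fun j => b (lift ord0 j)).
Proof.
apply/seteqP; split => -[t x] /=.
  move=> h; split; first by have := h ord0; rewrite /coordZ unlift_none /= in_itv.
  by move=> j; have := h (lift ord0 j); rewrite /coordZ liftK.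
move=> [h1 h2] k; rewrite /coordZ; case: unliftP => [j ->|->]; first exact: h2.
by move: h1; rewrite /= in_itv.
Qed.

Lemma coordsZ n : coords (fun z : measurableTypeR R * 'rV[R]_n => z : R * 'rV[R]_n)
  (lebZ R n) (@coordZ n) (fun a => (a ord0, \row_j a (lift ord0 j))).
Proof.
split.
- by move=> k h x y; rewrite /coordZ; case: unlift => [j|]; rewrite ?mxE.
- move=> k; rewrite /coordZ; case: unlift => [j|].
    have := @smooth_comp_affine R _ _ (snd : {linear (R * 'rV[R]_n)%type -> 'rV[R]_n}) 0 _ _ (smooth_coord j).
    by under eq_fun do rewrite addr0; apply => z; exact: cvg_snd.
  have := @smooth_comp_affine R _ _ (fst : {linear (R * 'rV[R]_n)%type -> R}) 0 _ _ (@smooth_id R).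
  by under eq_fun do rewrite addr0; apply => z; exact: cvg_fst.
- move=> z r r0; rewrite prod_normE /= gt_max; split.
    by move=> /andP[h1 /(norm_rV_lt _ r0) h2] k; rewrite /coordZ; case: unlift.
  move=> h; have := h ord0; rewrite /coordZ unlift_none => -> /=.
  by apply/(norm_rV_lt _ r0) => j; have := h (lift ord0 j); rewrite /coordZ liftK.
- move=> a k; rewrite /coordZ; case: unliftP => [j ->|->] //=; by rewrite mxE.
- move=> a b.
  have hV : compact (cbox (fun k (x : 'rV[R]_n) => x ord0 k) (fun j => a (lift ord0 j)) (fun j => b (lift ord0 j))).
    exact: (coords_compact (coordsV n)).
  have := compact_setX (@segment_compact R (a ord0) (b ord0)) hV.
  rewrite (_ : _ `*` _ = cbox (@coordZ n) a b) //; apply/seteqP; split => -[t x] /=.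
    move=> [h1 h2] k; rewrite /coordZ; case: unliftP => [j ->|->]; first exact: h2.
    by move: h1; rewrite /= in_itv.
  move=> h; split; first by have := h ord0; rewrite /coordZ unlift_none /= in_itv.
  by move=> j; have := h (lift ord0 j); rewrite /coordZ liftK.
- move=> k; rewrite /coordZ; case: unlift => [j|].
    exact: (measurableT_comp (measurable_coor j) measurable_snd).
  exact: measurable_fst.
- set G := <<s _ >>; have sG : sigma_algebra setT G by exact: smallest_sigma_algebra.
  rewrite measurable_prod_measurableType; apply: smallest_sub => //.
  move=> _ [A mA [B mB <-]].
  have -> : A `*` B = (A `*` setT) `&` (setT `*` B) by rewrite -setXI setIT setTI.
  have gI : setI_closed G.
    move=> X Y GX GY; rewrite -(setCK (X `&` Y)) setCI -setTD; have [_ gC gU] := sG.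
    apply: (gC _ _); rewrite -bigcup2E; apply: gU => -[|[|k]] /=; rewrite -?setTD.
    - exact: (gC _ GX).
    - exact: (gC _ GY).
    - by have [] := sG.
  apply: gI.
    apply: sub_sigma_algebra; exists ord0, A; split=> //.
    by apply/seteqP; split => -[t x]; rewrite /= /coordZ unlift_none // => -[].
  have := rV_gen mB; move: B {mB}; apply: smallest_sub.
    have := @sigma_algebra_image _ _ setT (@snd (measurableTypeR R) 'rV[R]_n) _ sG.
    rewrite /image_set_system (_ : [set B | _] = [set B | G (setT `*` B)]) //.
  move=> _ [k [Y [mY ->]]] /=; apply: sub_sigma_algebra.
  exists (lift ord0 k), Y; split=> //.
  by apply/seteqP; split => -[t x]; rewrite /= /coordZ liftK // => -[].
- move=> a b; rewrite obox_coordZ /lebZ.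
  rewrite -[X in (X < _)%E]/((leb \x lebesgue_rV R n)%E _) product_measure1E //; last exact: measurable_boxrV.
  set m := (X in (X * _)%E).
  have -> : m = (if (a ord0 < b ord0)%R then (b ord0 - a ord0)%:E else 0)%E.
    by rewrite /m -[LHS]/(lebesgue_measure _) lebesgue_measure_itv /= lte_fin.
  have h1 := (lebesgue_boxrV (fun j => a (lift ord0 j)) (fun j => b (lift ord0 j))).1.
  case: ifP => ab; last by rewrite mul0e ltry.
  by apply: lte_mul_pinfty => //; rewrite lee_fin subr_ge0 ltW.
Qed.

Lemma coordsZ_pos n (a b : 'I_n.+1 -> R) : (forall k, a k < b k) -> (0 < lebZ R n (obox (@coordZ n) a b))%E.
Proof.
move=> ab; rewrite obox_coordZ /lebZ.
rewrite -[X in (_ < X)%E]/((leb \x lebesgue_rV R n)%E _) product_measure1E //; last exact: measurable_boxrV.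
apply: mule_gt0; last by apply: (lebesgue_boxrV _ _).2 => j.
rewrite -[X in (_ < X)%E]/(lebesgue_measure _) lebesgue_measure_itv /= lte_fin ab.
by rewrite -EFinD lte_fin subr_gt0.
Qed.

Lemma mpres_shiftZ n (v : R * 'rV[R]_n) : mpres (lebZ R n) (fun z => (z.1 + v.1, z.2 + v.2)).
Proof. exact: mpres_prod (mpres_shiftR v.1) (mpres_shift_rV v.2). Qed.

(** Backward quotients with step [1/(m + 1)] are the form in which pointwise derivatives enter
    [weak_derivative_lipschitz]. *)
Lemma backward_difference (V : normedModType R) (f : V -> R) (x e : V) : derivable f x e ->
  m.+1%:R * (f x - f (x + (- m.+1%:R^-1) *: e)) @[m --> \oo] --> 'D_e f x.
Proof.
move=> df; have h0 (m : nat) : - m.+1%:R^-1 != 0 :> R by rewrite oppr_eq0 invr_eq0.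
have := derive_seq df h0; rewrite -[X in _ --> X -> _]oppr0 => /(_ (cvgN (@cvg_harmonic R))).
apply: cvg_trans; apply: near_eq_cvg; apply: nearW => m.
by rewrite invrN invrK mulNr -mulrN opprB.
Qed.

End coords_instances.

Section domain.
Context (R : realType) (d : nat) (Omega : set 'rV[R]_d).
Hypotheses (oO : open Omega) (bO : bounded_set Omega).
Local Notation muX := (lebesgue_rV R d).

Lemma bounded_boxrV : exists2 N : R, 0 < N & Omega `<=` boxrV (fun=> - N) (fun=> N).
Proof.
have [M [_ hM]] := bO; exists (`|M| + 2); first by rewrite ltr_wpDl.
move=> x Ox k; have h : `|x| < `|M| + 2.
  apply: le_lt_trans (hM (`|M| + 1) _ x Ox) _; last by rewrite ltrD2l ltrDl.
  by rewrite (le_lt_trans (ler_norm _)) // ltrDl.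
have M0 : 0 < `|M| + 2 by rewrite ltr_wpDl.
have := (norm_rV_lt x M0).1 h k.
by rewrite ltr_norml.
Qed.

Lemma measurable_domain : measurable Omega.
Proof. exact: (open_measurable_coords (coordsV R d)). Qed.

Lemma domain_fin : (muX Omega < +oo)%E.
Proof.
have [N _ hN] := bounded_boxrV; apply: le_lt_trans (lebesgue_boxrV (fun=> - N) (fun=> N)).1.
by apply: le_measure => //; rewrite inE; [exact: measurable_domain|exact: measurable_boxrV].
Qed.

Lemma is_d_unique j u g g' : is_d Omega j u g -> is_d Omega j u g' ->
  {ae muX, forall x, Omega x -> g x = g' x}.
Proof.
apply: (weak_derivative_unique (coordsV R d) oO measurable_domain domain_fin) => //.
by rewrite setDv measure0.
Qed.

(** The derivatives of a test function are bounded, so the Lipschitz criterion applies to it; the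
    outcome is integration by parts between two test functions. *)
Lemma is_d_test j psi : test_fun Omega psi -> is_d Omega j psi (fun x => 'D_(e_ R j) psi x).
Proof.
move=> tp; have [C hC] := derive_test_bounded (e_ R j) tp; have [s cS SO] := tp.
apply: (weak_derivative_lipschitz (coordsV R d) (O := Omega) (C := C) (sh := fun h x => x + h *: e_ R j) (e := e_ R j)) => //.
- exact: measurable_domain.
- exact: domain_fin.
- by move=> psi' tp'; exists psi'.
- by move=> h; exact: mpres_shift_rV.
- by move=> h z; rewrite scaleNr addrK.
- exact: (test_fun_L2 (coordsV R d) measurable_domain domain_fin tp).
- apply: measurable_funTS; apply: (continuous_measurable_coords (coordsV R d) (f := fun x => 'D_(e_ R j) psi x)).
  by apply: smooth_continuous; exact: smooth_derive.
- by move=> z h _; exact: smooth_lipschitz_dir.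
- apply: nearW => x _; apply: backward_difference.
  exact/diff_derivable/smooth_diff.
Qed.

End domain.

Section cylinder.
Context (R : realType) (d : nat) (T : R) (Omega : set 'rV[R]_d).
Hypotheses (oO : open Omega) (bO : bounded_set Omega) (T0 : 0 < T).
Local Notation X := 'rV[R]_d.
Local Notation muX := (lebesgue_rV R d).
Local Notation muZ := (lebZ R d).
Local Notation leb := (@lebesgue_measure R).
Local Notation Q := (Qset T Omega).

Lemma measurable_Q : measurable Q.
Proof. by apply: measurableX => //; exact: measurable_domain. Qed.

Lemma Q_fin : (muZ Q < +oo)%E.
Proof.
rewrite /lebZ -[X in (X < _)%E]/((leb \x muX)%E _) product_measure1E //; last exact: measurable_domain.
apply: lte_mul_pinfty => //; last exact: domain_fin.
rewrite -[X in X \is a fin_num]/(lebesgue_measure _) lebesgue_measure_itv /=.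
by case: ifP.
Qed.

Lemma open_Qopen : open (Qopen T Omega : set (R * X)).
Proof.
rewrite (_ : Qopen T Omega = fst @^-1` `]0, T[%classic `&` snd @^-1` Omega); last first.
  by apply/seteqP; split => -[t x].
apply: openI; apply: open_comp => //; first by move=> z _; exact: cvg_fst.
by move=> z _; exact: cvg_snd.
Qed.

Lemma Qopen_sub : Qopen T Omega `<=` Q.
Proof.
by move=> [t x] [/= h1 h2]; split=> //=; move: h1; rewrite /= !in_itv /= => /andP[-> /ltW ->].
Qed.

Lemma Q_Qopen_null : muZ (Q `\` Qopen T Omega) = 0%E.
Proof.
have mX := measurable_domain oO.
have h0 : muZ ([set T] `*` Omega) = 0%E.
  rewrite /lebZ -[LHS]/((leb \x muX)%E _) product_measure1E //.
  by rewrite -[X in (X * _)%E]/(lebesgue_measure _) lebesgue_measure_set1 mul0e.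
apply/eqP; rewrite -measure_le0 -h0; apply: le_measure; rewrite ?inE.
- by apply: measurableD; [exact: measurable_Q|exact: measurableX].
- exact: measurableX.
- move=> [t x] [[/= h1 h2] h3]; split=> //=; apply/eqP; move: h1; rewrite in_itv /= => /andP[h4 h5].
  rewrite eq_le h5 /= leNgt; apply/negP => h6; apply: h3; split=> //=; by rewrite in_itv /= h4.
Qed.

Lemma is_dt_unique u g g' : is_dt T Omega u g -> is_dt T Omega u g' ->
  {ae muZ, forall z, Q z -> g z = g' z}.
Proof.
apply: (weak_derivative_unique (coordsZ R d) open_Qopen measurable_Q Q_fin Qopen_sub Q_Qopen_null) => //.
Qed.

Lemma is_dx_unique j u g g' : is_dx T Omega j u g -> is_dx T Omega j u g' ->
  {ae muZ, forall z, Q z -> g z = g' z}.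
Proof.
apply: (weak_derivative_unique (coordsZ R d) open_Qopen measurable_Q Q_fin Qopen_sub Q_Qopen_null) => //.
Qed.

Lemma dt_ae u g : is_dt T Omega u g -> {ae muZ, forall z, Q z -> dt T Omega u z = g z}.
Proof. by move=> h; apply: (is_dt_unique _ h); rewrite /dt; case: xgetP => // /(_ g). Qed.

Lemma gradx_ae u (g : 'I_d -> R * X -> R) : (forall j, is_dx T Omega j u (g j)) ->
  {ae muZ, forall z, Q z -> forall j, gradx T Omega u z ord0 j = g j z}.
Proof.
move=> h; have hj j : {ae muZ, forall z, Q z -> gradx T Omega u z ord0 j = g j z}.
  have : is_dx T Omega j u (xget (cst 0) [set g | is_dx T Omega j u g]).
    by case: xgetP => // /(_ (g j)).
  by move=> /is_dx_unique /(_ (h j)); apply: filterS => z hz Qz; rewrite mxE; exact: hz.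
have : {ae muZ, forall z, forall j, Q z -> gradx T Omega u z ord0 j = g j z}.
  by apply: filter_forall => j; exact: hj.
by apply: filterS => z hz Qz j; exact: hz.
Qed.

End cylinder.

(** * Lipschitz functions of one variable *)

Section monotone_lipschitz_derivative.
Context (R : realType).
Local Notation leb := (@lebesgue_measure R).

Lemma lipschitz1_continuous (G : R -> R) : (forall r s, `|G r - G s| <= `|r - s|) -> continuous G.
Proof.
move=> hG x; apply/cvgrPdist_lt => e e0; near=> y; apply: le_lt_trans (hG x y) _.
by near: y; exact: cvgr_dist_lt.
Unshelve. all: by end_near. Qed.

Lemma derive_shift (F G : R -> R) (k x l : R) : derivable F x 1 -> F^`()%classic x = l ->
  {near x, (fun y => F y + k) =1 G} -> derivable G x 1 /\ 'D_1 G x = l.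
Proof.
move=> dF eF eq; have dc : derivable (cst k : R -> R) x 1 by exact: derivable_cst.
split; first exact: near_eq_derivable eq (derivableD dF dc).
by rewrite -(near_eq_derive _ eq) (deriveD dF dc) derive_cst addr0 -derive1E.
Qed.

Lemma derive_affine (G : R -> R) (a b x : R) : derivable G x 1 ->
  derivable (fun y => a * G y + b * y) x 1 /\ 'D_1 (fun y => a * G y + b * y) x = a * 'D_1 G x + b.
Proof.
move=> dG; have dI : derivable (@id R) x 1 by exact: derivable_id.
have d1 := derivableZ (k := a) dG; have d2 := derivableZ (k := b) dI.
split; first exact: (derivableD d1 d2).
rewrite (deriveD d1 d2) (deriveZ a dG) (deriveZ b dI) derive_id.
by rewrite -[b *: 1]/(b * 1) mulr1.
Qed.

Section stieltjes.
Variables (G : R -> R) (nG : {homo G : r s / r <= s}) (hG : forall r s, `|G r - G s| <= `|r - s|).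

Let rcG : right_continuous G.
Proof. by apply/right_continuousW; exact: lipschitz1_continuous. Qed.
Let isG := isCumulative.Build R _ R G nG rcG.
Let cG : cumulative R R := HB.pack G isG.

Let H (r : R) := r - G r.
Let nH : {homo H : r s / r <= s}.
Proof. by move=> r s rs; have := hG s r; rewrite /H !ger0_norm ?subr_ge0 ?nG //; lra. Qed.
Let rcH : right_continuous H.
Proof.
apply/right_continuousW => x; apply: cvgB; first exact: cvg_id.
exact: lipschitz1_continuous.
Qed.
Let isH := isCumulative.Build R _ R H nH rcH.
Let cH : cumulative R R := HB.pack H isH.

Let stieltjes_ocitv (F : cumulative R R) a b : a <= b ->
  lebesgue_stieltjes_measure F `]a, b]%classic = (F b - F a)%:E.
Proof.
move=> ab; rewrite /lebesgue_stieltjes_measure /measure_extension measurable_mu_extE /=; last exact: is_ocitv.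
by rewrite wlength_itv_bnd.
Qed.

(* The Stieltjes measures of [G] and of [id - G] add up to the Lebesgue measure. *)
Let stieltjes_le A : measurable A -> (lebesgue_stieltjes_measure cG A <= leb A)%E.
Proof.
move=> mA.
pose nu : {measure set _ -> \bar R} := measure_add (lebesgue_stieltjes_measure cG) (lebesgue_stieltjes_measure cH).
have nuE D : nu D = (lebesgue_stieltjes_measure cG D + lebesgue_stieltjes_measure cH D)%E by exact: measure_addE.
rewrite (@lebesgue_measure_unique R nu) //; last first.
  move=> _ [[a b] _ <-] /=.
  have [ab|ba] := leP a b; last first.
    by rewrite set_itv_ge ?measure0 // -leNgt /= bnd_simp ltW.
  rewrite nuE !stieltjes_ocitv // -EFinD lebesgue_measure_itv /= lte_fin.
  case: ifPn => [_|h]; first by rewrite -EFinD; congr (_%:E); rewrite /= /H; lra.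
  have -> : b = a by apply/eqP; rewrite eq_le ab leNgt h.
  by rewrite !subrr addr0.
by rewrite nuE leeDl.
Qed.

(** The Stieltjes measure of [G] lies below Lebesgue measure, so it has a density, and the
    differentiation theorem for integrals identifies this density with the derivative of [G].
    Restricting to []a, b]] makes the measure finite. *)
Lemma lipschitz_monotone_density (a b : R) : exists g : R -> R,
  [/\ leb.-integrable setT (EFin \o g), (forall x, a < x < b -> \int[leb]_(t in `]a, x]) g t = G x - G a)
    & {ae leb, forall x, a < x < b -> derivable G x 1 /\ 'D_1 G x = g x}].
Proof.
pose D : set (measurableTypeR R) := `]a, b]%classic.
have mD : measurable D by exact: measurable_itv.
have Dfin : (lebesgue_stieltjes_measure cG D < +oo)%E.
  apply: le_lt_trans (stieltjes_le mD) _.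
  by rewrite /D lebesgue_measure_itv /=; case: ifP => _; rewrite -?EFinD ltry.
pose nu : {finite_measure set _ -> \bar R} := mfrestr mD Dfin.
have nuleb : nu `<< leb.
  apply/null_content_dominatesP => A mA A0; apply/eqP; rewrite -measure_le0 -A0.
  apply: le_trans (stieltjes_le mA); rewrite /nu /= /mfrestr /mrestr.
  by apply: le_measure; rewrite ?inE //; exact: measurableI.
have [f [f0 ffin fi fE]] := radon_nikodym_sigma_finite nuleb.
pose g := fine \o f.
have fg x : f x = (g x)%:E by rewrite /g /= fineK.
have ig : leb.-integrable setT (EFin \o g).
  by apply: eq_integrable fi => // x _; rewrite /= fineK.
have mg : measurable_fun setT (g : R -> measurableTypeR R).
  by apply/measurable_EFinP; exact: (measurable_int _ ig).
have igy y : leb.-integrable [set` Interval (BRight a) (BRight y)] (EFin \o g).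
  by apply: (integrableS measurableT).
have lg : locally_integrable setT g by apply: open_integrable_locally => //; exact: openT.
have FE x : a < x < b -> \int[leb]_(t in [set` Interval (BRight a) (BRight x)]) (g t) = G x - G a.
  move=> /andP[ax xb]; rewrite /Rintegral.
  have := fE `]a, x]%classic (measurable_itv _).
  rewrite /nu /= /mfrestr /mrestr setIidl; last first.
    by move=> t; rewrite /D /= !in_itv /= => /andP[-> /le_trans]; apply; exact: ltW.
  rewrite stieltjes_ocitv ?ltW // => /(congr1 fine) /= ->.
  by congr fine; apply: eq_integral => t _; rewrite fg.
exists g; split=> //.
apply: filterS (@FTC1 R g (BRight a) igy lg); first exact: (ae_filter_ringOfSetsType leb).
move=> x h hx; have /andP[ax xb] := hx; have [dF eF] := h ax.
apply: (derive_shift (k := G a) dF eF); near=> y.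
by rewrite FE ?subrK //; apply/andP; split; near: y; [exact: lt_nbhsr|exact: lt_nbhsl].
Unshelve. all: by end_near. Qed.

Lemma lipschitz_monotone_derivable_ae : {ae leb, forall x, derivable G x 1}.
Proof.
have : {ae leb, forall x, forall N : nat, - N%:R < x < N%:R -> derivable G x 1}.
  apply/ae_foralln => N; have [g [_ _ hg]] := lipschitz_monotone_density (- N%:R) N%:R.
  apply: filterS hg; first exact: (ae_filter_ringOfSetsType leb).
  by move=> x h /h[].
apply: filterS; first exact: (ae_filter_ringOfSetsType leb).
move=> x h; apply: (h (Num.bound `|x|)).
by rewrite -ltr_norml; exact: archi_boundP.
Qed.

(** A version of the derivative that is measurable and bounded everywhere, as the chain rule needs
    when it composes it with affine functions: the upper limit of the difference quotients, clipped
    to [[-1, 1]]. Clipping changes nothing where [G] is differentiable, because [G] is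
    1-Lipschitz. *)
Lemma lipschitz_monotone_derivative : exists (N : set (measurableTypeR R)) (be : R -> R),
  [/\ measurable N, leb N = 0%E, measurable_fun setT (be : measurableTypeR R -> measurableTypeR R),
   forall y, `|be y| <= 1 & forall y, ~ N y -> derivable G y 1 /\ 'D_1 G y = be y].
Proof.
have [N [mN N0 hN]] := lipschitz_monotone_derivable_ae.
pose qt (m : nat) (y : R) := m.+1%:R * (G y - G (y + (- m.+1%:R^-1) *: 1)).
have mG : measurable_fun setT (G : measurableTypeR R -> measurableTypeR R).
  by apply: continuous_measurable_fun; exact: lipschitz1_continuous.
have mq m : measurable_fun setT (qt m : measurableTypeR R -> measurableTypeR R).
  apply: measurable_funM => //; apply: measurable_funB => //.
  apply: (measurableT_comp mG); exact: measurable_funD.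
pose be0 y := fine (limn_esup (fun m => (qt m y)%:E)).
have mbe0 : measurable_fun setT (be0 : measurableTypeR R -> measurableTypeR R).
  apply: (measurableT_comp (fine_measurable measurableT)).
  apply: measurable_fun_limn_esup => m; apply/measurable_EFinP; exact: mq.
exists N, (fun y => Num.min 1 (Num.max (- 1) (be0 y))); split=> //.
- by apply: measurable_minr => //; exact: measurable_maxr.
- by move=> y; rewrite ler_norml le_min ge_min le_max !lexx /= ?andbT ?orbT /= ?andbT; lra.
move=> y Ny; have dG : derivable G y 1 by apply: contrapT => h; apply: Ny; exact: hN.
split=> //; have hc := backward_difference dG.
have be0E : be0 y = 'D_1 G y.
  have hce : (qt m y)%:E @[m --> \oo] --> ('D_1 G y)%:E by apply: cvg_EFin => //; exact: nearW.
  rewrite /be0 is_cvg_limn_esupE; last by apply/cvg_ex; exists ('D_1 G y)%:E.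
  by rewrite (cvg_lim _ hce).
have h1 : `|'D_1 G y| <= 1.
  apply: (cvgr_to_le (cvg_norm hc)).
  apply: nearW => m; rewrite normrM normr_nat.
  have := hG y (y + (- m.+1%:R^-1) *: 1); rewrite opprD addNKr; rewrite [_ *: 1]mulr1 opprK => h.
  by rewrite mulrC -ler_pdivlMr // mul1r (le_trans h) // ger0_norm.
move: h1; rewrite ler_norml be0E => /andP[h1 h2].
by rewrite (max_idPr h1) (min_idPr h2).
Qed.

End stieltjes.

Lemma lipschitz_FTC (e : R -> R) (C T : R) : 0 < C -> 0 < T -> (forall r s, `|e r - e s| <= C * `|r - s|) ->
  exists g : R -> R, [/\ leb.-integrable `]0, T] (EFin \o g),
    {ae leb, forall t : measurableTypeR R, `]0, T]%classic t -> derivable e t 1 /\ 'D_1 e t = g t}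
    & \int[leb]_(t in `]0, T]) g t = e T - e 0].
Proof.
move=> C0 T0 eC; pose G x := (2 * C)^-1 * (e x + C * x).
have c0 : 0 < 2 * C by rewrite mulr_gt0.
have nG : {homo G : r s / r <= s}.
  move=> r s rs; rewrite /G ler_pM2l ?invr_gt0 //; have := eC r s.
  by rewrite (ler0_norm (_ : r - s <= 0)) ?subr_le0 // ler_norml => /andP[_ h]; lra.
have hG r s : `|G r - G s| <= `|r - s|.
  rewrite /G -mulrBr normrM (gtr0_norm (_ : 0 < (2 * C)^-1)) ?invr_gt0 // mulrC ler_pdivrMr //.
  have -> : e r + C * r - (e s + C * s) = (e r - e s) + C * (r - s) by ring.
  apply: le_trans (ler_normD _ _) _; have := eC r s; rewrite normrM (gtr0_norm C0); lra.
(* Up to [T + 1], so that the end point [T] is interior. *)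
have [g [ig gG dG]] := lipschitz_monotone_density nG hG 0 (T + 1).
have eE : e = (fun x => 2 * C * G x - C * x).
  by apply/funext => x; rewrite /G mulrA mulfV ?gt_eqF // mul1r addrK.
have mD : measurable (`]0, T]%classic : set (measurableTypeR R)) by exact: measurable_itv.
have ig0 : leb.-integrable `]0, T] (EFin \o g) by exact: (integrableS measurableT).
have ic : leb.-integrable `]0, T] (EFin \o (fun=> C)).
  apply/integrableP; split; first exact: measurable_cst.
  by rewrite integral_cst //= lebesgue_measure_itv /= lte_fin T0 -EFinD -EFinM ltry.
have ig2 : leb.-integrable `]0, T] (EFin \o (fun t => 2 * C * g t)) by exact: (integrableZl mD (2 * C) ig0).
exists (fun t => 2 * C * g t - C); split.
- exact: (integrableB mD ig2 ic).
- apply: filterS dG; first exact: (ae_filter_ringOfSetsType leb).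
  move=> t h; rewrite /= in_itv /= => /andP[t0 tT].
  have [|d1 d2] := h _; first by rewrite t0 (le_lt_trans tT) // ltrDl.
  have [h1 h2] := derive_affine (2 * C) (- C) d1.
  have E : e = fun x => 2 * C * G x + - C * x by rewrite {1}eE; apply/funext => x; rewrite mulNr.
  by rewrite E h2 d2.
rewrite RintegralB // RintegralZl // gG; last by rewrite T0 ltrDl ltr01.
rewrite /Rintegral integral_cst //= lebesgue_measure_itv /= lte_fin T0 -EFinD -EFinM /= eE.
by rewrite subr0 mulr0; ring.
Qed.

End monotone_lipschitz_derivative.

(** * Affine functions and simplicial meshes *)

Section affine_functions.
Context (R : realType) (d : nat).
Local Notation Z := (R * 'rV[R]_d)%type.
Implicit Types (c : R * Z) (a z e : Z).

Definition dotZ a z : R := \sum_k coordZ k a * coordZ k z.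

Definition affZ c z : R := c.1 + dotZ c.2 z.

Lemma coordZ_lin k h (x y : Z) : coordZ k (x + h *: y) = coordZ k x + h * coordZ k y.
Proof. exact: (coords_lin (coordsZ R d)). Qed.

Lemma coordZ_le k z : `|coordZ k z| <= `|z|.
Proof.
rewrite leNgt; apply/negP => h.
have h0 : 0 < `|coordZ k z| by apply: le_lt_trans h.
by have [/(_ h)/(_ k)] := coords_norm (coordsZ R d) z h0; rewrite ltxx.
Qed.

Lemma dotZ_lin a h (x y : Z) : dotZ a (x + h *: y) = dotZ a x + h * dotZ a y.
Proof.
rewrite /dotZ mulr_sumr -big_split; apply: eq_bigr => k _.
by rewrite coordZ_lin mulrDr mulrCA.
Qed.

Lemma dotZB a (x y : Z) : dotZ a (x - y) = dotZ a x - dotZ a y.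
Proof. by have := dotZ_lin a (- 1) x y; rewrite scaleN1r mulN1r. Qed.

Lemma dotZ0 a : dotZ a 0 = 0.
Proof. by have := dotZ_lin a (- 1) 0 0; rewrite scaler0 addr0 mulN1r subrr. Qed.

Lemma dotZ_sum (I : finType) (P : pred I) a (l : I -> R) (v : I -> Z) :
  dotZ a (\sum_(i | P i) l i *: v i) = \sum_(i | P i) l i * dotZ a (v i).
Proof.
elim/big_rec2 : _ => [|i x y _ <-]; first exact: dotZ0.
by rewrite addrC dotZ_lin addrC.
Qed.

Lemma dotZ_bound a : exists2 C : R, 0 <= C & forall z, `|dotZ a z| <= C * `|z|.
Proof.
exists (\sum_k `|coordZ k a|) => [|z]; first exact: sumr_ge0.
rewrite mulr_suml; apply: le_trans (ler_norm_sum _ _ _) _; apply: ler_sum => k _.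
by rewrite normrM ler_wpM2l // coordZ_le.
Qed.

Lemma affZ_lin c h z e : affZ c (z + h *: e) = affZ c z + h * dotZ c.2 e.
Proof. by rewrite /affZ dotZ_lin addrA. Qed.

Lemma affZ_line c h (x y : Z) : affZ c (x + h *: (y - x)) = affZ c x + h * (affZ c y - affZ c x).
Proof.
rewrite affZ_lin; congr (_ + h * _); rewrite -scaleN1r /affZ dotZ_lin mulN1r.
by rewrite opprD addrACA subrr add0r.
Qed.

Lemma affZ_sum (I : finType) (P : pred I) c (l : I -> R) (v : I -> Z) : \sum_(i | P i) l i = 1 ->
  affZ c (\sum_(i | P i) l i *: v i) = \sum_(i | P i) l i * affZ c (v i).
Proof.
move=> l1; rewrite /affZ dotZ_sum; under [RHS]eq_bigr do rewrite mulrDr.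
by rewrite big_split /= -mulr_suml l1 mul1r.
Qed.

Lemma affZ_lipschitz c : exists2 C : R, 0 <= C & forall z w, `|affZ c z - affZ c w| <= C * `|z - w|.
Proof.
have [C C0 hC] := dotZ_bound c.2; exists C => // z w.
have -> : affZ c z - affZ c w = dotZ c.2 (z - w); last exact: hC.
by rewrite dotZB /affZ opprD addrACA subrr add0r.
Qed.

Lemma affZ_continuous c : continuous (affZ c).
Proof.
have [C C0 hC] := affZ_lipschitz c; move=> z; apply/cvgrPdist_lt => e e0; near=> y.
apply: (@le_lt_trans _ _ ((C + 1) * `|z - y|)).
  by apply: le_trans (hC z y) _; rewrite ler_wpM2r // lerDl.
rewrite mulrC -ltr_pdivlMr ?ltr_wpDl //; near: y; apply: cvgr_dist_lt => //.
by rewrite divr_gt0 // ltr_wpDl.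
Unshelve. all: by end_near. Qed.

Definition is_aff (q : Z -> R) := exists c, forall z, q z = affZ c z.

Lemma is_aff_cst (r : R) : is_aff (fun=> r).
Proof.
exists (r, 0) => z; rewrite /affZ /dotZ /= big1 ?addr0 // => k _.
by rewrite /coordZ; case: unlift => [j|]; rewrite /= ?mxE mul0r.
Qed.

Lemma is_affD q q' : is_aff q -> is_aff q' -> is_aff (fun z => q z + q' z).
Proof.
move=> [c hc] [c' hc']; exists (c.1 + c'.1, c.2 + c'.2) => z.
rewrite hc hc' /affZ addrACA; congr (_ + _); rewrite /dotZ -big_split; apply: eq_bigr => k _.
by have := coordZ_lin k 1 c.2 c'.2; rewrite scale1r mul1r => /= ->; rewrite mulrDl.
Qed.

Lemma is_affZ r q : is_aff q -> is_aff (fun z => r * q z).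
Proof.
move=> [c hc]; exists (r * c.1, r *: c.2) => z; rewrite hc /affZ mulrDr; congr (_ + _).
rewrite /dotZ mulr_sumr; apply: eq_bigr => k _; rewrite mulrA; congr (_ * _).
have := coordZ_lin k r 0 c.2; rewrite add0r => ->.
suff -> : coordZ k (0 : Z) = 0 by rewrite add0r.
by rewrite /coordZ; case: unlift => [j|] //=; rewrite mxE.
Qed.

Lemma is_affB q q' : is_aff q -> is_aff q' -> is_aff (fun z => q z - q' z).
Proof.
move=> hq hq'; have := is_affD hq (is_affZ (- 1) hq').
by move=> [c hc]; exists c => z; rewrite -hc mulN1r.
Qed.

Lemma is_aff_sum (I : finType) (P : pred I) (q : I -> Z -> R) : (forall i, P i -> is_aff (q i)) ->
  is_aff (fun z => \sum_(i | P i) q i z).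
Proof.
move=> hq; elim: (index_enum I) => [|i s ih].
  by have [c hc] := is_aff_cst 0; exists c => z; rewrite big_nil.
have [Pi|nPi] := boolP (P i).
  by have [c hc] := is_affD (hq _ Pi) ih; exists c => z; rewrite big_cons Pi.
by have [c hc] := ih; exists c => z; rewrite big_cons (negbTE nPi).
Qed.

Lemma is_aff_coordZ k : is_aff (coordZ k).
Proof.
pose de (j : 'I_d.+1) : R := (j == k)%:R.
exists (0, (de ord0, \row_j de (lift ord0 j))) => z; rewrite /affZ /dotZ add0r.
rewrite (bigD1 k) //= !(coords_mk (coordsZ R d)) /de eqxx mul1r big1 ?addr0 // => j jk.
by rewrite (coords_mk (coordsZ R d) de) /de (negbTE jk) mul0r.
Qed.

Lemma is_aff_monomial (n : 'I_d.+1 -> nat) : (\sum_k n k <= 1)%N ->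
  is_aff (fun z => \prod_k coordZ k z ^+ n k).
Proof.
move=> n1; have [/forallP n0|/forallPn[k nk]] := boolP [forall k, n k == 0%N].
  have [c hc] := is_aff_cst 1; exists c => z; rewrite -hc big1 // => k _.
  by rewrite (eqP (n0 k)) expr0.
have nk1 : n k = 1%N.
  apply/eqP; rewrite eqn_leq lt0n nk andbT; apply: leq_trans n1.
  by rewrite (bigD1 k) //= leq_addr.
have nj j : j != k -> n j = 0%N.
  move=> jk; apply/eqP; rewrite -leqn0 -ltnS; apply: leq_trans n1.
  by rewrite (bigD1 k) //= (bigD1 j) //= nk1 add1n ltnS leq_addr.
have [c hc] := is_aff_coordZ k; exists c => z; rewrite -hc (bigD1 k) //= nk1 expr1 big1 ?mulr1 // => j jk.
by rewrite nj // expr0.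
Qed.

Lemma poly_fun1_aff (q : Z -> R) : poly_fun 1 q -> is_aff q.
Proof.
move=> [c hc]; have : is_aff (fun z : Z =>
    \sum_(m : 'I_2 * {ffun 'I_d -> 'I_2} | (m.1 + \sum_j m.2 j <= 1)%N)
            c m * z.1 ^+ m.1 * \prod_j z.2 ord0 j ^+ m.2 j); last first.
  by move=> [c' hc']; exists c' => z; rewrite hc.
apply: is_aff_sum => m m1.
pose n (k : 'I_d.+1) : nat := if unlift ord0 k is Some j then m.2 j else m.1.
have hn : (\sum_k n k <= 1)%N.
  rewrite big_ord_recl /n unlift_none; apply: leq_trans m1; rewrite leq_add2l.
  by apply: leq_sum => j _; rewrite liftK.
have [c' hc'] := is_affZ (c m) (is_aff_monomial hn); exists c' => z; rewrite -hc' -mulrA; congr (_ * _).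
rewrite big_ord_recl /n unlift_none; congr (_ * _); first by rewrite /coordZ unlift_none.
by apply: eq_bigr => j _; rewrite /coordZ liftK.
Qed.

Lemma poly_fun0_cst (q : Z -> R) : poly_fun 0 q -> exists r, forall z, q z = r.
Proof.
move=> [c hc]; exists (\sum_(m : 'I_1 * {ffun 'I_d -> 'I_1} | (m.1 + \sum_j m.2 j <= 0)%N) c m).
move=> z; rewrite hc; apply: eq_bigr => m _; rewrite (ord1 m.1) expr0 mulr1 big1 ?mulr1 // => j _.
by rewrite (ord1 (m.2 j)) expr0.
Qed.

Lemma cst_poly_fun0 (r : R) : poly_fun 0 (fun _ : Z => r).
Proof.
exists (fun=> r) => z; rewrite (big_pred1 (ord0, [ffun=> ord0])) /=; last first.
  move=> [m1 m2] /=; rewrite (ord1 m1) add0n.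
  have -> : m2 = [ffun=> ord0] by apply/ffunP => j; rewrite ffunE; exact: ord1.
  by rewrite eqxx big1 // => j _; rewrite ffunE.
by rewrite expr0 mulr1 big1 ?mulr1 // => j _; rewrite ffunE expr0.
Qed.

Lemma affZ_vanish c (p : Z) (r : R) : 0 < r -> (forall z, `|z - p| < r -> affZ c z = 0) -> forall z, affZ c z = 0.
Proof.
move=> r0 h z; pose t := r / (1 + `|z - p|) / 2.
have n0 : 0 < 1 + `|z - p| by rewrite ltr_pwDl.
have t0 : 0 < t by rewrite !divr_gt0.
have h0 : affZ c p = 0 by apply: h; rewrite subrr normr0.
have : affZ c (p + t *: (z - p)) = 0.
  apply: h; rewrite addrAC subrr add0r normrZ gtr0_norm //.
  apply: (@le_lt_trans _ _ (r / 2)); last by rewrite ltr_pdivrMr // ltr_pMr // ltr1n.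
  rewrite /t mulrAC ler_pM2r ?invr_gt0 // mulrAC -mulrA ler_piMr ?ltW //.
  by rewrite ltr_pdivrMr // mul1r ltrDr.
by rewrite affZ_line h0 add0r subr0 => /eqP; rewrite mulf_eq0 (gt_eqF t0) => /eqP.
Qed.

End affine_functions.

(** * Barycentric coordinates on the cells of the mesh *)

Section mesh_geometry.
Context (R : realType) (d : nat).
Local Notation X := 'rV[R]_d.
Local Notation Z := (R * 'rV[R]_d)%type.
Local Notation MZ := (measurableTypeR R * 'rV[R]_d)%type.
Local Notation muZ := (lebZ R d).
Local Notation leb := (@lebesgue_measure R).

Lemma coordZ_inj (z w : Z) : (forall k, coordZ k z = coordZ k w) -> z = w.
Proof.
case: z w => [t x] [s y] h; congr (_, _); first by have := h ord0; rewrite /coordZ unlift_none.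
by apply/rowP => j; have := h (lift ord0 j); rewrite /coordZ liftK.
Qed.

Lemma coordZ0 k : coordZ k (0 : Z) = 0.
Proof. by rewrite /coordZ; case: unlift => [j|] //=; rewrite mxE. Qed.

Lemma coordZ_sum (I : finType) (P : pred I) k (l : I -> R) (v : I -> Z) :
  coordZ k (\sum_(i | P i) l i *: v i) = \sum_(i | P i) l i * coordZ k (v i).
Proof.
elim/big_rec2 : _ => [|i x y _ <-]; first exact: coordZ0.
by rewrite addrC coordZ_lin addrC.
Qed.

Lemma dotv_ge0 (x : X) : 0 <= dotv x x.
Proof. by apply: sumr_ge0 => j _; rewrite -expr2 sqr_ge0. Qed.

Lemma enorm_sqr (x : X) : enorm x ^+ 2 = dotv x x.
Proof. by rewrite sqr_sqrtr // dotv_ge0. Qed.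

Lemma distZ_sub (p : Z) (r : R) : 0 < r -> exists2 r', 0 < r' &
  forall z, `|z - p| < r' -> distZ z p <= r.
Proof.
(* Each of the [d + 1] squared coordinates is then at most [r^2 / (d + 1)]. *)
move=> r0; exists (r / d.+1%:R) => [|z h]; first by rewrite divr_gt0.
rewrite /distZ enorm_sqr.
have -> : r = Num.sqrt (r ^+ 2) by rewrite sqrtr_sqr gtr0_norm.
apply: ler_wsqrtr.
have hk k : (coordZ k (z - p)) ^+ 2 <= r ^+ 2 / d.+1%:R.
  have h1 : `|coordZ k (z - p)| <= r / d.+1%:R by apply: le_trans (coordZ_le k _) (ltW h).
  rewrite -real_normK ?num_real //; apply: (@le_trans _ _ ((r / d.+1%:R) ^+ 2)).
    by rewrite ler_sqr ?nnegrE ?divr_ge0 // ltW.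
  rewrite expr_div_n ler_pM2l ?exprn_gt0 // lef_pV2 ?posrE ?exprn_gt0 //.
  by rewrite expr2 -natrM ler_nat leq_pmulr.
have -> : (z.1 - p.1) ^+ 2 + dotv (z.2 - p.2) (z.2 - p.2) = \sum_k (coordZ k (z - p)) ^+ 2.
  rewrite big_ord_recl /coordZ unlift_none; congr (_ + _).
  by apply: eq_bigr => j _; rewrite liftK expr2.
apply: le_trans (ler_sum _ (fun k _ => hk k)) _.
by rewrite sumr_const card_ord -[X in X <= _]mulr_natr mulfVK.
Qed.

Lemma ae_ball (P : Z -> Prop) (p : Z) (r : R) : {ae muZ, forall z : MZ, P z} -> 0 < r ->
  exists2 z, `|z - p| < r & P z.
Proof.
move=> [N [mN N0 hN]] r0; apply: contrapT => h.
pose a k := coordZ k p - r; pose b k := coordZ k p + r.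
have : (muZ (obox (@coordZ R d) a b) <= muZ N)%E.
  apply: le_measure; rewrite ?inE //; first exact: (measurable_obox (coordsZ R d)).
  move=> z hz; apply: hN => Pz; apply: h; exists z => //.
  apply/(coords_norm (coordsZ R d) _ r0) => k; have := hz k; rewrite /a /b.
  have := coordZ_lin k (- 1) z p; rewrite scaleN1r mulN1r => ->.
  by move=> h2; rewrite ltr_norml; lra.
apply/negP; rewrite -ltNge N0; apply: coordsZ_pos => k; rewrite /a /b; lra.
Qed.

Lemma lebZ_sigma_finite : sigma_finite setT muZ.
Proof.
have /sigma_finiteP[F [TF ndF Foo]] := sigma_finiteT leb.
have /sigma_finiteP[G [TG ndG Goo]] := sigma_finiteT (lebesgue_rV R d).
exists (fun n => F n `*` G n).
  rewrite -setXTT TF TG predeqE => -[x y]; split.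
    move=> [/= [n _ Fnx] [k _ Gky]]; exists (maxn n k) => //; split.
    - by move: x Fnx; exact/subsetPset/ndF/leq_maxl.
    - by move: y Gky; exact/subsetPset/ndG/leq_maxr.
  by move=> [n _ []/= ? ?]; split; exists n.
move=> k; have [? ?] := Foo k; have [? ?] := Goo k; split; first exact: measurableX.
rewrite /lebZ -[X in (X < _)%E]/((leb \x lebesgue_rV R d)%E _) product_measure1E //.
by rewrite lte_mul_pinfty // ge0_fin_numE.
Qed.

(** The measure [lebZ] with its sigma-finiteness recorded, for the Fubini argument of
    [preimage_affine_null]. *)
Definition lebZ_sf : {sigma_finite_measure set MZ -> \bar R} :=
  HB.pack (Measure.sort muZ) (Measure_isSigmaFinite.Build _ _ _ muZ lebZ_sigma_finite).

Lemma affZ_preimage_null (c : R * Z) (e : Z) (N : set (measurableTypeR R)) : dotZ c.2 e != 0 ->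
  measurable N -> leb N = 0%E -> {ae muZ, forall z : MZ, ~ N (affZ c z)}.
Proof.
move=> ce mN N0.
have ml : measurable_fun setT (affZ c : measurableTypeR R * X -> measurableTypeR R).
  exact: (continuous_measurable_coords (coordsZ R d) (f := affZ c) (@affZ_continuous _ _ c)).
exists (affZ c @^-1` N); split.
- by rewrite -[X in measurable X]setTI; exact: ml.
- apply: (@preimage_affine_null _ _ _ lebZ_sf (fun h z => (z.1 + (h *: e).1, z.2 + (h *: e).2)) _ _ N _ ml _ ce mN N0).
    by move=> h; exact: mpres_shiftZ.
  by move=> h z; have := affZ_lin c h z e.
- by move=> z /= /contrapT.
Qed.

Variables (D : set Z) (kappa : R) (M : mesh R d) (hM : simplicial_mesh D kappa M).
Variables (phi : 'I_(nnode M) -> Z -> R) (hphi : forall a, is_hat D a (phi a)).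
Implicit Types (K : {set 'I_(nnode M)}) (a : 'I_(nnode M)).
Local Notation pos := (@pos R d M).

(** The hat function of [a] on the cell [K], continued as an affine function to all of space-time:
    the barycentric coordinate of [a] if [a] is a vertex of [K], and 0 otherwise. Taking it from the
    given hat functions makes the link between the two immediate. *)
Definition bary K a : R * Z := xget 0 [set c | forall z, conv_cell K z -> phi a z = affZ c z].

Definition int_cell K : set Z := [set z | forall a, a \in K -> 0 < affZ (bary K a) z].

Lemma baryP K a : K \in cells M -> forall z, conv_cell K z -> phi a z = affZ (bary K a) z.
Proof.
move=> KM; have [_ /(_ K KM)[q /poly_fun1_aff[c hc] hq] _] := hphi a.
rewrite /bary; case: xgetP => [x -> //|h]; exfalso.
by apply: (h c) => z Kz; rewrite hq.
Qed.

Lemma conv_cell_pos K a : a \in K -> conv_cell K (pos a).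
Proof.
move=> aK; exists (fun b => (b == a)%:R); split=> //.
  by rewrite (bigD1 a) //= eqxx big1 ?addr0 // => b /andP[_ /negbTE ->].
by rewrite (bigD1 a) //= eqxx scale1r big1 ?addr0 // => b /andP[_ /negbTE ->]; rewrite scale0r.
Qed.

Lemma bary_pos K a b : K \in cells M -> b \in K -> affZ (bary K a) (pos b) = (b == a)%:R.
Proof. by move=> KM bK; rewrite -baryP //; [case: (hphi a)|exact: conv_cell_pos]. Qed.

Lemma bary_conv K (A : {set 'I_(nnode M)}) a (l : 'I_(nnode M) -> R) : K \in cells M -> A \subset K ->
  \sum_(b in A) l b = 1 -> affZ (bary K a) (\sum_(b in A) l b *: pos b) = if a \in A then l a else 0.
Proof.
move=> KM /fintype.subsetP AK l1; rewrite affZ_sum //.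
under eq_bigr => b bA do rewrite bary_pos ?AK //.
case: ifPn => aA.
  by rewrite (bigD1 a) //= eqxx mulr1 big1 ?addr0 // => b /andP[_ /negbTE ->]; rewrite mulr0.
by rewrite big1 // => b bA; case: eqP => [ba|_]; rewrite ?mulr0 //; move: aA; rewrite -ba bA.
Qed.

Lemma cell_ball K : K \in cells M -> exists (p : Z) (r : R), 0 < r /\ forall z, `|z - p| < r -> conv_cell K z.
Proof.
move=> KM; have [_ _ _ _ /(_ K KM)[p [r [r0 h _]]]] := hM.
have [r' r'0 h'] := distZ_sub p r0; exists p, r'; split=> // z /h' hz; exact: h.
Qed.

(** A cell contains a ball by shape regularity, so an affine identity can be checked on the cell
    alone, where points are convex combinations of the vertices. *)
Lemma cell_affine K (q : Z -> R) : K \in cells M -> is_aff q -> (forall z, conv_cell K z -> q z = 0) ->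
  forall z, q z = 0.
Proof.
move=> /cell_ball[p [r [r0 h]]] [c hc] hq z; rewrite hc.
by apply: (affZ_vanish r0) => w /h /hq; rewrite hc.
Qed.

Lemma is_aff_bary K a : is_aff (affZ (bary K a)).
Proof. by exists (bary K a). Qed.

Lemma bary_sum K z : K \in cells M -> \sum_(a in K) affZ (bary K a) z = 1.
Proof.
move=> KM; apply/eqP; rewrite -subr_eq0; apply/eqP; move: z.
apply: (cell_affine KM) => [|z [l [_ l1 ->]]].
  by apply: is_affB (is_aff_cst _ _); apply: is_aff_sum => a _; exact: is_aff_bary.
under eq_bigr => a aK do rewrite bary_conv // aK.
by rewrite l1 subrr.
Qed.

Lemma bary_repr K z : K \in cells M -> z = \sum_(a in K) affZ (bary K a) z *: pos a.
Proof.
move=> KM; apply: coordZ_inj => k; rewrite coordZ_sum.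
apply/eqP; rewrite -subr_eq0; apply/eqP; move: z.
apply: (cell_affine KM) => [|z [l [_ l1 ->]]].
  apply: is_affB; first exact: is_aff_coordZ.
  apply: is_aff_sum => a _; have [c hc] := is_affZ (coordZ k (pos a)) (is_aff_bary K a).
  by exists c => z; rewrite -hc mulrC.
rewrite coordZ_sum.
under [X in _ - X]eq_bigr => a aK do rewrite bary_conv // aK.
by rewrite subrr.
Qed.

Lemma conv_cellP K z : K \in cells M -> conv_cell K z <-> forall a, a \in K -> 0 <= affZ (bary K a) z.
Proof.
move=> KM; split.
  by move=> [l [l0 l1 ->]] a aK; rewrite bary_conv // aK.
move=> h; exists (fun a => if a \in K then affZ (bary K a) z else 0); split.
- by move=> a; case: ifP => // /h.
- by rewrite -[RHS](bary_sum z KM); apply: eq_bigr => a ->.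
- by rewrite {1}(bary_repr z KM); apply: eq_bigr => a ->.
Qed.

Lemma int_cell_sub K : K \in cells M -> int_cell K `<=` conv_cell K.
Proof. by move=> KM z h; apply/conv_cellP => // a /h /ltW. Qed.

Lemma open_int_cell K : open (int_cell K).
Proof.
rewrite openE => z hz; have := @filter_forall _ _ (fun a w => a \in K -> 0 < affZ (bary K a) w) (nbhs z) _; apply => a.
have [aK|aK] := boolP (a \in K); last by apply: nearW => w.
have h : 0 < affZ (bary K a) z by exact: hz.
near=> w => _; near: w.
exact: (@affZ_continuous _ _ (bary K a) z _ (lt_nbhsr h)).
Unshelve. all: by end_near. Qed.

Lemma closed_cell K : K \in cells M -> closed (conv_cell K).
Proof.
move=> KM.
have -> : conv_cell K = \bigcap_(a in [set a | a \in K]) (affZ (bary K a) @^-1` [set x | 0 <= x]).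
  by apply/seteqP; split => z; [move=> /(conv_cellP _ KM) h a; exact: h|move=> h; apply/(conv_cellP _ KM)].
apply: closed_bigI => a _; apply: closed_comp; last exact: closed_ge.
by move=> z _; exact: affZ_continuous.
Qed.

Lemma card_cell K : K \in cells M -> #|K| = d.+2.
Proof. by move=> KM; have [_ _ /(_ K KM)[]] := hM. Qed.

(** By conformity the common point lies in the face spanned by the common vertices. If the cells
    differ, having equally many vertices, some vertex of [K] is not in [K']; its barycentric
    coordinate vanishes on that face but is positive at an interior point. *)
Lemma int_cell_disjoint K K' z : K \in cells M -> K' \in cells M -> int_cell K z -> conv_cell K' z -> K = K'.
Proof.
move=> KM KM' Kz Kz'; apply/eqP; apply: contrapT => /negP KK'.
have [_ _ _ [/(_ K K' KM KM') h _] _] := hM.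
have : (conv_cell (K :&: K') z) by rewrite -h; split=> //; exact: int_cell_sub.
move=> [l [_ l1 zE]].
have : ~~ (K \subset K').
  by apply: contra KK' => sK; rewrite eqEcard sK !card_cell //= leqnn.
move=> /subsetPn[a aK aK']; have := Kz a aK.
by rewrite zE (bary_conv a KM _ l1) ?subsetIl // inE (negbTE aK') andbF ltxx.
Qed.

Lemma phi_ge0 K z a : K \in cells M -> conv_cell K z -> 0 <= phi a z.
Proof.
move=> KM [l [l0 l1 ->]]; rewrite (@baryP K) //; last by exists l.
by rewrite bary_conv //; case: ifP.
Qed.

Lemma phi_out K z a : K \in cells M -> conv_cell K z -> a \notin K -> phi a z = 0.
Proof.
move=> KM [l [l0 l1 ->]] aK; rewrite (@baryP K) //; last by exists l.
by rewrite bary_conv // (negbTE aK).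
Qed.

Lemma bary_out K z a : K \in cells M -> a \notin K -> affZ (bary K a) z = 0.
Proof.
move=> KM aK; move: z; apply: (cell_affine KM) (is_aff_bary K a) _ => z Kz.
by rewrite -baryP // (phi_out KM Kz).
Qed.

(** The partition of unity compared at [e] and at 0. It cancels the terms with [grad phi_a] in the
    sum of the local divergences. *)
Lemma slope_sum K e : K \in cells M -> \sum_a dotZ (bary K a).2 e = 0.
Proof.
move=> KM; have h z : \sum_a affZ (bary K a) z = 1.
  rewrite (bigID (mem K)) /= bary_sum // big1 ?addr0 // => a aK; exact: bary_out.
have := h e; have := h 0; rewrite /affZ.
under eq_bigr do rewrite dotZ0 addr0.
by rewrite big_split /= => -> /eqP; rewrite eq_sym addrC -subr_eq subrr => /eqP.
Qed.

(** A point of a cell outside its [int_cell] is a zero of some barycentric coordinate, and zero sets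
    of nonconstant affine functions are null. *)
Lemma ae_int_cell : {ae muZ, forall z : MZ, D z -> exists2 K, K \in cells M & int_cell K z}.
Proof.
have h K a : {ae muZ, forall z : MZ, K \in cells M -> a \in K -> affZ (bary K a) z != 0}.
  have [KM|KM] := boolP (K \in cells M); last exact: (filterS _ (filterT (F := almost_everywhere muZ))).
  have [aK|aK] := boolP (a \in K); last exact: (filterS _ (filterT (F := almost_everywhere muZ))).
  (* A second vertex: the coordinate of [a] drops from 1 at [a] to 0 at [b], so its slope along this
     edge is not zero. *)
  have [b bK ba] : exists2 b, b \in K & b != a.
    have : (0 < #|K :\ a|)%N by rewrite -(ltn_add2l (a \in K)) -cardsD1 card_cell // aK.
    by move=> /card_gt0P[b]; rewrite !inE => /andP[ba bK]; exists b.
  have ne : dotZ (bary K a).2 (pos b - pos a) != 0.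
    have := affZ_line (bary K a) 1 (pos a) (pos b); rewrite affZ_lin !bary_pos // eqxx (negbTE ba) !mul1r.
    by move=> /addrI ->; rewrite sub0r oppr_eq0 oner_eq0.
  apply: filterS (affZ_preimage_null ne (measurable_set1 0) (lebesgue_measure_set1 0)).
  by move=> z h _ _; apply/eqP.
have h2 : {ae muZ, forall z : MZ, forall (K : {set 'I_(nnode M)}) a, K \in cells M -> a \in K -> affZ (bary K a) z != 0}.
  by apply: filter_forall => K; apply: filter_forall => a.
apply: filterS h2 => z hz Dz; have [_ _ _ [_ DE] _] := hM.
move: Dz; rewrite -DE => -[K KM Kz]; exists K => // a aK.
by rewrite lt_neqAle eq_sym hz //=; move/(conv_cellP _ KM): Kz; apply.
Qed.

Lemma cell_sub K : K \in cells M -> conv_cell K `<=` D.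
Proof. by move=> KM z Kz; have [_ _ _ [_ <-] _] := hM; exists K. Qed.

(** Continuity turns equality almost everywhere into equality. As [z0] may lie on the boundary of
    the cell, it is approached through copies of an inscribed ball shrunk towards [z0], which stay
    in the cell by convexity and have positive measure. *)
Lemma piecewise_affine_eq K (u : Z -> R) c : K \in cells M -> {within D, continuous u} ->
  {ae muZ, forall z : MZ, conv_cell K z -> u z = affZ c z} -> forall z, conv_cell K z -> u z = affZ c z.
Proof.
move=> KM cu hu z0 Kz0; apply/eqP; rewrite -subr_eq0; apply: contrapT => /negP ne.
pose e := `|u z0 - affZ c z0| / 2; have e0 : 0 < e by rewrite divr_gt0 // normr_gt0.
have Dz0 := cell_sub KM Kz0.
have := @subspace_continuousP _ D _ u; move=> /iffLR/(_ cu z0 Dz0)/cvgrPdist_lt/(_ e e0).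
have /cvgrPdist_lt/(_ e e0) := @affZ_continuous _ _ c z0.
move=> /nbhs_ballP[r1 /= r10 h1] /nbhs_ballP[r2 /= r20 h2].
pose rr := Num.min r1 r2; have rr0 : 0 < rr by rewrite lt_min r10.
have [p [r [r0 hr]]] := cell_ball KM.
have n0 : 0 < 1 + (`|p - z0| + r) by rewrite ltr_pwDl // addr_ge0 // ltW.
(* The ratio brings the shrunken ball within [rr] of [z0]; being at most 1, it keeps the ball in the
   cell. *)
pose t := Num.min 1 (rr / (1 + (`|p - z0| + r))).
have t0 : 0 < t by rewrite lt_min ltr01 divr_gt0.
have t1 : t <= 1 by rewrite ge_min lexx.
have [w wp hw] := ae_ball (z0 + t *: (p - z0)) hu (mulr_gt0 t0 r0).
pose y := z0 + t^-1 *: (w - z0).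
have wE : w = z0 + t *: (y - z0).
  by rewrite /y addrAC subrr add0r scalerA divff ?gt_eqF // scale1r addrC subrK.
have Ky : conv_cell K y.
  apply: hr; rewrite -(ltr_pM2l t0) -[X in X * `|_|](gtr0_norm t0) -normrZ.
  apply: le_lt_trans wp; rewrite le_eqVlt; apply/orP; left; apply/eqP; congr `|_|.
  by rewrite wE opprD addrACA subrr add0r -scalerBr opprB addrA subrK.
have Kw : conv_cell K w.
  apply/(conv_cellP _ KM) => a aK; rewrite wE affZ_line.
  have := (conv_cellP _ KM).1 Ky a aK; have := (conv_cellP _ KM).1 Kz0 a aK; move: t0 t1.
  nra.
have wz : `|z0 - w| < rr.
  rewrite distrC; have -> : w - z0 = (w - (z0 + t *: (p - z0))) + t *: (p - z0) by rewrite opprD addrA subrK.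
  apply: le_lt_trans (ler_normD _ _) _; rewrite normrZ (gtr0_norm t0).
  apply: (@lt_le_trans _ _ (t * (1 + (`|p - z0| + r)))); last by rewrite -ler_pdivlMr // ge_min lexx orbT.
  rewrite mulrDr mulr1 mulrDr; lra.
have hz1 : `|affZ c z0 - affZ c w| < e.
  by apply: h1; rewrite -ball_normE /=; apply: lt_le_trans wz _; rewrite ge_min lexx.
have hz2 : `|u z0 - u w| < e.
  apply: h2; last exact: cell_sub Kw.
  by rewrite -ball_normE /=; apply: lt_le_trans wz _; rewrite ge_min lexx orbT.
have : `|u z0 - affZ c z0| < e + e.
  rewrite -[u z0](subrK (u w)) (hw Kw) -addrA; apply: le_lt_trans (ler_normD _ _) _.
  rewrite -{1}(hw Kw) ltrD // distrC //.
by rewrite /e -splitr ltxx.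
Qed.

End mesh_geometry.

(** * Lipschitz bounds along segments that cross several cells *)

Section lipschitz_gluing.
Context (R : realType).

(** Induction on the number of closed pieces. Let [c] be the last point of a piece that contains
    [a]: from [a] to [c] the bound of that piece applies, although the path may leave it in between.
    Beyond [c] the piece is never met again, and the others, being closed, cover [c] as well. *)
Lemma lipschitz_glue (I : finType) (A : I -> set R) (f : R -> R) (C : R) : 0 <= C ->
  (forall i, closed (A i)) -> (forall i r s, A i r -> A i s -> `|f r - f s| <= C * `|r - s|) ->
  forall (J : {set I}) a b, a <= b -> `[a, b] `<=` \bigcup_(i in [set i | i \in J]) A i ->
  `|f b - f a| <= C * (b - a).
Proof.
move=> C0 cA fA J; move: {2}#|J| (leqnn #|J|) => n; elim: n J => [|n ih] J Jn a b ab cov.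
  have [i /= iJ _] : (\bigcup_(i in [set i | i \in J]) A i) a by apply: cov; rewrite /= in_itv /= lexx.
  by move: Jn; rewrite leqn0 cards_eq0 => /eqP J0; rewrite J0 inE in iJ.
have [i /= iJ Aa] : (\bigcup_(i in [set i | i \in J]) A i) a by apply: cov; rewrite /= in_itv /= lexx.
pose S := A i `&` `[a, b]; pose c := sup S.
have Sa : S a by split => //; rewrite /= in_itv /= lexx.
have hS : has_sup S by split; [exists a|exists b => r [_]; rewrite /= in_itv /= => /andP[]].
have cS : closed S by apply: closedI => //; exact: interval_closed.
have [Ac] : S c by rewrite [S in S c](closure_id S).1 //; apply: closure_sup; [exists a|exists b => r [_]; rewrite /= in_itv /= => /andP[]].
rewrite /= in_itv /= => /andP[ac cb].
have h1 : `|f c - f a| <= C * (c - a) by apply: le_trans (fA _ _ _ Ac Aa) _; rewrite ger0_norm // subr_ge0.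
move: cb; rewrite le_eqVlt => /predU1P[<- //|cb].
have cov' : `[c, b] `<=` \bigcup_(j in [set j | j \in J :\ i]) A j.
  have cB : closed (\bigcup_(j in [set j | j \in J :\ i]) A j).
    by apply: closed_bigcup => //; exact: finite_finset || exact: finite_finpred.
  have h2 : `]c, b] `<=` \bigcup_(j in [set j | j \in J :\ i]) A j.
    move=> r /=; rewrite in_itv /= => /andP[cr rb].
    have rab : `[a, b]%classic r by rewrite /= in_itv /= rb (le_trans ac (ltW cr)).
    have [j /= jJ Ar] := cov r rab; exists j => //=; rewrite !inE jJ andbT.
    apply: contraTneq cr => ji; rewrite -leNgt; apply: ub_le_sup; first by case: hS.
    by split => //; rewrite -ji.
  have := closure_subset h2; rewrite -((closure_id _).1 cB) => h3; apply: subset_trans h3.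
  move=> r /=; rewrite in_itv /= => /andP[]; rewrite le_eqVlt => /predU1P[<- _|cr rb]; last first.
    by apply: subset_closure; rewrite /= in_itv /= cr.
  move=> B /nbhs_ballP[e /= e0 hB]; exists (Num.min b (c + e / 2)); split.
    by rewrite /= in_itv /= lt_min cb ltrDl divr_gt0 //= ge_min lexx.
  apply: hB; rewrite /ball /= ltr_norml; apply/andP; split.
    rewrite ltrBrDl addrC -ltrBrDl opprK gt_min; apply/orP; right; lra.
  have : c < Num.min b (c + e / 2) by rewrite lt_min cb ltrDl divr_gt0.
  by move: e0; lra.
have h2 : `|f b - f c| <= C * (b - c).
  apply: (ih (J :\ i)) (ltW cb) cov'.
  by rewrite -ltnS; apply: leq_trans Jn; rewrite [X in (_ < X)%N](cardsD1 i) iJ.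
have := ler_normD (f b - f c) (f c - f a); rewrite addrA subrK => /le_trans; apply.
by apply: le_trans (lerD h2 h1) _; lra.
Qed.

End lipschitz_gluing.

Section lipschitz_domains.
Context (R : realType) (d : nat).
Local Notation X := 'rV[R]_d.

Lemma dotv_continuous (e : X) : continuous (fun x : X => dotv x e).
Proof.
have : smooth (fun x : X => dotv x e).
  by apply: smooth_sum => j; apply: smooth_mul; [exact: smooth_coord|exact: smooth_cst].
exact: smooth_continuous.
Qed.

Lemma enorm_continuous (x0 : X) : continuous (fun x : X => enorm (x - x0)).
Proof.
have h : smooth (fun x : X => dotv (x - x0) (x - x0)).
  apply: smooth_sum => j.
  have hj : smooth (fun y : X => (y - x0) ord0 j).
    rewrite (_ : (fun y => _) = fun y : X => y ord0 j + (- x0 ord0 j)).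
      by apply: smooth_add; [exact: smooth_coord|exact: smooth_cst].
    by apply/funext => y; rewrite !mxE.
  exact: smooth_mul.
move=> x; apply: (@continuous_comp _ _ _ (fun x : X => dotv (x - x0) (x - x0)) Num.sqrt x).
  exact: (smooth_continuous h).
exact: sqrt_continuous.
Qed.

(** A Lipschitz domain lies on one side of its boundary, which excludes slits. As a consequence, the
    interior of the meshed set lies in the open cylinder, where the test functions live. *)
Lemma lipschitz_interior_closure (Omega : set X) : lipschitz_domain Omega ->
  interior (closure Omega) `<=` Omega.
Proof.
move=> [oO _ _ _ lip] x hx; apply: contrapT => nOx.
have /lip : bdry Omega x.
  split; first by apply: interior_subset.
  by move=> h; apply: nOx; exact: interior_subset.
move=> [r [k [e [gam [r0 e1 hgam gamc hO]]]]].
have en0 : enorm (x - x) = 0 by rewrite subrr /enorm /dotv big1 ?sqrtr0 // => j _; rewrite mxE mul0r.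
have hxg : dotv x e <= gam x.
  by rewrite leNgt; apply/negP => h; apply: nOx; apply/(hO x); rewrite ?en0.
have cg : continuous gam.
  move=> y; apply/(@cvgrPdist_lt _ _ _ (nbhs (y : X))) => eps eps0.
  have h : \forall w \near nbhs y, enorm (w - y) < eps / (`|k| + 1).
    have := @enorm_continuous y y; rewrite /continuous_at subrr /=.
    have -> : enorm (0 : X) = 0 by rewrite -(subrr x).
    by move=> /cvgr_lt; apply; rewrite divr_gt0 // ltr_wpDl.
  move: h; apply: filterS => w.
  rewrite ltr_pdivlMr ?ltr_wpDl // mulrC; apply: le_lt_trans.
  rewrite distrC; apply: le_trans (hgam _ _) _; rewrite ler_wpM2r ?sqrtr_ge0 //.
  by rewrite (le_trans (ler_norm _)) // lerDl.
(* Points [x - c e] with [c > 0] small are in the closure, yet strictly below the graph. *)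
have cl : x + (- c) *: e @[c --> (0 : R)] --> x.
  have : x + (- c) *: e @[c --> (0 : R)] --> x + (- 0) *: e.
    apply: cvgD; first exact: cvg_cst.
    by apply: cvgZr_tmp; apply: cvgN; exact: cvg_id.
  by rewrite oppr0 scale0r addr0.
have hy1 : \forall c \near (0 : R), enorm (x + (- c) *: e - x) < r.
  have hr : \forall w \near (x : X), enorm (w - x) < r.
    by have := @enorm_continuous x x; rewrite /continuous_at en0 => /cvgr_lt; exact.
  exact: (cl _ hr).
have hy2 : \forall c \near (0 : R), closure Omega (x + (- c) *: e) by exact: (cl _ hx).
have [c [c0 [yr yO]]] : exists c, 0 < c /\ (enorm (x + (- c) *: e - x) < r /\ closure Omega (x + (- c) *: e)).
  have hy : nbhs (0 : R) ([set c | enorm (x + (- c) *: e - x) < r] `&` [set c | closure Omega (x + (- c) *: e)]).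
    exact: filterI hy1 hy2.
  have [eps /= eps0 hB] := (@nbhs_ballP R R 0 _).1 hy.
  exists (eps / 2); split; first by rewrite divr_gt0.
  by apply: hB; rewrite /ball /= sub0r normrN gtr0_norm ?divr_gt0 //; move: eps0; lra.
pose y : X := x + (- c) *: e; rewrite -/y in yr yO.
have yg : dotv y e < gam y.
  rewrite gamc; apply: lt_le_trans hxg.
  have -> : dotv y e = dotv x e - c * dotv e e.
    rewrite /dotv mulr_sumr -sumrB; apply: eq_bigr => j _; rewrite !mxE; ring.
  by rewrite -enorm_sqr e1 expr1n mulr1 ltrBlDr ltrDl.
have : nbhs y [set w | enorm (w - x) < r /\ dotv w e < gam w].
  have h : gam w - dotv w e @[w --> y] --> gam y - dotv y e.
    have cgy : gam w @[w --> y] --> gam y by exact: (cg y).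
    exact: (cvgB cgy (@dotv_continuous e y)).
  have /cvgr_lt/(_ _ yr) h1 := @enorm_continuous x y.
  have yg0 : 0 < gam y - dotv y e by rewrite subr_gt0.
  move/cvgr_gt : h => /(_ _ yg0) h2.
  by apply: filterS (filterI h1 h2) => w [wr]; rewrite /= subr_gt0.
move=> /yO[w [Ow [wr wg]]].
by have := (hO w wr).1 Ow; rewrite ltNge (ltW wg).
Unshelve. all: by end_near. Qed.

End lipschitz_domains.

(** * Piecewise affine functions *)

(* [filterS] in a form that does not need the measurable structure to be inferred
   from the goal. *)
Lemma ae_imp d (T : measurableType d) (R : realType) (mu : {measure set T -> \bar R}) (P P' : T -> Prop) :
  (forall x, P x -> P' x) -> {ae mu, forall x, P x} -> {ae mu, forall x, P' x}.
Proof. by move=> h; apply: filterS. Qed.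

Section sections.
Context d1 d2 (T1 : measurableType d1) (T2 : measurableType d2) (R : realType).
Context (m1 : {measure set T1 -> \bar R}) (m2 : {sigma_finite_measure set T2 -> \bar R}).

Lemma ae_xsection (P : T1 * T2 -> Prop) : {ae (m1 \x m2)%E, forall z, P z} ->
  {ae m1, forall t, {ae m2, forall x, P (t, x)}}.
Proof.
move=> [N [mN N0 hN]]; have mS := measurable_fun_xsection m2 mN.
have : (\int[m1]_x `|(m2 \o xsection N) x| = 0)%E.
  by rewrite -[RHS]N0 /product_measure1; apply: eq_integral => x _; rewrite gee0_abs //= measure_ge0.
move/(ae_eq_integral_abs m1 measurableT mS); apply: filterS => t /(_ Logic.I) /= h.
exists (xsection N t); split => //; first exact: measurable_xsection.
by move=> x hx; rewrite /xsection /= inE; exact: hN.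
Qed.

End sections.

Section piecewise_affine.
Context (R : realType) (d : nat) (T : R) (Omega : set 'rV[R]_d).
Local Notation X := 'rV[R]_d.
Local Notation Z := (R * 'rV[R]_d)%type.
Local Notation MZ := (measurableTypeR R * 'rV[R]_d)%type.
Local Notation muZ := (lebZ R d).
Local Notation leb := (@lebesgue_measure R).
Local Notation Q := (Qset T Omega).
Hypotheses (lO : lipschitz_domain Omega) (T0 : 0 < T).

Let oO : open Omega. Proof. by case: lO. Qed.
Let bO : bounded_set Omega. Proof. by case: lO. Qed.

Lemma Qclosed_sub (z : Z) : Qclosed T Omega z -> 0 <= z.1 <= T /\ closure Omega z.2.
Proof.
move=> hz; split.
  have cl : closed (fst @^-1` `[0, T]%classic : set Z).
    by apply: closed_comp; [move=> w _; exact: cvg_fst|exact: interval_closed].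
  have : (fst @^-1` `[0, T]%classic : set Z) z.
    have hs : (Q : set Z) `<=` fst @^-1` `[0, T]%classic.
      by move=> -[t x] [/= + _]; rewrite !in_itv /= => /andP[/ltW -> ->].
    by have := closure_subset hs hz; rewrite -((closure_id _).1 cl).
  by rewrite /= in_itv.
have cl : closed (snd @^-1` closure Omega : set Z).
  by apply: closed_comp; [move=> w _; exact: cvg_snd|exact: closed_closure].
have hs : (Q : set Z) `<=` snd @^-1` closure Omega.
  by move=> -[t x] [/= _ h]; exact: subset_closure.
by have := closure_subset hs hz; rewrite -((closure_id _).1 cl).
Qed.

Lemma sub_Qclosed (z : Z) : 0 <= z.1 <= T -> Omega z.2 -> Qclosed T Omega z.
Proof.
case: z => t x /= /andP[t0 tT] Ox.
move: t0; rewrite le_eqVlt => /predU1P[<-|t0]; last first.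
  by apply: subset_closure; split => //=; rewrite in_itv /= t0.
move=> B /nbhs_ballP[e /= e0 hB]; exists (Num.min T (e / 2), x); split.
  by split => //=; rewrite in_itv /= lt_min T0 divr_gt0 //= ge_min lexx.
apply: hB; split => /=; last exact: ballxx.
rewrite /ball /= sub0r normrN gtr0_norm ?lt_min ?T0 ?divr_gt0 //.
by rewrite gt_min; apply/orP; right; move: e0; lra.
Qed.

Lemma interior_Qclosed : interior (Qclosed T Omega) `<=` Qopen T Omega.
Proof.
move=> z /nbhs_ballP[e /= e0 hB].
have hQ w : ball z e w -> 0 <= w.1 <= T /\ closure Omega w.2 by move=> /hB; exact: Qclosed_sub.
split.
  rewrite /= in_itv /=.
  have [] := hQ (z.1 - e / 2, z.2).
    split; last exact: ballxx.
    by rewrite /ball /= opprD addNKr opprK gtr0_norm ?divr_gt0 //; move: e0; lra.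
  have [] := hQ (z.1 + e / 2, z.2).
    split; last exact: ballxx.
    by rewrite /ball /= opprD addNKr normrN gtr0_norm ?divr_gt0 //; move: e0; lra.
  by rewrite /=; move: e0; lra.
apply: (lipschitz_interior_closure lO); apply/nbhs_ballP; exists e => //= x hx.
by have [] := hQ (z.1, x) (conj (ballxx _ e0) hx).
Qed.

Variables (kappa : R) (M : mesh R d) (hM : simplicial_mesh (Qclosed T Omega) kappa M).
Variables (phi : 'I_(nnode M) -> Z -> R) (hphi : forall a, is_hat (Qclosed T Omega) a (phi a)).
Implicit Types (K : {set 'I_(nnode M)}) (a : 'I_(nnode M)).
Local Notation intK := (int_cell phi).

Lemma int_cell_Qopen K : K \in cells M -> intK K `<=` Qopen T Omega.
Proof.
move=> KM z hz; apply: interior_Qclosed.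
have : nbhs z (intK K) by apply: open_nbhs_nbhs; split => //; exact: open_int_cell.
by apply: filterS => w /(int_cell_sub hM hphi KM); exact: (cell_sub hM KM).
Qed.

Definition pw_affine (c : {set 'I_(nnode M)} -> R * Z) (u : Z -> R) :=
  forall K, K \in cells M -> forall z, conv_cell K z -> u z = affZ (c K) z.

Lemma Vh_pw_affine u : in_Vh T Omega M u -> exists c, pw_affine c u.
Proof.
move=> [[_ hp] _ cu _].
have /choice[c hc] : forall K, exists cK, K \in cells M -> forall z, conv_cell K z -> u z = affZ cK z.
  move=> K; have [KM|_] := boolP (K \in cells M); last by exists 0.
  have [q /poly_fun1_aff[cK hcK] hq] := hp _ KM; exists cK => _.
  apply: (piecewise_affine_eq hM hphi KM cu); move: hq; apply: ae_imp => z hz Kz.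
  by rewrite hz // hcK.
by exists c => K KM; exact: hc.
Qed.

Lemma hat_pw_affine a : pw_affine (fun K => bary phi K a) (phi a).
Proof. by move=> K KM z; exact: (baryP hphi). Qed.

Definition zext (u : Z -> R) (z : Z) : R := if z.2 \in Omega then u z else 0.

Lemma zextE u t x : Omega x -> zext u (t, x) = u (t, x).
Proof. by move=> Ox; rewrite /zext mem_set. Qed.

Lemma pw_affine_lipschitz (c : {set 'I_(nnode M)} -> R * Z) : exists2 C : R, 0 <= C &
  (forall K z w, `|affZ (c K) z - affZ (c K) w| <= C * `|z - w|).
Proof.
have /choice[CK hCK] : forall K, exists C : R, 0 <= C /\
    forall z w, `|affZ (c K) z - affZ (c K) w| <= C * `|z - w|.
  by move=> K; have [C C0 hC] := affZ_lipschitz (c K); exists C.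
have CK0 K : 0 <= CK K by case: (hCK K).
(* A sum over the finitely many cells in place of a maximum. *)
exists (\sum_K CK K) => [|K z w]; first exact: sumr_ge0.
apply: le_trans ((hCK K).2 z w) _; rewrite ler_wpM2r // (bigD1 K) //= lerDl.
exact: sumr_ge0.
Qed.

Lemma pw_affine_segment (c : {set 'I_(nnode M)} -> R * Z) u : pw_affine c u ->
  exists2 C : R, 0 <= C & forall z w : Z, (forall r, 0 <= r <= 1 -> Qclosed T Omega (z + r *: (w - z))) ->
    `|u w - u z| <= C * `|w - z|.
Proof.
move=> cu; have [C C0 hC] := pw_affine_lipschitz c; exists C => // z w hzw.
pose p (r : R) : Z := z + r *: (w - z).
pose A (K : {set 'I_(nnode M)}) : set R := [set r | K \in cells M /\ conv_cell K (p r)].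
have cA K : closed (A K).
  have [KM|KM] := boolP (K \in cells M); last first.
    rewrite [X in closed X](_ : _ = set0); first exact: closed0.
    by apply/seteqP; split => r //= [h]; rewrite h in KM.
  rewrite [X in closed X](_ : _ = p @^-1` conv_cell K); last by apply/seteqP; split => r //= [].
  apply: closed_comp; last exact: (closed_cell hM hphi).
  by move=> r _; apply: cvgD; [exact: cvg_cst|apply: cvgZr_tmp; exact: cvg_id].
have fA K r s : A K r -> A K s -> `|u (p r) - u (p s)| <= (C * `|w - z|) * `|r - s|.
  move=> [KM hr] [_ hs]; rewrite !(cu K KM) //; apply: le_trans (hC _ _ _) _.
  by rewrite /p opprD addrACA subrr add0r -scalerBl normrZ mulrAC mulrA.
have := @lipschitz_glue R _ A (u \o p) (C * `|w - z|) _ cA fA [set: {set 'I_(nnode M)}]%SET 0 1 ler01.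
have p0 : p 0 = z by rewrite /p scale0r addr0.
have p1 : p 1 = w by rewrite /p scale1r addrC subrK.
rewrite subr0 mulr1 -[(_ \o p) 1]/(u (p 1)) -[(_ \o p) 0]/(u (p 0)) p0 p1.
apply; first by rewrite mulr_ge0.
move=> r /=; rewrite in_itv /= => /hzw.
by have [_ _ _ [_ <-] _] := hM => -[K KM Kp]; exists K => //=; rewrite inE.
Qed.

(** A segment may leave the cylinder, so the parameters with space component outside [Omega] form
    one more closed piece, indexed by [None]. On a cell the extension is still the affine function,
    since both vanish on the lateral boundary. *)
Lemma zext_lipschitz (c : {set 'I_(nnode M)} -> R * Z) u : pw_affine c u ->
  (forall z, GammaT T Omega z -> u z = 0) ->
  exists2 C : R, 0 <= C & forall z w : Z, 0 <= z.1 <= T -> 0 <= w.1 <= T ->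
    `|zext u z - zext u w| <= C * `|z - w|.
Proof.
move=> cu uG; have [C C0 hC] := pw_affine_lipschitz c; exists C => // z w hz hw.
rewrite distrC [`|z - w|]distrC.
pose p (r : R) : Z := z + r *: (w - z).
pose A (i : option {set 'I_(nnode M)}) : set R := if i is Some K
  then [set r | K \in cells M /\ conv_cell K (p r)] else [set r | ~ Omega (p r).2].
have cp : continuous p.
  by move=> r; apply: cvgD; [exact: cvg_cst|apply: cvgZr_tmp; exact: cvg_id].
have cA i : closed (A i).
  case: i => [K|]; rewrite /A; last first.
    rewrite -[X in closed X]/(~` ((snd \o p) @^-1` Omega)); apply: open_closedC.
    by apply: open_comp => // r _; apply: continuous_comp; [exact: cp|exact: cvg_snd].
  have [KM|KM] := boolP (K \in cells M); last first.
    rewrite [X in closed X](_ : _ = set0); first exact: closed0.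
    by apply/seteqP; split => r //= [].
  rewrite [X in closed X](_ : _ = p @^-1` conv_cell K); last by apply/seteqP; split => r //= [].
  by apply: closed_comp; [move=> r _; exact: cp|exact: (closed_cell hM hphi)].
have pE r s : p r - p s = (r - s) *: (w - z).
  by rewrite /p opprD addrACA subrr add0r scalerBl.
have fA i r s : A i r -> A i s -> `|zext u (p r) - zext u (p s)| <= (C * `|w - z|) * `|r - s|.
  case: i => [K|] /=; last first.
    move=> hr hs; rewrite /zext !memNset // subrr normr0 !mulr_ge0 //.
  have hu q : K \in cells M -> conv_cell K q -> zext u q = affZ (c K) q.
    move=> KM Kq; rewrite /zext; case: ifPn => Oq; first exact: cu.
    rewrite -(cu _ KM) // uG //; have [h1 h2] := Qclosed_sub (cell_sub hM KM Kq).
    split; first by rewrite /= in_itv.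
    by split => // /interior_subset h3; move/negP: Oq; apply; exact: mem_set.
  move=> [KM hr] [_ hs]; rewrite !hu //; apply: le_trans (hC _ _ _) _.
  by rewrite pE normrZ mulrAC mulrA.
have := @lipschitz_glue R _ A (zext u \o p) (C * `|w - z|) _ cA fA [set: option {set 'I_(nnode M)}]%SET 0 1 ler01.
have p0 : p 0 = z by rewrite /p scale0r addr0.
have p1 : p 1 = w by rewrite /p scale1r addrC subrK.
rewrite subr0 mulr1 -[(_ \o p) 1]/(zext u (p 1)) -[(_ \o p) 0]/(zext u (p 0)) p0 p1.
apply; first by rewrite mulr_ge0.
move=> r /=; rewrite in_itv /= => /andP[r0 r1].
have [Op|Op] := pselect (Omega (p r).2); last by exists None => //=; rewrite inE.
have : Qclosed T Omega (p r).
  apply: sub_Qclosed => //=; move: hz hw r0 r1 => /andP[z1 z2] /andP[w1 w2] r0 r1.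
  rewrite -[_ *: _]/(r * (w.1 - z.1)); apply/andP; split; nra.
by have [_ _ _ [_ <-] _] := hM => -[K KM Kp]; exists (Some K) => //=; rewrite inE.
Qed.

(** In the interior of [K] this is the derivative along [e] of [G \o u], where [u] equals
    [affZ (c K)] on [K] and [be] is the derivative of [G]; with [be = cst 1] it is the derivative of
    [u]. Off the open cells it is 0. *)
Definition pwgrad (be : R -> R) (c : {set 'I_(nnode M)} -> R * Z) (e z : Z) : R :=
  \sum_(K in cells M) \1_(intK K) z * (be (affZ (c K) z) * dotZ (c K).2 e).

Lemma pwgrad_int be c e K z : K \in cells M -> intK K z ->
  pwgrad be c e z = be (affZ (c K) z) * dotZ (c K).2 e.
Proof.
move=> KM Kz; rewrite /pwgrad (bigD1 K) //= indicE mem_set // mul1r big1 ?addr0 // => K' /andP[KM' K'K].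
rewrite indicE memNset ?mul0r // => K'z; move/eqP: K'K; apply.
apply: (int_cell_disjoint hM hphi KM' KM K'z); exact: (int_cell_sub hM hphi KM).
Qed.

Lemma pwgrad_bounded be c e : (forall y, `|be y| <= 1) -> exists2 C : R, 0 <= C &
  forall z, `|pwgrad be c e z| <= C.
Proof.
move=> hbe; exists (\sum_(K in cells M) `|dotZ (c K).2 e|) => [|z]; first exact: sumr_ge0.
apply: le_trans (ler_norm_sum _ _ _) _; apply: ler_sum => K _.
rewrite !normrM mulrA ler_piMl // mulr_ile1 // indicE normr_nat.
by case: (_ \in _); rewrite ?ler01.
Qed.

Lemma pwgrad_measurable be c e : measurable_fun setT (be : measurableTypeR R -> measurableTypeR R) ->
  measurable_fun setT (pwgrad be c e : MZ -> measurableTypeR R).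
Proof.
move=> mbe; rewrite (_ : pwgrad be c e = fun z : MZ => \sum_K
    if K \in cells M then \1_(intK K) z * (be (affZ (c K) z) * dotZ (c K).2 e) else 0); last first.
  by apply/funext => z; rewrite /pwgrad big_mkcond.
apply: (@measurable_sum _ _ R setT _ (index_enum _) (fun K (z : MZ) =>
  if K \in cells M then \1_(intK K) z * (be (affZ (c K) z) * dotZ (c K).2 e) else 0)) => K.
case: (K \in cells M) => //.
apply: measurable_funM.
  have oK : open (intK K) by exact: open_int_cell.
  have mK := open_measurable_coords (coordsZ R d) oK.
  exact: measurable_indic.
apply: measurable_funM => //; apply: (measurableT_comp mbe).
exact: (continuous_measurable_coords (coordsZ R d) (f := affZ (c K)) (@affZ_continuous _ _ (c K))).
Qed.

(** [G 0] may differ from 0, but constants are square integrable on the bounded cylinder. *)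
Lemma lipschitz_comp_L2 (G : R -> R) (u : Z -> R) : (forall r s, `|G r - G s| <= `|r - s|) ->
  in_L2 muZ Q u -> in_L2 muZ Q (G \o u).
Proof.
move=> hG Lu; have mQ : measurable Q := measurable_Q T oO; have fQ : (muZ Q < +oo)%E by exact: Q_fin.
have mG : measurable_fun setT (G : measurableTypeR R -> measurableTypeR R).
  by apply: continuous_measurable_fun; exact: lipschitz1_continuous.
have LG : in_L2 muZ Q (fun z => `|G 0| + `|u z|).
  apply: in_L2D => //; first by apply: (in_L2_bounded mQ (C := `|G 0|)) => // z _; rewrite normr_id.
  apply: (in_L2_dom mQ (C := 1) _ Lu) => [|z _]; last by rewrite normr_id mul1r.
  by apply: measurableT_comp Lu.1; exact: normr_measurable.
apply: (in_L2_dom mQ (C := 1) _ LG) => [|z _ /=]; first exact: measurableT_comp mG Lu.1.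
rewrite mul1r [leRHS]ger0_norm ?addr_ge0 //.
have := ler_normD (G 0) (G (u z) - G 0); rewrite addrC subrK => /le_trans; apply.
by rewrite lerD2l; have := hG (u z) 0; rewrite subr0.
Qed.

(** Where the slope of [u] along [e] is nonzero, the values of [u] avoid the exceptional set [N]
    almost everywhere and the classical chain rule applies. Where the slope is zero, [u] is constant
    along [e] inside the cell, so the quotients of [G \o u] vanish whether or not [G] is
    differentiable at the value taken. *)
Lemma weak_chain_rule (c : {set 'I_(nnode M)} -> R * Z) u (G be : R -> R) (N : set (measurableTypeR R)) (e : Z) :
  pw_affine c u -> in_L2 muZ Q u ->
  (forall r s, `|G r - G s| <= `|r - s|) ->
  measurable N -> leb N = 0%E -> measurable_fun setT (be : measurableTypeR R -> measurableTypeR R) ->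
  (forall y, `|be y| <= 1) -> (forall y, ~ N y -> derivable G y 1 /\ 'D_1 G y = be y) ->
  is_weak_derivative muZ Q (@test_fun R Z (Qopen T Omega)) (fun psi z => 'D_e psi z)
    (G \o u) (pwgrad be c e).
Proof.
move=> cu Lu hG mN N0 mbe hbe hder.
have [C1 C10 hC1] := pw_affine_segment cu.
have [C2 C20 hC2] := pwgrad_bounded c e hbe.
have mQ : measurable Q by exact: measurable_Q.
have mG : measurable_fun setT (G : measurableTypeR R -> measurableTypeR R).
  by apply: continuous_measurable_fun; exact: lipschitz1_continuous.
apply: (weak_derivative_lipschitz (coordsZ R d) (O := Qopen T Omega) (e := e)
  (C := C1 * `|e| + C2) (sh := fun h z => (z.1 + (h *: e).1, z.2 + (h *: e).2))) => //.
- exact: open_Qopen.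
- exact: Q_fin.
- exact: Qopen_sub.
- by move=> psi tp; exists psi.
- by move=> h; exact: mpres_shiftZ.
- by move=> h z /=; rewrite !scaleNr /= !addrK; case: z.
- exact: lipschitz_comp_L2.
- by apply: measurable_funTS; exact: pwgrad_measurable.
- by move=> z _; apply: le_trans (hC2 z) _; rewrite lerDr mulr_ge0.
- move=> z h hs; apply: le_trans (hG _ _) _.
  apply: le_trans (hC1 z (z + h *: e) _) _.
    move=> r r01; rewrite addrAC subrr add0r scalerA; have [/= hw Ow] := hs r r01.
    by apply: sub_Qclosed => //=; move: hw; rewrite in_itv /= => /andP[/ltW -> /ltW ->].
  by rewrite addrAC subrr add0r normrZ mulrCA mulrC ler_wpM2r // lerDl.
- have hN : {ae muZ, forall z : MZ, forall K, K \in cells M -> dotZ (c K).2 e != 0 -> ~ N (affZ (c K) z)}.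
    apply: filter_forall => K.
    have [e0|/eqP e0] := eqVneq (dotZ (c K).2 e) 0.
      by apply: nearW.
    by apply: filterS (affZ_preimage_null (introN eqP e0) mN N0) => z hz _ _.
  apply: filterS2 hN (ae_int_cell hM hphi) => z hz hz2 Qz.
  have [|K KM Kz] := hz2.
    case: Qz => /= h1 h2; apply: sub_Qclosed => //.
    by move: h1; rewrite in_itv /= => /andP[/ltW -> /ltW ->].
  rewrite (pwgrad_int _ _ _ KM Kz).
  have nK : nbhs (z : Z) (intK K) by apply: open_nbhs_nbhs; split => //; exact: open_int_cell.
  have hK : conv_cell K z by exact: (int_cell_sub hM hphi KM).
  set s := dotZ (c K).2 e; set y := affZ (c K) z.
  have lim : m.+1%:R * (G y - G (y + (- m.+1%:R^-1) *: s)) @[m --> \oo] --> be y * s.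
    have [s0|s0] := eqVneq s 0.
      rewrite s0 mulr0; under eq_fun do rewrite scaler0 addr0 subrr mulr0.
      exact: cvg_cst.
    have [dG dE] := hder y (hz K KM s0).
    have dd : differentiable G y by apply/derivable1_diffP.
    have dGs : derivable G y s by exact: diff_derivable.
    have hs : 'D_s G y = be y * s by rewrite derive_scal // dE mulrC.
    by rewrite -hs; exact: (backward_difference dGs).
  apply: cvg_trans lim; apply: near_eq_cvg.
  have : \forall m \near \oo, intK K ((z : Z) + (- m.+1%:R^-1) *: e).
    have hc : (z : Z) + (- m.+1%:R^-1) *: e @[m --> \oo] --> (z : Z).
      have : (z : Z) + (- m.+1%:R^-1) *: e @[m --> \oo] --> (z : Z) + (- 0) *: e.
        by apply: cvgD; [exact: cvg_cst|apply: cvgZr_tmp; apply: cvgN; exact: cvg_harmonic].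
      by rewrite oppr0 scale0r addr0.
    exact: (hc _ nK).
  apply: filterS => m hm /=.
  rewrite (cu K KM) // -[X in u X]/((z : Z) + (- m.+1%:R^-1) *: e) (cu K KM); last exact: (int_cell_sub hM hphi KM).
  by rewrite affZ_lin.
Qed.

End piecewise_affine.

(** * The space H10 *)

Section vector_L2.
Context d (T : measurableType d) (R : realType) (mu : {measure set T -> \bar R}).
Variables (D : set T) (mD : measurable D) (n : nat).
Implicit Types w : T -> 'rV[R]_n.

Lemma integrable_Rsum (I : Type) (r : seq I) (f : I -> T -> R) :
  (forall i, mu.-integrable D (EFin \o f i)) ->
  mu.-integrable D (EFin \o (fun z => \sum_(i <- r) f i z)) /\
  \int[mu]_(z in D) (\sum_(i <- r) f i z) = \sum_(i <- r) \int[mu]_(z in D) f i z.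
Proof.
move=> hf; elim: r => [|i r [ih1 ih2]].
  split; last first.
    by rewrite big_nil; under eq_Rintegral do rewrite big_nil; rewrite /Rintegral integral0.
  by under [X in _.-integrable _ (_ \o X)]eq_fun do rewrite big_nil; exact: integrable0.
have E : (fun z => \sum_(k <- i :: r) f k z) = (fun z => f i z + \sum_(k <- r) f k z).
  by apply/funext => z; rewrite big_cons.
split; last by rewrite big_cons -ih2 -RintegralD // E.
by rewrite E; exact: (integrableD mD (hf i) ih1).
Qed.

Definition in_L2v w := forall j, in_L2 mu D (fun z => w z ord0 j).

Definition vip w w' := \sum_j ip mu D (fun z => w z ord0 j) (fun z => w' z ord0 j).

Lemma Rintegral_dotv w w' : in_L2v w -> in_L2v w' -> \int[mu]_(z in D) dotv (w z) (w' z) = vip w w'.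
Proof.
move=> Lw Lw'; have h j := in_L2_integrableM mD (Lw j) (Lw' j).
exact: (integrable_Rsum (index_enum _) h).2.
Qed.

Lemma integrable_dotv w w' : in_L2v w -> in_L2v w' ->
  mu.-integrable D (EFin \o (fun z => dotv (w z) (w' z))).
Proof.
move=> Lw Lw'; have h j := in_L2_integrableM mD (Lw j) (Lw' j).
exact: (integrable_Rsum (index_enum _) h).1.
Qed.

Lemma in_L2_enorm w : in_L2v w -> in_L2 mu D (fun z => enorm (w z)).
Proof.
move=> Lw; apply/in_L2E => //; have := integrable_dotv Lw Lw => /integrableP[/measurable_EFinP md fd].
split; first exact: (measurableT_comp (continuous_measurable_fun (@sqrt_continuous R)) md).
apply: le_lt_trans fd; rewrite le_eqVlt; apply/orP; left; apply/eqP; apply: eq_integral => z _ /=.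
by rewrite enorm_sqr ger0_norm // dotv_ge0.
Qed.

Lemma L2norm_enorm w : in_L2v w -> L2norm mu D (fun z => enorm (w z)) = (Num.sqrt (vip w w))%:E.
Proof.
move=> Lw; rewrite L2normK //; last exact: in_L2_enorm.
congr (Num.sqrt _)%:E; rewrite -Rintegral_dotv //; apply: eq_Rintegral => z _.
by rewrite -expr2 enorm_sqr.
Qed.

Lemma vipC w w' : vip w w' = vip w' w.
Proof. by apply: eq_bigr => j _; rewrite ipC. Qed.

Lemma vip_ge0 w : 0 <= vip w w.
Proof. by apply: sumr_ge0 => j _; exact: ip_ge0. Qed.

Lemma vip_linl a w1 w2 w : in_L2v w1 -> in_L2v w2 -> in_L2v w ->
  vip (fun z => a *: w1 z + w2 z) w = a * vip w1 w + vip w2 w.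
Proof.
move=> L1 L2 L; rewrite /vip mulr_sumr -big_split; apply: eq_bigr => j _ /=.
rewrite -ip_linl //; congr ip; apply/funext => z; by rewrite !mxE.
Qed.

Lemma vip_ae w1 w1' w2 w2' : {ae mu, forall z, D z -> w1 z = w1' z} ->
  {ae mu, forall z, D z -> w2 z = w2' z} -> vip w1 w2 = vip w1' w2'.
Proof.
move=> h h'; apply: eq_bigr => j _; apply: ip_ae.
  by apply: filterS h => z hz Dz; rewrite hz.
by apply: filterS h' => z hz Dz; rewrite hz.
Qed.

Lemma vip_CS w w' : in_L2v w -> in_L2v w' -> `|vip w w'| <= Num.sqrt (vip w w) * Num.sqrt (vip w' w').
Proof.
move=> L L'; rewrite -!Rintegral_dotv //; apply: sqr_le_sqrt.
  by rewrite Rintegral_dotv // vip_ge0.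
apply: quad_CS => x y; rewrite !Rintegral_dotv //.
have Lx : in_L2v (fun z => y *: w' z + 0) by move=> j; under eq_fun do rewrite addr0 mxE; exact: in_L2Z.
have Lxy : in_L2v (fun z => x *: w z + (y *: w' z + 0)).
  by move=> j; under eq_fun do rewrite mxE [X in X + _]mxE; exact: in_L2_lin.
have L0 : in_L2v (fun=> 0) by move=> j; under eq_fun do rewrite mxE; exact: in_L2_0.
have := vip_ge0 (fun z => x *: w z + (y *: w' z + 0)).
have z0 v : in_L2v v -> vip (fun=> 0) v = 0.
  move=> Lv; have := vip_linl (-1) L0 L0 Lv.
  by under [X in vip X]eq_fun do rewrite scaler0 addr0; rewrite mulN1r addNr.
rewrite (vip_linl x L Lx Lxy) [vip w _]vipC (vip_linl x L Lx L) (vip_linl y L' L0 L).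
rewrite (vip_linl y L' L0 Lxy) (z0 _ Lxy) (z0 _ L) (vipC w' (fun z => x *: w z + (y *: w' z + 0))).
rewrite (vip_linl x L Lx L') (vip_linl y L' L0 L') (z0 _ L').
rewrite (vipC w' w); move: (vip w w) (vip w w') (vip w' w') => p q r.
by congr (0 <= _); ring.
Qed.

End vector_L2.

Lemma half_le (R : realFieldType) (e : R) : 0 < e -> e / 2 <= e.
Proof. by lra. Qed.

Lemma lin_lt (R : realFieldType) (c a b e1 e : R) : a < e1 -> b < e1 -> `|c| * e1 + e1 <= e ->
  `|c| * a + b < e.
Proof. by move=> h1 h2 h; apply: lt_le_trans h; rewrite ler_ltD // ler_wpM2l // ltW. Qed.

Lemma quad_rescale (R : fieldType) (p q r x y : R) : x != 0 ->
  x ^+ 2 * (p + 2 * (y / x) * q + (y / x) ^+ 2 * r) = x ^+ 2 * p + 2 * x * y * q + y ^+ 2 * r.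
Proof. by move=> x0; field. Qed.

Section H10.
Context (R : realType) (d : nat) (Omega : set 'rV[R]_d).
Hypotheses (oO : open Omega) (bO : bounded_set Omega).
Local Notation X := 'rV[R]_d.
Local Notation muX := (lebesgue_rV R d).
Local Notation L2X := (in_L2 muX Omega).
Implicit Types v w psi : X -> R.

Let mO : measurable Omega. Proof. exact: measurable_domain. Qed.
Let fO : (muX Omega < +oo)%E. Proof. exact: domain_fin. Qed.

Lemma test_L2 psi : test_fun Omega psi -> L2X psi.
Proof. exact: (test_fun_L2 (coordsV R d) mO fO). Qed.

Lemma is_d_lin j (c : R) v w g h : L2X v -> L2X w -> is_d Omega j v g -> is_d Omega j w h ->
  is_d Omega j (fun x => c * v x + w x) (fun x => c * g x + h x).
Proof.
move=> Lv Lw [Lg hg] [Lh hh]; split; first exact: in_L2_lin.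
move=> psi tp; have Lp := test_L2 tp; have Ldp := (is_d_test oO bO j tp).1.
rewrite -/(ip muX Omega (fun x => c * v x + w x) _) -/(ip muX Omega (fun x => c * g x + h x) _) !ip_linl //.
rewrite /ip hg // hh //; lra.
Qed.

Lemma grad_is_d v j : in_H1 Omega v -> is_d Omega j v (fun x => grad Omega v x ord0 j).
Proof.
move=> [_ /(_ j)[g hg]]; rewrite (_ : (fun x => _) = xget (cst 0) [set g | is_d Omega j v g]).
  by case: xgetP => // /(_ g).
by apply/funext => x; rewrite mxE.
Qed.

Lemma grad_L2 v : in_H1 Omega v -> in_L2v muX Omega (grad Omega v).
Proof. by move=> hv j; exact: (grad_is_d j hv).1. Qed.

Lemma grad_ae v (g : 'I_d -> X -> R) : (forall j, is_d Omega j v (g j)) ->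
  {ae muX, forall x, Omega x -> grad Omega v x = \row_j g j x}.
Proof.
move=> h; have hj j : {ae muX, forall x, Omega x -> grad Omega v x ord0 j = g j x}.
  have : is_d Omega j v (xget (cst 0) [set g | is_d Omega j v g]).
    by case: xgetP => // /(_ (g j)).
  by move=> /(is_d_unique oO bO)/(_ (h j)); apply: filterS => z hz Qz; rewrite mxE; exact: hz.
have : {ae muX, forall x, forall j, Omega x -> grad Omega v x ord0 j = g j x}.
  by apply: filter_forall => j.
by apply: filterS => x hx Ox; apply/rowP => j; rewrite hx // mxE.
Qed.

Lemma in_H1_lin (c : R) v w : in_H1 Omega v -> in_H1 Omega w -> in_H1 Omega (fun x => c * v x + w x).
Proof.
move=> hv hw; split; first by apply: in_L2_lin => //; [exact: hv.1|exact: hw.1].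
by move=> j; eexists; apply: is_d_lin (grad_is_d j hv) (grad_is_d j hw); [exact: hv.1|exact: hw.1].
Qed.

Lemma grad_lin (c : R) v w : in_H1 Omega v -> in_H1 Omega w ->
  {ae muX, forall x, Omega x -> grad Omega (fun x => c * v x + w x) x = c *: grad Omega v x + grad Omega w x}.
Proof.
move=> hv hw.
have h j := is_d_lin c hv.1 hw.1 (grad_is_d j hv) (grad_is_d j hw).
by apply: filterS (grad_ae h) => x hx Ox; rewrite hx //; apply/rowP => j; rewrite !mxE.
Qed.

Lemma test_H1 psi : test_fun Omega psi -> in_H1 Omega psi.
Proof. by move=> tp; split; [exact: test_L2|move=> j; eexists; exact: is_d_test]. Qed.

Definition aform v w := vip muX Omega (grad Omega v) (grad Omega w).

Definition gnorm v := Num.sqrt (aform v v).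

Lemma aformC v w : aform v w = aform w v. Proof. exact: vipC. Qed.

Lemma aform_lin (c : R) v w u : in_H1 Omega v -> in_H1 Omega w -> in_H1 Omega u ->
  aform (fun x => c * v x + w x) u = c * aform v u + aform w u.
Proof.
move=> hv hw hu; rewrite /aform -vip_linl //; try exact: grad_L2.
by apply: vip_ae; [exact: grad_lin|exact: aeW].
Qed.

Lemma aform_ge0 v : 0 <= aform v v. Proof. exact: vip_ge0. Qed.

Lemma gnorm_ge0 v : 0 <= gnorm v. Proof. exact: sqrtr_ge0. Qed.

Lemma gnorm_sqr v : gnorm v ^+ 2 = aform v v. Proof. by rewrite sqr_sqrtr // aform_ge0. Qed.

Lemma normX_grad v : in_H1 Omega v -> normX_vec Omega (grad Omega v) = (gnorm v)%:E.
Proof. by move=> hv; apply: L2norm_enorm => //; exact: grad_L2. Qed.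

Lemma aform_CS v w : in_H1 Omega v -> in_H1 Omega w -> `|aform v w| <= gnorm v * gnorm w.
Proof. by move=> hv hw; apply: vip_CS => //; exact: grad_L2. Qed.

Lemma aform_linr (c : R) v w u : in_H1 Omega v -> in_H1 Omega w -> in_H1 Omega u ->
  aform u (fun x => c * v x + w x) = c * aform u v + aform u w.
Proof. by move=> hv hw hu; rewrite aformC (aform_lin c hv hw hu) (aformC u v) (aformC u w). Qed.

Lemma aform_lin2 (c : R) v w : in_H1 Omega v -> in_H1 Omega w ->
  aform (fun x => c * v x + w x) (fun x => c * v x + w x) =
  c ^+ 2 * aform v v + 2 * c * aform v w + aform w w.
Proof.
move=> hv hw; have hs := in_H1_lin c hv hw.
rewrite (aform_lin c hv hw hs) (aform_linr c hv hw hv) (aform_linr c hv hw hw) (aformC w v).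
move: (aform v v) (aform v w) (aform w w) => p q r; ring.
Qed.

Lemma gnorm_lin (c : R) v w : in_H1 Omega v -> in_H1 Omega w ->
  gnorm (fun x => c * v x + w x) <= `|c| * gnorm v + gnorm w.
Proof.
move=> hv hw; have h := aform_CS hv hw; have hA := gnorm_sqr v; have hB := gnorm_sqr w.
rewrite -ler_sqr ?nnegrE ?addr_ge0 ?mulr_ge0 ?gnorm_ge0 // gnorm_sqr (aform_lin2 c hv hw) -hA -hB.
move: (aform v w) (gnorm v) (gnorm w) h => q A B h {hA hB}.
rewrite sqrrD exprMn real_normK ?num_real // lerD2r lerD2l -mulrA mulr_natl lerMn2r /=.
by apply: le_trans (ler_norm _) _; rewrite normrM -mulrA ler_wpM2l.
Qed.

Lemma test_fun_lin (c : R) psi1 psi2 : test_fun Omega psi1 -> test_fun Omega psi2 ->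
  test_fun Omega (fun x => c * psi1 x + psi2 x).
Proof.
move=> [s1 c1 o1] [s2 c2 o2].
have hs : closure [set x | c * psi1 x + psi2 x != 0] `<=` closure [set x | psi1 x != 0] `|` closure [set x | psi2 x != 0].
  rewrite -closureU; apply: closure_subset => x /=; apply: contraNP => /not_orP[/negP/negPn/eqP -> /negP/negPn/eqP ->].
  by rewrite mulr0 addr0.
split.
- by apply: smooth_add => //; apply: smooth_mul => //; exact: smooth_cst.
- by apply: (subclosed_compact _ (compactU c1 c2) hs); exact: closed_closure.
- by move=> x /hs[/o1|/o2].
Qed.

Lemma in_H10_H1 v : in_H10 Omega v -> in_H1 Omega v. Proof. by case. Qed.

Lemma L2normE_real v : L2X v -> normX Omega v = (Num.sqrt (ip muX Omega v v))%:E.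
Proof. by move=> Lv; exact: L2normK. Qed.

Lemma in_H10P v : in_H10 Omega v <-> in_H1 Omega v /\ forall eps : R, 0 < eps -> exists psi,
  [/\ test_fun Omega psi, Num.sqrt (ip muX Omega (v \- psi) (v \- psi)) < eps & gnorm (v \- psi) < eps].
Proof.
have hB psi : in_H1 Omega v -> test_fun Omega psi -> in_H1 Omega (v \- psi).
  move=> hv tp; have := in_H1_lin (-1) (test_H1 tp) hv.
  by congr in_H1; apply/funext => x /=; rewrite mulN1r addrC.
split=> -[hv h]; split=> // eps e0; have [psi [tp h1 h2]] := h eps e0; exists psi; split=> //.
- by move: h1; rewrite L2normE_real ?lte_fin //; exact: (hB _ hv tp).1.
- by move: h2; rewrite normX_grad ?lte_fin //; exact: hB.
- by rewrite L2normE_real ?lte_fin //; exact: (hB _ hv tp).1.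
- by rewrite normX_grad ?lte_fin //; exact: hB.
Qed.

Lemma in_H10_test psi : test_fun Omega psi -> in_H10 Omega psi.
Proof.
move=> tp; apply/in_H10P; split; first exact: test_H1.
move=> eps e0; exists psi; split=> //.
  rewrite (_ : psi \- psi = fun=> 0); last by apply/funext => x /=; rewrite subrr.
  by rewrite /ip; under eq_Rintegral do rewrite mul0r; rewrite /Rintegral integral0 sqrtr0.
rewrite (_ : psi \- psi = fun x => -1 * psi x + psi x); last by apply/funext => x /=; rewrite mulN1r addrC.
rewrite /gnorm (aform_lin2 _ (test_H1 tp) (test_H1 tp)).
by rewrite (_ : _ + _ = 0) ?sqrtr0 //; ring.
Qed.

Lemma L2dist_lin (c : R) v w : L2X v -> L2X w -> Num.sqrt (ip muX Omega (fun x => c * v x + w x) (fun x => c * v x + w x)) <=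
  `|c| * Num.sqrt (ip muX Omega v v) + Num.sqrt (ip muX Omega w w).
Proof.
move=> Lv Lw; have Ls := in_L2_lin mO c Lv Lw.
rewrite -ler_sqr ?nnegrE ?addr_ge0 ?mulr_ge0 ?sqrtr_ge0 //.
rewrite sqrrD exprMn !sqr_sqrtr ?ip_ge0 // real_normK ?num_real //.
rewrite (ip_linl mO c Lv Lw Ls) (ip_linr mO c Lv Lw Lv) (ip_linr mO c Lv Lw Lw).
have h : c * ip muX Omega v w <= `|c| * (Num.sqrt (ip muX Omega v v) * Num.sqrt (ip muX Omega w w)).
  apply: le_trans (ler_norm _) _; rewrite normrM ler_wpM2l //; exact: ip_CS.
by rewrite [ip muX Omega w v]ipC mulr2n; move: h; lra.
Qed.

Lemma in_H10_lin (c : R) v w : in_H10 Omega v -> in_H10 Omega w -> in_H10 Omega (fun x => c * v x + w x).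
Proof.
move=> /in_H10P[hv av] /in_H10P[hw aw]; apply/in_H10P; split; first exact: in_H1_lin.
move=> eps e0; pose e1 := eps / (`|c| + 1) / 2.
have c0 : 0 < `|c| + 1 by rewrite ltr_wpDl.
have e10 : 0 < e1 by rewrite !divr_gt0.
have [p1 [tp1 h1 h1']] := av _ e10; have [p2 [tp2 h2 h2']] := aw _ e10.
have E : (fun x => c * v x + w x) \- (fun x => c * p1 x + p2 x) = fun x => c * (v \- p1) x + (w \- p2) x.
  by apply/funext => x /=; ring.
have hB u p : in_H1 Omega u -> test_fun Omega p -> in_H1 Omega (u \- p).
  move=> hu tp; have := in_H1_lin (-1) (test_H1 tp) hu.
  by congr in_H1; apply/funext => x /=; rewrite mulN1r addrC.
have ee : `|c| * e1 + e1 <= eps.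
  have -> : `|c| * e1 + e1 = eps / 2 by rewrite /e1; field; rewrite gt_eqF.
  exact: half_le.
exists (fun x => c * p1 x + p2 x); split; first exact: test_fun_lin.
  rewrite E; apply: le_lt_trans (L2dist_lin _ (hB _ _ hv tp1).1 (hB _ _ hw tp2).1) _.
  exact: (lin_lt h1 h2 ee).
rewrite E; apply: le_lt_trans (gnorm_lin _ (hB _ _ hv tp1) (hB _ _ hw tp2)) _.
exact: (lin_lt h1' h2' ee).
Qed.

Lemma in_H10_Z (c : R) v : in_H10 Omega v -> in_H10 Omega (fun x => c * v x).
Proof.
move=> hv; have := in_H10_lin (c - 1) hv hv.
by congr in_H10; apply/funext => x; ring.
Qed.

Lemma in_H10_B v w : in_H10 Omega v -> in_H10 Omega w -> in_H10 Omega (v \- w).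
Proof.
move=> hv hw; have := in_H10_lin (-1) hw hv.
by congr in_H10; apply/funext => x /=; ring.
Qed.

Section poincare.
Variables (CP : R) (hCP : poincare_constant Omega CP).

Lemma poincare v : in_H10 Omega v -> Num.sqrt (ip muX Omega v v) <= (CP * diam Omega) * gnorm v.
Proof.
move=> hv; have := hCP.2 v hv; have hv1 := in_H10_H1 hv.
by rewrite (normX_grad hv1) (L2normE_real hv1.1) -EFinM lee_fin.
Qed.

Lemma diam_ge0 : 0 <= diam Omega.
Proof.
rewrite /diam; set S := [set _ | _ in _].
have [hs|hs] := pselect (has_sup S); last by rewrite sup_out.
have [[r Sr] ub] := hs; have r0 : 0 <= r by case: Sr => p _ <-; exact: sqrtr_ge0.
by apply: le_trans r0 _; exact: ub_le_sup.
Qed.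

Lemma CPh_ge0 : 0 <= CP * diam Omega.
Proof. by rewrite mulr_ge0 ?diam_ge0 // ltW // hCP.1. Qed.

End poincare.

(* The quadratic form [N^2 y^2 + 2 y g(psi) + a(psi, psi)], evaluated at
   [psi = y v + x phi], is at least [(N y - |psi|)^2 >= 0]; its discriminant is the claim. *)
Lemma hilbert_ineq (g : (X -> R) -> R) (N : R) v phi :
  (forall (c : R) v w, in_H10 Omega v -> in_H10 Omega w -> g (fun x => c * v x + w x) = c * g v + g w) ->
  (forall v, in_H10 Omega v -> `|g v| <= N * gnorm v) ->
  in_H10 Omega v -> in_H10 Omega phi ->
  (g phi + aform v phi) ^+ 2 <= (N ^+ 2 + 2 * g v + aform v v) * aform phi phi.
Proof.
move=> gl gN hv hp.
have h l : 0 <= (N ^+ 2 + 2 * g v + aform v v) + 2 * l * (g phi + aform v phi) + l ^+ 2 * aform phi phi.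
  have hs := in_H10_lin l hp hv.
  have h1 := gN _ hs; have h2 := gnorm_sqr (fun x => l * phi x + v x).
  have h3 : 0 <= (N - gnorm (fun x => l * phi x + v x)) ^+ 2 by exact: sqr_ge0.
  move: h1; rewrite ler_norml => /andP[h1 _]; move: h1 h2 h3.
  rewrite (aform_lin2 _ (in_H10_H1 hp) (in_H10_H1 hv)) (gl _ _ _ hp hv) (aformC phi v); set G := gnorm _ => h1 h2 h3.
  have h4 : (N - G) ^+ 2 = N ^+ 2 - 2 * (N * G) + G ^+ 2 by ring.
  move: h1 h3; rewrite h4 h2; clear.
  move: (aform phi phi) (aform v phi) (aform v v) (g phi) (g v) (N * G) => p q r s t m; lra.
apply: quad_CS => x y; have [->|x0] := eqVneq x 0.
  by rewrite expr0n /= !mul0r mulr0 !mul0r !add0r mulr_ge0 ?sqr_ge0 ?aform_ge0.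
have := mulr_ge0 (sqr_ge0 x) (h (y / x)); congr (0 <= _).
exact: quad_rescale.
Qed.

End H10.

(** * A countable family of test functions dense in H10 *)

Section separability.
Context (R : realType) (d : nat) (Omega : set 'rV[R]_d).
Hypotheses (oO : open Omega) (bO : bounded_set Omega).
Local Notation X := 'rV[R]_d.
Local Notation muX := (lebesgue_rV R d).

Let mO : measurable Omega. Proof. exact: measurable_domain. Qed.
Let fO : (muX Omega < +oo)%E. Proof. exact: domain_fin. Qed.

Lemma test_fun_derive (V : normedModType R) (O : set V) e psi : test_fun O psi -> test_fun O (fun x => 'D_e psi x).
Proof.
move=> tp; have [sp cS SO] := tp.
have h : closure [set x | 'D_e psi x != 0] `<=` closure [set x | psi x != 0].
  rewrite [X in _ `<=` X](closure_id _).1; last exact: closed_closure.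
  apply: closure_subset => x /=; apply: contraNP => nx; apply/eqP.
  exact: (derive_test_out e tp).
split; first exact: smooth_derive.
- by apply: (subclosed_compact _ cS h); exact: closed_closure.
- exact: subset_trans SO.
Qed.

Lemma test_fun_lipschitz (O : set X) psi : test_fun O psi ->
  exists2 C : R, 0 <= C & forall x y, `|psi x - psi y| <= C * `|x - y|.
Proof.
move=> tp; have [sp _ _] := tp.
have /choice[Ci hCi] : forall i, exists C : R, forall x, `|'D_(e_ R i) psi x| <= C.
  by move=> i; exact: (derive_test_bounded (e_ R i) tp).
have Ci0 i : 0 <= Ci i by apply: le_trans (hCi i 0).
exists (\sum_i Ci i) => [|x y]; first exact: sumr_ge0.
have hD z : `|'D_(x - y) psi z| <= (\sum_i Ci i) * `|x - y|.
  have -> : x - y = \sum_i (x - y) ord0 i *: e_ R i by rewrite {1}(row_sum_delta (x - y)).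
  rewrite deriveE; last exact: smooth_diff.
  rewrite linear_sum -(row_sum_delta (x - y)) mulr_suml.
  apply: le_trans (ler_norm_sum _ _ _) _; apply: ler_sum => i _.
  rewrite linearZ /= normrM mulrC -deriveE; last exact: smooth_diff.
  apply: ler_pM => //; rewrite leNgt; apply/negP => h.
  have h0 : 0 < `|(x - y) ord0 i| by apply: le_lt_trans h.
  by have := (norm_rV_lt (x - y) h0).1 h i; rewrite ltxx.
by have := smooth_lipschitz_dir sp hD y 1; rewrite scale1r (addrC y) subrK normr1 mulr1.
Qed.

(** [Omega] has finite measure, so separability in the gradient norm reduces to uniform
    approximation of the derivatives. *)
Lemma gnorm_test_le (p q : X -> R) (del : R) : 0 <= del -> test_fun Omega p -> test_fun Omega q ->
  (forall x j, Omega x -> `|'D_(e_ R j) p x - 'D_(e_ R j) q x| <= del) ->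
  gnorm Omega (p \- q) <= del * Num.sqrt (d%:R * fine (muX Omega)).
Proof.
move=> d0 tp tq h.
rewrite (_ : p \- q = fun x => -1 * q x + p x); last by apply/funext => x /=; rewrite mulN1r addrC.
have hd j := is_d_lin oO bO (-1) (test_L2 oO bO tq) (test_L2 oO bO tp) (is_d_test oO bO j tq) (is_d_test oO bO j tp).
have m0 : 0 <= fine (muX Omega) by exact: fine_ge0.
rewrite -[del](ger0_norm d0) -(sqrtr_sqr del) -sqrtrM ?sqr_ge0 //; apply: ler_wsqrtr.
rewrite /aform (vip_ae (grad_ae oO bO hd) (grad_ae oO bO hd)) /vip.
rewrite mulrCA mulr_natl -[d in _ *+ d](card_ord d) -sumr_const; apply: ler_sum => j _.
have L := (hd j).1; under [X in ip _ _ X _]eq_fun do rewrite mxE.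
under [X in ip _ _ _ X]eq_fun do rewrite mxE.
rewrite /ip; apply: (@le_trans _ _ (\int[muX]_(x in Omega) (del ^+ 2))); last first.
  by rewrite /Rintegral integral_cst // fineM // ge0_fin_numE.
apply: le_Rintegral => //.
- exact: in_L2_integrableM.
- by apply: (in_L2_integrable mO fO); apply: (in_L2_bounded mO (C := del ^+ 2)) => // x _; rewrite ger0_norm ?sqr_ge0.
- move=> x Ox; rewrite -expr2 -real_normK ?num_real // ler_sqr ?nnegrE //.
  by rewrite mulN1r addrC h.
Qed.

Lemma test_fun0 : test_fun Omega (fun _ : X => 0 : R).
Proof.
have E : [set x : X | (0 : R) != 0] = set0 by apply/seteqP; split => x //=; rewrite eqxx.
by split; [exact: smooth_cst|rewrite E closure0; exact: compact0|rewrite E closure0].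
Qed.

(* Up to [1 / n], a gradient is constant on the cells of a fine grid, with values in
   [Z^d / n]; such step functions form a countable set, and one test function is
   selected for each of them. *)
Lemma H10_separable : exists psi_ : nat -> X -> R, (forall k, test_fun Omega (psi_ k)) /\
  forall v, in_H10 Omega v -> forall eps : R, 0 < eps -> exists k, gnorm Omega (v \- psi_ k) < eps.
Proof.
have [N N0 hN] := bounded_boxrV bO.
(* The grid cube of [x] in [[-N, N]^d], with [k + 1] cubes in each direction. *)
pose cell k (x : X) : {ffun 'I_d -> 'I_k.+1} :=
  [ffun j => inord (Num.truncn ((x ord0 j + N) / (2 * N) * k.+1%:R))].
(* A code consists of the fineness [k], an integer vector for each grid cube, and the resolution [n]
   of the values. *)
pose code := ({k : nat & {ffun {ffun 'I_d -> 'I_k.+1} -> {ffun 'I_d -> int}}} * nat)%type.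
pose P (c : code) (psi : X -> R) := forall x j, Omega x ->
  `|'D_(e_ R j) psi x - (tagged c.1 (cell (tag c.1) x) j)%:~R / c.2.+1%:R| <= 2 / c.2.+1%:R.
pose pick (c : code) : X -> R := xget (fun=> 0) [set psi | test_fun Omega psi /\ P c psi].
have tpick c : test_fun Omega (pick c).
  by rewrite /pick; case: xgetP => [x _ []|_] //; exact: test_fun0.
exists (fun k => if unpickle k is Some c then pick c else fun=> 0); split.
  by move=> k; case: unpickle => [c|]; [exact: tpick|exact: test_fun0].
move=> v hv eps e0; have hv1 := in_H10_H1 hv.
have [_ /(_ (eps / 2))] := (in_H10P oO bO v).1 hv; rewrite divr_gt0 // => /(_ isT)[psi [tp _ vp]].
pose K := Num.sqrt (d%:R * fine (muX Omega)); have K0 : 0 <= K by exact: sqrtr_ge0.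
(* Two functions with the same code have partial derivatives that differ by at most twice
   [2/(n + 1)]. *)
have [n hn] : exists n : nat, 4 / n.+1%:R * K < eps / 2.
  exists (Num.bound (8 * K / eps)); set b := Num.bound _.
  have hb : 8 * K / eps < b%:R by apply: archi_boundP; rewrite divr_ge0 ?mulr_ge0 // ltW.
  have b1 : b%:R < b.+1%:R :> R by rewrite ltr_nat.
  rewrite mulrAC ltr_pdivrMr // mulrAC ltr_pdivlMr //.
  have := lt_trans hb b1; rewrite ltr_pdivrMr //; lra.
have /choice[CL hCL] : forall j, exists C : R, 0 <= C /\
    forall x y, `|'D_(e_ R j) psi x - 'D_(e_ R j) psi y| <= C * `|x - y|.
  by move=> j; have [C C0 hC] := test_fun_lipschitz (test_fun_derive (e_ R j) tp); exists C.
pose C := \sum_j CL j; have C0 : 0 <= C by apply: sumr_ge0 => j _; case: (hCL j).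
have hC j x y : `|'D_(e_ R j) psi x - 'D_(e_ R j) psi y| <= C * `|x - y|.
  apply: le_trans ((hCL j).2 x y) _; rewrite ler_wpM2r // /C (bigD1 j) //= lerDl.
  by apply: sumr_ge0 => i _; case: (hCL i).
have [k hk] : exists k : nat, C * (2 * N / k.+1%:R) <= 1 / n.+1%:R.
  exists (Num.bound (C * 2 * N * n.+1%:R)); set b := Num.bound _.
  have hb : C * 2 * N * n.+1%:R < b%:R by apply: archi_boundP; rewrite !mulr_ge0 // ltW.
  have b1 : b%:R < b.+1%:R :> R by rewrite ltr_nat.
  by rewrite mulrA ler_pdivrMr // mulrAC ler_pdivlMr // mul1r mulrA ltW // (lt_trans hb b1).
have hcell x y : Omega x -> Omega y -> cell k x = cell k y -> `|x - y| < 2 * N / k.+1%:R.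
  move=> Ox Oy xy; apply/norm_rV_lt => [|j]; first by rewrite divr_gt0 // mulr_gt0.
  have := congr1 (fun f : {ffun 'I_d -> 'I_k.+1} => val (f j)) xy; rewrite !ffunE /=.
  have hz z : Omega z -> 0 <= (z ord0 j + N) / (2 * N) * k.+1%:R < k.+1%:R.
    move=> /hN/(_ j)/andP[z1 z2].
    rewrite mulr_ge0 ?divr_ge0 //=; [|lra|lra].
    rewrite gtr_pMl ?ltr0n // ltr_pdivrMr ?mulr_gt0 //; lra.
  have h z : Omega z -> (Num.truncn ((z ord0 j + N) / (2 * N) * k.+1%:R) < k.+1)%N.
    move=> /hz /andP[z0 z1]; rewrite -(ltr_nat R); apply: le_lt_trans z1.
    by have /andP[] := truncn_itv z0.
  rewrite !inordK ?h // => E.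
  have /andP[x0 _] := hz x Ox; have /andP[y0 _] := hz y Oy.
  have /andP[x1 x2] := truncn_itv x0; have /andP[y1 y2] := truncn_itv y0.
  rewrite E in x1 x2; rewrite !mxE.
  have k0 : 0 < k.+1%:R :> R by rewrite ltr0n.
  have N2 : 0 < 2 * N by rewrite mulr_gt0.
  have E2 : x ord0 j - y ord0 j = ((x ord0 j + N) / (2 * N) * k.+1%:R - (y ord0 j + N) / (2 * N) * k.+1%:R) * (2 * N / k.+1%:R).
    by field; rewrite ?gt_eqF // ?lt0r_neq0 // ?pnatr_eq0.
  have hp : 0 < 2 * N / k.+1%:R by rewrite divr_gt0.
  rewrite E2 normrM [X in _ * X]gtr0_norm // gtr_pMl //; clear E2.
  move: (_ * _) (_ * k.+1%:R) x1 x2 y1 y2 => A B; rewrite -natr1; move: (_%:R) => t x1 x2 y1 y2.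
  by rewrite ltr_norml; apply/andP; split; lra.
pose rep (c : {ffun 'I_d -> 'I_k.+1}) : X := xget 0 [set x | Omega x /\ cell k x = c].
pose f : {ffun {ffun 'I_d -> 'I_k.+1} -> {ffun 'I_d -> int}} :=
  [ffun c => [ffun j => Num.floor (n.+1%:R * 'D_(e_ R j) psi (rep c))]].
pose c : code := (Tagged (fun k => {ffun {ffun 'I_d -> 'I_k.+1} -> {ffun 'I_d -> int}}) f, n).
have Pc : P c psi.
  move=> x j Ox; rewrite /c /= !ffunE.
  have [Or cr] : Omega (rep (cell k x)) /\ cell k (rep (cell k x)) = cell k x.
    by rewrite /rep; case: xgetP => [y _ //|/(_ x)]; case.
  set y := rep _ in Or cr *.
  have n0 : 0 < n.+1%:R :> R by rewrite ltr0n.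
  have h1 : `|'D_(e_ R j) psi x - 'D_(e_ R j) psi y| <= 1 / n.+1%:R.
    apply: le_trans (hC j x y) _; apply: le_trans hk; rewrite ler_wpM2l //.
    by apply/ltW/hcell.
  set g := 'D_(e_ R j) psi y in h1 *.
  have h2 : `|g - (Num.floor (n.+1%:R * g))%:~R / n.+1%:R| <= 1 / n.+1%:R.
    have /andP[f1 f2] := floor_itv (n.+1%:R * g); rewrite intrD in f2.
    rewrite -(ler_pM2r n0) mulfVK ?gt_eqF // -[X in _ * X](gtr0_norm n0) -normrM mulrBl mulfVK ?gt_eqF //.
    rewrite ger0_norm mulrC ?subr_ge0 //; lra.
  have -> : 2 / n.+1%:R = 1 / n.+1%:R + 1 / n.+1%:R :> R by rewrite -mulrDl.
  by have := ler_normD ('D_(e_ R j) psi x - g) (g - (Num.floor (n.+1%:R * g))%:~R / n.+1%:R);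
     rewrite addrA subrK => /le_trans; apply; exact: lerD.
have Pp : P c (pick c) by rewrite /pick; case: xgetP => [x _ []|/(_ psi)] //; case.
exists (pickle c); rewrite pickleK.
have hg : gnorm Omega (psi \- pick c) < eps / 2.
  apply: le_lt_trans hn; apply: gnorm_test_le => //.
  move=> x j Ox; have := Pc x j Ox; have := Pp x j Ox; rewrite /c /=.
  set a := 2 / _; move: ('D_(e_ R j) psi x) ('D_(e_ R j) _ x) => p q.
  rewrite !ler_norml => /andP[q1 q2] /andP[p1 p2].
  have -> : 4 / n.+1%:R = 2 / n.+1%:R + 2 / n.+1%:R :> R by rewrite -mulrDl -natrD.
  rewrite -/a; move: a (_ / n.+1%:R) p1 p2 q1 q2 => a r p1 p2 q1 q2.
  by apply/andP; split; lra.
have hB u q : in_H1 Omega u -> test_fun Omega q -> in_H1 Omega (u \- q).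
  move=> hu tq; have := in_H1_lin oO bO (-1) (test_H1 oO bO tq) hu.
  by congr in_H1; apply/funext => x /=; rewrite mulN1r addrC.
have -> : v \- pick c = fun x => 1 * (v \- psi) x + (psi \- pick c) x by apply/funext => x /=; ring.
apply: le_lt_trans (gnorm_lin oO bO 1 (hB _ _ hv1 tp) (hB _ _ (test_H1 oO bO tp) (tpick c))) _.
apply: (lin_lt vp hg); by rewrite normr1 mul1r -splitr.
Qed.

End separability.

(** * Smooth quasi-interpolation on a uniform grid *)

Section quasi_interpolation.
Context (R : realType).

Definition ramp (x : R) : R := x * step x.

(** The second difference of a smoothed positive part. As for the usual hats, sums of integer
    translates telescope, which gives the partition of unity and the reproduction of affine
    functions; unlike them, [hatf] is smooth. *)
Definition hatf (x : R) : R := ramp (x + 1) - 2 * ramp x + ramp (x - 1).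

Lemma ramp_le0 x : x <= 0 -> ramp x = 0.
Proof. by move=> x0; rewrite /ramp step_le0 ?mulr0. Qed.

Lemma ramp_ge1 x : 1 <= x -> ramp x = x.
Proof. by move=> x1; rewrite /ramp step_ge1 ?mulr1. Qed.

Lemma hatf_out x : x <= -1 \/ 2 <= x -> hatf x = 0.
Proof.
by rewrite /hatf => -[h|h]; [rewrite !ramp_le0 ?mulr0 ?subr0 ?addr0 //; lra|rewrite !ramp_ge1; lra].
Qed.

Lemma smooth_hatf : smooth hatf.
Proof.
have sr : smooth ramp by apply: smooth_mul; [exact: smooth_id|exact: smooth_step].
have st c : smooth (fun x => ramp (x + c)).
  exact: (@smooth_comp_affine R R R (idfun : {linear R -> R}) c ramp (fun x => cvg_id) sr).
rewrite (_ : hatf = fun x => ramp (x + 1) + ((-2) * ramp x + ramp (x + (- 1)))).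
  by apply: smooth_add => //; apply: smooth_add => //; apply: smooth_mul => //; exact: smooth_cst.
by apply/funext => x; rewrite /hatf; ring.
Qed.

Lemma hatf_bound : exists2 B : R, 0 <= B & (forall x, `|hatf x| <= B) /\
  forall x h, `|hatf (x + h) - hatf x| <= B * `|h|.
Proof.
have cS : compact (`[-1, 2]%classic : set R) by exact: segment_compact.
have out (x : R) : ~ `[-1, 2]%classic x -> x < -1 \/ 2 < x.
  by rewrite /= in_itv /= => /negP; rewrite negb_and -!ltNge => /orP[]; [left|right].
have [C1 h1] : exists C, forall x, `|hatf x| <= C.
  apply: (compact_supp_bounded cS); first exact: (smooth_continuous smooth_hatf).
  by move=> x /out h; apply: hatf_out; case: h => /ltW; [left|right].
have sd : smooth (fun x : R => 'D_1 hatf x) by apply: smooth_derive; exact: smooth_hatf.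
have [C2 h2] : exists C, forall x : R, `|'D_1 hatf x| <= C.
  apply: (compact_supp_bounded cS); first exact: (smooth_continuous sd).
  move=> x /out h; rewrite -[RHS](derive_cst (0 : R) x 1); apply: near_eq_derive.
  case: h => h; near=> y; apply: hatf_out; [left|right]; apply/ltW; near: y; [exact: lt_nbhsl|exact: lt_nbhsr].
have C10 : 0 <= C1 by apply: le_trans (h1 0).
have C20 : 0 <= C2 by apply: le_trans (h2 0).
exists (C1 + C2); first exact: addr_ge0.
split=> [x|x h]; first by apply: le_trans (h1 x) _; rewrite lerDl.
have := smooth_lipschitz_dir smooth_hatf h2 x h; rewrite [h *: 1]mulr1 => /le_trans; apply.
by rewrite ler_wpM2r // lerDr.
Unshelve. all: by end_near. Qed.

Lemma sum_hatf m (y : R) : 1 <= y -> y <= m%:R - 1 -> \sum_(k < m) hatf (y - k%:R) = 1.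
Proof.
move=> y1 ym.
have h n : \sum_(k < n) hatf (y - k%:R) =
    (ramp (y + 1) - ramp y) - (ramp (y - n%:R + 1) - ramp (y - n%:R)).
  elim: n => [|n ih]; first by rewrite big_ord0 subr0 subrr.
  rewrite big_ord_recr /= ih /hatf -[n.+1%:R]natr1 (_ : y - (n%:R + 1) + 1 = y - n%:R); last by ring.
  rewrite (_ : y - (n%:R + 1) = y - n%:R - 1); ring.
rewrite h (@ramp_ge1 (y + 1)); last lra.
rewrite (@ramp_ge1 y) // (@ramp_le0 (y - m%:R + 1)); last lra.
rewrite (@ramp_le0 (y - m%:R)); lra.
Qed.

Lemma sum_hatf1 m (y : R) : 1 <= y -> y <= m%:R - 1 -> \sum_(k < m) k%:R * hatf (y - k%:R) = y.
Proof.
move=> y1 ym.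
have h n : \sum_(k < n) k%:R * hatf (y - k%:R) =
    ramp y - ramp (y - n%:R) - n%:R * (ramp (y - n%:R + 1) - ramp (y - n%:R)).
  elim: n => [|n ih]; first by rewrite big_ord0 subr0 subrr mul0r subrr.
  rewrite big_ord_recr /= ih /hatf -[n.+1%:R]natr1 (_ : y - (n%:R + 1) + 1 = y - n%:R); last by ring.
  rewrite (_ : y - (n%:R + 1) = y - n%:R - 1); ring.
rewrite h (@ramp_ge1 y) // (@ramp_le0 (y - m%:R + 1)); last lra.
rewrite (@ramp_le0 (y - m%:R)); lra.
Qed.

(** A cut-off that dominates [hatf], up to a constant, together with its translates by at most one;
    the width 4 leaves room for both. *)
Definition near4 (z : R) : R := (`|z| < 4)%R%:R.

(** Bounded overlap: only boundedly many integers lie within 4 of [y]. The bound does not depend on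
    the size of the grid, so the estimates below do not degenerate as it is refined. *)
Lemma sum_near4 m (y : R) : \sum_(k < m) near4 (y - k%:R) <= 9.
Proof.
have key (a n : nat) : (\sum_(k < n) (a <= k < a + 9) <= 9)%N.
  have E : (\sum_(k < n) (a <= k < a + 9) = minn n (a + 9) - minn n a)%N.
    elim: n => [|n ih]; first by rewrite big_ord0 !min0n.
    rewrite big_ord_recr /= ih; case: (leqP a n) => an; case: (ltnP n (a + 9)) => na /=; lia.
  by rewrite E; lia.
have [[k0 k0P]|nk] := pselect (exists k : nat, `|y - k%:R| < 4); last first.
  rewrite big1 // => k _; rewrite /near4; case: ltP => // h; exfalso; apply: nk; by exists k.
have ex : exists k : nat, `|y - k%:R| < 4 by exists k0.
have [a aP amin] := ex_minnP ex.
apply: (@le_trans _ _ (\sum_(k < m) (a <= k < a + 9)%N)%:R); last by rewrite (ler_nat R _ 9) key.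
rewrite natr_sum; apply: ler_sum => k _; rewrite /near4; case: ltP => h /=; last by rewrite ler0n.
suff -> : (a <= k < a + 9)%N by [].
rewrite amin //= -(ltr_nat R) natrD; move: h aP; rewrite !ltr_norml => /andP[h1 h2] /andP[h3 h4].
by move: h1 h2 h3 h4; move: (k%:R) (a%:R) => p q; lra.
Qed.

Lemma near4_ge0 z : 0 <= near4 z. Proof. by rewrite /near4; case: (_ < _). Qed.

Variables (d : nat) (del : R) (n0 : nat).
Hypothesis del0 : 0 < del.
Local Notation X := 'rV[R]_d.
Local Notation m := (2 * n0)%N.
Local Notation index := {ffun 'I_d -> 'I_(2 * n0)}.

Definition gridy (x : X) (j : 'I_d) : R := x ord0 j / del + n0%:R.

Definition node (k : index) : X := \row_j (del * ((k j)%:R - n0%:R)).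

Definition wgt (k : index) (x : X) : R := \prod_j hatf (gridy x j - (k j)%:R).

Definition wnear (k : index) (x : X) : R := \prod_j near4 (gridy x j - (k j)%:R).

(** Points far enough from the rim of the grid that every translate entering the telescoping sums is
    present. *)
Definition good (x : X) := forall j, 1 <= gridy x j <= m%:R - 1.

Lemma gridy_sub x (k : index) j : gridy x j - (k j)%:R = (x - node k) ord0 j / del.
Proof. by rewrite /gridy !mxE; field; rewrite gt_eqF. Qed.

Lemma wgt_near k x : wgt k x != 0 -> `|x - node k| < 2 * del.
Proof.
move=> h; apply/norm_rV_lt => [|j]; first by rewrite mulr_gt0.
have hj : hatf (gridy x j - (k j)%:R) != 0.
  by apply: contraNneq h => h; rewrite /wgt (bigD1 j) //= h mul0r.
have h1 : -1 < gridy x j - (k j)%:R < 2.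
  rewrite ltNge [_ < 2]ltNge -negb_or; apply: contra hj => /orP hj; apply/eqP/hatf_out.
  by case: hj; [left|right].
have -> : (x - node k) ord0 j = (gridy x j - (k j)%:R) * del by rewrite gridy_sub mulfVK // gt_eqF.
rewrite normrM (gtr0_norm del0) ltr_pM2r // ltr_norml; move: h1 => /andP[]; lra.
Qed.

Lemma wnear_near k x : wnear k x != 0 -> `|x - node k| < 4 * del.
Proof.
move=> h; apply/norm_rV_lt => [|j]; first by rewrite mulr_gt0.
have hj : near4 (gridy x j - (k j)%:R) != 0.
  by apply: contraNneq h => h; rewrite /wnear (bigD1 j) //= h mul0r.
have h1 : `|gridy x j - (k j)%:R| < 4 by move: hj; rewrite /near4; case: (_ < _); rewrite ?eqxx.
have -> : (x - node k) ord0 j = (gridy x j - (k j)%:R) * del by rewrite gridy_sub mulfVK // gt_eqF.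
by rewrite normrM (gtr0_norm del0) ltr_pM2r.
Qed.

Lemma wnear_ge0 k x : 0 <= wnear k x.
Proof. by apply: prodr_ge0 => j _; exact: near4_ge0. Qed.

Lemma sum_wnear x : \sum_k wnear k x <= 9 ^+ d.
Proof.
rewrite /wnear -(bigA_distr_bigA (fun j (a : 'I_m) => near4 (gridy x j - a%:R))).
rewrite -[X in _ <= _ ^+ X]card_ord -prodr_const; apply: ler_prod => j _.
by rewrite sum_near4 andbT; apply: sumr_ge0 => k _; exact: near4_ge0.
Qed.

Lemma sum_wgt x : good x -> \sum_k wgt k x = 1.
Proof.
move=> gx; rewrite /wgt -(bigA_distr_bigA (fun j (a : 'I_m) => hatf (gridy x j - a%:R))).
by rewrite big1 // => j _; have /andP[h1 h2] := gx j; exact: sum_hatf.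
Qed.

Lemma sum_wgt_node x j : good x -> \sum_k node k ord0 j * wgt k x = x ord0 j.
Proof.
move=> gx.
have h : \sum_(k : index) (k j)%:R * wgt k x = gridy x j.
  (* The coordinate [k j] is absorbed into the [j]-th factor, so that the sum over multi-indices
     factorises. *)
  transitivity (\sum_(k : index) \prod_i ((if i == j then (k i)%:R else 1) * hatf (gridy x i - (k i)%:R))).
    apply: eq_bigr => k _; rewrite big_split /=; congr (_ * _).
    by rewrite (bigD1 j) //= eqxx big1 ?mulr1 // => i /negbTE ->.
  rewrite -(bigA_distr_bigA (fun i (a : 'I_m) => (if i == j then a%:R else 1) * hatf (gridy x i - a%:R))).
  rewrite (bigD1 j) //= eqxx [X in _ * X]big1 ?mulr1.
    by have /andP[h1 h2] := gx j; exact: sum_hatf1.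
  move=> i /negbTE ij; have /andP[h1 h2] := gx i; rewrite -[RHS](sum_hatf h1 h2).
  by apply: eq_bigr => a _; rewrite ij mul1r.
transitivity (\sum_(k : index) (del * ((k j)%:R * wgt k x) - del * n0%:R * wgt k x)).
  by apply: eq_bigr => k _; rewrite mxE; ring.
rewrite sumrB -!mulr_sumr h sum_wgt // /gridy; field; exact: lt0r_neq0.
Qed.

Variables (B : R) (B0 : 0 <= B) (hB : forall x, `|hatf x| <= B)
  (hB' : forall x h, `|hatf (x + h) - hatf x| <= B * `|h|).

Lemma hatf_near4 z : `|hatf z| <= B * near4 z.
Proof.
rewrite /near4; case: ltP => h; first by rewrite mulr1.
rewrite hatf_out ?normr0 ?mulr0 //; move: h; rewrite ler_normr => /orP[h|h]; [right|left]; lra.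
Qed.

Lemma wgt_bound k x : `|wgt k x| <= B ^+ d * wnear k x.
Proof.
rewrite /wgt /wnear normr_prod -[X in B ^+ X](card_ord d) -prodr_const -big_split /=.
by apply: ler_prod => j _; rewrite normr_ge0 hatf_near4.
Qed.

(** Only the [j]-th factor changes. A step of at most [del] moves its argument by at most one grid
    unit, so the change is still controlled by [wnear] at [x]. *)
Lemma wgt_lipschitz k x j h : `|h| <= del ->
  `|wgt k (x + h *: e_ R j) - wgt k x| <= (`|h| / del) * (B ^+ d * wnear k x).
Proof.
move=> hd.
have E i : i != j -> gridy (x + h *: e_ R j) i = gridy x i.
  by move=> ij; rewrite /gridy !mxE eqxx /= (negbTE ij) mulr0 addr0.
have Ej : gridy (x + h *: e_ R j) j = gridy x j + h / del.
  by rewrite /gridy !mxE !eqxx mulr1; ring.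
have -> : wgt k (x + h *: e_ R j) - wgt k x =
    (hatf (gridy x j - (k j)%:R + h / del) - hatf (gridy x j - (k j)%:R)) *
    \prod_(i | i != j) hatf (gridy x i - (k i)%:R).
  rewrite /wgt !(bigD1 (P := predT) j) //= Ej mulrBl; congr (_ * _ - _); first by congr hatf; ring.
  by apply: eq_bigr => i ij; rewrite E.
have h1 : `|h / del| <= 1 by rewrite normrM normfV (gtr0_norm del0) ler_pdivrMr // mul1r.
have h2 : `|hatf (gridy x j - (k j)%:R + h / del) - hatf (gridy x j - (k j)%:R)|
    <= (`|h| / del) * (B * near4 (gridy x j - (k j)%:R)).
  rewrite /near4; case: ltP => hn.
    by rewrite mulr1; apply: le_trans (hB' _ _) _; rewrite normrM normfV (gtr0_norm del0) mulrC.
  rewrite !mulr0 [hatf (_ + _)]hatf_out; last first.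
    move: h1 hn; rewrite ler_norml ler_normr => /andP[a1 a2] /orP[a3|a3]; [right|left]; lra.
  rewrite hatf_out ?subrr ?normr0 //.
  by move: hn; rewrite ler_normr => /orP[a3|a3]; [right|left]; lra.
rewrite normrM normr_prod.
have -> : (`|h| / del) * (B ^+ d * wnear k x) = ((`|h| / del) * (B * near4 (gridy x j - (k j)%:R))) *
    \prod_(i | i != j) (B * near4 (gridy x i - (k i)%:R)).
  rewrite /wnear -[X in B ^+ X](card_ord d) -prodr_const -big_split /= (bigD1 j) //=; ring.
apply: ler_pM => //; first by apply: prodr_ge0 => i _.
by apply: ler_prod => i _; rewrite normr_ge0 hatf_near4.
Qed.

Lemma smooth_wgt k : smooth (wgt k).
Proof.
apply: smooth_prod => j.
have := @smooth_comp R X hatf (fun x => gridy x j - (k j)%:R) smooth_hatf; apply.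
rewrite (_ : (fun x => _) = fun x : X => x ord0 j * del^-1 + (n0%:R - (k j)%:R)); last first.
  by apply/funext => x; rewrite /gridy addrA.
apply: smooth_add; last exact: smooth_cst.
by apply: smooth_mul; [exact: smooth_coord|exact: smooth_cst].
Qed.

End quasi_interpolation.

Section soft_threshold.
Context (R : realFieldType).

(** Soft thresholding: values up to [e] in modulus are removed and a constant is subtracted
    elsewhere. Differences do not increase, and gradients are kept where [|s| > e]. *)
Definition soft (e s : R) : R := s - Num.max (- e) (Num.min e s).

Lemma soft_small e s : `|s| <= e -> soft e s = 0.
Proof. by rewrite ler_norml /soft => /andP[h1 h2]; rewrite (min_idPr h2) (max_idPr h1) subrr. Qed.

Lemma soft_pos e s : 0 <= e -> e < s -> soft e s = s - e.
Proof. by move=> e0 h; rewrite /soft (min_idPl (ltW h)) (@max_idPr _ _ (- e) e _) //; lra. Qed.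

Lemma soft_neg e s : 0 <= e -> s < - e -> soft e s = s + e.
Proof.
move=> e0 h; have se : s <= e by lra.
by rewrite /soft (min_idPr se) (max_idPl (ltW h)) opprK.
Qed.

Lemma soft_dist e s : 0 <= e -> `|soft e s - s| <= e.
Proof.
move=> e0; rewrite /soft addrAC subrr add0r normrN ler_norml le_max lexx /=.
by rewrite ge_max ge_min lexx /= andbT; lra.
Qed.

Lemma soft_lipschitz e s r : 0 <= e -> `|soft e s - soft e r| <= `|s - r|.
Proof.
move=> e0; wlog rs : s r / r <= s.
  by move=> h; have [/h|/ltW/h] := leP r s; rewrite // distrC [`|r - s|]distrC.
rewrite [leRHS]ger0_norm ?subr_ge0 // ler_norml.
have [hr|hr] := ltP r (- e).
  rewrite (soft_neg e0 hr); have [hs|hs] := ltP s (- e); first by rewrite (soft_neg e0 hs); lra.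
  have [hs2|hs2] := ltP e s; first by rewrite (soft_pos e0 hs2); lra.
  by rewrite soft_small ?ler_norml ?hs ?hs2 //; lra.
have [hr2|hr2] := ltP e r.
  have hs : e < s by lra.
  by rewrite (soft_pos e0 hr2) (soft_pos e0 hs); lra.
rewrite [soft e r]soft_small ?ler_norml ?hr ?hr2 //.
have [hs2|hs2] := ltP e s; first by rewrite (soft_pos e0 hs2); lra.
by rewrite soft_small ?ler_norml; lra.
Qed.

End soft_threshold.

(** * Zero boundary values: locally affine Lipschitz functions belong to H10 *)

Section locally_affine_H10.
Context (R : realType) (d : nat) (Omega : set 'rV[R]_d).
Hypotheses (oO : open Omega) (bO : bounded_set Omega).
Local Notation X := 'rV[R]_d.
Local Notation muX := (lebesgue_rV R d).
Variables (v : X -> R) (g : 'I_d -> X -> R) (C : R).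
Hypotheses (C0 : 0 <= C) (vC : forall x y, `|v x - v y| <= C * `|x - y|)
  (v0 : forall x, ~ Omega x -> v x = 0)
  (mg : forall j, measurable_fun setT (g j : X -> measurableTypeR R))
  (gC : forall j x, `|g j x| <= C)
  (vg : {ae muX, forall x, Omega x ->
    (exists2 r : R, 0 < r & forall y, `|y - x| < r -> v y = v x + \sum_j g j x * (y - x) ord0 j) /\
    (v x = 0 -> forall j, g j x = 0)}).

Let mO : measurable Omega. Proof. exact: measurable_domain. Qed.
Let fO : (muX Omega < +oo)%E. Proof. exact: domain_fin. Qed.

Let cv : continuous v.
Proof.
move=> x; apply/(@cvgrPdist_lt _ _ _ (nbhs (x : X))) => e e0.
have C1 : 0 < C + 1 by rewrite ltr_wpDl.
apply: filterS (_ : \forall y \near nbhs (x : X), `|x - y| < e / (C + 1)); last first.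
  by have := @cvgr_dist_lt _ _ _ (nbhs (x : X)) _ id x cvg_id (e / (C + 1)); apply; rewrite divr_gt0.
move=> y hy; apply: le_lt_trans (vC x y) _; move: hy; rewrite ltr_pdivlMr // mulrC.
by apply: le_lt_trans; rewrite ler_wpM2r // lerDl.
Qed.

Lemma norm_e_le1 (j : 'I_d) : `|e_ R j| <= 1.
Proof.
rewrite leNgt; apply/negP => h; have h0 : 0 < `|e_ R j| by apply: lt_trans h.
suff : `|e_ R j| < `|e_ R j| by rewrite ltxx.
apply/norm_rV_lt => // k; apply: le_lt_trans h; rewrite !mxE normr_nat.
by case: (_ && _); rewrite ?ler01.
Qed.

Lemma loc_affine_cvg (f : X -> R) (s : 'I_d -> R) x r j : 0 < r ->
  (forall y, `|y - x| < r -> f y = f x + \sum_i s i * (y - x) ord0 i) ->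
  m.+1%:R * (f x - f (x + (- m.+1%:R^-1) *: e_ R j)) @[m --> \oo] --> s j.
Proof.
move=> r0 hr; apply: cvg_trans (@cvg_cst _ (s j) _ \oo _); apply: near_eq_cvg.
near=> m; have m0 : m.+1%:R != 0 :> R by rewrite pnatr_eq0.
rewrite (hr (x + (- m.+1%:R^-1) *: e_ R j)); last first.
  rewrite addrAC subrr add0r normrZ normrN.
  apply: (@le_lt_trans _ _ (m.+1%:R^-1)); last first.
    by near: m; have := @cvg_harmonic R => /cvgr_lt; exact.
  by rewrite ger0_norm ?invr_ge0 // ler_piMr ?invr_ge0 // norm_e_le1.
rewrite addrAC subrr add0r (bigD1 j) //= big1 => [|i ij].
  by rewrite !mxE !eqxx mulr1 addr0; field.
by rewrite !mxE eqxx /= (negbTE ij) mulr0n !mulr0.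
Unshelve. all: by end_near. Qed.

Lemma loc_affine_L2 : in_L2 muX Omega v.
Proof.
have [N N0 hN] := bounded_boxrV bO.
have mv : measurable_fun setT (v : X -> measurableTypeR R).
  exact: (continuous_measurable_coords (coordsV R d) (f := v) cv).
apply: (in_L2_bounded mO (C := `|v 0| + C * N)) => //; first exact: measurable_funTS.
move=> x Ox; have xN : `|x| < N.
  by apply/norm_rV_lt => // k; have := hN x Ox k; rewrite ltr_norml.
have := ler_normD (v x - v 0) (v 0); rewrite subrK addrC => /le_trans; apply.
rewrite lerD2l; apply: le_trans (vC _ _) _; rewrite subr0 ler_wpM2l // ltW //.
Qed.

Lemma loc_affine_is_d j : is_d Omega j v (g j).
Proof.
apply: (weak_derivative_lipschitz (coordsV R d) (O := Omega) (C := C) (sh := fun h x => x + h *: e_ R j) (e := e_ R j)) => //.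
- by move=> psi tp; exists psi.
- by move=> h; exact: mpres_shift_rV.
- by move=> h x; rewrite scaleNr addrK.
- exact: loc_affine_L2.
- exact: measurable_funTS.
- move=> x h _; apply: le_trans (vC _ _) _; rewrite addrAC subrr add0r normrZ.
  by rewrite ler_wpM2l // ler_piMr // norm_e_le1.
- apply: filterS vg => x hx Ox; have [[r r0 hr] _] := hx Ox.
  exact: (@loc_affine_cvg v (fun i => g i x) x r j r0 hr).
Qed.

Variables (B : R) (B0 : 0 <= B) (hB : forall x : R, `|hatf x| <= B)
  (hB' : forall x h : R, `|hatf (x + h) - hatf x| <= B * `|h|).
Variables (N : R) (N0 : 0 < N) (hN : Omega `<=` boxrV (fun=> - N) (fun=> N)).

Section fixed_scale.
Variables (del : R) (n0 : nat).
Hypotheses (del0 : 0 < del) (del1 : del <= 1) (hn0 : (N + 1) / del + 1 < n0%:R).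
Local Notation index := {ffun 'I_d -> 'I_(2 * n0)}.
Local Notation pt := (@node R d del n0).
Local Notation wg := (@wgt R d del n0).
(** Around a point where [|v| < del], the nodes with nonzero weight carry values below
    [(2 C + 1) del], hence below [eps]: the interpolant vanishes there. *)
Let eps := 4 * (C + 1) * del.
Let eps0 : 0 <= eps. Proof. by rewrite !mulr_ge0 // ?addr_ge0 // ltW. Qed.

(* The weights reproduce affine functions, so the interpolant has the exact gradient
   wherever [v] is affine at scale [del]; the soft threshold makes it vanish near
   the boundary. *)
Definition qinterp (x : X) : R := \sum_(k : index) soft eps (v (pt k)) * wg k x.

Let K := B ^+ d * 9 ^+ d.

Let K0 : 0 <= K. Proof. by rewrite mulr_ge0 // exprn_ge0. Qed.

Lemma good_box (x : X) : (forall j, `|x ord0 j| < N + 1) -> good del n0 x.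
Proof.
move=> h j; have hj : `|x ord0 j / del| < (N + 1) / del.
  by rewrite normrM normfV (gtr0_norm del0) ltr_pM2r ?invr_gt0.
move: hj hn0; rewrite ltr_norml /gridy natrM; move: (_ / del) (_ / del) (n0%:R) => a c n /andP[h1 h2] h3.
by apply/andP; split; lra.
Qed.

Lemma good_Omega x : Omega x -> good del n0 x.
Proof.
by move=> Ox; apply: good_box => j; have := hN Ox j; rewrite ltr_norml; lra.
Qed.

Lemma qinterp_smooth : smooth qinterp.
Proof. by apply: smooth_sum => k; apply: smooth_mul; [exact: smooth_cst|exact: smooth_wgt]. Qed.

(** The support lies in the set where [|v| >= del], which is closed by continuity and inside [Omega]
    because [v] vanishes outside. *)
Lemma qinterp_test : test_fun Omega qinterp.
Proof.
pose S : set X := [set x | del <= `|v x|].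
have cS : closed S.
  rewrite (_ : S = (fun x => `|v x|) @^-1` [set r | del <= r]) //.
  apply: closed_comp; last exact: closed_ge.
  by move=> x _; apply: continuous_comp; [exact: cv|exact: norm_continuous].
have SO : S `<=` Omega.
  by move=> x; rewrite /S /= => h; apply: contrapT => /v0 v0x; move: h; rewrite v0x normr0 leNgt del0.
have supp : closure [set x | qinterp x != 0] `<=` S.
  rewrite [X in _ `<=` X](closure_id S).1 //; apply: closure_subset => x /= nx.
  rewrite /S /= leNgt; apply/negP => vx; move/eqP: nx; apply; apply: big1 => k _.
  have [->|wk] := eqVneq (wg k x) 0; first by rewrite mulr0.
  have := wgt_near del0 wk => xk; rewrite soft_small ?mul0r //.
  have := ler_normD (v (pt k) - v x) (v x); rewrite subrK => /le_trans; apply.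
  have := vC (pt k) x; rewrite [`|pt k - x|]distrC => hv.
  have h2 : C * `|x - pt k| <= C * (2 * del) by rewrite ler_wpM2l // ltW.
  apply: le_trans (lerD (le_trans hv h2) (ltW vx)) _.
  have := mulr_ge0 C0 (ltW del0); rewrite /eps.
  have -> : C * (2 * del) + del = 2 * (C * del) + del by ring.
  have -> : 4 * (C + 1) * del = 4 * (C * del) + 4 * del by ring.
  by move: (C * del) del0 => Cd d0 Cd0; lra.
split; first exact: qinterp_smooth; last exact: subset_trans SO.
have cB : compact (cbox (fun k (x : X) => x ord0 k) (fun=> - N) (fun=> N)).
  by case: (coordsV R d) => _ _ _ _ h _ _ _; exact: h.
apply: (subclosed_compact _ cB); first exact: closed_closure.
move=> x /supp/SO/hN h k; have /andP[h1 h2] := h k.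
by rewrite (ltW h1) (ltW h2).
Qed.

Lemma qinterp_dist x y (c : R) : (forall k, wnear del k x != 0 -> `|soft eps (v (pt k)) - c| <= y) ->
  0 <= y -> \sum_(k : index) `|soft eps (v (pt k)) - c| * (B ^+ d * wnear del k x) <= y * K.
Proof.
move=> h y0; apply: (@le_trans _ _ (\sum_(k : index) y * (B ^+ d * wnear del k x))).
  apply: ler_sum => k _; have [->|wk] := eqVneq (wnear del k x) 0; first by rewrite !mulr0.
  by rewrite ler_wpM2r ?h // mulr_ge0 ?exprn_ge0 // wnear_ge0.
rewrite -!mulr_sumr ler_wpM2l // ler_wpM2l ?exprn_ge0 //; exact: sum_wnear.
Qed.

Lemma qinterp_close x : Omega x -> `|qinterp x - v x| <= (eps + 4 * C * del) * K.
Proof.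
move=> Ox; have gx := good_Omega Ox.
have -> : qinterp x - v x = \sum_(k : index) (soft eps (v (pt k)) - v x) * wg k x.
  by under [RHS]eq_bigr do rewrite mulrBl; rewrite sumrB -mulr_sumr sum_wgt // mulr1.
apply: le_trans (ler_norm_sum _ _ _) _.
apply: (@le_trans _ _ (\sum_(k : index) `|soft eps (v (pt k)) - v x| * (B ^+ d * wnear del k x))).
  by apply: ler_sum => k _; rewrite normrM ler_wpM2l // wgt_bound.
apply: qinterp_dist; last by rewrite addr_ge0 // !mulr_ge0 // ltW.
move=> k /(wnear_near del0) xk.
have := ler_normD (soft eps (v (pt k)) - v (pt k)) (v (pt k) - v x); rewrite addrA subrK => /le_trans; apply.
apply: lerD; first exact: soft_dist.
apply: le_trans (vC _ _) _; rewrite distrC [4 * C]mulrC -mulrA ler_wpM2l // ltW //.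
Qed.

Lemma qinterp_lipschitz x j h : Omega x -> `|h| <= del ->
  `|qinterp (x + h *: e_ R j) - qinterp x| <= 4 * C * K * `|h|.
Proof.
move=> Ox hd; have gx := good_Omega Ox.
have gxh : good del n0 (x + h *: e_ R j).
  apply: good_box => i; rewrite !mxE; apply: le_lt_trans (ler_normD _ _) _.
  apply: ltr_leD; first by have := hN Ox i; rewrite ltr_norml.
  rewrite normrM normr_nat; case: (_ && _); rewrite ?mulr1 ?mulr0 //; exact: le_trans del1.
(* The weights sum to one at both points, so a constant may be subtracted from the nodal values. The
   remaining differences are of order [del] and compensate the factor [1/del] in the Lipschitz bound
   of the weights. *)
set c := soft eps (v x).
have -> : qinterp (x + h *: e_ R j) - qinterp x =
    \sum_(k : index) (soft eps (v (pt k)) - c) * (wg k (x + h *: e_ R j) - wg k x).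
  have -> : \sum_(k : index) (soft eps (v (pt k)) - c) * (wg k (x + h *: e_ R j) - wg k x) =
    (qinterp (x + h *: e_ R j) - qinterp x) -
      c * (\sum_k wg k (x + h *: e_ R j) - \sum_k wg k x).
    rewrite /qinterp -!sumrB mulr_sumr -sumrB; apply: eq_bigr => k _; ring.
  by rewrite !sum_wgt // subrr mulr0 subr0.
apply: le_trans (ler_norm_sum _ _ _) _.
apply: (@le_trans _ _ (\sum_(k : index) (`|h| / del) * (`|soft eps (v (pt k)) - c| * (B ^+ d * wnear del k x)))).
  apply: ler_sum => k _; rewrite normrM mulrCA ler_wpM2l //; exact: wgt_lipschitz.
rewrite -mulr_sumr.
have -> : 4 * C * K * `|h| = (`|h| / del) * (4 * C * del * K) by field; rewrite gt_eqF.
rewrite ler_wpM2l ?divr_ge0 // ?(ltW del0) //.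
apply: qinterp_dist; last by rewrite !mulr_ge0 // ltW.
move=> k /(wnear_near del0) xk; apply: le_trans (soft_lipschitz _ _ eps0) _.
apply: le_trans (vC _ _) _; rewrite distrC [4 * C]mulrC -mulrA ler_wpM2l // ltW //.
Qed.

Lemma qinterp_grad_bound x j : Omega x -> `|'D_(e_ R j) qinterp x| <= 4 * C * K.
Proof.
move=> Ox; have dq := diff_derivable (smooth_diff qinterp_smooth x) : derivable qinterp x (e_ R j).
apply: (cvgr_to_le (cvg_norm (backward_difference dq))).
near=> m; rewrite normrM normr_nat distrC -ler_pdivlMl // mulrC.
have hm : `|- m.+1%:R^-1| <= del :> R.
  rewrite normrN ger0_norm ?invr_ge0 //; near: m.
  by have := @cvg_harmonic R => /cvgr_le; exact.
by apply: le_trans (qinterp_lipschitz j Ox hm) _; rewrite normrN ger0_norm ?invr_ge0.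
Unshelve. all: by end_near. Qed.

Lemma qinterp_grad_exact x r j : Omega x -> 3 * del <= r ->
  (forall y, `|y - x| < r -> v y = v x + \sum_i g i x * (y - x) ord0 i) ->
  (v x = 0 -> forall i, g i x = 0) -> v x = 0 \/ eps + 3 * (C * del) < `|v x| ->
  'D_(e_ R j) qinterp x = g j x.
Proof.
move=> Ox dr hr g0 vx.
(* Within [3 del] of [x] thresholding subtracts a constant: 0 where [v] vanishes identically, [eps]
   or [- eps] where [|v|] is large. The radius is the reach [2 del] of a weight plus [del] for a
   neighbourhood of [x]. *)
have [s hs] : exists s, forall p, `|p - x| < 3 * del -> soft eps (v p) = v p - s.
  case: vx => [vx|vx].
    exists 0 => p px; have -> : v p = 0.
      rewrite hr ?(lt_le_trans px) // vx add0r big1 // => i _; by rewrite g0 ?mul0r.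
    by rewrite soft_small ?subr0 // normr0.
  have hp p : `|p - x| < 3 * del -> `|v p - v x| <= 3 * (C * del).
    by move=> px; apply: le_trans (vC _ _) _; rewrite mulrCA ler_wpM2l // ltW.
  have [v1|v1] := leP 0 (v x).
    exists eps => p /hp; rewrite ler_norml => /andP[h1 h2]; rewrite soft_pos //.
    by move: vx; rewrite ger0_norm //; lra.
  exists (- eps) => p /hp; rewrite ler_norml => /andP[h1 h2]; rewrite opprK soft_neg //.
  by move: vx; rewrite ltr0_norm //; lra.
have hV y : `|y - x| < del -> qinterp y = v x - s + \sum_i g i x * (y - x) ord0 i.
  move=> yx.
  have gy : good del n0 y.
    apply: good_box => i; rewrite -[y](subrK x) mxE; apply: le_lt_trans (ler_normD _ _) _.
    rewrite addrC; apply: ltr_leD; first by have := hN Ox i; rewrite ltr_norml.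
    apply: le_trans del1; apply/ltW; exact: ((norm_rV_lt (y - x) del0).1 yx i).
  transitivity (\sum_(k : index) ((v x - s) * wg k y + \sum_i g i x * ((pt k - x) ord0 i * wg k y))).
    apply: eq_bigr => k _; have [->|wk] := eqVneq (wg k y) 0.
      by rewrite !mulr0 add0r big1 // => i _; rewrite !mulr0.
    have px : `|pt k - x| < 3 * del.
      rewrite -(subrK y (pt k)) -addrA; apply: le_lt_trans (ler_normD _ _) _.
      have := wgt_near del0 wk; rewrite distrC => h; lra.
    rewrite hs // hr ?(lt_le_trans px) //.
    rewrite addrAC mulrDl mulr_suml; congr (_ + _).
    by apply: eq_bigr => i _; rewrite mulrA.
  rewrite big_split /= -mulr_sumr sum_wgt // mulr1; congr (_ + _).
  rewrite exchange_big; apply: eq_bigr => i _ /=; rewrite -mulr_sumr; congr (_ * _).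
  transitivity (\sum_(k : index) (pt k ord0 i * wg k y - x ord0 i * wg k y)).
    by apply: eq_bigr => k _; rewrite !mxE mulrBl.
  by rewrite sumrB sum_wgt_node // -mulr_sumr sum_wgt // mulr1 !mxE.
have hx : qinterp x = v x - s.
  by rewrite hV ?subrr ?normr0 // big1 ?addr0 // => i _; rewrite mxE mulr0.
have h1 : forall y, `|y - x| < del -> qinterp y = qinterp x + \sum_i g i x * (y - x) ord0 i.
  by move=> y /hV; rewrite hx.
have dq := diff_derivable (smooth_diff qinterp_smooth x) : derivable qinterp x (e_ R j).
exact: (cvg_unique _ (backward_difference dq) (@loc_affine_cvg qinterp (fun i => g i x) x del j del0 h1)).
Qed.

End fixed_scale.

Let scale (m : nat) : R := m.+1%:R^-1.
Let shift (m : nat) : nat := Num.bound ((N + 1) / scale m + 1).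
Let q m : X -> R := qinterp (scale m) (shift m).
Let K := B ^+ d * 9 ^+ d.

Let scale0 m : 0 < scale m. Proof. by rewrite invr_gt0. Qed.
Let scale1 m : scale m <= 1. Proof. by rewrite invf_le1 // ler1n. Qed.
Let shiftP m : (N + 1) / scale m + 1 < (shift m)%:R.
Proof. by apply: archi_boundP; rewrite addr_ge0 // divr_ge0 ?(ltW (scale0 m)) // addr_ge0 // ltW. Qed.
Let K0 : 0 <= K. Proof. by rewrite mulr_ge0 // exprn_ge0. Qed.
Let tq m : test_fun Omega (q m).
Proof. by apply: qinterp_test. Qed.
Let scale_cvg : scale m @[m --> \oo] --> (0 : R). Proof. exact: cvg_harmonic. Qed.

Lemma sqr_cvg0 (f : nat -> X -> R) (b : R) :
  (forall m, measurable_fun Omega (f m : X -> measurableTypeR R)) ->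
  (forall m x, Omega x -> `|f m x| <= b) ->
  {ae muX, forall x, Omega x -> f m x @[m --> \oo] --> (0 : R)} ->
  \int[muX]_(x in Omega) (f m x * f m x) @[m --> \oo] --> (0 : R).
Proof.
move=> mf fb fc.
have -> : (0 : R) = \int[muX]_(x in Omega) (0 * 0) by under eq_Rintegral do rewrite mul0r; rewrite /Rintegral integral0.
apply: (Rintegral_dominated_cvg (g := fun=> b * b)) => //.
- by move=> m; exact: (measurable_funM (mf m) (mf m)).
- by apply: filterS fc => x hx Ox; apply: cvgM; exact: hx.
- by apply: (in_L2_integrable mO fO); apply: (in_L2_bounded mO (C := `|b * b|)).
- apply: aeW => x Ox m; rewrite normrM; apply: ler_pM => //; exact: fb.
Qed.

Let L2_cvg : ip muX Omega (v \- q m) (v \- q m) @[m --> \oo] --> (0 : R).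
Proof.
apply: (@sqr_cvg0 _ ((8 * C + 4) * K)).
- by move=> m; apply: measurable_funB; [exact: loc_affine_L2.1|exact: (test_L2 oO bO (tq m)).1].
- move=> m x Ox; rewrite distrC; apply: le_trans (qinterp_close (scale0 m) (shiftP m) Ox) _.
  rewrite ler_wpM2r //; have := scale1 m; have := ltW (scale0 m); move: (scale m) => c c0 c1.
  have -> : 4 * (C + 1) * c + 4 * C * c = (8 * C + 4) * c by ring.
  by rewrite ler_piMr // addr_ge0 // mulr_ge0.
- apply: aeW => x Ox; apply/cvgrPdist_le => e e0.
  have c0 : 0 < (8 * C + 4) * K + 1 by rewrite ltr_wpDl // mulr_ge0 // addr_ge0 // mulr_ge0.
  near=> m.
  rewrite sub0r normrN distrC; apply: le_trans (qinterp_close (scale0 m) (shiftP m) Ox) _.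
  have -> : (4 * (C + 1) * scale m + 4 * C * scale m) * K = ((8 * C + 4) * K) * scale m by ring.
  apply: (@le_trans _ _ (((8 * C + 4) * K + 1) * scale m)); first by rewrite ler_wpM2r ?(ltW (scale0 m)) // lerDl.
  rewrite -ler_pdivlMl // mulrC; near: m.
  by have /cvgr_le := scale_cvg; apply; rewrite divr_gt0.
Unshelve. all: by end_near. Qed.

(** At almost every point the difference is exactly 0 from some scale on, and [qinterp_grad_bound]
    provides a bound that does not depend on the scale. *)
Let grad_cvg j : \int[muX]_(x in Omega) ((-1 * 'D_(e_ R j) (q m) x + g j x) * (-1 * 'D_(e_ R j) (q m) x + g j x))
  @[m --> \oo] --> (0 : R).
Proof.
apply: (@sqr_cvg0 _ (4 * C * K + C)).
- move=> m; have md := (is_d_test oO bO j (tq m)).1.1.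
  have m1 : measurable_fun Omega (fun _ : X => -1 : measurableTypeR R) by exact: measurable_cst.
  exact: (measurable_funD (measurable_funM m1 md) (measurable_funTS (mg j))).
- move=> m x Ox; apply: le_trans (ler_normD _ _) _; apply: lerD; last exact: gC.
  rewrite mulN1r normrN; exact: (qinterp_grad_bound (scale0 m) (scale1 m) (shiftP m)).
- apply: filterS vg => x hx Ox; have [[r r0 hr] g0] := hx Ox.
  apply: cvg_trans (@cvg_cst _ (0 : R) _ \oo _); apply: near_eq_cvg.
  have c0 : 0 < 7 * C + 4 by rewrite ltr_wpDl // mulr_ge0.
  have h1 : \forall m \near \oo, 3 * scale m <= r.
    near=> m; rewrite mulrC -ler_pdivlMr //; near: m.
    by have /cvgr_le := scale_cvg; apply; rewrite divr_gt0.
  have h2 : \forall m \near \oo, v x = 0 \/ 4 * (C + 1) * scale m + 3 * (C * scale m) < `|v x|.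
    have [vx|vx] := eqVneq (v x) 0; first by apply: nearW => m; left.
    near=> m; right.
    have -> : 4 * (C + 1) * scale m + 3 * (C * scale m) = (7 * C + 4) * scale m by ring.
    rewrite mulrC -ltr_pdivlMr //; near: m.
    by have /cvgr_lt := scale_cvg; apply; rewrite divr_gt0 // normr_gt0.
  apply: filterS2 h1 h2 => m m1 m2.
  by rewrite (qinterp_grad_exact (scale0 m) (scale1 m) (shiftP m) j Ox m1 hr g0 m2) mulN1r addNr.
Unshelve. all: by end_near. Qed.

Lemma in_H10_aux : in_H10 Omega v.
Proof.
have Hv : in_H1 Omega v by split; [exact: loc_affine_L2|move=> j; eexists; exact: loc_affine_is_d].
apply/(in_H10P oO bO); split=> // eps e0.
(* [d + 1] rather than [d]: the sum of [d] such bounds stays strictly below [eps^2]. *)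
have e20 : 0 < eps ^+ 2 / d.+1%:R by rewrite divr_gt0 // exprn_gt0.
have h1 : \forall m \near \oo, ip muX Omega (v \- q m) (v \- q m) < eps ^+ 2.
  by have /cvgr_lt := L2_cvg; apply; rewrite exprn_gt0.
have h2 : \forall m \near \oo, forall j,
    \int[muX]_(x in Omega) ((-1 * 'D_(e_ R j) (q m) x + g j x) * (-1 * 'D_(e_ R j) (q m) x + g j x)) < eps ^+ 2 / d.+1%:R.
  by apply: filter_forall => j; have /cvgr_lt := @grad_cvg j; apply.
have [m [m1 m2]] : exists m, ip muX Omega (v \- q m) (v \- q m) < eps ^+ 2 /\ forall j,
    \int[muX]_(x in Omega) ((-1 * 'D_(e_ R j) (q m) x + g j x) * (-1 * 'D_(e_ R j) (q m) x + g j x)) < eps ^+ 2 / d.+1%:R.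
  near \oo => m; exists m; split; near: m; [exact: h1|exact: h2].
have hs (a : R) : a < eps ^+ 2 -> Num.sqrt a < eps.
  by move=> h; rewrite -[X in _ < X](gtr0_norm e0) -sqrtr_sqr ltr_sqrt // exprn_gt0.
exists (q m); split; [exact: tq|exact: hs|].
apply: hs.
rewrite (_ : v \- q m = fun x => -1 * q m x + v x); last by apply/funext => x /=; rewrite mulN1r addrC.
have hd j := is_d_lin oO bO (-1) (test_L2 oO bO (tq m)) loc_affine_L2 (is_d_test oO bO j (tq m)) (loc_affine_is_d j).
rewrite /aform (vip_ae (grad_ae oO bO hd) (grad_ae oO bO hd)) /vip.
apply: (@le_lt_trans _ _ (\sum_(j < d) eps ^+ 2 / d.+1%:R)).
  apply: ler_sum => j _; apply/ltW; have := m2 j; congr (_ < _).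
  by apply: eq_Rintegral => x _; rewrite !mxE.
rewrite sumr_const card_ord -[X in X < _]mulr_natr mulrAC ltr_pdivrMr ?ltr0n //.
by rewrite ltr_pM2l ?exprn_gt0 // ltr_nat.
Unshelve. all: by end_near. Qed.

End locally_affine_H10.

(** The condition at the zeros of [v] matches the soft threshold, which erases the function and its
    gradient there. *)
Lemma loc_affine_H10 (R : realType) (d : nat) (Omega : set 'rV[R]_d) (v : 'rV[R]_d -> R)
    (g : 'I_d -> 'rV[R]_d -> R) (C : R) :
  open Omega -> bounded_set Omega -> 0 <= C -> (forall x y, `|v x - v y| <= C * `|x - y|) ->
  (forall x, ~ Omega x -> v x = 0) ->
  (forall j, measurable_fun setT (g j : _ -> measurableTypeR R)) -> (forall j x, `|g j x| <= C) ->
  {ae lebesgue_rV R d, forall x, Omega x ->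
    (exists2 r : R, 0 < r & forall y, `|y - x| < r -> v y = v x + \sum_j g j x * (y - x) ord0 j) /\
    (v x = 0 -> forall j, g j x = 0)} ->
  in_H10 Omega v /\ forall j, is_d Omega j v (g j).
Proof.
move=> oO bO C0 vC v0 mg gC vg; have [B B0 [hB hB']] := hatf_bound R; have [N N0 hN] := bounded_boxrV bO.
split; last by move=> j; exact: (loc_affine_is_d oO bO C0 vC mg gC vg).
exact: (in_H10_aux oO bO C0 vC v0 mg gC vg B0 hB hB' N0 hN).
Qed.

(** * Space-time slices and Bochner spaces *)

Section fubini_rectangle.
Context d1 d2 (T1 : measurableType d1) (T2 : measurableType d2) (R : realType).
Context (m1 : {sigma_finite_measure set T1 -> \bar R}) (m2 : {sigma_finite_measure set T2 -> \bar R}).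
Variables (A : set T1) (B : set T2) (mA : measurable A) (mB : measurable B) (h : T1 * T2 -> R).
Hypothesis ih : (m1 \x m2)%E.-integrable (A `*` B) (EFin \o h).

Let f := (EFin \o h) \_ (A `*` B).

Let mf : (m1 \x m2)%E.-integrable setT f.
Proof. exact: (integrable_mkcond _ (measurableX mA mB)).1 ih. Qed.

Let fE t : A t -> (fun y => f (t, y)) = (fun y => (h (t, y))%:E) \_ B.
Proof.
move=> At; apply/funext => y; rewrite /f !patchE.
have -> : ((t, y) \in A `*` B) = (y \in B) by apply/idP/idP; rewrite !inE => //= -[].
by [].
Qed.

Let fE0 t : ~ A t -> (fun y => f (t, y)) = fun=> 0%E.
Proof. by move=> nA; apply/funext => y; rewrite /f patchE memNset // => -[]. Qed.

Lemma fubini_ae_integrable : {ae m1, forall t, A t -> m2.-integrable B (fun x => (h (t, x))%:E)}.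
Proof.
apply: filterS (ae_integrable1 mf) => t + At; rewrite (fE At) => ht.
by apply/integrable_mkcond.
Qed.

Let FE t : A t -> fubini_F m2 f t = (\int[m2]_(x in B) (h (t, x))%:E)%E.
Proof. by move=> At; rewrite /fubini_F (fE At) -integral_mkcond. Qed.

Let FE0 t : ~ A t -> fubini_F m2 f t = 0%E.
Proof. by move=> nA; rewrite /fubini_F (fE0 nA) integral0. Qed.

Let finF : {ae m1, forall t, A t -> fubini_F m2 f t = (\int[m2]_(x in B) h (t, x))%:E}.
Proof.
apply: filterS fubini_ae_integrable => t /[swap] At /(_ At) it.
by rewrite (FE At) /Rintegral fineK //; exact: integrable_fin_num.
Qed.

Lemma fubini_integrable : m1.-integrable A (EFin \o (fun t => \int[m2]_(x in B) h (t, x))).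
Proof.
have iF : m1.-integrable A (fubini_F m2 f) by apply: (integrableS measurableT) (integrable_fubini_F mf).
apply/integrableP; split.
  apply/measurable_EFinP.
  have mF : measurable_fun setT (fun t => fine (fubini_F m2 f t)).
    exact: (measurableT_comp (fine_measurable measurableT) (measurable_fubini_F mf)).
  apply: eq_measurable_fun (measurable_funTS mF) => t; rewrite inE => At.
  by rewrite (FE At).
have /integrableP[_] := iF; apply: le_lt_trans.
rewrite le_eqVlt; apply/orP; left; apply/eqP; apply: ge0_ae_eq_integral_nomeas => //.
by apply: filterS finF => t /[swap] At /(_ At) ->.
Qed.

Lemma fubini_Rintegral : \int[(m1 \x m2)%E]_(z in A `*` B) h z = \int[m1]_(t in A) \int[m2]_(x in B) h (t, x).
Proof.
have E : (\int[(m1 \x m2)%E]_(z in A `*` B) (h z)%:E =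
    \int[m1]_(t in A) ((\int[m2]_(x in B) h (t, x))%R)%:E)%E.
  rewrite integral_mkcond -/f -(integral12_prod_meas1 mf) [RHS]integral_mkcond.
  apply: ae_eq_integral_nomeas; apply: filterS finF => t ht _; rewrite patchE; case: ifPn => [|/negP] At.
    by rewrite ht //; exact: set_mem.
  by rewrite FE0 // => h1; apply: At; exact: mem_set.
by rewrite {1 2}/Rintegral E.
Qed.

End fubini_rectangle.

Section space_time_slices.
Context (R : realType) (d : nat) (T : R) (Omega : set 'rV[R]_d).
Hypotheses (oO : open Omega) (bO : bounded_set Omega) (T0 : 0 < T).
Local Notation X := 'rV[R]_d.
Local Notation Z := (R * 'rV[R]_d)%type.
Local Notation MZ := (measurableTypeR R * 'rV[R]_d)%type.
Local Notation muX := (lebesgue_rV R d).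
Local Notation muZ := (lebZ R d).
Local Notation leb := (@lebesgue_measure R).
Local Notation Q := (Qset T Omega).
Local Notation I := (`]0, T[%classic : set (measurableTypeR R)).
Implicit Types (a h : Z -> R) (v : X -> R).

Let mO : measurable Omega. Proof. exact: measurable_domain. Qed.
Let mQ : measurable Q. Proof. exact: measurable_Q. Qed.
Let mI : measurable I. Proof. exact: measurable_itv. Qed.
Let mI' : measurable (`]0, T]%classic : set (measurableTypeR R)). Proof. exact: measurable_itv. Qed.

Lemma I_fin : (leb I < +oo)%E.
Proof. by rewrite -[X in (X < _)%E]/(lebesgue_measure _) lebesgue_measure_itv /= lte_fin T0 -EFinD ltry. Qed.

Lemma I_sub t : I t -> `]0, T]%classic t.
Proof. by rewrite /= !in_itv /= => /andP[-> /ltW ->]. Qed.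

Lemma aeT : {ae leb, forall t : measurableTypeR R, t != T}.
Proof.
exists [set T]; split; [exact: measurable_set1|exact: lebesgue_measure_set1|].
by move=> t /= /negP/negPn/eqP.
Qed.

Lemma Rintegral_I (H : R -> R) : \int[leb]_(t in `]0, T]%classic) H t = \int[leb]_(t in I) H t.
Proof.
rewrite /Rintegral [in LHS]integral_mkcond [in RHS]integral_mkcond; congr fine.
apply: ae_eq_integral_nomeas; apply: filterS aeT => t tT _; rewrite !patchE.
suff -> : (t \in `]0, T]%classic) = (t \in `]0, T[%classic) by [].
by apply/idP/idP; rewrite !inE /= !in_itv /= => /andP[-> h] /=; [rewrite lt_neqAle tT|exact: ltW].
Qed.

Lemma ae_I_sub (P : R -> Prop) : {ae leb, forall t : measurableTypeR R, `]0, T]%classic t -> P t} ->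
  {ae leb, forall t : measurableTypeR R, I t -> P t}.
Proof. by apply: filterS => t ht /I_sub; exact: ht. Qed.

Lemma slice_integrable h : muZ.-integrable Q (EFin \o h) ->
  [/\ {ae leb, forall t : measurableTypeR R, I t -> muX.-integrable Omega (fun x => (h (t, x))%:E)},
      leb.-integrable I (EFin \o (fun t => \int[muX]_(x in Omega) h (t, x)))
    & \int[muZ]_(z in Q) h z = \int[leb]_(t in I) \int[muX]_(x in Omega) h (t, x)].
Proof.
move=> ih; split.
- by apply: ae_I_sub; exact: (fubini_ae_integrable mI' mO ih).
- by apply: (integrableS mI' mI _ (fubini_integrable mI' mO ih)) => t; exact: I_sub.
- by rewrite -Rintegral_I; exact: (fubini_Rintegral mI' mO ih).
Qed.

Lemma slice_ae (P : Z -> Prop) : {ae muZ, forall z : MZ, Q z -> P z} ->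
  {ae leb, forall t : measurableTypeR R, I t -> {ae muX, forall x, Omega x -> P (t, x)}}.
Proof.
move=> /(@ae_xsection _ _ _ _ _ leb muX); apply: filterS => t ht It.
by apply: filterS ht => x hx Ox; apply: hx; split => //=; exact: I_sub.
Qed.

Lemma slice_measurable a t : measurable_fun Q (a : MZ -> measurableTypeR R) -> I t ->
  measurable_fun Omega (fun x => a (t, x) : measurableTypeR R).
Proof.
move=> ma It; have mp : measurable_fun Omega (pair t : X -> MZ).
  by apply: measurable_funTS; exact: measurable_pair1.
apply: (measurable_comp mQ _ ma mp).
by move=> _ [x Ox <-]; split => //=; exact: I_sub.
Qed.

Lemma slice_L2 a : in_L2 muZ Q a ->
  {ae leb, forall t : measurableTypeR R, I t -> in_L2 muX Omega (fun x => a (t, x))}.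
Proof.
move=> La; have [h _ _] := slice_integrable (in_L2_integrable_sqr La).
apply: filterS h => t /[swap] It /(_ It) it; apply/in_L2E; split; first exact: slice_measurable La.1 It.
have /integrableP[_] := it; apply: le_lt_trans; rewrite le_eqVlt; apply/orP; left; apply/eqP.
by apply: eq_integral => x _ /=; rewrite ger0_norm ?sqr_ge0.
Qed.

Lemma slice_ip a b : in_L2 muZ Q a -> in_L2 muZ Q b ->
  leb.-integrable I (EFin \o (fun t => ip muX Omega (fun x => a (t, x)) (fun x => b (t, x)))) /\
  ip muZ Q a b = \int[leb]_(t in I) ip muX Omega (fun x => a (t, x)) (fun x => b (t, x)).
Proof. by move=> La Lb; have [_ h1 h2] := slice_integrable (in_L2_integrableM mQ La Lb). Qed.

Lemma in_L2_snd v : in_L2 muX Omega v -> in_L2 muZ Q (fun z => v z.2).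
Proof.
move=> Lv; have mv : measurable_fun Q ((fun z => v z.2) : MZ -> measurableTypeR R).
  apply: (measurable_comp mO _ Lv.1 (measurable_funTS measurable_snd)).
  by move=> _ [z [_ Oz] <-].
apply/in_L2E; split=> //.
have mf : measurable_fun setT (((fun z : MZ => ((v z.2) ^+ 2)%:E) \_ Q)%E).
  apply/(measurable_restrictT _ mQ); apply/measurable_EFinP; exact: measurable_funX.
rewrite integral_mkcond -[X in (X < _)%E]/(\int[(leb \x muX)%E]_z _)%E.
rewrite fubini_tonelli1 //; last by move=> z; rewrite patchE; case: ifP => // _; rewrite lee_fin sqr_ge0.
have /in_L2E[_ fv] := Lv.
have -> : fubini_F muX ((fun z : MZ => ((v z.2) ^+ 2)%:E) \_ Q) =
    ((fun t => (\int[muX]_(x in Omega) ((v x) ^+ 2)%:E)%E) \_ `]0, T]%classic).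
  apply/funext => t; rewrite /fubini_F [RHS]patchE; case: ifPn => [|/negP] ht.
    rewrite [RHS]integral_mkcond; apply: eq_integral => x _; rewrite !patchE.
    suff -> : ((t, x) \in Q) = (x \in Omega) by [].
    apply/idP/idP; rewrite !inE; first by case.
    by move=> Ox; split => //; exact: set_mem.
  rewrite integral0_eq // => x _; rewrite patchE memNset // => -[h _]; apply: ht; exact: mem_set.
rewrite -integral_mkcond integral_cst // lte_mul_pinfty //.
- by apply: integral_ge0 => x _; rewrite lee_fin sqr_ge0.
- by rewrite ge0_fin_numE // integral_ge0 // => x _; rewrite lee_fin sqr_ge0.
- by rewrite -[X in (X < _)%E]/(lebesgue_measure _) lebesgue_measure_itv /= lte_fin T0 -EFinD ltry.
Qed.

Lemma slice_ip_measurable a v : in_L2 muZ Q a -> in_L2 muX Omega v ->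
  leb.-integrable I (EFin \o (fun t => ip muX Omega (fun x => a (t, x)) v)).
Proof. by move=> La Lv; have [] := slice_ip La (in_L2_snd Lv). Qed.

End space_time_slices.

(** * Functionals evaluated along a path with values in H10 *)

Section paths.
Context (R : realType) (d : nat) (T : R) (Omega : set 'rV[R]_d).
Hypotheses (oO : open Omega) (bO : bounded_set Omega) (T0 : 0 < T).
Local Notation X := 'rV[R]_d.
Local Notation leb := (@lebesgue_measure R).
Local Notation Q := (Qset T Omega).
Local Notation I := (`]0, T[%classic : set (measurableTypeR R)).

Let mI : measurable I. Proof. exact: measurable_itv. Qed.

(** The continuous functions [x / (x^2 + 1/(m + 1))] converge to the inverse everywhere, also at 0,
    where the inverse is 0 by convention. *)
Lemma measurable_invr : measurable_fun setT ((fun x : R => x^-1) : measurableTypeR R -> measurableTypeR R).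
Proof.
have h (m : nat) : measurable_fun setT ((fun x : R => x * (x * x + m.+1%:R^-1)^-1) : measurableTypeR R -> measurableTypeR R).
  apply: continuous_measurable_fun; apply: smooth_continuous; apply: smooth_mul; first exact: smooth_id.
  apply: smooth_inv => [|x]; last by rewrite gt_eqF // ltr_wpDl ?invr_gt0 // -expr2 sqr_ge0.
  by apply: smooth_add; [apply: smooth_mul; exact: smooth_id|exact: smooth_cst].
apply: (measurable_fun_cvg h) => x _.
have [->|x0] := eqVneq x 0.
  by rewrite invr0; under eq_fun do rewrite mul0r; exact: cvg_cst.
have -> : x^-1 = x * (x * x + 0)^-1 by rewrite addr0 invfM mulVKf.
apply: cvgM; first exact: cvg_cst.
apply: cvgV; first by rewrite addr0 mulf_neq0.
by apply: cvgD; [exact: cvg_cst|exact: cvg_harmonic].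
Qed.

(** Values along a path are only known to agree almost everywhere with a measurable function of [t].
    Since the integral ignores null sets, this is enough for linearity. *)
Definition aeint (h : R -> R) := exists2 h', leb.-integrable I (EFin \o h') &
  {ae leb, forall t : measurableTypeR R, I t -> h t = h' t}.

Lemma aeint_lin (c : R) h k : aeint h -> aeint k -> aeint (fun t => c * h t + k t) /\
  \int[leb]_(t in I) (c * h t + k t) = c * \int[leb]_(t in I) h t + \int[leb]_(t in I) k t.
Proof.
move=> [h' ih hh] [k' ik hk].
have E : {ae leb, forall t : measurableTypeR R, I t -> c * h t + k t = c * h' t + k' t}.
  by apply: filterS2 hh hk => t h1 h2 It; rewrite h1 // h2.
have ich : leb.-integrable I (EFin \o (fun t => c * h' t)).
  exact: (integrableZl mI c ih).
split; first by exists (fun t => c * h' t + k' t) => //; exact: (integrableD mI ich ik).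
rewrite (ae_eq_Rintegral_nomeas E) (ae_eq_Rintegral_nomeas hh) (ae_eq_Rintegral_nomeas hk).
by rewrite -RintegralZl // -RintegralD.
Qed.

Variables (phi : R -> X -> R) (hphi : in_L2H10 T Omega phi).

Lemma path_H10 : {ae leb, forall t : measurableTypeR R, I t -> in_H10 Omega (phi t)}.
Proof. by case: hphi. Qed.

Definition H10_linear (F : (X -> R) -> R) := forall (c : R) v w, in_H10 Omega v -> in_H10 Omega w ->
  F (fun x => c * v x + w x) = c * F v + F w.

Lemma H10_linear_sum F n (c : 'I_n -> R) (v : 'I_n -> X -> R) : H10_linear F -> (forall i, in_H10 Omega (v i)) ->
  in_H10 Omega (fun x => \sum_i c i * v i x) /\ F (fun x => \sum_i c i * v i x) = \sum_i c i * F (v i).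
Proof.
move=> Fl hv; have hz := in_H10_test oO bO (test_fun0 Omega).
have F0 : F (fun=> 0) = 0.
  have := Fl (-1) _ _ hz hz; under [X in F X]eq_fun do rewrite mulr0 addr0.
  by rewrite mulN1r addNr.
elim: n c v hv => [|n ih] c v hv.
  by split; [under eq_fun do rewrite big_ord0|under eq_fun do rewrite big_ord0; rewrite big_ord0].
have [h1 h2] := ih (fun i => c (lift ord0 i)) (fun i => v (lift ord0 i)) (fun i => hv _).
have E : (fun x => \sum_i c i * v i x) = fun x => c ord0 * v ord0 x + (fun x => \sum_i c (lift ord0 i) * v (lift ord0 i) x) x.
  by apply/funext => x; rewrite big_ord_recl.
rewrite E big_ord_recl; split; first exact: (in_H10_lin oO bO (c ord0) (hv ord0) h1).
by rewrite (Fl _ _ _ (hv ord0) h1) h2.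
Qed.

(** On a simple path the functional is a finite sum of indicators times [F t (v i)]. Continuity of
    [F t] in the gradient norm passes to the limit, and the upper limit of the approximations is a
    measurable representative. *)
Lemma path_measurable (F : R -> (X -> R) -> R) :
  {ae leb, forall t : measurableTypeR R, I t -> H10_linear (F t) /\
     exists C : R, forall v, in_H10 Omega v -> `|F t v| <= C * gnorm Omega v} ->
  (forall v, in_H10 Omega v -> measurable_fun I (fun t => F t v : measurableTypeR R)) ->
  exists2 h, measurable_fun I (h : measurableTypeR R -> measurableTypeR R) &
    {ae leb, forall t : measurableTypeR R, I t -> F t (phi t) = h t}.
Proof.
move=> hF mF; have [aeH [phi_ [sphi cphi]] _] := hphi.
have /choice[h_ hh] : forall k, exists h : R -> R, measurable_fun I (h : measurableTypeR R -> measurableTypeR R) /\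
    forall t, H10_linear (F t) -> in_H10 Omega (phi_ k t) /\ F t (phi_ k t) = h t.
  move=> k; have [n [A [v [hv ->]]]] := sphi k.
  exists (fun t => \sum_i \1_(A i) t * F t (v i)); split; last first.
    by move=> t Ft; exact: (H10_linear_sum (fun i => \1_(A i) t) Ft (fun i => (hv i).2)).
  apply: (@measurable_sum _ _ R I _ (index_enum _) (fun i t => \1_(A i) t * F t (v i))) => i.
  apply: measurable_funM; last exact: mF (hv i).2.
  by apply: measurable_funTS; exact: measurable_indic (hv i).1.
have lim : {ae leb, forall t : measurableTypeR R, I t -> h_ k t @[k --> \oo] --> F t (phi t)}.
  have hF2 := hF; have aeH2 := aeH.
  have : {ae leb, forall t : measurableTypeR R, I t -> (H10_linear (F t) /\
     exists C : R, forall v, in_H10 Omega v -> `|F t v| <= C * gnorm Omega v) /\ in_H10 Omega (phi t)}.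
    by apply: filterS2 hF aeH => t h1 h2 It; split; [exact: h1|exact: h2].
  move=> h1; apply: filterS2 h1 cphi => t + + It => /(_ It)[[Fl [C hC]] Hp] /(_ It) cp.
  have Hk k : in_H10 Omega (phi_ k t) by case: ((hh k).2 t Fl).
  have cg : gnorm Omega (phi_ k t \- phi t) @[k --> \oo] --> (0 : R).
    have := cp; under eq_fun => k do rewrite (normX_grad oO (in_H10_H1 (in_H10_B oO bO (Hk k) Hp))).
    by move/fine_cvg.
  apply/cvgrPdist_le => e e0; near=> k.
  have -> : h_ k t = F t (phi_ k t) by case: ((hh k).2 t Fl).
  have -> : F t (phi t) - F t (phi_ k t) = - F t (phi_ k t \- phi t).
    have -> : phi_ k t \- phi t = fun x => -1 * phi t x + phi_ k t x by apply/funext => x /=; ring.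
    by rewrite (Fl _ _ _ Hp (Hk k)) mulN1r opprD opprK.
  rewrite normrN; apply: le_trans (hC _ (in_H10_B oO bO (Hk k) Hp)) _.
  apply: (@le_trans _ _ ((`|C| + 1) * gnorm Omega (phi_ k t \- phi t))).
    by rewrite ler_wpM2r ?gnorm_ge0 // (le_trans (ler_norm _)) // lerDl.
  have C1 : 0 < `|C| + 1 by rewrite ltr_wpDl.
  rewrite -ler_pdivlMl // mulrC; near: k.
  by have /cvgr_le := cg; apply; rewrite divr_gt0 // ltr_wpDl.
exists (fun t => fine (limn_esup (fun k => (h_ k t)%:E))).
  apply: (measurableT_comp (fine_measurable measurableT)).
  by apply: measurable_fun_limn_esup => k; apply/measurable_EFinP; exact: (hh k).1.
apply: filterS lim => t + It => /(_ It) hc.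
have hce : (h_ k t)%:E @[k --> \oo] --> (F t (phi t))%:E by apply: cvg_EFin => //; exact: nearW.
rewrite is_cvg_limn_esupE; last by apply/cvg_ex; exists (F t (phi t))%:E.
by rewrite (cvg_lim _ hce).
Unshelve. all: by end_near. Qed.

(** Measurability in [t] of the gradient norm of [phi t] is not at hand, so Cauchy-Schwarz is
    applied to the product of [C] and [k = h / C]: this quotient is measurable and bounded by that
    norm, hence its square integral is at most the energy. *)
Lemma path_CS (h C : R -> R) : measurable_fun I (h : measurableTypeR R -> measurableTypeR R) ->
  in_L2 leb I C -> {ae leb, forall t : measurableTypeR R, I t -> `|h t| <= C t * gnorm Omega (phi t)} ->
  leb.-integrable I (EFin \o h) /\
  (energy T Omega phi = 1%E -> `|\int[leb]_(t in I) h t| <= Num.sqrt (ip leb I C C)).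
Proof.
move=> mh LC hb; have [aeH _ fe] := hphi.
(* Where [C] vanishes, so does [h] almost everywhere, and [0^-1 = 0] gives [k = 0]; thus [h = C k]
   survives. *)
pose k t := h t * (C t)^-1.
have mk : measurable_fun I (k : measurableTypeR R -> measurableTypeR R).
  by apply: measurable_funM => //; exact: (measurableT_comp measurable_invr LC.1).
have kle : ((\int[leb]_(t in I) ((k t) ^+ 2)%:E) <= energy T Omega phi)%E.
  apply: ge0_ae_le_integral.
  - by move=> t _; rewrite lee_fin sqr_ge0.
  - by move=> t _; rewrite expe_ge0 // L2norm_ge0.
  - apply: filterS2 hb aeH => t + + It => /(_ It) hb /(_ It) Hp.
    rewrite (normX_grad oO (in_H10_H1 Hp)) -EFin_expe lee_fin -[X in X <= _]real_normK ?num_real //.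
    rewrite ler_sqr ?nnegrE ?gnorm_ge0 // /k normrM normfV.
    have [C0|C0] := eqVneq (C t) 0; first by rewrite C0 normr0 invr0 mulr0 gnorm_ge0.
    rewrite ler_pdivrMr ?normr_gt0 //; apply: le_trans hb _.
    by rewrite mulrC ler_wpM2l ?gnorm_ge0 // ler_norm.
have Lk : in_L2 leb I k by apply/in_L2E; split => //; exact: le_lt_trans fe.
have hE : {ae leb, forall t : measurableTypeR R, I t -> h t = C t * k t}.
  apply: filterS hb => t + It => /(_ It) hb; rewrite /k.
  have [C0|C0] := eqVneq (C t) 0; last by rewrite mulrCA mulfV ?mulr1.
  by move: hb; rewrite C0 mul0r normr_le0 => /eqP ->; rewrite !mul0r.
have iCk := in_L2_integrableM mI LC Lk.
split.
  apply/integrableP; split; first exact/measurable_EFinP.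
  have /integrableP[_] := iCk; apply: le_lt_trans; rewrite le_eqVlt; apply/orP; left; apply/eqP.
  by apply: ge0_ae_eq_integral_nomeas => //; apply: filterS hE => t + It => /(_ It) /= ->.
move=> e1; rewrite (ae_eq_Rintegral_nomeas hE) -/(ip leb I C k).
apply: le_trans (ip_CS mI LC Lk) _; rewrite -[leRHS]mulr1 ler_wpM2l ?sqrtr_ge0 //.
rewrite -[leRHS]sqrtr1; apply: ler_wsqrtr.
by move: kle; rewrite e1 ip_integral // lee_fin.
Qed.

End paths.

(** * Time derivatives in H-1 *)

Section time_derivative.
Context (R : realType) (d : nat) (T : R) (Omega : set 'rV[R]_d).
Hypotheses (oO : open Omega) (bO : bounded_set Omega) (T0 : 0 < T).
Local Notation X := 'rV[R]_d.
Local Notation Z := (R * 'rV[R]_d)%type.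
Local Notation MZ := (measurableTypeR R * 'rV[R]_d)%type.
Local Notation muX := (lebesgue_rV R d).
Local Notation muZ := (lebZ R d).
Local Notation leb := (@lebesgue_measure R).
Local Notation Q := (Qset T Omega).
Local Notation I := (`]0, T[%classic : set (measurableTypeR R)).

Let mO : measurable Omega. Proof. exact: measurable_domain. Qed.
Let fO : (muX Omega < +oo)%E. Proof. exact: domain_fin. Qed.
Let mQ : measurable Q. Proof. exact: measurable_Q. Qed.
Let mI : measurable I. Proof. exact: measurable_itv. Qed.
Let fI : (leb I < +oo)%E. Proof. exact: I_fin. Qed.

Lemma tensor_smooth (theta : R -> R) (psi : X -> R) : smooth theta -> smooth psi ->
  smooth (fun z : Z => theta z.1 * psi z.2).
Proof.
move=> st sp; apply: smooth_mul.
  have cf : continuous (fst : Z -> R) by move=> z; exact: cvg_fst.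
  have := @smooth_comp_affine R Z R (fst : {linear Z -> R}) 0 theta cf st.
  by congr smooth; apply/funext => z; rewrite addr0.
have cs : continuous (snd : Z -> X) by move=> z; exact: cvg_snd.
have := @smooth_comp_affine R Z X (snd : {linear Z -> X}) 0 psi cs sp.
by congr smooth; apply/funext => z; rewrite addr0.
Qed.

Lemma tensor_test (theta : R -> R) (psi : X -> R) : @test_fun R R `]0, T[%classic theta -> test_fun Omega psi ->
  @test_fun R Z (Qopen T Omega) (fun z : Z => theta z.1 * psi z.2).
Proof.
move=> [st ct ot] [sp cp op].
set St := closure [set x | theta x != 0] in ct ot; set Sp := closure [set x | psi x != 0] in cp op.
have cS : compact (St `*` Sp : set Z) by exact: compact_setX.
have sub : closure [set z : Z | theta z.1 * psi z.2 != 0] `<=` St `*` Sp.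
  have cl : closed (St `*` Sp : set Z).
    rewrite (_ : _ `*` _ = (fst @^-1` St) `&` (snd @^-1` Sp)) //; apply: closedI.
      by apply: closed_comp (@closed_closure _ _) => z _; exact: cvg_fst.
    by apply: closed_comp (@closed_closure _ _) => z _; exact: cvg_snd.
  rewrite [X in _ `<=` X](closure_id _).1 //; apply: closure_subset => z /=.
  by rewrite mulf_eq0 negb_or => /andP[h1 h2]; split; exact: subset_closure.
split; first exact: tensor_smooth.
- by apply: (subclosed_compact _ cS sub); exact: closed_closure.
- by move=> z /sub[h1 h2]; split; [exact: ot|exact: op].
Qed.

Lemma tensor_dt (theta : R -> R) (psi : X -> R) (z : Z) : smooth theta -> smooth psi ->
  'D_((1, 0) : Z) (fun z : Z => theta z.1 * psi z.2) z = 'D_1 theta z.1 * psi z.2.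
Proof.
move=> st sp; have ss := tensor_smooth st sp.
have d1 := diff_derivable (smooth_diff ss z) : derivable _ z ((1, 0) : Z).
have d2 := diff_derivable (smooth_diff st z.1) : derivable theta z.1 1.
have c1 := backward_difference d1.
have c2 : psi z.2 @[m --> \oo] --> psi z.2 by exact: cvg_cst.
have c3 := cvgM (backward_difference d2) c2.
have E : (fun m : nat => m.+1%:R * (theta z.1 * psi z.2 -
      theta (z + (- m.+1%:R^-1) *: ((1, 0) : Z)).1 * psi (z + (- m.+1%:R^-1) *: ((1, 0) : Z)).2)) =
    (fun m : nat => m.+1%:R * (theta z.1 - theta (z.1 + (- m.+1%:R^-1) *: 1)) * psi z.2).
  by apply/funext => m /=; rewrite scaler0 addr0; ring.
by move: c1; rewrite [X in nbhs (X @ \oo)]E => c1; exact: (cvg_unique _ c1 (c3 _)).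
Qed.

Lemma tensor_dx (theta : R -> R) (psi : X -> R) (e : X) (z : Z) : smooth theta -> smooth psi ->
  'D_((0, e) : Z) (fun z : Z => theta z.1 * psi z.2) z = theta z.1 * 'D_e psi z.2.
Proof.
move=> st sp; have ss := tensor_smooth st sp.
have d1 := diff_derivable (smooth_diff ss z) : derivable _ z ((0, e) : Z).
have d2 := diff_derivable (smooth_diff sp z.2) : derivable psi z.2 e.
have c1 := backward_difference d1.
have c2 : theta z.1 @[m --> \oo] --> theta z.1 by exact: cvg_cst.
have c3 := cvgM c2 (backward_difference d2).
have E : (fun m : nat => m.+1%:R * (theta z.1 * psi z.2 -
      theta (z + (- m.+1%:R^-1) *: ((0, e) : Z)).1 * psi (z + (- m.+1%:R^-1) *: ((0, e) : Z)).2)) =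
    (fun m : nat => theta z.1 * (m.+1%:R * (psi z.2 - psi (z.2 + (- m.+1%:R^-1) *: e)))).
  by apply/funext => m /=; rewrite scaler0 addr0; ring.
by move: c1; rewrite [X in nbhs (X @ \oo)]E => c1; exact: (cvg_unique _ c1 (c3 _)).
Qed.

Variables (CP : R) (hCP : poincare_constant Omega CP).
Local Notation CPh := (CP * diam Omega).

(** [Hm1norm] leaves out the functions of zero [L^2] norm but divides by the gradient norm. With the
    Poincare inequality this shows that the two have the same zeros on [H^1_0]. *)
Lemma normX0_gnorm0 v : in_H1 Omega v -> ip muX Omega v v = 0 -> gnorm Omega v = 0.
Proof.
move=> hv v0; have hz := ip_eq0 mO hv.1 v0.
have hd j : is_d Omega j v (fun=> 0).
  split; first exact: in_L2_0.
  move=> psi tp; rewrite (@ae_eq_Rintegral_nomeas _ _ _ _ _ _ (fun=> 0)); last first.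
    by apply: filterS hz => x hx Ox; rewrite hx // mul0r.
  rewrite [in RHS](@eq_Rintegral _ _ _ _ _ (fun=> 0)); last by move=> x _; rewrite mul0r.
  by rewrite /Rintegral integral0 oppr0.
rewrite /gnorm /aform (vip_ae (grad_ae oO bO hd) (grad_ae oO bO hd)) /vip big1 ?sqrtr0 // => j _.
by rewrite /ip; under eq_Rintegral do rewrite mxE mul0r; rewrite /Rintegral integral0.
Qed.

(** Otherwise the Poincare inequality would make every test function vanish almost everywhere,
    whereas the bumps of a box inside [Omega] converge to an indicator of positive integral. This
    keeps the suprema of the dual norms from being empty. *)
Lemma H10_nontrivial : Omega !=set0 -> exists2 psi, test_fun Omega psi & 0 < gnorm Omega psi.
Proof.
move=> [x0 Ox0]; apply: contrapT => hn.
have tz psi : test_fun Omega psi -> ip muX Omega psi psi = 0.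
  move=> tp; apply: contrapT => /eqP n0; apply: hn; exists psi => //.
  rewrite lt_neqAle gnorm_ge0 andbT eq_sym; apply: contra_neq n0 => g0.
  have := poincare oO hCP (in_H10_test oO bO tp); rewrite g0 mulr0 => h.
  have h0 : Num.sqrt (ip muX Omega psi psi) == 0 by rewrite eq_le h sqrtr_ge0.
  by apply/eqP; move: h0; rewrite sqrtr_eq0 eq_le ip_ge0 andbT.
have [r /= r0 hr] := (@nbhs_ballP _ _ x0 Omega).1 (open_nbhs_nbhs (conj oO Ox0)).
pose a k := x0 ord0 k - r / 2; pose b k := x0 ord0 k + r / 2.
have sub : cbox (fun k (x : X) => x ord0 k) a b `<=` Omega.
  move=> x hx; apply: hr; rewrite -ball_normE /ball_ /=; apply/norm_rV_lt => // k.
  have /andP[] := hx k; rewrite !mxE /a /b ltr_norml => *; apply/andP; split; lra.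
have hz m := ip_eq0 mO (test_L2 oO bO (test_fun_bump (coordsV R d) m sub)) (tz _ (test_fun_bump (coordsV R d) m sub)).
have z : {ae muX, forall x, forall m, Omega x -> bump (fun k (x : X) => x ord0 k) a b m x = 0} by exact/ae_foralln.
have : muX (boxrV a b) = 0%E.
  apply/negligibleP; first exact: measurable_boxrV.
  apply: negligibleS z => x bx h; have Ox : Omega x.
    by apply: sub => k; have /andP[h1 h2] := bx k; apply/andP; split; exact: ltW.
  have : (0 : R) = 1; last by move/esym/eqP; rewrite oner_eq0.
  have c := @bump_cvg _ _ _ (fun k (x : X) => x ord0 k) a b x; rewrite indicE mem_set // in c.
  have c0 : bump (fun k (x : X) => x ord0 k) a b m x @[m --> \oo] --> (0 : R).
    by apply: cvg_near_cst; apply: nearW => m; exact: h.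
  exact: (cvg_unique _ c0 c).
have h : (0 < muX (boxrV a b))%E by apply: (lebesgue_boxrV a b).2 => k; rewrite /a /b; lra.
by move=> E; move: h; rewrite E ltxx.
Qed.

(** Nonemptiness matters: an empty supremum is minus infinity, whose square is infinite. *)
Lemma ereal_sup_sqr_le (S : set (\bar R)) (c : R) : S !=set0 -> (forall y, S y -> (`|y| <= c%:E)%E) ->
  (ereal_sup S ^+ 2 <= (c ^+ 2)%:E)%E.
Proof.
move=> [y Sy] hS; have h1 : (ereal_sup S <= c%:E)%E.
  by apply: ge_ereal_sup => z /hS; apply: le_trans; exact: lee_abs.
have h2 : (- c%:E <= ereal_sup S)%E.
  by apply: le_trans (ereal_sup_ubound Sy); rewrite leeNl; apply: le_trans (hS y Sy); rewrite -abseN lee_abs.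
move: h1 h2; case: (ereal_sup S) => [r| |]; rewrite ?leye_eq ?leeNy_eq //.
rewrite -EFinN !lee_fin => h1 h2; nra.
Qed.

Lemma Hm1norm_sqr_le F b : Omega !=set0 -> (forall v, in_H10 Omega v -> `|F v| <= b * gnorm Omega v) ->
  (Hm1norm Omega F ^+ 2 <= (b ^+ 2)%:E)%E.
Proof.
move=> O0 h; apply: ereal_sup_sqr_le.
  have [psi tp g0] := H10_nontrivial O0; have hp := in_H10_test oO bO tp.
  exists (F psi / fine (normX_vec Omega (grad Omega psi)))%:E; exists psi => //; split=> //.
  rewrite (L2normE_real oO (in_H10_H1 hp).1) eqe sqrtr_eq0 -ltNge; move: g0; rewrite lt_neqAle => /andP[g0 _].
  rewrite lt_neqAle ip_ge0 andbT eq_sym; apply: contra_neq g0 => /normX0_gnorm0 -> //; exact: in_H10_H1.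
move=> _ [v [hv nv] <-]; have hv1 := in_H10_H1 hv.
rewrite (normX_grad oO hv1) lee_fin /=.
have g0 : 0 < gnorm Omega v.
  rewrite lt_neqAle gnorm_ge0 andbT eq_sym; apply: contra nv => /eqP g0.
  have := poincare oO hCP hv; rewrite g0 mulr0 => h0; rewrite (L2normE_real oO hv1.1).
  by rewrite eqe eq_le h0 sqrtr_ge0.
by rewrite normrM normfV (gtr0_norm g0) ler_pdivrMr // h.
Qed.

(** The supremum runs over signed quotients; the absolute value comes from testing with [v] and with
    its opposite. If the gradient norm of [v] is 0, the boundedness of [F] gives [F v = 0]. *)
Lemma Hm1norm_ge F v : in_Hm1 Omega F -> in_H10 Omega v ->
  (`|F v|%:E <= Hm1norm Omega F * (gnorm Omega v)%:E)%E.
Proof.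
move=> [Fl [C hC]] hv; have hv1 := in_H10_H1 hv.
have hC' : `|F v| <= C * gnorm Omega v by have := hC v hv; rewrite (normX_grad oO hv1) -EFinM lee_fin.
have [g0|g0] := eqVneq (gnorm Omega v) 0.
  by rewrite g0 mule0 lee_fin; move: hC'; rewrite g0 mulr0.
have gp : 0 < gnorm Omega v by rewrite lt_neqAle eq_sym g0 gnorm_ge0.
have hn u : in_H10 Omega u -> gnorm Omega u = gnorm Omega v -> ((F u)%:E <= Hm1norm Omega F * (gnorm Omega v)%:E)%E.
  move=> hu gu; have hu1 := in_H10_H1 hu.
  have -> : F u = F u / gnorm Omega v * gnorm Omega v by rewrite mulfVK.
  rewrite EFinM lee_pmul2r; [|by []|by rewrite lte_fin]; apply: ereal_sup_ubound.
  exists u; last by rewrite (normX_grad oO hu1) gu.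
  split; first exact: hu.
  apply: contra_neq g0; rewrite (L2normE_real oO hu1.1) -gu => -[] /eqP; rewrite sqrtr_eq0 => h.
  by apply: (normX0_gnorm0 hu1); apply/eqP; rewrite eq_le h ip_ge0.
have hz := in_H10_test oO bO (test_fun0 Omega).
have F0 : F (fun=> 0) = 0.
  have := Fl (-1) _ _ hz hz; under [X in F X]eq_fun do rewrite mulr0 addr0.
  by rewrite mulN1r addNr.
have FN : F (fun x => -1 * v x) = - F v.
  have := Fl (-1) _ _ hv hz; under [X in F X]eq_fun do rewrite addr0.
  by rewrite F0 addr0 mulN1r.
have h1 := hn v hv erefl.
have h2 : ((- F v)%:E <= Hm1norm Omega F * (gnorm Omega v)%:E)%E.
  rewrite -FN; apply: hn; first exact: in_H10_Z.
  have hz1 := in_H10_H1 hz.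
  rewrite (_ : (fun x => -1 * v x) = fun x => -1 * v x + (fun=> 0) x); last by apply/funext => x; rewrite addr0.
  rewrite /gnorm (aform_lin2 oO bO _ hv1 hz1).
  have a0 u : in_H1 Omega u -> aform Omega u (fun=> 0) = 0.
    move=> hu; rewrite aformC; have := aform_lin oO bO (-1) hz1 hz1 hu.
    by under [X in aform _ X _]eq_fun do rewrite mulr0 addr0; rewrite mulN1r addNr.
  by rewrite a0 // a0 // mulr0 !addr0 expr2 mulN1r opprK mul1r.
by have [h|h] := leP 0 (F v); rewrite ?(ger0_norm h) ?(ltr0_norm h).
Qed.

Lemma H10_dense_zero (psi_ : nat -> X -> R) (F : (X -> R) -> R) : (forall k, test_fun Omega (psi_ k)) ->
  (forall v, in_H10 Omega v -> forall e, 0 < e -> exists k, gnorm Omega (v \- psi_ k) < e) ->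
  H10_linear Omega F -> (exists C : R, forall v, in_H10 Omega v -> `|F v| <= C * gnorm Omega v) ->
  (forall k, F (psi_ k) = 0) -> forall v, in_H10 Omega v -> F v = 0.
Proof.
move=> tpsi dpsi Fl [C hC] F0 v hv.
apply/eqP; rewrite -normr_le0; apply/ler_addgt0Pr => e e0; rewrite add0r.
have C1 : 0 < `|C| + 1 by rewrite ltr_wpDl.
have [k hk] := dpsi v hv (e / (`|C| + 1)) (divr_gt0 e0 C1).
have hp := in_H10_test oO bO (tpsi k).
have -> : F v = F (v \- psi_ k).
  have := Fl (-1) _ _ hp hv; rewrite F0 mulr0 add0r => <-.
  by congr F; apply/funext => x /=; rewrite mulN1r addrC.
apply: le_trans (hC _ (in_H10_B oO bO hv hp)) _.
apply: (@le_trans _ _ ((`|C| + 1) * gnorm Omega (v \- psi_ k))).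
  by rewrite ler_wpM2r ?gnorm_ge0 // (le_trans (ler_norm C)) // lerDl.
by rewrite -ler_pdivlMl 1?mulrC ?ltW.
Qed.

(** For a fixed [v] this is the fundamental lemma in time, with an exceptional set that depends on
    [v]. A countable dense family leaves a single null set, and boundedness on each slice extends
    the equality to all [v]. *)
Lemma is_dt_Hm1_unique w g g' : is_dt_Hm1 T Omega w g -> is_dt_Hm1 T Omega w g' ->
  {ae leb, forall t : measurableTypeR R, I t -> forall v, in_H10 Omega v -> g t v = g' t v}.
Proof.
move=> [h1 m1 b1 w1] [h1' m1' b1' w1'].
have L2g f v : (forall t, I t -> in_Hm1 Omega (f t)) ->
    (forall v, in_H10 Omega v -> measurable_fun I (fun t => f t v : measurableTypeR R)) ->
    (\int[leb]_(t in I) (Hm1norm Omega (f t) ^+ 2) < +oo)%E ->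
    in_H10 Omega v -> in_L2 leb I (fun t => f t v).
  move=> hf mf bf hv; have hge t (It : I t) := Hm1norm_ge (hf t It) hv.
  have [g0|g0] := eqVneq (gnorm Omega v) 0.
    apply: (in_L2_bounded mI (C := 0)) => //; first exact: mf.
    by move=> t It; have := hge t It; rewrite g0 mule0 lee_fin.
  have gp : 0 < gnorm Omega v by rewrite lt_neqAle eq_sym g0 gnorm_ge0.
  have : in_L2 leb I (fun t => (gnorm Omega v)^-1 * f t v).
    apply/in_L2E; split; first by apply: measurable_funM => //; exact: mf.
    apply: le_lt_trans bf; apply: ge0_ae_le_integral.
    - by move=> t _; rewrite lee_fin sqr_ge0.
    - by move=> t _; rewrite sqre_ge0.
    - apply: aeW => t It; have := hge t It; rewrite muleC -lee_pdivrMl // -EFinM => hg.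
      have a0 : (0 <= ((gnorm Omega v)^-1 * `|f t v|)%:E)%E by rewrite lee_fin mulr_ge0 ?invr_ge0 ?gnorm_ge0.
      have := lee_pmul a0 a0 hg hg; rewrite -EFinM -expe2; apply: le_trans; rewrite lee_fin.
      by rewrite -expr2 !exprMn real_normK ?num_real.
  move=> /(in_L2Z mI (gnorm Omega v)); congr in_L2; apply/funext => t.
  by rewrite mulrA mulfV // mul1r.
have eqv v : in_H10 Omega v -> {ae leb, forall t : measurableTypeR R, I t -> g t v = g' t v}.
  move=> hv; have Lg := L2g g v h1 m1 b1 hv; have Lg' := L2g g' v h1' m1' b1' hv.
  have := @test_orthogonal0 _ _ _ _ _ _ _ _ _ (coordsR R) `]0, T[%classic I (fun t => g t v - g' t v).
  have oI : open (`]0, T[%classic : set R) by exact: interval_open.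
  move=> /(_ oI mI (fun t h => h) (in_L2B mI Lg Lg')) h.
  have : {ae leb, forall t : measurableTypeR R, `]0, T[%classic t -> g t v - g' t v = 0}.
    apply: h => psi tp; have Lp := test_fun_L2 (coordsR R) mI fI tp.
    rewrite -/(ip leb I (fun t => g t v - g' t v) psi) (ipBl mI Lg Lg' Lp).
    have := w1 v psi hv tp; rewrite (w1' v psi hv tp) => /oppr_inj E.
    by rewrite ![ip _ _ (fun t => _ t v) _]ipC /ip E subrr.
  by apply: filterS => t ht /ht /eqP; rewrite subr_eq0 => /eqP.
have [psi_ [tpsi dpsi]] := H10_separable oO bO.
have : {ae leb, forall t : measurableTypeR R, forall k, I t -> g t (psi_ k) = g' t (psi_ k)}.
  by apply/ae_foralln => k; apply: eqv; exact: in_H10_test.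
apply: filterS => t ht It v hv.
have [gl [C hC]] := h1 t It; have [gl' [C' hC']] := h1' t It.
apply/eqP; rewrite -subr_eq0; apply/eqP.
apply: (H10_dense_zero tpsi dpsi (F := fun v => g t v - g' t v)) => //.
- by move=> a u u' hu hu'; rewrite gl // gl' //; ring.
- exists (C + C') => u hu; have hu1 := in_H10_H1 hu.
  apply: le_trans (ler_normB _ _) _; rewrite mulrDl; apply: lerD.
    by have := hC u hu; rewrite (normX_grad oO hu1) -EFinM lee_fin.
  by have := hC' u hu; rewrite (normX_grad oO hu1) -EFinM lee_fin.
- by move=> k; rewrite ht // subrr.
Qed.

Hypothesis O0 : Omega !=set0.
Variables (w gam : Z -> R) (Cg : R).
Hypotheses (Lw : in_L2 muZ Q w) (mg : measurable_fun setT (gam : MZ -> measurableTypeR R))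
  (gC : forall z, `|gam z| <= Cg) (wg : is_dt T Omega w gam).

Definition dt_functional (t : R) (v : X -> R) : R := ip muX Omega (fun x => gam (t, x)) v.

Lemma gam_slice_L2 t : in_L2 muX Omega (fun x => gam (t, x)).
Proof.
apply: (in_L2_bounded mO (C := Cg)) => //.
by apply: measurable_funTS; exact: (measurable_fun_pair2 t mg).
Qed.

Lemma dt_functional_bound t v : in_H10 Omega v ->
  `|dt_functional t v| <= (CPh * Num.sqrt (ip muX Omega (fun x => gam (t, x)) (fun x => gam (t, x)))) * gnorm Omega v.
Proof.
move=> hv; apply: le_trans (ip_CS mO (gam_slice_L2 t) (in_H10_H1 hv).1) _.
have := poincare oO hCP hv; have := sqrtr_ge0 (ip muX Omega (fun x => gam (t, x)) (fun x => gam (t, x))).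
move: (Num.sqrt _) (Num.sqrt _) (gnorm Omega v) (CPh) => a b c e; nra.
Qed.

Lemma ip_bounded_le t : ip muX Omega (fun x => gam (t, x)) (fun x => gam (t, x)) <= Cg ^+ 2 * fine (muX Omega).
Proof.
rewrite /ip; apply: (@le_trans _ _ (\int[muX]_(x in Omega) (Cg ^+ 2))); last first.
  by rewrite /Rintegral integral_cst // fineM // ge0_fin_numE.
have Cg0 : 0 <= Cg by apply: le_trans (gC 0).
apply: le_Rintegral => //.
- exact: in_L2_integrableM (gam_slice_L2 t) (gam_slice_L2 t).
- by apply: (in_L2_integrable mO fO); apply: (in_L2_bounded mO (C := Cg ^+ 2)) => // x _; rewrite ger0_norm ?sqr_ge0.
- by move=> x _; rewrite -expr2 -real_normK ?num_real // ler_sqr ?nnegrE.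
Qed.

(** If [v] is a test function, so is its product with [theta] on the cylinder, and the claim is the
    definition of the weak derivative. The sum [J] of the two integrals over [Q] is continuous in
    the [L^2] norm of [v], so density covers [H^1_0]. *)
Lemma dt_functional_weak v (theta : R -> R) : in_H10 Omega v -> @test_fun R R `]0, T[%classic theta ->
  \int[leb]_(t in I) ('D_1 theta t * \int[muX]_(x in Omega) (w (t, x) * v x)) =
  - \int[leb]_(t in I) (theta t * dt_functional t v).
Proof.
move=> hv tt; have [st _ _] := tt.
have Lg : in_L2 muZ Q gam by exact: wg.1.
have bt (k : R -> R) a : smooth k -> (exists C, forall t, `|k t| <= C) -> in_L2 muZ Q a ->
    in_L2 muZ Q (fun z => k z.1 * a z).
  move=> sk [C hC] La; apply: (in_L2_dom mQ (C := C) _ La); last first.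
    by move=> z _; rewrite normrM ler_wpM2r.
  apply: measurable_funM La.1; apply: measurable_funTS.
  apply: (measurableT_comp _ measurable_fst).
  by apply: continuous_measurable_fun; exact: smooth_continuous.
have L1 := bt _ w (smooth_derive (1 : R) st) (derive_test_bounded (1 : R) tt) Lw.
have L2 := bt _ gam st (test_fun_bounded tt) Lg.
pose J u := ip muZ Q (fun z => 'D_1 theta z.1 * w z) (fun z => u z.2) + ip muZ Q (fun z => theta z.1 * gam z) (fun z => u z.2).
have conv k a u : in_L2 muZ Q (fun z => k z.1 * a z) -> in_L2 muZ Q a -> in_L2 muX Omega u ->
    ip muZ Q (fun z => k z.1 * a z) (fun z => u z.2) = \int[leb]_(t in I) (k t * ip muX Omega (fun x => a (t, x)) u).
  move=> Lk La Lu; rewrite (slice_ip oO Lk (in_L2_snd oO T0 Lu)).2.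
  apply: ae_eq_Rintegral_nomeas; apply: filterS (slice_L2 oO La) => t ht It.
  exact: (ipZl mO (k t) (ht It) Lu).
suff J0 : J v = 0.
  move: J0; rewrite /J (conv ('D_1 theta) w v L1 Lw (in_H10_H1 hv).1) (conv theta gam v L2 Lg (in_H10_H1 hv).1).
  by move=> /eqP; rewrite addr_eq0 => /eqP.
have Jt psi : test_fun Omega psi -> J psi = 0.
  move=> tp; have := wg.2 _ (tensor_test tt tp).
  have -> : \int[muZ]_(z in Q) (w z * 'D_((1, 0) : Z) (fun z : Z => theta z.1 * psi z.2) z) =
      ip muZ Q (fun z => 'D_1 theta z.1 * w z) (fun z => psi z.2).
    by apply: eq_Rintegral => z _; rewrite tensor_dt //; [ring|case: tp].
  have -> : \int[muZ]_(z in Q) (gam z * (theta z.1 * psi z.2)) = ip muZ Q (fun z => theta z.1 * gam z) (fun z => psi z.2).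
    by apply: eq_Rintegral => z _; ring.
  by rewrite /J => ->; rewrite addNr.
have normsnd u : in_L2 muX Omega u -> Num.sqrt (ip muZ Q (fun z => u z.2) (fun z => u z.2)) = Num.sqrt T * Num.sqrt (ip muX Omega u u).
  move=> Lu; rewrite (slice_ip oO (in_L2_snd oO T0 Lu) (in_L2_snd oO T0 Lu)).2 /=.
  rewrite -sqrtrM ?ltW //; congr Num.sqrt.
  rewrite -[ip muX Omega [eta u] [eta u]]/(ip muX Omega u u); move: (ip muX Omega u u) => c.
  rewrite /Rintegral integral_cst // -[X in (_ * X)%E]/(lebesgue_measure _).
  by rewrite lebesgue_measure_itv /= lte_fin T0 -EFinD -EFinM /= subr0 mulrC.
pose B := Num.sqrt (ip muZ Q (fun z => 'D_1 theta z.1 * w z) (fun z => 'D_1 theta z.1 * w z)) +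
  Num.sqrt (ip muZ Q (fun z => theta z.1 * gam z) (fun z => theta z.1 * gam z)).
have B0 : 0 <= B by rewrite addr_ge0 // sqrtr_ge0.
apply/eqP; rewrite -normr_le0; apply/ler_addgt0Pr => e e0; rewrite add0r.
have hv1 := in_H10_H1 hv.
have c0 : 0 < B * Num.sqrt T + 1 by rewrite ltr_wpDl // mulr_ge0 // sqrtr_ge0.
have [_ /(_ (e / (B * Num.sqrt T + 1)))] := (in_H10P oO bO v).1 hv; rewrite divr_gt0 // => /(_ isT)[psi [tp hp _]].
have Lp := test_L2 oO bO tp; have Ld := in_L2B mO hv1.1 Lp.
have -> : J v = J (v \- psi).
  rewrite -[RHS]addr0 -{1}(Jt psi tp) /J /=.
  have h a : in_L2 muZ Q a -> ip muZ Q a (fun z => v z.2) = ip muZ Q a (fun z => v z.2 - psi z.2) + ip muZ Q a (fun z => psi z.2).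
    move=> La; rewrite ![ip _ _ a _]ipC (ipBl mQ (in_L2_snd oO T0 hv1.1) (in_L2_snd oO T0 Lp) La); ring.
  by rewrite (h _ L1) (h _ L2); ring.
rewrite /J; apply: le_trans (ler_normD _ _) _.
have Ls := in_L2_snd oO T0 Ld.
apply: le_trans (lerD (ip_CS mQ L1 Ls) (ip_CS mQ L2 Ls)) _.
rewrite -mulrDl -/B (normsnd _ Ld) mulrA.
apply: (@le_trans _ _ ((B * Num.sqrt T + 1) * Num.sqrt (ip muX Omega (v \- psi) (v \- psi)))).
  by rewrite ler_wpM2r ?sqrtr_ge0 // lerDl.
by rewrite -ler_pdivlMl // mulrC ltW.
Qed.

Lemma is_dt_Hm1_functional : is_dt_Hm1 T Omega w dt_functional.
Proof.
split.
- move=> t It; split.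
    move=> a v u hv hu; rewrite /dt_functional.
    exact: (ip_linr mO a (in_H10_H1 hv).1 (in_H10_H1 hu).1 (gam_slice_L2 t)).
  eexists => v hv; rewrite (normX_grad oO (in_H10_H1 hv)) -EFinM lee_fin; exact: dt_functional_bound.
- move=> v hv; have := slice_ip_measurable oO T0 wg.1 (in_H10_H1 hv).1.
  by move=> /measurable_int/measurable_EFinP.
- pose c := CPh * Num.sqrt (Cg ^+ 2 * fine (muX Omega)).
  have h : (\int[leb]_(t in I) (Hm1norm Omega (dt_functional t) ^+ 2) <= \int[leb]_(t in I) (c ^+ 2)%:E)%E.
    apply: ge0_ae_le_integral => [t _|t _|]; rewrite ?sqre_ge0 ?lee_fin ?sqr_ge0 //.
    apply: aeW => t It; apply: Hm1norm_sqr_le => // v hv; apply: le_trans (dt_functional_bound t hv) _.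
    rewrite ler_wpM2r ?gnorm_ge0 // ler_wpM2l ?(CPh_ge0 hCP) //; exact: ler_wsqrtr (ip_bounded_le t).
  by apply: le_lt_trans h _; rewrite integral_cst // lte_mul_pinfty // lee_fin sqr_ge0.
- by move=> v theta hv tt; exact: dt_functional_weak.
Qed.

Lemma dt_Hm1_ae : {ae leb, forall t : measurableTypeR R, I t -> forall v, in_H10 Omega v ->
  dt_Hm1 T Omega w t v = dt_functional t v}.
Proof.
apply: (is_dt_Hm1_unique _ is_dt_Hm1_functional).
by rewrite /dt_Hm1; case: xgetP => // /(_ _ is_dt_Hm1_functional).
Qed.

End time_derivative.

Section path_estimates.
Context (R : realType) (d : nat) (T : R) (Omega : set 'rV[R]_d).
Hypotheses (oO : open Omega) (bO : bounded_set Omega) (T0 : 0 < T).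
Local Notation X := 'rV[R]_d.
Local Notation Z := (R * 'rV[R]_d)%type.
Local Notation muX := (lebesgue_rV R d).
Local Notation muZ := (lebZ R d).
Local Notation leb := (@lebesgue_measure R).
Local Notation Q := (Qset T Omega).
Local Notation I := (`]0, T[%classic : set (measurableTypeR R)).

Let mO : measurable Omega. Proof. exact: measurable_domain. Qed.
Let mI : measurable I. Proof. exact: measurable_itv. Qed.

Variables (phi : R -> X -> R) (hphi : in_L2H10 T Omega phi).

(** Cauchy-Schwarz in time, with [N t] a bound for the squared norm of the functional on the slice
    at [t]. Only the integral of [N] enters the result, which is what later lets a cross term be
    integrated exactly. *)
Lemma path_estimate (F : R -> (X -> R) -> R) (N : R -> R) :
  leb.-integrable I (EFin \o N) ->
  {ae leb, forall t : measurableTypeR R, I t -> [/\ 0 <= N t, H10_linear Omega (F t) &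
     forall v, in_H10 Omega v -> `|F t v| <= Num.sqrt (N t) * gnorm Omega v]} ->
  (forall v, in_H10 Omega v -> measurable_fun I (fun t => F t v : measurableTypeR R)) ->
  aeint T (fun t => F t (phi t)) /\
  (energy T Omega phi = 1%E -> `|\int[leb]_(t in I) F t (phi t)| <= Num.sqrt (\int[leb]_(t in I) N t)).
Proof.
move=> iN hF mF.
have mN : measurable_fun I (N : measurableTypeR R -> measurableTypeR R).
  by have /measurable_int/measurable_EFinP := iN.
have [|h mh hh] := path_measurable oO bO hphi (F := F) _ mF.
  by apply: filterS hF => t h It; have [_ h1 h2] := h It; split => //; exists (Num.sqrt (N t)).
pose C t := Num.sqrt (N t).
have CN : {ae leb, forall t : measurableTypeR R, I t -> C t * C t = N t}.
  by apply: filterS hF => t h' It; have [h1 _ _] := h' It; rewrite -expr2 sqr_sqrtr.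
have mC : measurable_fun I (C : measurableTypeR R -> measurableTypeR R).
  exact: (measurableT_comp (continuous_measurable_fun (@sqrt_continuous R)) mN).
have LC : in_L2 leb I C.
  apply/in_L2E; split => //; have /integrableP[_] := iN; apply: le_lt_trans.
  apply: ge0_ae_le_integral => [t _|t _|]; rewrite ?lee_fin ?sqr_ge0 //.
  by apply: filterS CN => t h' It; rewrite expr2 h' //= lee_fin ler_norm.
have hb : {ae leb, forall t : measurableTypeR R, I t -> `|h t| <= C t * gnorm Omega (phi t)}.
  have hp := path_H10 hphi.
  have hF2 : {ae leb, forall t : measurableTypeR R, I t -> forall v, in_H10 Omega v -> `|F t v| <= Num.sqrt (N t) * gnorm Omega v}.
    by apply: filterS hF => t h' It; case: (h' It).
  have hF3 : {ae leb, forall t : measurableTypeR R, I t -> `|F t (phi t)| <= C t * gnorm Omega (phi t)}.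
    by apply: filterS2 hp hF2 => t h1 h2 It; apply: (h2 It); exact: h1.
  by apply: filterS2 hh hF3 => t h1 h2 It; rewrite -h1 //; exact: h2.
have [ih he] := path_CS oO hphi mh LC hb.
split; first by exists h.
move=> e1; rewrite (ae_eq_Rintegral_nomeas hh); apply: le_trans (he e1) _.
by rewrite /ip (ae_eq_Rintegral_nomeas CN).
Qed.

Variables (CP : R) (hCP : poincare_constant Omega CP).
Local Notation CPh := (CP * diam Omega).

Lemma path_ip (a : Z -> R) : in_L2 muZ Q a ->
  aeint T (fun t => ip muX Omega (fun x => a (t, x)) (phi t)) /\
  (energy T Omega phi = 1%E -> `|\int[leb]_(t in I) ip muX Omega (fun x => a (t, x)) (phi t)| <=
    CPh * Num.sqrt (ip muZ Q a a)).
Proof.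
move=> La; have [i1 e1] := slice_ip oO La La.
have := @path_estimate (fun t v => ip muX Omega (fun x => a (t, x)) v)
  (fun t => CPh ^+ 2 * ip muX Omega (fun x => a (t, x)) (fun x => a (t, x))) (integrableZl mI _ i1).
case.
- apply: filterS (slice_L2 oO La) => t + It => /(_ It) Lt; split.
  + by rewrite mulr_ge0 ?sqr_ge0 ?ip_ge0.
  + by move=> c v u hv hu; exact: (ip_linr mO c (in_H10_H1 hv).1 (in_H10_H1 hu).1 Lt).
  + move=> v hv; apply: le_trans (ip_CS mO Lt (in_H10_H1 hv).1) _.
    rewrite sqrtrM ?sqr_ge0 // sqrtr_sqr ger0_norm ?(CPh_ge0 hCP) //.
    have := poincare oO hCP hv; have := sqrtr_ge0 (ip muX Omega (fun x => a (t, x)) (fun x => a (t, x))).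
    move: (Num.sqrt _) (Num.sqrt _) (gnorm Omega v) (CPh) => p q r e; nra.
- move=> v hv; have := slice_ip_measurable oO T0 La (in_H10_H1 hv).1.
  by move=> /measurable_int/measurable_EFinP.
move=> h1 h2; split=> // e; apply: le_trans (h2 e) _.
rewrite RintegralZl // -e1 sqrtrM ?sqr_ge0 // sqrtr_sqr ger0_norm //; exact: CPh_ge0 hCP.
Qed.

Lemma slice_L2v (W : Z -> X) : in_L2v muZ Q W ->
  {ae leb, forall t : measurableTypeR R, I t -> in_L2v muX Omega (fun x => W (t, x))}.
Proof.
move=> LW; have : {ae leb, forall t : measurableTypeR R, forall j, I t -> in_L2 muX Omega (fun x => W (t, x) ord0 j)}.
  by apply: filter_forall => j; apply: (slice_L2 oO (LW j)).
by apply: filterS => t h It j; exact: h.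
Qed.

Lemma slice_vip (W W' : Z -> X) : in_L2v muZ Q W -> in_L2v muZ Q W' ->
  leb.-integrable I (EFin \o (fun t => vip muX Omega (fun x => W (t, x)) (fun x => W' (t, x)))) /\
  vip muZ Q W W' = \int[leb]_(t in I) vip muX Omega (fun x => W (t, x)) (fun x => W' (t, x)).
Proof.
move=> LW LW'; have h j := slice_ip oO (LW j) (LW' j).
have [h1 h2] := integrable_Rsum mI (index_enum _) (fun j => (h j).1).
by split; [exact: h1|rewrite [RHS]h2; apply: eq_bigr => j _; exact: (h j).2].
Qed.

Lemma path_vip (W : Z -> X) : in_L2v muZ Q W ->
  aeint T (fun t => vip muX Omega (fun x => W (t, x)) (grad Omega (phi t))) /\
  (energy T Omega phi = 1%E -> `|\int[leb]_(t in I) vip muX Omega (fun x => W (t, x)) (grad Omega (phi t))| <=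
    Num.sqrt (vip muZ Q W W)).
Proof.
move=> LW; have [i1 e1] := slice_vip LW LW.
have := @path_estimate (fun t v => vip muX Omega (fun x => W (t, x)) (grad Omega v))
  (fun t => vip muX Omega (fun x => W (t, x)) (fun x => W (t, x))) i1.
case.
- apply: filterS (slice_L2v LW) => t + It => /(_ It) Lt; split.
  + exact: vip_ge0.
  + move=> c v u hv hu; have hv1 := in_H10_H1 hv; have hu1 := in_H10_H1 hu.
    have Lg w : in_H1 Omega w -> in_L2v muX Omega (grad Omega w) by move=> hw; exact: grad_L2.
    rewrite ![vip _ _ (fun x => W (t, x)) _]vipC -(vip_linl mO c (Lg _ hv1) (Lg _ hu1) Lt).
    by apply: vip_ae; [exact: grad_lin|exact: aeW].
  + move=> v hv; exact: (vip_CS mO Lt (grad_L2 (in_H10_H1 hv))).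
- move=> v hv.
  apply: (@measurable_sum _ _ R I _ (index_enum _) (fun j t => ip muX Omega (fun x => W (t, x) ord0 j) (fun x => grad Omega v x ord0 j))) => j.
  have := slice_ip_measurable oO T0 (LW j) (grad_L2 (in_H10_H1 hv) j).
  by move=> /measurable_int/measurable_EFinP.
by move=> h1 h2; split=> // e; rewrite e1; exact: h2.
Qed.

End path_estimates.

(** * The projection onto piecewise constants and the equilibrated flux *)

Section L2_sums.
Context (dd : measure_display) (TT : measurableType dd) (R : realType).
Variables (mu : {measure set TT -> \bar R}) (D : set TT).
Hypothesis mD : measurable D.

Lemma in_L2_indic (A : set TT) f : measurable A -> A `<=` D -> in_L2 mu A f ->
  in_L2 mu D (fun z => \1_A z * f z).
Proof.
move=> mA AD /in_L2E[mf ff]; have E : (fun z => \1_A z * f z) = f \_ A.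
  by apply/funext => z; rewrite patchE indicE; case: ifP => _; rewrite ?mul1r ?mul0r.
apply/in_L2E; rewrite E; split; first by apply: measurable_funTS; exact/(measurable_restrictT _ mA).
move: ff; rewrite integral_mkcond [in X in _ -> X]integral_mkcond; congr (_ < _)%E.
apply: eq_integral => z _; rewrite !patchE; case: ifPn => zA; last first.
  by rewrite indicE (negbTE zA) mul0r expr0n; case: ifP.
by rewrite mem_set ?indicE ?zA ?mul1r //; apply: AD; exact: set_mem.
Qed.

Lemma Rintegral_indic (A : set TT) h : A `<=` D ->
  \int[mu]_(z in D) (\1_A z * h z) = \int[mu]_(z in A) h z.
Proof.
move=> AD; rewrite /Rintegral integral_mkcond [in RHS]integral_mkcond; congr fine.
apply: eq_integral => z _; rewrite !patchE indicE; have [zA|zA] := boolP (z \in A).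
  by rewrite mem_set ?mul1r //; apply: AD; exact: set_mem.
by rewrite mul0r; case: ifP.
Qed.

End L2_sums.

Section projection.
Context (R : realType) (d : nat) (T : R) (Omega : set 'rV[R]_d).
Local Notation X := 'rV[R]_d.
Local Notation Z := (R * 'rV[R]_d)%type.
Local Notation MZ := (measurableTypeR R * 'rV[R]_d)%type.
Local Notation muZ := (lebZ R d).
Local Notation Q := (Qset T Omega).
Hypotheses (lO : lipschitz_domain Omega) (T0 : 0 < T).

Let oO : open Omega. Proof. by case: lO. Qed.
Let bO : bounded_set Omega. Proof. by case: lO. Qed.
Let mQ : measurable Q. Proof. exact: measurable_Q. Qed.
Let fQ : (muZ Q < +oo)%E. Proof. exact: Q_fin. Qed.

Lemma dt_L2 u : in_L2 muZ Q (dt T Omega u).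
Proof. by rewrite /dt; case: xgetP => [g _ []|_] //; exact: in_L2_0. Qed.

Lemma gradx_L2 u : in_L2v muZ Q (gradx T Omega u).
Proof.
move=> j; rewrite (_ : (fun z => _) = xget (cst 0) [set g | is_dx T Omega j u g]).
  by case: xgetP => [g _ []|_] //; exact: in_L2_0.
by apply/funext => z; rewrite mxE.
Qed.

Variables (kappa : R) (M : mesh R d) (hM : simplicial_mesh (Qclosed T Omega) kappa M).
Variables (phi : 'I_(nnode M) -> Z -> R) (hphi : forall a, is_hat (Qclosed T Omega) a (phi a)).
Implicit Types (K : {set 'I_(nnode M)}) (a : 'I_(nnode M)) (v : Z -> R).
Local Notation intK := (int_cell phi).
Local Notation ae_eqQ u v := {ae muZ, forall z : MZ, Q z -> u z = v z}.

Lemma measurable_int_cell K : measurable (intK K : set MZ).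
Proof. exact: (open_measurable_coords (coordsZ R d) (@open_int_cell _ _ _ phi K)). Qed.

Lemma Q_Qclosed : Q `<=` Qclosed T Omega.
Proof. by move=> z; exact: subset_closure. Qed.

Lemma pw_affine_measurable (c : {set 'I_(nnode M)} -> R * Z) u : pw_affine c u -> measurable_fun Q (u : MZ -> measurableTypeR R).
Proof.
move=> cu _ Y mY; rewrite [X in measurable X](_ : _ = Q `&`
    \bigcup_(K in [set K | K \in cells M]) (conv_cell K `&` affZ (c K) @^-1` Y)).
  apply: measurableI => //; apply: fin_bigcup_measurable => // K KM; apply: measurableI.
    rewrite -[X in measurable X]setCK; apply: measurableC.
    exact: (open_measurable_coords (coordsZ R d) (closed_openC (closed_cell hM hphi KM))).
  rewrite -[X in measurable X]setTI.
  exact: (continuous_measurable_coords (coordsZ R d) (f := affZ (c K)) (@affZ_continuous _ _ (c K))).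
apply/seteqP; split => z [Qz]; last by move=> [K KM [Kz]] /=; rewrite -(cu K KM).
move=> Yz; split => //; have [_ _ _ [_ E] _] := hM; have := Q_Qclosed Qz; rewrite -E => -[K KM Kz].
by exists K => //; split => //=; rewrite -(cu K KM).
Qed.

Lemma hat_bounded a z : Q z -> `|phi a z| <= 1.
Proof.
move=> Qz; have [_ _ _ [_ E] _] := hM; have := Q_Qclosed Qz; rewrite -E => -[K KM Kz].
rewrite ger0_norm; last exact: (phi_ge0 hphi a KM Kz).
have [aK|aK] := boolP (a \in K); last by rewrite (phi_out hphi KM Kz aK).
rewrite -(bary_sum hM hphi z KM) (bigD1 a) //= (baryP hphi a KM Kz) lerDl.
by apply: sumr_ge0 => b /andP[bK _]; move/(conv_cellP hM hphi _ KM): Kz; apply.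
Qed.

Lemma hat_mul_L2 a v : in_L2 muZ Q v -> in_L2 muZ Q (fun z => phi a z * v z).
Proof.
move=> Lv; apply: (in_L2_dom mQ (C := 1) _ Lv) => [|z Qz].
  by apply: measurable_funM Lv.1; exact: (pw_affine_measurable (hat_pw_affine hphi a)).
by rewrite normrM ler_wpM2r // hat_bounded.
Qed.

Lemma indic_cell_L2 K : in_L2 muZ Q (\1_(intK K) : MZ -> R).
Proof.
apply: (in_L2_bounded mQ (C := 1)) => //.
  by apply: measurable_funTS; exact: measurable_indic (measurable_int_cell K).
by move=> z _; rewrite indicE normr_nat; case: (_ \in _).
Qed.

Definition pwc (q : {set 'I_(nnode M)} -> R) (z : Z) : R := \sum_(K in cells M) \1_(intK K) z * q K.

Lemma pwc_int q K z : K \in cells M -> intK K z -> pwc q z = q K.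
Proof.
move=> KM Kz; rewrite /pwc (bigD1 K) //= indicE mem_set // mul1r big1 ?addr0 // => K' /andP[KM' K'K].
rewrite indicE memNset ?mul0r // => K'z; move/eqP: K'K; apply.
apply: (int_cell_disjoint hM hphi KM' KM K'z); exact: (int_cell_sub hM hphi KM).
Qed.

Lemma pwcE q : pwc q = fun z => \sum_K (if K \in cells M then q K else 0) * \1_(intK K) z.
Proof.
apply/funext => z; rewrite /pwc big_mkcond; apply: eq_bigr => K _.
by case: ifP => _; rewrite ?mul0r // mulrC.
Qed.

Lemma pwc_L2 q : in_L2 muZ Q (pwc q).
Proof. by rewrite pwcE; apply: in_L2_sum => // K; apply: in_L2Z => //; exact: indic_cell_L2. Qed.

Lemma ip_pwc v q : in_L2 muZ Q v ->
  ip muZ Q v (pwc q) = \sum_(K in cells M) q K * ip muZ Q v (\1_(intK K) : MZ -> R).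
Proof.
move=> Lv; rewrite ipC pwcE ip_suml //; last by move=> K; apply: in_L2Z => //; exact: indic_cell_L2.
rewrite [RHS]big_mkcond; apply: eq_bigr => K _; rewrite (ipZl mQ _ (indic_cell_L2 K) Lv) ipC.
by case: ifP => _; rewrite ?mul0r.
Qed.

Lemma ae_cell : {ae muZ, forall z : MZ, Q z -> exists2 K, K \in cells M & intK K z}.
Proof. by apply: filterS (ae_int_cell hM hphi) => z h /Q_Qclosed. Qed.

(* The inner products are over [Q], so this is the mean over the cell; it is [0] on a
   null cell. *)
Definition avg v K : R := (ip muZ Q (\1_(intK K) : MZ -> R) (\1_(intK K) : MZ -> R))^-1 *
  ip muZ Q v (\1_(intK K) : MZ -> R).

Definition pi0 v : Z -> R := pwc (avg v).

Lemma piecewise_cst_pwc w : piecewise_poly (cells M) Q 0 w -> exists q, ae_eqQ w (pwc q).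
Proof.
move=> [_ hw]; have /choice[q hq] : forall K, exists r : R, K \in cells M ->
    {ae muZ, forall z : MZ, conv_cell K z -> w z = r}.
  move=> K; have [KM|_] := boolP (K \in cells M); last by exists 0.
  have [p /poly_fun0_cst[r hr] hp] := hw K KM; exists r => _.
  by move: hp; apply: ae_imp => z hz Kz; rewrite hz.
exists q; have h : {ae muZ, forall z : MZ, forall K, K \in cells M -> conv_cell K z -> w z = q K}.
  apply: filter_forall => K; have [KM|_] := boolP (K \in cells M); last exact: nearW.
  by move: (hq K KM); apply: ae_imp => z hz _.
apply: filterS2 h ae_cell => z hz hc Qz; have [K KM Kz] := hc Qz.
by rewrite (pwc_int q KM Kz) (hz K KM) //; exact: (int_cell_sub hM hphi KM).
Qed.

Lemma pwc_piecewise q : piecewise_poly (cells M) Q 0 (pwc q).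
Proof.
split=> [|K KM]; first exact: pwc_L2.
exists (fun=> q K); first exact: cst_poly_fun0.
apply: filterS (ae_int_cell hM hphi) => z hz Kz; have [K' KM' K'z] := hz (cell_sub hM KM Kz).
by rewrite (pwc_int q KM' K'z) (int_cell_disjoint hM hphi KM' KM K'z Kz).
Qed.

Lemma pi0P v : in_L2 muZ Q v -> is_Pi0 M Q v (pi0 v).
Proof.
move=> Lv; split; first exact: pwc_piecewise.
move=> w hw; have [q hq] := piecewise_cst_pwc hw; have Lp := pwc_L2 (avg v).
rewrite -[LHS]/(ip muZ Q (fun z => v z - pi0 v z) w) (ip_ae (aeW _ (fun _ _ => erefl)) hq).
rewrite ip_pwc ?big1 //; last exact: in_L2B.
move=> K KM; have L1 := indic_cell_L2 K; rewrite (ipBl mQ Lv Lp L1).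
have -> : ip muZ Q (pi0 v) (\1_(intK K) : MZ -> R) = avg v K * ip muZ Q (\1_(intK K) : MZ -> R) (\1_(intK K) : MZ -> R).
  rewrite -(ipZl mQ _ L1 L1); apply: eq_Rintegral => z _; rewrite indicE.
  case: (boolP (z \in intK K)) => zK; last by rewrite !mulr0.
  by rewrite /pi0 (pwc_int (avg v) KM (set_mem zK)) !mulr1.
(* On a null cell Cauchy-Schwarz makes the product of [v] with the indicator vanish too, in
   agreement with the value 0 of the mean. *)
rewrite /avg; have [c0|c0] := eqVneq (ip muZ Q (\1_(intK K) : MZ -> R) (\1_(intK K) : MZ -> R)) 0.
  have := ip_CS mQ Lv L1; rewrite c0 sqrtr0 !mulr0 normr_le0 => /eqP ->; by rewrite subr0 mulr0.
by rewrite mulrAC mulVf // mul1r subrr mulr0.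
Qed.

Lemma Pi0_unique v g g' : in_L2 muZ Q v -> is_Pi0 M Q v g -> is_Pi0 M Q v g' -> ae_eqQ g g'.
Proof.
move=> Lv [hg eg] [hg' eg']; have [Lg Lg'] := (hg.1, hg'.1).
have Ld : in_L2 muZ Q (fun z => g z - g' z) by exact: in_L2B.
have e w : piecewise_poly (cells M) Q 0 w -> ip muZ Q g w = ip muZ Q g' w.
  move=> hw; have := eg w hw; rewrite -[LHS]/(ip muZ Q (fun z => v z - g z) w) (ipBl mQ Lv Lg hw.1).
  have := eg' w hw; rewrite -[LHS]/(ip muZ Q (fun z => v z - g' z) w) (ipBl mQ Lv Lg' hw.1).
  by move=> /eqP; rewrite subr_eq0 => /eqP -> /eqP; rewrite subr_eq0 => /eqP.
have h0 : ip muZ Q (fun z => g z - g' z) (fun z => g z - g' z) = 0.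
  have E u : in_L2 muZ Q u -> ip muZ Q u (fun z => g z - g' z) = ip muZ Q u g - ip muZ Q u g'.
    by move=> Lu; rewrite ipC (ipBl mQ Lg Lg' Lu); congr (_ - _); exact: ipC.
  apply: etrans (ipBl mQ Lg Lg' Ld) _; apply: etrans (congr2 (fun x y => x - y) (E g Lg) (E g' Lg')) _.
  by rewrite (e _ hg) (e _ hg') subrr.
by apply: filterS (ip_eq0 mQ Ld h0) => z hz /hz /eqP; rewrite subr_eq0 => /eqP.
Qed.

Lemma Pi0P v : in_L2 muZ Q v -> is_Pi0 M Q v (Pi0 M Q v).
Proof. by move=> Lv; rewrite /Pi0; case: xgetP => // /(_ _ (pi0P Lv)). Qed.

Lemma Pi0_pi0 v : in_L2 muZ Q v -> ae_eqQ (Pi0 M Q v) (pi0 v).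
Proof. by move=> Lv; exact: (Pi0_unique Lv (Pi0P Lv) (pi0P Lv)). Qed.

Lemma Pi0_L2 v : in_L2 muZ Q v -> in_L2 muZ Q (Pi0 M Q v).
Proof. by move=> /Pi0P[[]]. Qed.

(** A piecewise constant summand is reproduced by the projection and cancels from the oscillation;
    this discards [L] times the time derivative of the increment. *)
Lemma Pi0_shift v w q : in_L2 muZ Q v -> in_L2 muZ Q w -> ae_eqQ v (fun z => w z + pwc q z) ->
  ae_eqQ (fun z => v z - Pi0 M Q v z) (fun z => w z - Pi0 M Q w z).
Proof.
move=> Lv Lw vw; have [hg eg] := Pi0P Lw.
have h : is_Pi0 M Q v (fun z => Pi0 M Q w z + pwc q z).
  split.
    split; first by apply: in_L2D => //; [exact: Pi0_L2|exact: pwc_L2].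
    move=> K KM; have [p1 /poly_fun0_cst[r1 hr1] h1] := hg.2 K KM.
    have [p2 /poly_fun0_cst[r2 hr2] h2] := (pwc_piecewise q).2 K KM.
    exists (fun=> r1 + r2); first exact: cst_poly_fun0.
    have h1' : {ae muZ, forall z : MZ, conv_cell K z -> Pi0 M Q w z = p1 z} := h1.
    have h2' : {ae muZ, forall z : MZ, conv_cell K z -> pwc q z = p2 z} := h2.
    have h : {ae muZ, forall z : MZ, conv_cell K z -> Pi0 M Q w z + pwc q z = r1 + r2}.
      by apply: filterS2 h1' h2' => z e1 e2 Kz; rewrite e1 // e2 // hr1 hr2.
    exact: h.
  move=> u hu; rewrite -[RHS](eg u hu); apply: ae_eq_Rintegral_nomeas.
  by apply: filterS vw => z h Qz; rewrite h // opprD addrACA subrr addr0.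
have := Pi0_unique Lv (Pi0P Lv) h.
by move=> h1; apply: filterS2 vw h1 => z h1 h2 Qz; rewrite h1 // h2 // opprD addrACA subrr addr0.
Qed.

Local Notation om a := (patch_set (Qclosed T Omega) (phi a)).

Lemma patch_sub a : om a `<=` Q.
Proof.
move=> z hz; apply: Qopen_sub; apply: (interior_Qclosed lO); move: z hz; apply: interiorS.
apply: (@subset_trans _ (closure (Qclosed T Omega))); first by apply: closure_subset => z [].
by rewrite -(closure_id _).1 //; exact: closed_closure.
Qed.

Lemma measurable_patch a : measurable (om a : set MZ).
Proof. exact: (open_measurable_coords (coordsZ R d) (@open_interior _ _)). Qed.

(** If [a] is not a vertex of [K], its hat function vanishes on the open set [int_cell K], which
    therefore contains no point of the closure of the support. *)
Lemma patch_cell a K z : K \in cells M -> intK K z -> (\1_(om a) z : R) = (a \in K)%:R.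
Proof.
move=> KM Kz; rewrite indicE; congr (_%:R); congr (nat_of_bool _).
have [aK|aK] := boolP (a \in K).
  apply: mem_set; have : nbhs z (intK K) by apply: open_nbhs_nbhs; split => //; exact: open_int_cell.
  apply: filterS => w Kw; apply: subset_closure; have Kw' := int_cell_sub hM hphi KM Kw.
  split; first exact: (cell_sub hM KM).
  by rewrite (baryP hphi a KM Kw') gt_eqF // Kw.
apply/negbTE/negP => /set_mem/interior_subset h.
have [] := h (intK K) (open_nbhs_nbhs (conj (open_int_cell (K := K)) Kz)).
by move=> w [[_ /eqP]] + Kw; apply; exact: (phi_out hphi KM (int_cell_sub hM hphi KM Kw) aK).
Qed.

Lemma hat_gradx a : {ae muZ, forall z : MZ, Q z -> forall K, K \in cells M -> intK K z ->
  forall j, gradx T Omega (phi a) z ord0 j = dotZ (bary phi K a).2 (0, e_ R j)}.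
Proof.
have L : in_L2 muZ Q (phi a).
  apply: (in_L2_bounded mQ (C := 1)) => //; last by move=> z; exact: hat_bounded.
  exact: (pw_affine_measurable (hat_pw_affine hphi a)).
have h j : is_dx T Omega j (phi a) (pwgrad phi (cst 1) (fun K => bary phi K a) (0, e_ R j)).
  have := @weak_chain_rule R d T Omega lO T0 kappa M hM phi hphi _ (phi a) id (cst 1) set0 (0, e_ R j) (hat_pw_affine hphi a) L.
  apply => //.
  - by move=> y; rewrite normr1.
  - by move=> y _; split; [exact: derivable_id|rewrite derive_id].
apply: filterS (gradx_ae oO bO h) => z hz Qz K KM Kz j.
by rewrite hz // (pwgrad_int hM hphi _ _ _ KM Kz) mul1r.
Qed.

Lemma avg_sum (I : finType) (u : I -> Z -> R) K : (forall i, in_L2 muZ Q (u i)) ->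
  \sum_i avg (u i) K = avg (fun z => \sum_i u i z) K.
Proof. by move=> Lu; rewrite /avg (ip_suml mQ _ Lu (indic_cell_L2 K)) mulr_sumr. Qed.

Lemma local_div_sum (S : Z -> R) (F : Z -> X) : in_L2 muZ Q S -> in_L2v muZ Q F ->
  ae_eqQ (fun z => \sum_a \1_(om a) z * (- Pi0 M Q (phi a \* S) z
     - dotv (gradx T Omega (phi a) z) (Pi0_vec M Q F z))) (fun z => - Pi0 M Q S z).
Proof.
move=> LS LF.
have h1 : {ae muZ, forall z : MZ, forall a, Q z -> Pi0 M Q (phi a \* S) z = pi0 (phi a \* S) z}.
  by apply: filter_forall => a; exact: (Pi0_pi0 (hat_mul_L2 a LS)).
have h2 : {ae muZ, forall z : MZ, forall j, Q z -> Pi0_vec M Q F z ord0 j = pi0 (fun y => F y ord0 j) z}.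
  by apply: filter_forall => j; apply: filterS (Pi0_pi0 (LF j)) => z h Qz; rewrite mxE h.
have h3 : {ae muZ, forall z : MZ, forall a, Q z -> forall K, K \in cells M -> intK K z ->
  forall j, gradx T Omega (phi a) z ord0 j = dotZ (bary phi K a).2 (0, e_ R j)}.
  by apply: filter_forall => a; exact: hat_gradx.
have h12 : {ae muZ, forall z : MZ, Q z -> (forall a, Pi0 M Q (phi a \* S) z = pi0 (phi a \* S) z) /\
    (forall j, Pi0_vec M Q F z ord0 j = pi0 (fun y => F y ord0 j) z)}.
  by apply: filterS2 h1 h2 => z e1 e2 Qz; split => i; [exact: e1|exact: e2].
have h4 : {ae muZ, forall z : MZ, Q z -> (exists2 K, K \in cells M & intK K z) /\ Pi0 M Q S z = pi0 S z}.
  by apply: filterS2 ae_cell (Pi0_pi0 LS) => z h1' h2' Qz; split; [exact: h1'|exact: h2'].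
have h5 : {ae muZ, forall z : MZ, Q z -> forall a K, K \in cells M -> intK K z ->
   forall j, gradx T Omega (phi a) z ord0 j = dotZ (bary phi K a).2 (0, e_ R j)}.
  by apply: filterS h3 => z h Qz a; exact: h.
have {h1 h2 h3} h35 : {ae muZ, forall z : MZ, Q z -> ((exists2 K, K \in cells M & intK K z) /\ Pi0 M Q S z = pi0 S z) /\
    forall a K, K \in cells M -> intK K z -> forall j, gradx T Omega (phi a) z ord0 j = dotZ (bary phi K a).2 (0, e_ R j)}.
  by apply: filterS2 h4 h5 => z e1 e2 Qz; split; [exact: e1|exact: e2].
apply: filterS2 h12 h35 => z h12' h35' Qz.
have [hS hF] := h12' Qz; have [[[K KM Kz] ->] hg] := h35' Qz.
rewrite /pi0 (pwc_int _ KM Kz).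
transitivity (\sum_a (- avg (phi a \* S) K - \sum_j dotZ (bary phi K a).2 (0, e_ R j) * avg (fun y => F y ord0 j) K)).
  apply: eq_bigr => a _; rewrite (patch_cell a KM Kz) hS /pi0 (pwc_int _ KM Kz).
  have -> : dotv (gradx T Omega (phi a) z) (Pi0_vec M Q F z) =
      \sum_j dotZ (bary phi K a).2 (0, e_ R j) * avg (fun y => F y ord0 j) K.
    by apply: eq_bigr => j _; rewrite (hg a K KM Kz) hF /pi0 (pwc_int _ KM Kz).
  have [aK|aK] := boolP (a \in K); first by rewrite mul1r.
  have d0 e : dotZ (bary phi K a).2 e = 0.
    have := bary_out hM hphi e KM aK; have := bary_out hM hphi 0 KM aK.
    by rewrite /affZ dotZ0 addr0 => ->; rewrite add0r.
  rewrite mul0r [X in _ - X]big1 ?subr0; last by move=> j _; rewrite d0 mul0r.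
  rewrite /avg [X in _^-1 * X](_ : _ = 0) ?mulr0 ?oppr0 //.
  rewrite /ip (@eq_Rintegral _ _ _ _ _ (fun=> 0)) ?/Rintegral ?integral0 // => w _; rewrite indicE.
  case: (boolP (w \in intK K)) => wK; last by rewrite mulr0.
  by rewrite /= (phi_out hphi KM (int_cell_sub hM hphi KM (set_mem wK)) aK) !mul0r.
rewrite big_split /= sumrN (@avg_sum _ (fun a => phi a \* S)); last by move=> a; exact: hat_mul_L2.
rewrite sumrN exchange_big /= [X in _ - X]big1 ?subr0; last first.
  by move=> j _; rewrite -mulr_suml (slope_sum hM hphi _ KM) mul0r.
congr (- (_ * _)); apply: eq_Rintegral => w _; rewrite indicE.
case: (boolP (w \in intK K)) => wK; last by rewrite !mulr0.
have Kw := int_cell_sub hM hphi KM (set_mem wK).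
rewrite !mulr1 -mulr_suml (bigID (mem K)) /= [X in _ + X]big1 ?addr0; last first.
  by move=> a aK; rewrite (phi_out hphi KM Kw aK).
under eq_bigr => a aK do rewrite (baryP hphi a KM Kw).
by rewrite (bary_sum hM hphi w KM) mul1r.
Qed.

End projection.

(** * The divergence of the equilibrated flux, on the cylinder and on time slices *)

Section flux.
Context (R : realType) (d : nat) (T : R) (Omega : set 'rV[R]_d).
Local Notation X := 'rV[R]_d.
Local Notation Z := (R * 'rV[R]_d)%type.
Local Notation MZ := (measurableTypeR R * 'rV[R]_d)%type.
Local Notation muX := (lebesgue_rV R d).
Local Notation muZ := (lebZ R d).
Local Notation leb := (@lebesgue_measure R).
Local Notation Q := (Qset T Omega).
Local Notation I := (`]0, T[%classic : set (measurableTypeR R)).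
Hypotheses (lO : lipschitz_domain Omega) (T0 : 0 < T).

Let oO : open Omega. Proof. by case: lO. Qed.
Let bO : bounded_set Omega. Proof. by case: lO. Qed.
Let mO : measurable Omega. Proof. exact: measurable_domain. Qed.
Let mQ : measurable Q. Proof. exact: measurable_Q. Qed.
Let fQ : (muZ Q < +oo)%E. Proof. exact: Q_fin. Qed.
Let mI : measurable I. Proof. exact: measurable_itv. Qed.
Let fI : (leb I < +oo)%E. Proof. exact: I_fin. Qed.

Variables (kappa : R) (M : mesh R d) (hM : simplicial_mesh (Qclosed T Omega) kappa M).
Variables (phi : 'I_(nnode M) -> Z -> R) (hphi : forall a, is_hat (Qclosed T Omega) a (phi a)).
Variables (S : Z -> R) (F : Z -> X) (LS : in_L2 muZ Q S) (LF : in_L2v muZ Q F).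
Variables (p : nat) (sig : 'I_(nnode M) -> Z -> X).
Hypothesis hsig : forall a, local_flux T Omega p a (phi a) S F (sig a).
Local Notation om a := (patch_set (Qclosed T Omega) (phi a)).
Local Notation sigma := (global_flux T Omega phi sig).
Let g a z := - Pi0 M Q (phi a \* S) z - dotv (gradx T Omega (phi a) z) (Pi0_vec M Q F z).

Let Lloc a j : in_L2 muZ Q (fun z => \1_(om a) z * sig a z ord0 j).
Proof.
apply: in_L2_indic => //; [exact: measurable_patch|exact: (patch_sub lO)|].
by have [[h _ _] _] := hsig a; case: (h j).
Qed.

Let Lg a : in_L2 muZ Q (fun z => \1_(om a) z * g a z).
Proof.
apply: in_L2_indic => //; [exact: measurable_patch|exact: (patch_sub lO)|].
by have [[_ [h _] _] _] := hsig a.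
Qed.

Lemma flux_L2 : in_L2v muZ Q sigma.
Proof.
move=> j; rewrite (_ : (fun z => _) = fun z => \sum_a \1_(om a) z * sig a z ord0 j); first exact: (in_L2_sum mQ _ (fun a => Lloc a j)).
by apply/funext => z; rewrite /global_flux summxE; apply: eq_bigr => a _; rewrite mxE.
Qed.

Lemma cgradx_L2 psi : test_fun (Qopen T Omega) psi -> in_L2v muZ Q (cgradx psi).
Proof.
move=> tp j; rewrite (_ : (fun z => _) = 'D_((0, e_ R j) : Z) psi); last by apply/funext => z; rewrite mxE.
exact: (test_fun_L2 (coordsZ R d) mQ fQ (test_fun_derive _ tp)).
Qed.

(** A test function of the open cylinder is supported away from [GammaT], so it is admissible in the
    Green formula of every patch; the sum of these formulas has no boundary or interface terms. *)
Lemma flux_green psi : test_fun (Qopen T Omega) psi ->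
  vip muZ Q sigma (cgradx psi) = ip muZ Q (Pi0 M Q S) psi.
Proof.
move=> tp; have Lp : in_L2 muZ Q psi := test_fun_L2 (coordsZ R d) mQ fQ tp.
have Lc := cgradx_L2 tp; have LP : in_L2 muZ Q (Pi0 M Q S) := Pi0_L2 lO hM hphi LS.
have tG : test_fun (~` GammaT T Omega) psi.
  have [h1 h2 h3] := tp; split => // z /h3[_ Oz] [_ [_]]; apply.
  by rewrite (interior_id _).1.
pose k a z := \1_(om a) z * (dotv (sig a z) (cgradx psi z) + g a z * psi z).
have k0 a : \int[muZ]_(z in Q) k a z = 0.
  have [[_ _ h] _] := hsig a; rewrite -[RHS](h _ tG).
  exact: (@Rintegral_indic _ _ _ muZ Q (om a : set MZ) (fun z => dotv (sig a z) (cgradx psi z) + g a z * psi z)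
    (@patch_sub _ _ _ _ lO _ phi a)).
have ik a : muZ.-integrable Q (EFin \o k a).
  have Ls : in_L2v muZ Q (fun z => \1_(om a) z *: sig a z).
    by move=> j; rewrite (_ : (fun z => _) = fun z => \1_(om a) z * sig a z ord0 j) //; apply/funext => z; rewrite mxE.
  have := integrableD mQ (integrable_dotv mQ Ls Lc) (in_L2_integrableM mQ (Lg a) Lp).
  have E z : k a z = dotv (\1_(om a) z *: sig a z) (cgradx psi z) + \1_(om a) z * g a z * psi z.
    rewrite /k mulrDr -[in RHS]mulrA; congr (_ + _).
    by rewrite /dotv mulr_sumr; apply: eq_bigr => j _; rewrite [in RHS]mxE mulrA.
  by congr integrable; apply/funext => z /=; rewrite E EFinD.
have [_ ks] := integrable_Rsum mQ (index_enum _) ik.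
rewrite [RHS]big1 // in ks.
have kE : {ae muZ, forall z : MZ, Q z -> \sum_a k a z = dotv (sigma z) (cgradx psi z) - Pi0 M Q S z * psi z}.
  apply: filterS (local_div_sum lO T0 hM hphi LS LF) => z h Qz.
  rewrite /k; under eq_bigr => a _ do rewrite mulrDr mulrA.
  rewrite big_split /= -mulr_suml (h Qz) mulNr; congr (_ - _).
  rewrite /dotv /global_flux; under eq_bigr => a _ do rewrite mulr_sumr.
  rewrite exchange_big /=; apply: eq_bigr => j _; rewrite summxE mulr_suml.
  by apply: eq_bigr => a _; rewrite [in RHS]mxE mulrA.
move: ks; rewrite (ae_eq_Rintegral_nomeas kE) (RintegralB mQ (integrable_dotv mQ flux_L2 Lc) (in_L2_integrableM mQ LP Lp)).
by rewrite (Rintegral_dotv mQ flux_L2 Lc) => /eqP; rewrite subr_eq0 => /eqP.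
Qed.

Lemma slice_ip_L2 a v : in_L2 muZ Q a -> in_L2 muX Omega v ->
  in_L2 leb I (fun t => ip muX Omega (fun x => a (t, x)) v).
Proof.
move=> La Lv; apply/in_L2E; split.
  by have := slice_ip_measurable oO T0 La Lv; move=> /measurable_int/measurable_EFinP.
have [/integrableP[_]] := slice_ip oO La La; move=> h _.
have /integrableP[_] := integrableZl mI (ip muX Omega v v) (slice_ip oO La La).1; apply: le_lt_trans.
apply: ge0_ae_le_integral => [t _|t _|]; rewrite ?lee_fin ?sqr_ge0 //.
apply: filterS (slice_L2 oO La) => t + It => /(_ It) Lt /=.
rewrite lee_fin [leRHS]ger0_norm ?mulr_ge0 ?ip_ge0 //.
have := ip_CS mO Lt Lv; rewrite -sqrtrM ?ip_ge0 // => hh.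
rewrite -[X in X <= _]real_normK ?num_real // -[leRHS]sqr_sqrtr ?mulr_ge0 ?ip_ge0 //.
by rewrite ler_sqr ?nnegrE ?sqrtr_ge0 // mulrC.
Qed.

Variables (CP : R) (hCP : poincare_constant Omega CP).
Local Notation CPh := (CP * diam Omega).

(** The exceptional times must not depend on [v], because the identity is later used at
    [v = phi t]. *)
Lemma flux_slice : {ae leb, forall t : measurableTypeR R, I t -> forall v, in_H10 Omega v ->
  vip muX Omega (fun x => sigma (t, x)) (grad Omega v) = ip muX Omega (fun x => Pi0 M Q S (t, x)) v}.
Proof.
have LP : in_L2 muZ Q (Pi0 M Q S) := Pi0_L2 lO hM hphi LS.
have Ls := flux_L2.
have Ld psi j : test_fun Omega psi -> in_L2 muX Omega ('D_(e_ R j) psi).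
  by move=> tp; exact: (test_L2 oO bO (test_fun_derive _ tp)).
pose A psi t := \sum_j ip muX Omega (fun x => sigma (t, x) ord0 j) ('D_(e_ R j) psi) -
  ip muX Omega (fun x => Pi0 M Q S (t, x)) psi.
have LA psi : test_fun Omega psi -> in_L2 leb I (A psi).
  move=> tp; apply: in_L2B => //; last exact: (slice_ip_L2 LP (test_L2 oO bO tp)).
  by apply: in_L2_sum => // j; exact: (slice_ip_L2 (Ls j) (Ld _ j tp)).
have A0 psi : test_fun Omega psi -> {ae leb, forall t : measurableTypeR R, I t -> A psi t = 0}.
  move=> tp; have oI : open (`]0, T[%classic : set R) by exact: interval_open.
  apply: (test_orthogonal0 (coordsR R) oI mI (fun t h => h) (LA _ tp)) => theta tt.
  have [st _ _] := tt; have [sp _ _] := tp.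
  have Lt : in_L2 leb I theta := test_fun_L2 (coordsR R) mI fI tt.
  have tts := tensor_test tt tp; have := flux_green tts.
  have e1 j : ip muZ Q (fun z => sigma z ord0 j) (fun z => cgradx (fun z => theta z.1 * psi z.2) z ord0 j) =
      ip leb I (fun t => ip muX Omega (fun x => sigma (t, x) ord0 j) ('D_(e_ R j) psi)) theta.
    rewrite (slice_ip oO (Ls j) (cgradx_L2 tts j)).2; apply: ae_eq_Rintegral_nomeas.
    apply: filterS (slice_L2 oO (Ls j)) => t + It => /(_ It) Lt'.
    rewrite mulrC ipC -(ipC _ _ ('D_(e_ R j) psi)) -(ipZl mO _ (Ld _ j tp) Lt').
    by apply: eq_Rintegral => x _; rewrite mxE tensor_dx.
  have e2 : ip muZ Q (Pi0 M Q S) (fun z => theta z.1 * psi z.2) =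
      ip leb I (fun t => ip muX Omega (fun x => Pi0 M Q S (t, x)) psi) theta.
    rewrite (slice_ip oO LP (test_fun_L2 (coordsZ R d) mQ fQ tts)).2; apply: ae_eq_Rintegral_nomeas.
    apply: filterS (slice_L2 oO LP) => t + It => /(_ It) Lt'.
    have E3 := ipZl mO (theta t) (test_L2 oO bO tp) Lt'.
    apply: etrans (ipC _ _ _ _) (etrans E3 _); rewrite mulrC; congr (_ * _); exact: ipC.
  rewrite /vip; under eq_bigr do rewrite e1; rewrite e2 => E.
  have L1 j := slice_ip_L2 (Ls j) (Ld _ j tp).
  rewrite -[LHS]/(ip leb I (A psi) theta) /A.
  rewrite (ipBl mI (in_L2_sum mI _ L1) (slice_ip_L2 LP (test_L2 oO bO tp)) Lt).
  by rewrite (ip_suml mI _ L1 Lt) E subrr.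
have [psi_ [tpsi dpsi]] := H10_separable oO bO.
have h1 : {ae leb, forall t : measurableTypeR R, forall k, I t -> A (psi_ k) t = 0}.
  by apply/ae_foralln => k; exact: A0.
have h2 : {ae leb, forall t : measurableTypeR R, I t -> in_L2v muX Omega (fun x => sigma (t, x)) /\
    in_L2 muX Omega (fun x => Pi0 M Q S (t, x))}.
  by apply: filterS2 (slice_L2v oO Ls) (slice_L2 oO LP) => t e1 e2 It; split; [exact: e1|exact: e2].
apply: filterS2 h1 h2 => t h1 h2 It v hv; have [Lst LPt] := h2 It.
apply/eqP; rewrite -subr_eq0; apply/eqP.
apply: (H10_dense_zero oO bO tpsi dpsi
  (F := fun v => vip muX Omega (fun x => sigma (t, x)) (grad Omega v) - ip muX Omega (fun x => Pi0 M Q S (t, x)) v)) => //.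
- move=> c u w hu hw; have [hu1 hw1] := (in_H10_H1 hu, in_H10_H1 hw).
  have lin_sub (p1 p2 q1 q2 : R) : c * (p1 - p2) + (q1 - q2) = (c * p1 + q1) - (c * p2 + q2) by ring.
  rewrite lin_sub; congr (_ - _); last exact: (ip_linr mO c hu1.1 hw1.1 LPt).
  rewrite ![vip _ _ (fun x => sigma _) _]vipC.
  by apply: etrans (vip_ae (grad_lin oO bO c hu1 hw1) (aeW _ (fun _ _ => erefl))) _; exact: vip_linl (grad_L2 hu1) (grad_L2 hw1) Lst.
- exists (Num.sqrt (vip muX Omega (fun x => sigma (t, x)) (fun x => sigma (t, x))) +
    Num.sqrt (ip muX Omega (fun x => Pi0 M Q S (t, x)) (fun x => Pi0 M Q S (t, x))) * CPh) => u hu.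
  apply: le_trans (ler_normB _ _) _; rewrite mulrDl; apply: lerD.
    exact: (vip_CS mO Lst (grad_L2 (in_H10_H1 hu))).
  apply: le_trans (ip_CS mO LPt (in_H10_H1 hu).1) _.
  by rewrite -mulrA ler_wpM2l ?sqrtr_ge0 //; exact: (poincare oO hCP hu).
- move=> k; rewrite -[RHS](h1 k It) /A; congr (_ - _); apply: eq_bigr => j _.
  apply: ip_ae; first exact: aeW.
  by apply: filterS (grad_ae oO bO (fun j => is_d_test oO bO j (tpsi k))) => x h Ox; rewrite h // mxE.
Qed.

End flux.

(** * Slices of piecewise affine functions and the energy identity *)

Section slices_of_piecewise_affine.
Context (R : realType) (d : nat) (T : R) (Omega : set 'rV[R]_d).
Local Notation X := 'rV[R]_d.
Local Notation Z := (R * 'rV[R]_d)%type.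
Local Notation MZ := (measurableTypeR R * 'rV[R]_d)%type.
Local Notation muZ := (lebZ R d).
Local Notation leb := (@lebesgue_measure R).
Local Notation Q := (Qset T Omega).
Local Notation I := (`]0, T[%classic : set (measurableTypeR R)).
Hypotheses (lO : lipschitz_domain Omega) (T0 : 0 < T).

Let oO : open Omega. Proof. by case: lO. Qed.
Let bO : bounded_set Omega. Proof. by case: lO. Qed.

Variables (kappa : R) (M : mesh R d) (hM : simplicial_mesh (Qclosed T Omega) kappa M).
Variables (phi : 'I_(nnode M) -> Z -> R) (hphi : forall a, is_hat (Qclosed T Omega) a (phi a)).
Variables (c : {set 'I_(nnode M)} -> R * Z) (u : Z -> R).
Hypotheses (cu : pw_affine c u) (uG : forall z, GammaT T Omega z -> u z = 0).
Local Notation intK := (int_cell phi).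

Lemma norm_pair (t s : R) (x y : X) : `|(t, x) - (s, y) : Z| = Num.max `|t - s| `|x - y|.
Proof. by []. Qed.

Lemma dotZ_snd (a : Z) (h : X) : dotZ a (0, h) = \sum_j dotZ a (0, e_ R j) * h ord0 j.
Proof.
have -> : (0, h) = \sum_j h ord0 j *: ((0, e_ R j) : Z).
  apply: coordZ_inj => k; rewrite coordZ_sum /coordZ; case: unliftP => [i _|_] /=.
    rewrite (bigD1 i) //= mxE !eqxx mulr1 big1 ?addr0 // => j ji.
    by rewrite mxE eqxx eq_sym (negbTE ji) mulr0.
  by rewrite big1 // => j _; rewrite mulr0.
by rewrite dotZ_sum; apply: eq_bigr => j _; rewrite mulrC.
Qed.

Lemma pw_slice_H10 : {ae leb, forall t : measurableTypeR R, I t -> in_H10 Omega (fun x => zext Omega u (t, x)) /\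
  forall j, is_d Omega j (fun x => zext Omega u (t, x)) (fun x => pwgrad phi (cst 1) c (0, e_ R j) (t, x))}.
Proof.
have [C1 C10 hC1] := zext_lipschitz lO T0 hM hphi cu uG.
have hg1 (y : R) : `|(cst 1 : R -> R) y| <= 1 by rewrite normr1.
have /choice[Cg hCg] : forall j, exists C : R, 0 <= C /\ forall z, `|pwgrad phi (cst 1) c (0, e_ R j) z| <= C.
  by move=> j; have [C h1 h2] := pwgrad_bounded phi c (0, e_ R j) hg1; exists C.
pose C := C1 + \sum_j Cg j.
have Cg0 : 0 <= \sum_j Cg j by apply: sumr_ge0 => j _; case: (hCg j).
(* An affine piece with nonzero spatial slope vanishes only on a null set, so almost every zero of
   [u] comes with zero gradient, as [loc_affine_H10] asks. *)
have ae0 : {ae muZ, forall z : MZ, Q z -> (exists2 K, K \in cells M & intK K z) /\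
    forall K j, dotZ (c K).2 (0, e_ R j) != 0 -> affZ (c K) z != 0}.
  have h1 : {ae muZ, forall z : MZ, forall K, forall j, dotZ (c K).2 (0, e_ R j) != 0 -> affZ (c K) z != 0}.
    apply: filter_forall => K; apply: filter_forall => j.
    have [e0|e0] := eqVneq (dotZ (c K).2 (0, e_ R j)) 0; first by apply: nearW.
    apply: filterS (affZ_preimage_null e0 (measurable_set1 0) (lebesgue_measure_set1 0)).
    by move=> z h _; apply/eqP.
  by apply: filterS2 (ae_cell hM hphi) h1 => z e1 e2 Qz; split; [exact: e1|exact: e2].
apply: filterS (slice_ae ae0) => t ht It.
have tT : 0 <= t <= T by move: It; rewrite /= in_itv /= => /andP[/ltW -> /ltW ->].
apply: (loc_affine_H10 (C := C)) => //.
- by rewrite addr_ge0.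
- move=> x y; apply: le_trans (hC1 (t, x) (t, y) tT tT) _.
  rewrite norm_pair subrr normr0 (max_idPr _) //.
  by rewrite ler_wpM2r // lerDl.
- by move=> x nO; rewrite /zext memNset.
- move=> j; have mg := pwgrad_measurable phi (be := cst 1) c (0, e_ R j) (measurable_cst _).
  exact: (measurable_fun_pair2 t mg).
- move=> j x; apply: le_trans ((hCg j).2 _) _; rewrite /C (bigD1 j) //= addrCA lerDl.
  by rewrite addr_ge0 // sumr_ge0 // => k _; case: (hCg k).
apply: filterS (ht It) => x + Ox => /(_ Ox)[[K KM Kz] hne].
have gE j : pwgrad phi (cst 1) c (0, e_ R j) (t, x) = dotZ (c K).2 (0, e_ R j).
  by rewrite (pwgrad_int hM hphi _ _ _ KM Kz) mul1r.
have vE y : intK K (t, y) -> zext Omega u (t, y) = affZ (c K) (t, y).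
  move=> Ky; rewrite zextE; last by have [] := int_cell_Qopen lO hM hphi KM Ky.
  by apply: (cu KM); exact: (int_cell_sub hM hphi KM).
split.
  have /nbhs_ballP[r /= r0 hr] : nbhs ((t, x) : Z) (intK K) by apply: open_nbhs_nbhs; split => //; exact: open_int_cell.
  exists r => // y hy.
  have Ky : intK K (t, y).
    apply: hr; split => /=; first exact: ballxx.
    by rewrite -ball_normE /ball_ /= distrC.
  rewrite !vE //; under eq_bigr do rewrite gE.
  rewrite -dotZ_snd /affZ -addrA; congr (_ + _).
  have := dotZ_lin (c K).2 1 (t, x) (0, y - x); rewrite scale1r mul1r => <-.
  by congr dotZ; congr (_, _); [rewrite /= addr0|rewrite /= addrC subrK].
by rewrite vE // => v0 j; rewrite gE; apply: contrapT => /eqP /(hne K j); rewrite v0 eqxx.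
Qed.

End slices_of_piecewise_affine.

Section energy_identity.
Context (R : realType) (d : nat) (T : R) (Omega : set 'rV[R]_d).
Local Notation X := 'rV[R]_d.
Local Notation Z := (R * 'rV[R]_d)%type.
Local Notation muX := (lebesgue_rV R d).
Local Notation muZ := (lebZ R d).
Local Notation leb := (@lebesgue_measure R).
Local Notation Q := (Qset T Omega).
Local Notation I := (`]0, T[%classic : set (measurableTypeR R)).
Hypotheses (lO : lipschitz_domain Omega) (T0 : 0 < T).

Let oO : open Omega. Proof. by case: lO. Qed.
Let bO : bounded_set Omega. Proof. by case: lO. Qed.
Let mO : measurable Omega. Proof. exact: measurable_domain. Qed.
Let fO : (muX Omega < +oo)%E. Proof. exact: domain_fin. Qed.
Let mQ : measurable Q. Proof. exact: measurable_Q. Qed.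
Let fQ : (muZ Q < +oo)%E. Proof. exact: Q_fin. Qed.

Variables (kappa : R) (M : mesh R d) (hM : simplicial_mesh (Qclosed T Omega) kappa M).
Variables (phi : 'I_(nnode M) -> Z -> R) (hphi : forall a, is_hat (Qclosed T Omega) a (phi a)).
Variables (c : {set 'I_(nnode M)} -> R * Z) (u : Z -> R).
Hypotheses (cu : pw_affine c u) (uG : forall z, GammaT T Omega z -> u z = 0) (Lu : in_L2 muZ Q u).
Hypothesis u0 : forall x, Omega x -> u (0, x) = 0.
Local Notation intK := (int_cell phi).
Local Notation gam := (pwgrad phi (cst 1) c (1, 0)).

(** Times are clamped to [[0, T]] so that [U], and with it the energy [e], is Lipschitz on the whole
    line, as [lipschitz_FTC] asks. *)
Let clamp (t : R) := Num.max 0 (Num.min t T).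
Let clamp_in t : 0 <= clamp t <= T.
Proof. by rewrite /clamp le_max lexx /= ge_max ge_min lexx orbT ltW. Qed.
Let clampE t : 0 <= t <= T -> clamp t = t.
Proof. by move=> /andP[t0 tT]; rewrite /clamp (min_idPl tT) (max_idPr t0). Qed.
Let clamp_lip s t : `|clamp s - clamp t| <= `|s - t|.
Proof.
have T0' := ltW T0; have := ler_norm (s - t); have := ler_norm (t - s); rewrite [`|t - s|]distrC.
move: `|s - t| => r h1 h2; rewrite /clamp !minEle; case: (leP s T) => ?; case: (leP t T) => ?; rewrite !maxEle.
- by case: (leP 0 s) => ?; case: (leP 0 t) => ?; rewrite ler_norml; apply/andP; split; lra.
- by case: (leP 0 s) => ?; case: (leP 0 T) => ?; rewrite ler_norml; apply/andP; split; lra.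
- by case: (leP 0 t) => ?; case: (leP 0 T) => ?; rewrite ler_norml; apply/andP; split; lra.
- by case: (leP 0 T) => ?; rewrite ler_norml; apply/andP; split; lra.
Qed.

Let U t x := zext Omega u (clamp t, x).

Let U_bounds : exists C : R, [/\ 0 < C, forall s t x, `|U s x - U t x| <= C * `|s - t|,
  forall t x y, `|U t x - U t y| <= C * `|x - y| & forall t x, `|U t x| <= C].
Proof.
have [C C0 hC] := zext_lipschitz lO T0 hM hphi cu uG.
have U0 x : U 0 x = 0.
  rewrite /U clampE ?lexx ?ltW // /zext; case: ifPn => // /set_mem; exact: u0.
have h1 s t x : `|U s x - U t x| <= C * `|s - t|.
  apply: le_trans (hC (clamp s, x) (clamp t, x) (clamp_in s) (clamp_in t)) _.
  rewrite ler_wpM2l // norm_pair subrr normr0; apply: le_trans (clamp_lip s t).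
  by rewrite ge_max lexx normr_ge0.
have CT : C <= C + C * T + 1 by rewrite -addrA lerDl addr_ge0 // mulr_ge0 // ltW.
(* [C] bounds the slopes, [C T] the values, since [U] vanishes at time 0, and 1 makes the constant
   positive. *)
exists (C + C * T + 1); split.
- by rewrite ltr_wpDl // addr_ge0 // mulr_ge0 // ltW.
- by move=> s t x; apply: le_trans (h1 s t x) _; rewrite ler_wpM2r.
- move=> t x y; apply: le_trans (hC (clamp t, x) (clamp t, y) (clamp_in t) (clamp_in t)) _.
  by rewrite norm_pair subrr normr0 (max_idPr _) // ler_wpM2r.
- move=> t x; have -> : U t x = U (clamp t) x - U 0 x by rewrite U0 subr0 /U (clampE (clamp_in t)).
  apply: le_trans (h1 _ _ _) _; rewrite subr0; have /andP[k0 kT] := clamp_in t.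
  rewrite ger0_norm //; apply: le_trans (_ : C * T <= _); first by rewrite ler_wpM2l.
  by rewrite addrAC lerDr addr_ge0.
Qed.

Lemma Rintegral_bounded (f : X -> R) K : measurable_fun Omega (f : X -> measurableTypeR R) ->
  (forall x, Omega x -> `|f x| <= K) -> `|\int[muX]_(x in Omega) f x| <= K * fine (muX Omega).
Proof.
move=> mf hf; have Lf : in_L2 muX Omega f by exact: (in_L2_bounded mO fO mf hf).
have iF := in_L2_integrable mO fO Lf.
apply: le_trans (le_normr_Rintegral mO iF) _.
have -> : K * fine (muX Omega) = \int[muX]_(x in Omega) K.
  by rewrite /Rintegral integral_cst // fineM // ge0_fin_numE.
apply: le_Rintegral => //.
- exact: integrable_norm.
- by apply: (in_L2_integrable mO fO); apply: (in_L2_bounded mO fO (C := `|K|)).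
Qed.

Let U_measurable t : measurable_fun Omega (U t : X -> measurableTypeR R).
Proof.
have [C [C0 _ hC _]] := U_bounds; apply: measurable_funTS.
apply: (continuous_measurable_coords (coordsV R d) (f := U t)) => x.
apply/(@cvgrPdist_lt _ _ _ (nbhs (x : X))) => e e0.
have d0 : 0 < (e : R) / C by exact: divr_gt0.
apply: filterS (nbhsx_ballx (x : X) _ d0) => y; rewrite -ball_normE /= => h.
by apply: le_lt_trans (hC t x y) _; rewrite mulrC -ltr_pdivlMr.
Qed.

Let e t := ip muX Omega (U t) (U t).

Let U_L2 t : in_L2 muX Omega (U t).
Proof. by have [C [_ _ _ hC]] := U_bounds; exact: (in_L2_bounded mO fO (U_measurable t) (fun x _ => hC t x)). Qed.

Let e_diff s t : e s - e t = \int[muX]_(x in Omega) (U s x * U s x - U t x * U t x).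
Proof.
by apply/esym; apply: RintegralB => //; exact: (in_L2_integrableM mO (U_L2 _) (U_L2 _)).
Qed.

Let diff_bound C s t x : (forall s t x, `|U s x - U t x| <= C * `|s - t|) -> (forall t x, `|U t x| <= C) ->
  `|U s x * U s x - U t x * U t x| <= 2 * C ^+ 2 * `|s - t|.
Proof.
move=> h1 h2; have -> : U s x * U s x - U t x * U t x = (U s x - U t x) * (U s x + U t x) by ring.
rewrite normrM; have := h1 s t x; have := ler_normD (U s x) (U t x); have := h2 s x; have := h2 t x.
move: (normr_ge0 (U s x - U t x)) (normr_ge0 (U s x + U t x)) (normr_ge0 (s - t)).
move: `|U s x - U t x| `|U s x + U t x| `|s - t| `|U s x| `|U t x| => p q r v w p0 q0 r0 h3 h4 h5 h6.
have : p * q <= (C * r) * (C + C) by apply: ler_pM => //; apply: le_trans h5 _; exact: lerD.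
by move/le_trans; apply; rewrite le_eqVlt; apply/orP; left; apply/eqP; ring.
Qed.

(** Differentiation under the integral: the quotients of [U^2] are bounded by [2 C^2], and inside a
    cell they converge because [u] is affine there. *)
Let e_derive : {ae leb, forall t : measurableTypeR R, I t ->
  m.+1%:R * (e t - e (t + (- m.+1%:R^-1) *: 1)) @[m --> \oo] -->
    2 * ip muX Omega (fun x => gam (t, x)) (fun x => u (t, x))}.
Proof.
have [C [C0 h1 _ h2]] := U_bounds.
apply: filterS (slice_ae (ae_cell hM hphi)) => t ht It.
have tT : 0 <= t <= T by move: It; rewrite /= in_itv /= => /andP[/ltW -> /ltW ->].
have mu x : Omega x -> U t x = u (t, x) by move=> Ox; rewrite /U clampE // zextE.
pose f_ (m : nat) x := m.+1%:R * (U t x * U t x - U (t + (- m.+1%:R^-1) *: 1) x * U (t + (- m.+1%:R^-1) *: 1) x).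
have mf m : measurable_fun Omega (f_ m : X -> measurableTypeR R).
  by apply: measurable_funM => //; apply: measurable_funB; apply: measurable_funM; exact: U_measurable.
have Lgam : in_L2 muX Omega (fun x => gam (t, x)).
  have hg1 (y : R) : `|(cst 1 : R -> R) y| <= 1 by rewrite normr1.
  have [Cg _ hCg] := pwgrad_bounded phi c (1, 0) hg1.
  apply: (in_L2_bounded mO fO (C := Cg)) => //; apply: measurable_funTS.
  have mg := pwgrad_measurable phi (be := cst 1) c (1, 0) (measurable_cst _).
  exact: (measurable_fun_pair2 t mg).
have E : 2 * ip muX Omega (fun x => gam (t, x)) (fun x => u (t, x)) =
    \int[muX]_(x in Omega) (2 * (gam (t, x) * U t x)).
  rewrite RintegralZl //; last exact: (in_L2_integrableM mO Lgam (U_L2 t)).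
  by congr (_ * _); apply: eq_Rintegral => x /set_mem Ox; rewrite mu.
have E2 : (fun m : nat => m.+1%:R * (e t - e (t + (- m.+1%:R^-1) *: 1))) =
    fun m => \int[muX]_(x in Omega) f_ m x.
  apply/funext => m; rewrite e_diff /f_ RintegralZl //.
  have := integrableB mO (in_L2_integrableM mO (U_L2 t) (U_L2 t))
    (in_L2_integrableM mO (U_L2 (t + (- m.+1%:R^-1) *: 1)) (U_L2 (t + (- m.+1%:R^-1) *: 1))).
  by apply: eq_integrable.
rewrite E E2; apply: (Rintegral_dominated_cvg (g := fun=> 2 * C ^+ 2)) => //.
- by apply: measurable_funM => //; apply: measurable_funM; [exact: Lgam.1|exact: U_measurable].
- apply: filterS (ht It) => x + Ox => /(_ Ox)[K KM Kz].
  set a := affZ (c K) (t, x); set s := dotZ (c K).2 (1, 0).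
  have -> : gam (t, x) = s by rewrite (pwgrad_int hM hphi _ _ _ KM Kz) mul1r.
  have UE r : intK K (r, x) -> U r x = affZ (c K) (r, x).
    move=> Kr; have [/= r0 _] := int_cell_Qopen lO hM hphi KM Kr.
    rewrite /U clampE; last by move: r0; rewrite /= in_itv /= => /andP[/ltW -> /ltW ->].
    by rewrite zextE // (cu KM) //; exact: (int_cell_sub hM hphi KM).
  have Uta : U t x = a by rewrite UE.
  (* The backward quotient of the square of an affine function with slope [s] and value [a] is
     exactly [2 s a - s^2 / (m + 1)]. *)
  have lim : 2 * (s * a) - m.+1%:R^-1 * s ^+ 2 @[m --> \oo] --> 2 * (s * U t x).
    rewrite Uta -[X in _ --> X]subr0 -[X in _ - X](mul0r (s ^+ 2)).
    by apply: cvgB; [exact: cvg_cst|apply: cvgMl; exact: cvg_harmonic].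
  apply: cvg_trans lim; apply: near_eq_cvg.
  have nK : nbhs ((t, x) : Z) (intK K) by apply: open_nbhs_nbhs; split => //; exact: open_int_cell.
  have hc : ((t, x) : Z) + (- m.+1%:R^-1) *: ((1, 0) : Z) @[m --> \oo] --> ((t, x) : Z).
    have : ((t, x) : Z) + (- m.+1%:R^-1) *: ((1, 0) : Z) @[m --> \oo] --> ((t, x) : Z) + (- 0) *: ((1, 0) : Z).
      by apply: cvgD; [exact: cvg_cst|apply: cvgZr_tmp; apply: cvgN; exact: cvg_harmonic].
    by rewrite oppr0 scale0r addr0.
  have : \forall m \near \oo, intK K (((t, x) : Z) + (- m.+1%:R^-1) *: ((1, 0) : Z)) by exact: (hc _ nK).
  apply: filterS => m hm /=.
  have pE : ((t, x) : Z) + (- m.+1%:R^-1) *: ((1, 0) : Z) = (t + (- m.+1%:R^-1) *: 1, x).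
    by congr (_, _); rewrite /= scaler0 addr0.
  have -> : f_ m x = m.+1%:R * (a * a - (a - m.+1%:R^-1 * s) * (a - m.+1%:R^-1 * s)).
    rewrite /f_ Uta (UE (t + (- m.+1%:R^-1) *: 1)); last by rewrite -pE.
    by rewrite -pE affZ_lin mulNr.
  have m0 : m.+1%:R != 0 :> R by rewrite pnatr_eq0.
  by field.
- by apply: (in_L2_integrable mO fO); apply: (in_L2_bounded mO fO (C := `|2 * C ^+ 2|)).
- apply: aeW => x Ox m; rewrite /f_ normrM normr_nat.
  have := diff_bound t (t + (- m.+1%:R^-1) *: 1) x h1 h2.
  have -> : `|t - (t + (- m.+1%:R^-1) *: 1)| = m.+1%:R^-1.
    by rewrite opprD addrA subrr add0r [_ *: 1]mulr1 opprK ger0_norm.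
  by move=> h; rewrite mulrC -ler_pdivlMr.
Qed.

Lemma final_slice_L2 : in_L2 muX Omega (fun x => u (T, x)).
Proof.
have UT x : Omega x -> U T x = u (T, x) by move=> Ox; rewrite /U clampE ?lexx ?ltW // zextE.
apply: in_L2_ae (U_L2 T); last exact: aeW.
apply: eq_measurable_fun (U_measurable T) => x /set_mem Ox; exact: UT.
Qed.

(** The energy [e] is Lipschitz, hence the integral of its almost everywhere derivative. This takes
    the place of the integration by parts formula for the pairing of [H^1_0] with its dual. *)
Lemma energy_identity : 2 * ip muZ Q gam u = ip muX Omega (fun x => u (T, x)) (fun x => u (T, x)).
Proof.
have [C [C0 h1 _ h2]] := U_bounds.
pose K := 2 * C ^+ 2 * fine (muX Omega) + 1.
have K0 : 0 < K by rewrite ltr_wpDl // mulr_ge0 ?fine_ge0 // mulr_ge0 // sqr_ge0.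
have eK s t : `|e s - e t| <= K * `|s - t|.
  rewrite e_diff; apply: le_trans (Rintegral_bounded (K := 2 * C ^+ 2 * `|s - t|) _ _) _.
  - by apply: measurable_funB; apply: measurable_funM; exact: U_measurable.
  - by move=> x _; exact: diff_bound.
  by rewrite mulrAC ler_wpM2r // lerDl.
have [g [ig dg gE]] := lipschitz_FTC K0 T0 eK.
have Lgam : in_L2 muZ Q gam.
  have hg1 (y : R) : `|(cst 1 : R -> R) y| <= 1 by rewrite normr1.
  have [Cg _ hCg] := pwgrad_bounded phi c (1, 0) hg1.
  apply: (in_L2_bounded mQ fQ (C := Cg)) => //; apply: measurable_funTS.
  exact: (pwgrad_measurable phi (be := cst 1) c (1, 0) (measurable_cst _)).
have [i1 ->] := slice_ip oO Lgam Lu.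
rewrite -RintegralZl //.
have gt : {ae leb, forall t : measurableTypeR R, I t ->
    2 * ip muX Omega (fun x => gam (t, x)) (fun x => u (t, x)) = g t}.
  apply: filterS2 e_derive dg => t h3 h4 It; have [d1 <-] := h4 (I_sub It).
  exact: (cvg_unique _ (h3 It) (backward_difference d1)).
rewrite (ae_eq_Rintegral_nomeas gt) -Rintegral_I gE.
have -> : e 0 = 0.
  rewrite /e /ip (@eq_Rintegral _ _ _ _ _ (fun=> 0)) ?/Rintegral ?integral0 // => x /set_mem Ox.
  by rewrite /U clampE ?lexx ?ltW // zextE // u0 // mul0r.
rewrite subr0; apply: eq_Rintegral => x /set_mem Ox.
by rewrite /U clampE ?lexx ?ltW // zextE.
Qed.

End energy_identity.

(** * Residuals *)

Section residual_functionals.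
Context (R : realType) (d : nat) (T : R) (Omega : set 'rV[R]_d).
Local Notation X := 'rV[R]_d.
Local Notation Z := (R * 'rV[R]_d)%type.
Local Notation MZ := (measurableTypeR R * 'rV[R]_d)%type.
Local Notation muX := (lebesgue_rV R d).
Local Notation muZ := (lebZ R d).
Local Notation leb := (@lebesgue_measure R).
Local Notation Q := (Qset T Omega).
Local Notation I := (`]0, T[%classic : set (measurableTypeR R)).
Local Notation ae_eqQ u v := {ae muZ, forall z : MZ, Q z -> u z = v z}.
Hypotheses (lO : lipschitz_domain Omega) (T0 : 0 < T).

Let oO : open Omega. Proof. by case: lO. Qed.
Let bO : bounded_set Omega. Proof. by case: lO. Qed.
Let O0 : Omega !=set0. Proof. by case: lO. Qed.
Let mO : measurable Omega. Proof. exact: measurable_domain. Qed.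
Let mQ : measurable Q. Proof. exact: measurable_Q. Qed.
Let fQ : (muZ Q < +oo)%E. Proof. exact: Q_fin. Qed.
Let mI : measurable I. Proof. exact: measurable_itv. Qed.

Lemma weak_derivative_lin (e : Z) (c : R) u v g h : in_L2 muZ Q u -> in_L2 muZ Q v ->
  is_weak_derivative muZ Q (@test_fun R Z (Qopen T Omega)) (fun psi z => 'D_e psi z) u g ->
  is_weak_derivative muZ Q (@test_fun R Z (Qopen T Omega)) (fun psi z => 'D_e psi z) v h ->
  is_weak_derivative muZ Q (@test_fun R Z (Qopen T Omega)) (fun psi z => 'D_e psi z)
    (fun z => c * u z + v z) (fun z => c * g z + h z).
Proof.
move=> Lu Lv [Lg hg] [Lh hh]; split; first exact: in_L2_lin.
move=> psi tp; have Lp : in_L2 muZ Q psi := test_fun_L2 (coordsZ R d) mQ fQ tp.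
have Ld : in_L2 muZ Q ('D_e psi) := test_fun_L2 (coordsZ R d) mQ fQ (test_fun_derive e tp).
apply: etrans (ip_linl mQ c Lu Lv Ld) _; apply: etrans (congr1 -%R (esym (ip_linl mQ c Lg Lh Lp))).
by rewrite /ip hg // hh //; ring.
Qed.

Variables (CP : R) (hCP : poincare_constant Omega CP).
Local Notation CPh := (CP * diam Omega).

(** A rescaled constant path; it shows that the supremum in [L2Hm1norm] is not over the empty
    set. *)
Lemma unit_energy_path : exists2 phi, in_L2H10 T Omega phi & energy T Omega phi = 1%E.
Proof.
have [psi tp g0] := H10_nontrivial oO bO hCP O0; have hp := in_H10_test oO bO tp.
(* The constant path with value [k psi] has energy [T k^2] times the squared gradient norm of
   [psi]. *)
pose k := (Num.sqrt T * gnorm Omega psi)^-1.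
have sT : 0 < Num.sqrt T by rewrite sqrtr_gt0.
have k0 : 0 < k by rewrite invr_gt0 mulr_gt0.
have hk := in_H10_Z oO bO k hp; have hk1 := in_H10_H1 hk.
have gk : gnorm Omega (fun x => k * psi x) = k * gnorm Omega psi.
  have hz := in_H10_H1 (in_H10_test oO bO (test_fun0 Omega)).
  have a0 v : in_H1 Omega v -> aform Omega v (fun=> 0) = 0.
    move=> hv; rewrite aformC; have := aform_lin oO bO (-1) hz hz hv.
    by under [X in aform _ X _]eq_fun do rewrite mulr0 addr0; rewrite mulN1r addNr.
  rewrite (_ : (fun x => k * psi x) = fun x => k * psi x + (fun=> 0) x); last by apply/funext => x; rewrite addr0.
  rewrite /gnorm (aform_lin2 oO bO k (in_H10_H1 hp) hz) a0 ?(a0 _ hz) //; last exact: in_H10_H1.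
  by rewrite mulr0 !addr0 sqrtrM ?sqr_ge0 // sqrtr_sqr gtr0_norm.
have e1 : energy T Omega (fun _ x => k * psi x) = 1%E.
  rewrite /energy (normX_grad oO hk1) gk integral_cst //.
  rewrite -[X in (_ * X)%E]/(lebesgue_measure _) lebesgue_measure_itv /= lte_fin T0 -EFinD subr0.
  rewrite -EFinM; congr (_%:E); rewrite -expr2 /k -[X in _ * X](sqr_sqrtr (ltW T0)) -exprMn.
  by rewrite -mulrA [gnorm _ _ * _]mulrC mulVf ?expr1n // mulf_neq0 // gt_eqF.
exists (fun _ x => k * psi x) => //; split.
- by apply: aeW => t _.
- exists (fun _ _ x => k * psi x); split.
    move=> _; exists 1%N, (fun _ => setT), (fun _ x => k * psi x); split.
      by move=> _; split; [exact: measurableT|].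
    by apply/funext => t; apply/funext => x; rewrite big_ord1 indicT mul1r.
  apply: aeW => t _; apply: cvg_near_cst; apply: nearW => _.
  have hd := in_H10_H1 (in_H10_B oO bO hk hk).
  rewrite (normX_grad oO hd); congr (_%:E); apply/eqP; rewrite eq_le gnorm_ge0 andbT.
  have := gnorm_lin oO bO (-1) hk1 hk1.
  rewrite (_ : (fun x => -1 * (k * psi x) + k * psi x) = (fun _ => 0)); last by apply/funext => x; rewrite mulN1r addNr.
  rewrite (_ : _ \- _ = (fun _ => 0)); last by apply/funext => x /=; rewrite subrr.
  move=> _; have h0 := @aform_lin R d Omega oO bO (-1) (fun=> 0) (fun=> 0) (fun=> 0).
  have hz := in_H10_H1 (in_H10_test oO bO (test_fun0 Omega)).
  move: (h0 hz hz hz); under [X in aform _ X _]eq_fun do rewrite mulr0 addr0.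
  by rewrite mulN1r addNr /gnorm => ->; rewrite sqrtr0.
- by rewrite e1 ltry.
Qed.

Lemma L2Hm1norm_sqr_le (F : (R -> X -> R) -> R) (b : R) :
  (forall phi, in_L2H10 T Omega phi -> energy T Omega phi = 1%E -> `|F phi| <= b) ->
  (L2Hm1norm T Omega F ^+ 2 <= (b ^+ 2)%:E)%E.
Proof.
move=> h; apply: ereal_sup_sqr_le.
  by have [phi p1 p2] := unit_energy_path; exists (F phi)%:E; exists phi.
by move=> _ [phi [p1 p2] <-]; rewrite lee_fin; exact: h.
Qed.

Section along_a_path.
Variables (phi : R -> X -> R) (hphi : in_L2H10 T Omega phi).

Definition Jf (a : Z -> R) := \int[leb]_(t in I) ip muX Omega (fun x => a (t, x)) (phi t).
Definition Vf (W : Z -> X) := \int[leb]_(t in I) vip muX Omega (fun x => W (t, x)) (grad Omega (phi t)).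

Lemma Jf_ae a b : ae_eqQ a b -> Jf a = Jf b.
Proof.
move=> /slice_ae h; apply: ae_eq_Rintegral_nomeas; apply: filterS h => t + It => /(_ It) h.
by apply: ip_ae => //; exact: aeW.
Qed.

Lemma Vf_ae W W' : ae_eqQ W W' -> Vf W = Vf W'.
Proof.
move=> /slice_ae h; apply: ae_eq_Rintegral_nomeas; apply: filterS h => t + It => /(_ It) h.
by apply: vip_ae => //; exact: aeW.
Qed.

Lemma Jf_lin (c : R) a b : in_L2 muZ Q a -> in_L2 muZ Q b ->
  Jf (fun z => c * a z + b z) = c * Jf a + Jf b.
Proof.
move=> La Lb.
have [_ <-] := aeint_lin c (path_ip oO bO T0 hphi hCP La).1 (path_ip oO bO T0 hphi hCP Lb).1.
have h : {ae leb, forall t : measurableTypeR R, I t -> in_L2 muX Omega (fun x => a (t, x)) /\ in_L2 muX Omega (fun x => b (t, x))}.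
  by apply: filterS2 (slice_L2 oO La) (slice_L2 oO Lb) => t h1 h2 It; split; [exact: h1|exact: h2].
apply: ae_eq_Rintegral_nomeas; apply: filterS2 h (path_H10 hphi) => t h1 h2 It.
by have [l1 l2] := h1 It; exact: (ip_linl mO c l1 l2 (in_H10_H1 (h2 It)).1).
Qed.

Lemma Vf_lin (c : R) W W' : in_L2v muZ Q W -> in_L2v muZ Q W' ->
  Vf (fun z => c *: W z + W' z) = c * Vf W + Vf W'.
Proof.
move=> LW LW'.
have [_ <-] := aeint_lin c (path_vip oO bO T0 hphi LW).1 (path_vip oO bO T0 hphi LW').1.
have h : {ae leb, forall t : measurableTypeR R, I t -> in_L2v muX Omega (fun x => W (t, x)) /\ in_L2v muX Omega (fun x => W' (t, x))}.
  by apply: filterS2 (slice_L2v oO LW) (slice_L2v oO LW') => t h1 h2 It; split; [exact: h1|exact: h2].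
apply: ae_eq_Rintegral_nomeas; apply: filterS2 h (path_H10 hphi) => t h1 h2 It.
by have [l1 l2] := h1 It; exact: (vip_linl mO c l1 l2 (grad_L2 (in_H10_H1 (h2 It)))).
Qed.

Lemma Vf_dotv W : in_L2v muZ Q W ->
  \int[leb]_(t in I) \int[muX]_(x in Omega) dotv (W (t, x)) (grad Omega (phi t) x) = Vf W.
Proof.
move=> LW; apply: ae_eq_Rintegral_nomeas; apply: filterS2 (slice_L2v oO LW) (path_H10 hphi) => t h1 h2 It.
exact: (Rintegral_dotv mO (h1 It) (grad_L2 (in_H10_H1 (h2 It)))).
Qed.

Lemma Jf_dt w gam Cg : in_L2 muZ Q w -> measurable_fun setT (gam : MZ -> measurableTypeR R) ->
  (forall z, `|gam z| <= Cg) -> is_dt T Omega w gam ->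
  \int[leb]_(t in I) dt_Hm1 T Omega w t (phi t) = Jf gam.
Proof.
move=> Lw mg gC hg; apply: ae_eq_Rintegral_nomeas.
by apply: filterS2 (dt_Hm1_ae oO bO T0 hCP O0 Lw mg gC hg) (path_H10 hphi) => t h1 h2 It; apply: h1 => //; exact: h2.
Qed.

End along_a_path.

Variables (kappa : R) (M : mesh R d) (hM : simplicial_mesh (Qclosed T Omega) kappa M).
Variables (hat : 'I_(nnode M) -> Z -> R) (hhat : forall a, is_hat (Qclosed T Omega) a (hat a)).
Variables (c : {set 'I_(nnode M)} -> R * Z) (u : Z -> R).
Hypotheses (cu : pw_affine c u) (uG : forall z, GammaT T Omega z -> u z = 0) (Lu : in_L2 muZ Q u).
Hypothesis u0 : forall x, Omega x -> u (0, x) = 0.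
Local Notation gam := (pwgrad hat (cst 1) c (1, 0)).
Variables (Lgam : in_L2 muZ Q gam) (W : Z -> X) (LW : in_L2v muZ Q W).
Hypothesis hW : {ae muZ, forall z : MZ, Q z -> forall j, W z ord0 j = pwgrad hat (cst 1) c (0, e_ R j) z}.

(* For almost every [t], [hilbert_ineq] bounds the square of the functional by
   [CPh^2 |gam|^2 + 2 (gam, u) + |W|^2]; the integral in time of the cross term is
   [|u(T)|^2] by [energy_identity]. *)
Lemma heat_residual_bound phi : in_L2H10 T Omega phi -> energy T Omega phi = 1%E ->
  `|Jf phi gam + Vf phi W| <= Num.sqrt (CPh ^+ 2 * ip muZ Q gam gam + vip muZ Q W W
     + ip muX Omega (fun x => u (T, x)) (fun x => u (T, x))).
Proof.
move=> hphi e1.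
(* Completing the square; it gives [0 <= N t], which [path_estimate] asks for. *)
have nonneg (a p q : R) : - (a * q) <= p -> 0 <= a ^+ 2 + 2 * p + q ^+ 2.
  by have := sqr_ge0 (a - q); nra.
have [ij _] := path_ip oO bO T0 hphi hCP Lgam; have [iv _] := path_vip oO bO T0 hphi LW.
have [_ E] := aeint_lin 1 ij iv; rewrite mul1r in E; rewrite -[X in `|X|]E.
pose G t := fun x => gam (t, x).
pose N t := CPh ^+ 2 * ip muX Omega (G t) (G t) + 2 * ip muX Omega (G t) (fun x => u (t, x)) +
  vip muX Omega (fun x => W (t, x)) (fun x => W (t, x)).
have [i1 E1] := slice_ip oO Lgam Lgam; have [i2 E2] := slice_ip oO Lgam Lu; have [i3 E3] := slice_vip oO LW LW.
have j1 := integrableZl mI (CPh ^+ 2) i1; have j2 := integrableZl mI 2 i2.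
have iN : leb.-integrable I (EFin \o N) by exact: (integrableD mI (integrableD mI j1 j2) i3).
have EN : \int[leb]_(t in I) N t = CPh ^+ 2 * ip muZ Q gam gam + vip muZ Q W W
     + ip muX Omega (fun x => u (T, x)) (fun x => u (T, x)).
  rewrite /N RintegralD //; last exact: (integrableD mI j1 j2).
  rewrite RintegralD // !RintegralZl // -E1 -E2 -E3 (energy_identity lO T0 hM hhat cu uG Lu u0).
  by rewrite addrAC.
have h0 := @path_estimate R d T Omega oO bO phi hphi (fun t v => 1 * ip muX Omega (G t) v + vip muX Omega (fun x => W (t, x)) (grad Omega v)) N iN.
rewrite -EN; apply: (h0 _ _).2 => //.
- have hs : {ae leb, forall t : measurableTypeR R, I t -> [/\ in_L2 muX Omega (G t), in_L2v muX Omega (fun x => W (t, x))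
     & {ae muX, forall x, Omega x -> forall j, W (t, x) ord0 j = pwgrad hat (cst 1) c (0, e_ R j) (t, x)}]}.
    have h1 : {ae leb, forall t : measurableTypeR R, I t -> in_L2 muX Omega (G t) /\ in_L2v muX Omega (fun x => W (t, x))}.
      by apply: filterS2 (slice_L2 oO Lgam) (slice_L2v oO LW) => t h1 h2 It; split; [exact: h1|exact: h2].
    by apply: filterS2 h1 (slice_ae hW) => t h1 h2 It; have [l1 l2] := h1 It; split => //; exact: h2.
  apply: filterS2 hs (pw_slice_H10 lO T0 hM hhat cu uG) => t h1 h2 It.
  have [LG LWt hWt] := h1 It; have [hv hd] := h2 It.
  pose v0 := fun x => zext Omega u (t, x).
  have gv : {ae muX, forall x, Omega x -> W (t, x) = grad Omega v0 x}.
    by apply: filterS2 hWt (grad_ae oO bO hd) => x e1' e2 Ox; rewrite e2 //; apply/rowP => j; rewrite mxE e1'.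
  have vW v : vip muX Omega (fun x => W (t, x)) (grad Omega v) = aform Omega v0 v.
    by apply: vip_ae => //; exact: aeW.
  have WW : vip muX Omega (fun x => W (t, x)) (fun x => W (t, x)) = aform Omega v0 v0 by exact: vip_ae.
  have Gu : ip muX Omega (G t) (fun x => u (t, x)) = ip muX Omega (G t) v0.
    by apply: eq_Rintegral => x /set_mem Ox; rewrite /v0 zextE.
  pose n := CPh * Num.sqrt (ip muX Omega (G t) (G t)).
  have gl (k : R) v w : in_H10 Omega v -> in_H10 Omega w ->
      ip muX Omega (G t) (fun x => k * v x + w x) = k * ip muX Omega (G t) v + ip muX Omega (G t) w.
    by move=> hv' hw'; exact: (ip_linr mO k (in_H10_H1 hv').1 (in_H10_H1 hw').1 LG).
  have gn v : in_H10 Omega v -> `|ip muX Omega (G t) v| <= n * gnorm Omega v.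
    move=> hv'; apply: le_trans (ip_CS mO LG (in_H10_H1 hv').1) _; rewrite /n [CPh * _]mulrC -mulrA.
    by rewrite ler_wpM2l ?sqrtr_ge0 //; exact: (poincare oO hCP hv').
  have NE : N t = n ^+ 2 + 2 * ip muX Omega (G t) v0 + aform Omega v0 v0.
    have n2 : n ^+ 2 = CPh ^+ 2 * ip muX Omega (G t) (G t) by rewrite /n (exprMn 2 CPh) sqr_sqrtr ?ip_ge0.
    by rewrite /N Gu WW n2.
  have N0 : 0 <= N t.
    by rewrite NE -(gnorm_sqr Omega v0); apply: nonneg; have := gn _ hv; rewrite ler_norml => /andP[].
  split; first exact: N0.
  + move=> k v w hv' hw'; rewrite !vW (gl k v w hv' hw') [aform _ _ (fun x => _)]aformC.
    rewrite (aform_lin oO bO k (in_H10_H1 hv') (in_H10_H1 hw') (in_H10_H1 hv)) [aform _ v _]aformC [aform _ w _]aformC.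
    by move: (ip _ _ _ v) (ip _ _ _ w) (aform _ _ v) (aform _ _ w) => p q r s; ring.
  + move=> v hv'; rewrite vW mul1r.
    have := hilbert_ineq oO bO gl gn hv hv'; rewrite -NE => h.
    rewrite -sqrtr_sqr /gnorm -sqrtrM //; exact: ler_wsqrtr.
- move=> v hv; apply: measurable_funD.
    apply: measurable_funM => //; have := slice_ip_measurable oO T0 Lgam (in_H10_H1 hv).1.
    by move=> /measurable_int/measurable_EFinP.
  apply: (@measurable_sum _ _ R I _ (index_enum _) (fun j t => ip muX Omega (fun x => W (t, x) ord0 j) (fun x => grad Omega v x ord0 j))) => j.
  have := slice_ip_measurable oO T0 (LW j) (grad_L2 (in_H10_H1 hv) j).
  by move=> /measurable_int/measurable_EFinP.
Qed.

End residual_functionals.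

(** * The residual bounds and the real values of the estimators *)

Section estimates.
Context (R : realType) (d : nat) (T : R) (Omega : set 'rV[R]_d).
Local Notation X := 'rV[R]_d.
Local Notation Z := (R * 'rV[R]_d)%type.
Local Notation MZ := (measurableTypeR R * 'rV[R]_d)%type.
Local Notation muX := (lebesgue_rV R d).
Local Notation muZ := (lebZ R d).
Local Notation leb := (@lebesgue_measure R).
Local Notation Q := (Qset T Omega).
Local Notation I := (`]0, T[%classic : set (measurableTypeR R)).
Local Notation ae_eqQ u v := {ae muZ, forall z : MZ, Q z -> u z = v z}.
Hypotheses (lO : lipschitz_domain Omega) (T0 : 0 < T).

Let oO : open Omega. Proof. by case: lO. Qed.
Let bO : bounded_set Omega. Proof. by case: lO. Qed.
Let O0 : Omega !=set0. Proof. by case: lO. Qed.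
Let mO : measurable Omega. Proof. exact: measurable_domain. Qed.
Let mQ : measurable Q. Proof. exact: measurable_Q. Qed.
Let mI : measurable I. Proof. exact: measurable_itv. Qed.

Lemma gradx_is_dx u j : (exists g, is_dx T Omega j u g) -> is_dx T Omega j u (fun z => gradx T Omega u z ord0 j).
Proof.
move=> [g hg]; rewrite (_ : (fun z => _) = xget (cst 0) [set g | is_dx T Omega j u g]).
  by case: xgetP => // /(_ g).
by apply/funext => z; rewrite mxE.
Qed.

(** Minkowski's inequality in the plane for [(a, sqrt x)] and [(e, 0)]. It splits the linearisation
    part off the root that contains the initial error. *)
Lemma sqrte_sqr_add_le (a e : R) (x : \bar R) : 0 <= a -> 0 <= e -> (0 <= x)%E ->
  (sqrte (((a + e) ^+ 2)%:E + x) <= sqrte ((a ^+ 2)%:E + x) + e%:E)%E.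
Proof.
case: x => [r| |] a0 e0 r0; [|exact: leey|by []].
move: r0; rewrite lee_fin => r0; rewrite lee_fin.
rewrite -[leLHS]/(Num.sqrt ((a + e) ^+ 2 + r)) -[leRHS]/(Num.sqrt (a ^+ 2 + r) + e).
have s0 := sqrtr_ge0 (a ^+ 2 + r).
have sa : a <= Num.sqrt (a ^+ 2 + r).
  by rewrite -{1}(ger0_norm a0) -sqrtr_sqr; apply: ler_wsqrtr; rewrite lerDl.
rewrite -[leRHS]ger0_norm ?addr_ge0 // -sqrtr_sqr; apply: ler_wsqrtr.
rewrite [leRHS]sqrrD sqr_sqrtr ?addr_ge0 ?sqr_ge0 // sqrrD.
have := ler_wpM2r e0 sa; move: (Num.sqrt _) => q; rewrite !mulr2n => h; lra.
Qed.

Variables (CP : R) (hCP : poincare_constant Omega CP).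
Local Notation CPh := (CP * diam Omega).
Variables (kappa : R) (M : mesh R d) (hM : simplicial_mesh (Qclosed T Omega) kappa M).
Variables (hat : 'I_(nnode M) -> Z -> R) (hhat : forall a, is_hat (Qclosed T Omega) a (hat a)).
Variables (b B : R -> R) (hb : forall r s, `|b r - b s| <= `|r - s|) (hB : forall r s, `|B r - B s| <= `|r - s|).
Variables (f : Z -> R) (Lf : in_L2 muZ Q f) (L : R) (L0 : 0 <= L).
Variables (s s' : Z -> R) (Ls : in_L2 muZ Q s).
Variables (gb : Z -> R) (Cb : R) (mgb : measurable_fun setT (gb : MZ -> measurableTypeR R))
  (hCb : forall z, `|gb z| <= Cb) (hgb : is_dt T Omega (b \o s) gb)
  (hdB : forall j, exists g, is_dx T Omega j (B \o s) g).
Local Notation ds := (s' \- s).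
Variable (c : {set 'I_(nnode M)} -> R * Z).
Hypotheses (cds : pw_affine c ds) (dsG : forall z, GammaT T Omega z -> ds z = 0) (Lds : in_L2 muZ Q ds).
Hypothesis ds0 : forall x, Omega x -> ds (0, x) = 0.
Local Notation gam := (pwgrad hat (cst 1) c (1, 0)).
Local Notation S := (dt T Omega (fun z => L * (s' z - s z) + b (s z)) \- f).
Local Notation F := (gradx T Omega (fun z => L * (s' z - s z) + B (s z))).
Local Notation w := (dt T Omega (b \o s) \- f).
Variables (p : nat) (sig : 'I_(nnode M) -> Z -> X).
Hypothesis hsig : forall a, local_flux T Omega p a (hat a) S F (sig a).
Local Notation sigma := (global_flux T Omega hat sig).
Local Notation P := (Pi0 M Q S).

Let ds_chain e : is_weak_derivative muZ Q (@test_fun R Z (Qopen T Omega)) (fun psi z => 'D_e psi z)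
  ds (pwgrad hat (cst 1) c e).
Proof.
have := @weak_chain_rule R d T Omega lO T0 kappa M hM hat hhat c ds id (cst 1) set0 e cds Lds.
apply => //.
- by move=> y; rewrite normr1.
- by move=> y _; split; [exact: derivable_id|rewrite derive_id].
Qed.

Let gam_bounded : exists2 C : R, 0 <= C & forall z, `|gam z| <= C.
Proof. by apply: pwgrad_bounded => y; rewrite normr1. Qed.

Let gam_measurable : measurable_fun setT (gam : MZ -> measurableTypeR R).
Proof. exact: (pwgrad_measurable hat (be := cst 1) c (1, 0) (measurable_cst _)). Qed.

Let Lgam : in_L2 muZ Q gam. Proof. exact: (ds_chain (1, 0)).1. Qed.
Let LW : in_L2v muZ Q (gradx T Omega ds). Proof. exact: gradx_L2. Qed.
Let LWB : in_L2v muZ Q (gradx T Omega (B \o s)). Proof. exact: gradx_L2. Qed.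
Let Lgb : in_L2 muZ Q gb. Proof. exact: hgb.1. Qed.
Let LS : in_L2 muZ Q S. Proof. by apply: in_L2B => //; exact: dt_L2. Qed.
Let Lw : in_L2 muZ Q w. Proof. by apply: in_L2B => //; exact: dt_L2. Qed.
Let LF : in_L2v muZ Q F. Proof. exact: gradx_L2. Qed.
Let LP : in_L2 muZ Q P. Proof. exact: (Pi0_L2 lO hM hhat LS). Qed.
Let Lsig : in_L2v muZ Q sigma. Proof. exact: (flux_L2 lO hsig). Qed.

Let LsF : in_L2v muZ Q (fun z => sigma z + F z).
Proof.
move=> j; have := in_L2D mQ (Lsig j) (LF j); congr in_L2; apply/funext => z.
by rewrite [in RHS]mxE.
Qed.

Let w_ae : ae_eqQ w (fun z => gb z - f z).
Proof. by apply: filterS (dt_ae oO bO hgb) => z h Qz /=; rewrite h. Qed.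

(** [S] contains the chosen derivative of a sum; uniqueness replaces it by the two explicit
    derivatives of the summands. *)
Let S_ae : ae_eqQ S (fun z => L * gam z + (gb z - f z)).
Proof.
have h := weak_derivative_lin lO L Lds (lipschitz_comp_L2 lO hb Ls) (ds_chain (1, 0)) hgb.
by apply: filterS (dt_ae oO bO h) => z h' Qz /=; rewrite h' // addrA.
Qed.

Let F_ae : ae_eqQ F (fun z => L *: gradx T Omega ds z + gradx T Omega (B \o s) z).
Proof.
have h j := weak_derivative_lin lO L Lds (lipschitz_comp_L2 lO hB Ls)
  (gradx_is_dx (ex_intro _ _ (ds_chain (0, e_ R j)))) (gradx_is_dx (hdB j)).
by apply: filterS (gradx_ae oO bO h) => z h' Qz; apply/rowP => j; rewrite h' // !mxE.
Qed.

Let osc_ae : ae_eqQ (fun z => S z - P z) (fun z => w z - Pi0 M Q w z).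
Proof.
apply: (Pi0_shift lO hM hhat (q := fun K => L * dotZ (c K).2 (1, 0)) LS Lw).
apply: filterS2 S_ae w_ae => z h1 h2 Qz; rewrite h1 // h2 // addrC; congr (_ + _).
by rewrite /pwc /pwgrad mulr_sumr; apply: eq_bigr => K _; rewrite mul1r mulrCA.
Qed.

Section path.
Variables (phi : R -> X -> R) (hphi : in_L2H10 T Omega phi).

Lemma residual_H_functionals : residual_H T Omega ds phi = Jf T Omega phi gam + Vf T Omega phi (gradx T Omega ds).
Proof.
have [C _ hC] := gam_bounded.
by rewrite /residual_H (Jf_dt lO T0 hCP hphi Lds gam_measurable hC (ds_chain (1, 0))) (Vf_dotv lO hphi LW).
Qed.

Lemma residual_lin_functionals : residual_lin T Omega L b B f s' s phi =
  Jf T Omega phi (fun z => S z - P z) + Vf T Omega phi (fun z => sigma z + F z).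
Proof.
have lin1 a1 a2 : in_L2 muZ Q a1 -> in_L2 muZ Q a2 -> Jf T Omega phi (fun z => a1 z - a2 z) = Jf T Omega phi a1 - Jf T Omega phi a2.
  move=> l1 l2; rewrite -[RHS]addrC -mulN1r -(Jf_lin lO T0 hCP hphi (-1) l2 l1).
  by apply: Jf_ae; apply: aeW => z _; rewrite mulN1r addrC.
(* The identity on slices trades [(sigma, grad phi)] for [(P, phi)], so that [P] cancels in the
   sum. *)
have -> : Vf T Omega phi (fun z => sigma z + F z) = Jf T Omega phi P + Vf T Omega phi F.
  rewrite -[RHS](_ : 1 * Vf T Omega phi sigma + Vf T Omega phi F = _).
    rewrite -(Vf_lin lO T0 hphi 1 Lsig LF); apply: Vf_ae; apply: aeW => z _; by rewrite scale1r.
  rewrite mul1r; congr (_ + _); apply: ae_eq_Rintegral_nomeas.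
  by apply: filterS2 (flux_slice lO T0 hM hhat LS LF hsig hCP) (path_H10 hphi) => t h1 h2 It; apply: h1 => //; exact: h2.
rewrite (lin1 _ _ LS LP) addrA subrK (Jf_ae phi S_ae) (Vf_ae phi F_ae).
rewrite (Jf_lin lO T0 hCP hphi L Lgam (in_L2B mQ Lgb Lf)) (Vf_lin lO T0 hphi L LW LWB) (lin1 _ _ Lgb Lf).
rewrite /residual_lin residual_H_functionals /residual.
rewrite (Jf_dt lO T0 hCP hphi (lipschitz_comp_L2 lO hb Ls) mgb hCb hgb) (Vf_dotv lO hphi LWB).
rewrite -/(Jf T Omega phi f).
move: (Jf _ _ _ _) (Jf _ _ _ _) (Jf _ _ _ _) (Vf _ _ _ _) (Vf _ _ _ _) => x1 x2 x3 x4 x5; ring.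
Qed.

Lemma residual_lin_bound : energy T Omega phi = 1%E ->
  `|residual_lin T Omega L b B f s' s phi| <=
    Num.sqrt (vip muZ Q (fun z => sigma z + F z) (fun z => sigma z + F z)) +
    CPh * Num.sqrt (ip muZ Q (fun z => w z - Pi0 M Q w z) (fun z => w z - Pi0 M Q w z)).
Proof.
move=> e1; rewrite residual_lin_functionals addrC; apply: le_trans (ler_normD _ _) _.
apply: lerD; first exact: ((path_vip oO bO T0 hphi LsF).2 e1).
rewrite -(ip_ae osc_ae osc_ae).
exact: ((path_ip oO bO T0 hphi hCP (in_L2B mQ LS LP)).2 e1).
Qed.

Lemma residual_H_bound : energy T Omega phi = 1%E ->
  `|residual_H T Omega ds phi| <= Num.sqrt (CPh ^+ 2 * ip muZ Q gam gam
     + vip muZ Q (gradx T Omega ds) (gradx T Omega ds) + ip muX Omega (fun x => ds (T, x)) (fun x => ds (T, x))).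
Proof.
move=> e1; rewrite residual_H_functionals.
apply: (heat_residual_bound lO T0 hCP hM hhat cds dsG Lds ds0 Lgam LW) => //.
by apply: filterS (gradx_ae oO bO (fun j => ds_chain (0, e_ R j))) => z h Qz j; rewrite h.
Qed.

End path.

Local Notation A_F := (Num.sqrt (vip muZ Q (fun z => sigma z + F z) (fun z => sigma z + F z))).
Local Notation A_osc := (CPh * Num.sqrt (ip muZ Q (fun z => w z - Pi0 M Q w z) (fun z => w z - Pi0 M Q w z))).
Local Notation A_lin := (Num.sqrt (CPh ^+ 2 * ip muZ Q gam gam
     + vip muZ Q (gradx T Omega ds) (gradx T Omega ds) + ip muX Omega (fun x => ds (T, x)) (fun x => ds (T, x)))).

Lemma eta_F_real : normQ_vec T Omega (fun z => sigma z + F z) = A_F%:E.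
Proof.
exact: (L2norm_enorm mQ LsF).
Qed.

Lemma eta_osc_real : (CPh%:E * normQ T Omega (w \- Pi0 M Q w)%R)%E = A_osc%:E.
Proof.
have L1 := in_L2B mQ Lw (Pi0_L2 lO hM hhat Lw).
by rewrite [normQ _ _ _](L2normK mQ L1) -EFinM.
Qed.

Lemma sqr_normQ_vec_gradx : (normQ_vec T Omega (gradx T Omega ds) ^+ 2)%E =
  (vip muZ Q (gradx T Omega ds) (gradx T Omega ds))%:E.
Proof. by rewrite [normQ_vec _ _ _](L2norm_enorm mQ LW) -EFin_expe sqr_sqrtr // vip_ge0. Qed.

Lemma sqr_normX_final : (normX Omega (fun x => ds (T, x)) ^+ 2)%E =
  (ip muX Omega (fun x => ds (T, x)) (fun x => ds (T, x)))%:E.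
Proof.
have L1 := final_slice_L2 lO T0 hM hhat cds dsG ds0.
by rewrite [normX _ _](L2normK mO L1) -EFin_expe sqr_sqrtr ?ip_ge0.
Qed.

Lemma eta_lin_real : sqrte ((CPh ^+ 2)%:E * normQ T Omega (dt T Omega ds) ^+ 2
   + normQ_vec T Omega (gradx T Omega ds) ^+ 2 + normX Omega (fun x => ds (T, x)) ^+ 2)%E = A_lin%:E.
Proof.
rewrite sqr_normQ_vec_gradx sqr_normX_final [normQ _ _ _](L2norm_ae (dt_ae oO bO (ds_chain (1, 0)))) (L2normK mQ Lgam).
by rewrite -EFin_expe sqr_sqrtr ?ip_ge0.
Qed.

Lemma Vnorm_bound : (Vnorm T Omega ds <= A_lin%:E)%E.
Proof.
have [C _ hC] := gam_bounded.
rewrite /Vnorm sqr_normX_final.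
pose N t := CPh ^+ 2 * ip muX Omega (fun x => gam (t, x)) (fun x => gam (t, x)) +
  vip muX Omega (fun x => gradx T Omega ds (t, x)) (fun x => gradx T Omega ds (t, x)).
have [i1 E1] := slice_ip oO Lgam Lgam; have [i3 E3] := slice_vip oO LW LW.
have j1 := integrableZl mI (CPh ^+ 2) i1.
have iN : leb.-integrable I (EFin \o N) by exact: (integrableD mI j1 i3).
have N0 t : 0 <= N t by rewrite addr_ge0 ?vip_ge0 // mulr_ge0 ?sqr_ge0 ?ip_ge0.
(* The [H^{-1}] norm is not known to be measurable in [t], so the integrands are compared through
   [ge0_ae_le_integral]. *)
have h : (\int[leb]_(t in I) (normX_vec Omega (fun x => gradx T Omega ds (t, x)) ^+ 2
    + Hm1norm Omega (dt_Hm1 T Omega ds t) ^+ 2) <= \int[leb]_(t in I) (N t)%:E)%E.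
  apply: ge0_ae_le_integral => [t _|t _|].
  - by rewrite adde_ge0 // sqre_ge0.
  - by rewrite lee_fin.
  apply: filterS2 (slice_L2v oO LW) (dt_Hm1_ae oO bO T0 hCP O0 Lds gam_measurable hC (ds_chain (1, 0))) => t h1 h2 It.
  rewrite [normX_vec _ _](L2norm_enorm mO (h1 It)) -EFin_expe sqr_sqrtr ?vip_ge0 // addeC /N EFinD leeD2r //.
  have := @Hm1norm_sqr_le R d Omega oO bO CP hCP (dt_Hm1 T Omega ds t)
    (CPh * Num.sqrt (ip muX Omega (fun x => gam (t, x)) (fun x => gam (t, x)))) O0.
  rewrite (exprMn 2 CPh) sqr_sqrtr ?ip_ge0 //; apply => v hv; rewrite h2 //.
  exact: (dt_functional_bound oO bO hCP gam_measurable hC).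
rewrite -[leRHS]/(sqrte (CPh ^+ 2 * ip muZ Q gam gam
     + vip muZ Q (gradx T Omega ds) (gradx T Omega ds) + ip muX Omega (fun x => ds (T, x)) (fun x => ds (T, x)))%:E).
rewrite lee_sqrt; last by rewrite lee_fin !addr_ge0 ?vip_ge0 ?ip_ge0 // mulr_ge0 ?sqr_ge0 ?ip_ge0.
rewrite EFinD leeD2r //; apply: le_trans h _.
have -> : CPh ^+ 2 * ip muZ Q gam gam + vip muZ Q (gradx T Omega ds) (gradx T Omega ds) = \int[leb]_(t in I) N t.
  by rewrite /N RintegralD // RintegralZl // -E1 -E3.
by rewrite -[leRHS]/((fine (\int[leb]_(t in I) (N t)%:E))%:E) fineK //; exact: integrable_fin_num.
Qed.

Lemma sqr_err_disc_bound :
  (L2Hm1norm T Omega (residual_lin T Omega L b B f s' s) ^+ 2 <= ((A_F + A_osc) ^+ 2)%:E)%E.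
Proof. by apply: (L2Hm1norm_sqr_le lO T0 hCP) => phi; exact: residual_lin_bound. Qed.

Lemma sqr_err_bound :
  (L2Hm1norm T Omega (residual T Omega b B f s) ^+ 2 <= ((A_F + A_osc + L * A_lin) ^+ 2)%:E)%E.
Proof.
apply: (L2Hm1norm_sqr_le lO T0 hCP) => phi hphi e1.
have -> : residual T Omega b B f s phi = residual_lin T Omega L b B f s' s phi - L * residual_H T Omega ds phi.
  by rewrite /residual_lin addrAC subrr add0r.
apply: le_trans (ler_normB _ _) _; apply: lerD; first exact: residual_lin_bound.
by rewrite normrM (ger0_norm L0) ler_wpM2l // residual_H_bound.
Qed.

End estimates.

(** The initial error [x] remains an extended real, while the three estimators have become real
    numbers. *)
Lemma estimates_assembly (R : realType) (nd nr ef eo el vn x y : \bar R) (AF Ao Al L : R) :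
  0 <= AF -> 0 <= Ao -> 0 <= Al -> 0 <= L -> (0 <= x)%E -> y = x ->
  ef = AF%:E -> eo = Ao%:E -> el = Al%:E -> (vn <= Al%:E)%E ->
  (nd <= ((AF + Ao) ^+ 2)%:E)%E -> (nr <= ((AF + Ao + L * Al) ^+ 2)%:E)%E ->
  [/\ (sqrte (nd + y) <= sqrte ((ef + eo) ^+ 2 + x))%E, (vn <= el)%E
    & (sqrte (nr + x) <= sqrte ((ef + eo) ^+ 2 + x) + L%:E * el)%E].
Proof.
move=> F0 o0 l0 L0 x0 -> -> -> -> hv hd hr; split=> //.
  rewrite lee_sqrt; last by rewrite adde_ge0 // sqre_ge0.
  by rewrite leeD2r //; apply: le_trans hd _; rewrite -EFinD -EFin_expe.
apply: (@le_trans _ _ (sqrte (((AF + Ao + L * Al) ^+ 2)%:E + x))).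
  by rewrite lee_sqrt ?leeD2r // adde_ge0 // lee_fin sqr_ge0.
have := sqrte_sqr_add_le (addr_ge0 F0 o0) (mulr_ge0 L0 l0) x0; rewrite EFinM => /le_trans; apply.
by rewrite leeD2r // -EFinD -EFin_expe.
Qed.

Theorem theorem5p6 (R : realType) (d : nat) (hd : (0 < d)%N)
  (Omega : set 'rV[R]_d) (hOmega : lipschitz_domain Omega)
  (T : R) (hT : 0 < T)
  (CP : R) (hCP : poincare_constant Omega CP)
  (b B : R -> R) (hbB : admissible_nonlinearities b B)
  (f : R * 'rV[R]_d -> R) (hf : in_L2 (lebZ R d) (Qset T Omega) f)
  (u0 s0 : 'rV[R]_d -> R)
  (hu0 : in_L2 (lebesgue_rV R d) Omega u0)
  (hs0 : in_L2 (lebesgue_rV R d) Omega s0)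
  (hbs0 : {ae lebesgue_rV R d, forall x, Omega x -> b (s0 x) = u0 x})
  (L : R) (hL : 1 < L)
  (kappa : R) (M : mesh R d)
  (hM : simplicial_mesh (Qclosed T Omega) kappa M)
  (phi : 'I_(nnode M) -> R * 'rV[R]_d -> R)
  (hphi : forall a, is_hat (Qclosed T Omega) a (phi a))
  (P : ('rV[R]_d -> R) -> 'rV[R]_d -> R)
  (hP : discrete_projection T Omega M P)
  (s : nat -> R * 'rV[R]_d -> R)
  (hs : forall i, in_Vh T Omega M (s i))
  (hs_init : forall i x, Omega x -> s i (0, x) = P s0 x)
  (hs_scheme : forall i vh, in_Vh T Omega M vh ->
     residual_lin T Omega L b B f (s i.+1) (s i) (fun t x => vh (t, x)) = 0)
  (Sr : nat -> R * 'rV[R]_d -> R)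
  (hS : forall i,
     Sr i = dt T Omega (fun z => L * (s i.+1 z - s i z) + b (s i z)) \- f)
  (F : nat -> R * 'rV[R]_d -> 'rV[R]_d)
  (hF : forall i,
     F i = gradx T Omega (fun z => L * (s i.+1 z - s i z) + B (s i z)))
  (p : nat) (hp : (2 <= p)%N)
  (sig : nat -> 'I_(nnode M) -> R * 'rV[R]_d -> 'rV[R]_d)
  (hsig : forall i a, local_flux T Omega p a (phi a) (Sr i) (F i) (sig i a))
  (i : nat) :
  let CPh := CP * diam Omega in
  let sigma := global_flux T Omega phi (sig i) in
  let ds := s i.+1 \- s i in
  let w := dt T Omega (b \o s i) \- f in
  let init := fun k : nat =>
    ((L ^+ 2)%:E * normX Omega (fun x => s k (0, x) - s0 x)%R ^+ 2)%E in
  let eta_F := normQ_vec T Omega (fun z => sigma z + F i z) in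
  let eta_osc := (CPh%:E * normQ T Omega (w \- Pi0 M (Qset T Omega) w)%R)%E in
  let eta_disc := sqrte ((eta_F + eta_osc) ^+ 2 + init i)%E in
  let eta_lin := sqrte ((CPh ^+ 2)%:E * normQ T Omega (dt T Omega ds) ^+ 2
                        + normQ_vec T Omega (gradx T Omega ds) ^+ 2
                        + normX Omega (fun x => ds (T, x)) ^+ 2)%E in
  let eta := (eta_disc + L%:E * eta_lin)%E in
  let err := sqrte (L2Hm1norm T Omega (residual T Omega b B f (s i)) ^+ 2
                    + init i)%E in
  let err_disc :=
    sqrte (L2Hm1norm T Omega
             (residual_lin T Omega L b B f (s i.+1) (s i)) ^+ 2
           + init i.+1)%E in
  let err_lin := Vnorm T Omega ds in
  [/\ (err_disc <= eta_disc)%E, (err_lin <= eta_lin)%E & (err <= eta)%E].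

Proof.
have [oO bO] : open Omega /\ bounded_set Omega by case: hOmega.
have mQ : measurable (Qset T Omega) by exact: measurable_Q.
have [nb nB b0 lip _] := hbB.
have lb r t : `|b r - b t| <= `|r - t| by have [_] := lip t r.
have lB r t : `|B r - B t| <= `|r - t| by have [] := lip t r.
have L0 : 0 <= L by apply: le_trans (ltW hL).
have Ls k : in_L2 (lebZ R d) (Qset T Omega) (s k) by have [[h _] _ _ _] := hs k.
have [Nb [beb [mNb Nb0 mbb bb db]]] := lipschitz_monotone_derivative nb lb.
have [NB [beB [mNB NB0 mbB bB dB]]] := lipschitz_monotone_derivative nB lB.
have [c1 hc1] := Vh_pw_affine hM hphi (hs i); have [c2 hc2] := Vh_pw_affine hM hphi (hs i.+1).
have [Cb _ hCb] := pwgrad_bounded phi c1 (1, 0) bb.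
have mgb := pwgrad_measurable phi c1 (1, 0) mbb.
have hgb : is_dt T Omega (b \o s i) (pwgrad phi beb c1 (1, 0)) :=
  weak_chain_rule hOmega hT hM hphi (1, 0) hc1 (Ls i) lb mNb Nb0 mbb bb db.
have hdB j : exists g, is_dx T Omega j (B \o s i) g.
  by eexists; exact: (weak_chain_rule hOmega hT hM hphi (0, e_ R j) hc1 (Ls i) lB mNB NB0 mbB bB dB).
have [cd hcd] : exists cd : {set 'I_(nnode M)} -> R * (R * 'rV[R]_d), pw_affine cd (s i.+1 \- s i).
  have /choice[cd hcd] : forall K : {set 'I_(nnode M)}, exists c, forall z, affZ (c2 K) z - affZ (c1 K) z = affZ c z.
    by move=> K; apply: is_affB; [exists (c2 K)|exists (c1 K)].
  by exists cd => K KM z Kz /=; rewrite (hc1 K KM) // (hc2 K KM) // hcd.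
have dsG z : GammaT T Omega z -> (s i.+1 \- s i) z = 0.
  by move=> Gz; have [_ _ _ h1] := hs i; have [_ _ _ h2] := hs i.+1; rewrite /= h1 // h2 // subrr.
have Lds : in_L2 (lebZ R d) (Qset T Omega) (s i.+1 \- s i) by exact: (in_L2B mQ (Ls i.+1) (Ls i)).
have ds0 x : Omega x -> (s i.+1 \- s i) (0, x) = 0 by move=> Ox; rewrite /= !hs_init // subrr.
have hsig' a : local_flux T Omega p a (phi a)
    (dt T Omega (fun z => L * (s i.+1 z - s i z) + b (s i z)) \- f)
    (gradx T Omega (fun z => L * (s i.+1 z - s i z) + B (s i z))) (sig i a).
  by have := hsig i a; rewrite hS hF.
(* All iterates start from the same discrete initial value, so the initial errors in [err_disc] and
   [eta_disc] coincide. *)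
have init_eq : normX Omega (fun x => s i.+1 (0, x) - s0 x) = normX Omega (fun x => s i (0, x) - s0 x).
  by apply: L2norm_ae; apply: aeW => x Ox; rewrite !hs_init.
have CPh0 := CPh_ge0 hCP.
(* The last goal comes first because it determines the real numbers [AF], [Ao] and [Al] in the
   others. *)
rewrite hF; apply: estimates_assembly; last 1 first.
- exact: (sqr_err_bound hOmega hT hCP hM hphi lb lB hf L0 (Ls i) mgb hCb hgb hdB hcd dsG Lds ds0 hsig').
- exact: sqrtr_ge0.
- by rewrite mulr_ge0 ?sqrtr_ge0.
- exact: sqrtr_ge0.
- exact: L0.
- by rewrite mule_ge0 ?sqre_ge0 // lee_fin sqr_ge0.
- by rewrite init_eq.
- exact: (eta_F_real hOmega hsig').
- exact: (eta_osc_real hOmega CP hM hphi b hf (s i)).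
- exact: (eta_lin_real hOmega hT CP hM hphi hcd dsG Lds ds0).
- exact: (Vnorm_bound hOmega hT hCP hM hphi hcd dsG Lds ds0).
- exact: (sqr_err_disc_bound hOmega hT hCP hM hphi lb lB hf (Ls i) mgb hCb hgb hdB hcd Lds hsig').
Qed.
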